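(* The dg box operad $\mathrm{Lax}_\infty$ is a minimal model of the box operad $\mathrm{Lax}$, via the morphism of dg box operads $\mathrm{Lax}_\infty\to\mathrm{Lax}$ with $m_{0,2}\mapsto m$, $m_{1,1}\mapsto f$, $m_{2,0}\mapsto c$ and $m_{p,q}\mapsto0$ otherwise.
   Context: **Box operads.** $k$ is a field of characteristic $0$; dg modules are homologically graded, with Koszul signs. An $\mathbb N^3$-dg module is a family $M=(M(p,q,r))_{p,q,r\in\mathbb N}$ of dg $k$-modules; $(p,q,r)$ is called an arity. A dg box operad $B$ is an $\mathbb N^3$-dg module with composition chain maps $\mu:B(p,n,r)\otimes\bigotimes_{i=1}^n B(p_{i-1},q_i,p_i)\to B(p+p_0,\sum_i q_i,r+p_n)$ for all $n\ge 0$ and all indices (for $n=0$: a map $\mu_{p_0}:B(p,0,r)\to B(p+p_0,0,r+p_0)$ for every $p_0\ge0$) and a unit $1\in B(0,1,0)$, such that $\mu(x;\mu(x_1;x^1_1,\dots),\dots,\mu(x_n;x^n_1,\dots))=\pm\mu(\mu(x;x_1,\dots,x_n);x_1^1,\dots)$ (Koszul sign) whenever arities match, and $\mu(x;1,\dots,1)=x=\mu(1;x)$. Morphisms are arity-wise chain maps preserving $\mu$ and $1$; quasi-isomorphisms are arity-wise. Ungraded modules are dg modules in degree $0$. **Stackings.** Let $\mathsf{Box}$ be the $\mathbb N^3$-coloured symmetric operad in sets governing box operads: it is generated by operations $C^{p_0,\dots,p_n;p,r}_{q_1,\dots,q_n}$ with inputs $(p,n,r),(p_0,q_1,p_1),\dots,(p_{n-1},q_n,p_n)$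 and output $(p+p_0,\sum q_i,r+p_n)$, and a constant $\eta$ with output $(0,1,0)$, subject to the following relations, for formal inputs $x$ of colour $(p,n,r)$, $x_i$ of colour $(p_{i-1},m_i,p_i)$ ($1\le i\le n$) and $x^i_j$ of colour $(p^i_{j-1},q^i_j,p^i_j)$ ($1\le j\le m_i$) with $p^i_{m_i}=p^{i+1}_0$, where $C$ denotes in each place the generator with the evident indices: $C(x;C(x_1;x^1_1,\dots,x^1_{m_1}),\dots,C(x_n;x^n_1,\dots,x^n_{m_n}))=C(C(x;x_1,\dots,x_n);x^1_1,\dots,x^n_{m_n})$ (for $n=0$: $C^{b;p+a,r+a}\circ_1C^{a;p,r}=C^{a+b;p,r}$), and $C^{0,\dots,0;p,r}_{1,\dots,1}(x;\eta,\dots,\eta)=x=C^{p,r;0,0}_n(\eta;x)$. An operation $S$ with $n$ inputs is a stacking of $n$ boxes, inducing $\mu_S(x_1,\dots,x_n)$ in any box operad. $S$ has an underlying planar rooted tree (in a generator the first box is the root and the others its children from left to right; $\eta$ is the trivial tree; composition is substitution); $S$ is in standard order if boxes are numbered in preorder. $S$ also has a wiring graph: in a generator, the lower $p$ incoming wires enter the root box and its $r$ outgoing wires are the lower outgoing wires; the upper $p_0$ incoming wires enter box $1$, the $p_i$ outgoing wires of box $i$ enter box $i+1$, the $p_n$ outgoing wires of box $n$ are the upper outgoing wires (if $n=0$, $p_0$ wires pass straight through); composition is substitution. Connected components of the wiring graph include isolated boxes and wires passing straight through. An arity is thin if $p=r=0$, semi-thin if exactly one of $p,r$ is $0$, non-thin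 if $p,r>0$. A stacking $S$ is thin-quadratic if it has no semi-thin boxes, is in standard order, its wiring graph has exactly two components, and it is of one of the types: (I) $S$ consists of exactly two thin boxes; (II) two boxes, the root non-thin and the upper one thin; (III) the root is thin and all other boxes are non-thin, and the output is not thin. **Desuspended sign.** For $S$ in standard order define $S^{\rm d}\in\mathbb Z/2$ recursively: $S^{\rm d}=0$ if $S=\eta$ or $S$ is an identity (single box), and if $S=C^{p_0,\dots,p_n;p,r}_{q_1,\dots,q_n}\circ(\mathrm{id},S_1,\dots,S_n)$ with root box $(p,n,r)$ and $S_1,\dots,S_n$ in standard order, then $S^{\rm d}=(p_0+p_n)r+\sum_{i=1}^n(q_i-1)(n-i+p-r+p_0-p_{i-1})+\sum_iS_i^{\rm d}$. **$\mathrm{Lax}$.** The box operad generated by elements $m$ of arity $(0,2,0)$, $f$ of arity $(1,1,1)$, $c$ of arity $(2,0,1)$, all in degree $0$, with relations (1) $\mu(m;m,1)=\mu(m;1,m)$; (2) $\mu(m;f,f)=\mu(f;m)$; (3) $\mu(m;c,f)=\mu(m;\mu(f;f),c)$; (4) $\mu(m;\mu_1(c),c)=\mu(m;\mu(f;c),c)$. **$\mathrm{Lax}_\infty$.** The free graded box operad generated by elements $m_{p,q}$, for $p,q\in\mathbb N$ with $p+q\ge2$, of degree $p+q-2$ and arity $(p,q,r)$ with $r=0$ if $p=0$ and $r=1$ if $p\ge1$, with differential the derivation determined by $$d(m_{p,q})=\sum_S(-1)^{\epsilon}\mu_S(m_{p_1,q_1}\otimes\cdots\otimes m_{p_n,q_n}),$$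 the sum over all thin-quadratic stackings $S$ with output arity $(p,q,r)$, whose boxes have arities $(p_i,q_i,r_i)$ with $p_i+q_i\ge2$ and $r_i=0$ if $p_i=0$, $r_i=1$ if $p_i\geq 1$. Here, with $e_1=q_1-1+p_1-r_1$ (box $1$ is the root), $\epsilon=S^{\rm d}+e_1+1$ for type I, $\epsilon=S^{\rm d}+e_1$ for type II, and $\epsilon=S^{\rm d}+1$ for type III. This makes $\mathrm{Lax}_\infty$ a dg box operad. **Minimal model.** A minimal model of $B$ is a dg box operad $M\cong(\mathcal T(X),d)$, where $\mathcal T(X)$ is the free graded box operad on an $\mathbb N^3$-graded module $X$, with a quasi-isomorphism $M\to B$ and such that $X\to\mathcal T(X)\xrightarrow{d}\mathcal T(X)\twoheadrightarrow X$ is $0$. *)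

(* Defs.v *)
From HB Require Import structures.
From mathcomp Require Import all_boot all_order all_algebra.

Set Implicit Arguments.
Unset Strict Implicit.
Unset Printing Implicit Defensive.

Import Order.TTheory GRing.Theory Num.Theory.
Local Open Scope ring_scope.

(* An arity (p, q, r) has p incoming wires, q inputs and r outgoing wires.    *)
Definition arity := (nat * nat * nat)%type.
Definition ar_in (a : arity) : nat := a.1.1.
Definition ar_up (a : arity) : nat := a.1.2.
Definition ar_out (a : arity) : nat := a.2.

(* A row of arities (p_0, q_1, p_1), (p_1, q_2, p_2), ..., (p_{n-1}, q_n, p_n)*)
(* on top of a box (p, n, r).  The number p0 is a separate datum because it   *)
(* is not determined by the row when n = 0; p_n is [top p0 s].                *)
Fixpoint chained (p0 : nat) (s : seq arity) : bool :=
  if s is a :: s' then (ar_in a == p0) && chained (ar_out a) s' else true.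
Definition top (p0 : nat) (s : seq arity) : nat := last p0 (map ar_out s).
Definition composable (a : arity) (p0 : nat) (s : seq arity) : bool :=
  (size s == ar_up a) && chained p0 s.
Definition comp_arity (a : arity) (p0 : nat) (s : seq arity) : arity :=
  ((ar_in a + p0)%N, sumn (map ar_up s), (ar_out a + top p0 s)%N).

(* The row mu(x_1; ys_1), ..., mu(x_n; ys_n), where the concatenation of the  *)
(* rows ys_i, of arities ts_i, starts with q0 wires.                          *)
Fixpoint comp_row (T : Type) (mu : T -> nat -> seq T -> T) (q0 : nat)
    (xs : seq T) (yss : seq (seq T)) (tss : seq (seq arity)) : seq T :=
  match xs, yss, tss with
  | x :: xs', ys :: yss', ts :: tss' =>
      mu x q0 ys :: comp_row mu (top q0 ts) xs' yss' tss'
  | _, _, _ => [::]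
  end.

(* An N^3-graded family of graded k-modules M(p,q,r)_e is represented by its  *)
(* total direct sum, with [piece (p,q,r) e] the summand M(p,q,r)_e.           *)
Record grmod (k : fieldType) := GrMod {
  gr_sort :> lmodType k;
  piece : arity -> int -> gr_sort -> Prop;
  piece0 : forall a e, piece a e 0;
  piece_lin : forall a e (c : k) u v,
    piece a e u -> piece a e v -> piece a e (c *: u + v);
  piece_span : forall v, exists s : seq (arity * int * gr_sort),
    (forall t, t \in s -> piece t.1.1 t.1.2 t.2) /\ v = \sum_(t <- s) t.2;
  piece_direct : forall s : seq (arity * int * gr_sort),
    uniq [seq t.1 | t <- s] ->
    (forall t, t \in s -> piece t.1.1 t.1.2 t.2) ->
    \sum_(t <- s) t.2 = 0 -> forall t, t \in s -> t.2 = 0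
}.

Definition sgn (k : fieldType) (e : int) : k := (-1) ^ e.

Fixpoint pieces (k : fieldType) (M : grmod k) (s : seq (arity * int))
    (xs : seq M) : Prop :=
  match s, xs with
  | [::], [::] => True
  | t :: s', x :: xs' => piece t.1 t.2 x /\ pieces s' xs'
  | _, _ => False
  end.

Definition graded_map (k : fieldType) (M N : grmod k) (g : M -> N) : Prop :=
  forall a e x, piece a e x -> piece a e (g x).

(* Exponent of the Koszul sign exchanging                                     *)
(*   x_1, ys_1, x_2, ys_2, ..., x_n, ys_n  and  x_1, ..., x_n, ys_1, ..., ys_n*)
(* for x_i of degree ds_i and ys_i a sequence with degrees ess_i.             *)
Fixpoint koszul (ds : seq int) (ess : seq (seq int)) : int :=
  match ds, ess with
  | _ :: ds', es :: ess' =>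
      (\sum_(e <- es) e) * (\sum_(d <- ds') d) + koszul ds' ess'
  | _, _ => 0
  end.

(* [mu x p0 xs] is only meaningful for homogeneous x, xs of composable        *)
(* arities, with p0 the number of wires entering the row xs; its values on    *)
(* other arguments are unconstrained.                                         *)
Record boxop (k : fieldType) := BoxOp {
  bo_mod :> grmod k;
  mu : bo_mod -> nat -> seq bo_mod -> bo_mod;
  one : bo_mod;
  one_piece : piece (0, 1, 0)%N 0 one;
  mu_piece : forall a e p0 s x xs,
    composable a p0 (unzip1 s) -> piece a e x -> pieces s xs ->
    piece (comp_arity a p0 (unzip1 s)) (e + \sum_(d <- unzip2 s) d)
      (mu x p0 xs);
  mu_linl : forall a e p0 s (c : k) x y zs,
    composable a p0 (unzip1 s) -> piece a e x -> piece a e y -> pieces s zs ->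
    mu (c *: x + y) p0 zs = c *: mu x p0 zs + mu y p0 zs;
  mu_linr : forall a e p0 s1 t s2 (c : k) x zs1 y z zs2,
    composable a p0 (unzip1 (s1 ++ t :: s2)) -> piece a e x ->
    pieces s1 zs1 -> piece t.1 t.2 y -> piece t.1 t.2 z -> pieces s2 zs2 ->
    mu x p0 (zs1 ++ (c *: y + z) :: zs2) =
      c *: mu x p0 (zs1 ++ y :: zs2) + mu x p0 (zs1 ++ z :: zs2);
  mu_assoc : forall a e p0 s x xs q0 (tss : seq (seq (arity * int))) yss,
    composable a p0 (unzip1 s) -> piece a e x -> pieces s xs ->
    shape tss = [seq ar_up t.1 | t <- s] -> chained q0 (unzip1 (flatten tss)) ->
    shape yss = shape tss -> pieces (flatten tss) (flatten yss) ->
    mu x (p0 + q0)%N (comp_row mu q0 xs yss (map unzip1 tss)) =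
      sgn k (koszul (unzip2 s) (map unzip2 tss)) *:
        mu (mu x p0 xs) q0 (flatten yss);
  mu_1r : forall a e x, piece a e x -> mu x 0%N (nseq (ar_up a) one) = x;
  mu_1l : forall a e x, piece a e x -> mu one (ar_in a) [:: x] = x
}.

Definition box_morphism (k : fieldType) (A B : boxop k) (phi : A -> B) : Prop :=
  [/\ graded_map phi, phi (one A) = one B &
      forall a e p0 s x xs,
        composable a p0 (unzip1 s) -> piece a e x -> pieces s xs ->
        phi (mu x p0 xs) = mu (phi x) p0 (map phi xs)].

Record dgboxop (k : fieldType) := DgBoxOp {
  dg_op :> boxop k;
  diff : {linear dg_op -> dg_op};
  diff_piece : forall a e x, piece a e x -> piece a (e - 1) (diff x);
  diff_diff : forall x, diff (diff x) = 0;
  diff_mu : forall a e p0 s x xs,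
    composable a p0 (unzip1 s) -> piece a e x -> pieces s xs ->
    diff (mu x p0 xs) = mu (diff x) p0 xs +
      \sum_(i < size xs) sgn k (e + \sum_(d <- take i (unzip2 s)) d) *:
        mu x p0 (set_nth 0 xs i (diff xs`_i))
}.

Definition dg_box_morphism (k : fieldType) (A B : dgboxop k) (phi : A -> B) :
    Prop :=
  box_morphism phi /\ forall x, phi (diff A x) = diff B (phi x).

(* In each arity and degree, the map induced on homology is injective and     *)
(* surjective.                                                                *)
Definition quasi_iso (k : fieldType) (A B : dgboxop k) (phi : A -> B) : Prop :=
  forall (a : arity) (e : int),
    (forall z, piece a e z -> diff A z = 0 ->
       (exists2 w, piece a (e + 1) w & phi z = diff B w) ->
       exists2 w, piece a (e + 1) w & z = diff A w)
    /\ (forall y, piece a e y -> diff B y = 0 ->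
         exists z w, [/\ piece a e z, diff A z = 0, piece a (e + 1) w
                       & y = phi z + diff B w]).

(* The operation C(id, S_1, ..., S_n) with root box a is [Node a p0 Ss]; every*)
(* stacking other than eta has a unique such form (see [stackingP] below).    *)
(* The preorder of the tree is the standard order of the boxes.               *)
Inductive stacking := Eta | Node of arity & nat & seq stacking.

Fixpoint stacking_rect' (P : stacking -> Prop) (PE : P Eta)
    (PN : forall a p0 ss, (forall i, P (nth Eta ss i)) -> P (Node a p0 ss))
    (S : stacking) : P S :=
  match S with
  | Eta => PE
  | Node a p0 ss => PN a p0 ss
      ((fix row (ss : seq stacking) : forall i, P (nth Eta ss i) :=
         match ss return forall i, P (nth Eta ss i) with
         | [::] => fun i => match i with 0 => PE | _.+1 => PE end
         | s :: ss' => fun i => match i with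
             | 0 => stacking_rect' PE PN s
             | j.+1 => row ss' j
             end
         end) ss)
  end.

Fixpoint stacking_enc (S : stacking) : GenTree.tree (arity * nat) :=
  match S with
  | Eta => GenTree.Node 0 [::]
  | Node a p0 ss =>
      GenTree.Node 1 (GenTree.Leaf (a, p0) :: map stacking_enc ss)
  end.

Fixpoint stacking_dec (t : GenTree.tree (arity * nat)) : stacking :=
  match t with
  | GenTree.Node _ (GenTree.Leaf (a, p0) :: ts) =>
      Node a p0 (map stacking_dec ts)
  | _ => Eta
  end.

Lemma stacking_encK : cancel stacking_enc stacking_dec.
Proof.
elim/stacking_rect' => //= a p0 ss IH; congr Node.
elim: ss IH => //= s ss IHss IH; rewrite (IH 0%N) IHss // => i.
exact: (IH i.+1).
Qed.

HB.instance Definition _ := Countable.copy stacking (can_type stacking_encK).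

Fixpoint st_ar (S : stacking) : arity :=
  match S with
  | Eta => (0, 1, 0)%N
  | Node a p0 ss => comp_arity a p0 (map st_ar ss)
  end.

Fixpoint st_wf (S : stacking) : bool :=
  match S with
  | Eta => true
  | Node a p0 ss => composable a p0 (map st_ar ss) && all st_wf ss
  end.

Fixpoint boxes (S : stacking) : seq arity :=
  match S with
  | Eta => [::]
  | Node a _ ss => a :: flatten (map boxes ss)
  end.

Definition st_id (a : arity) : stacking := Node a 0 (nseq (ar_up a) Eta).

(* The operation mu_S(x_1, ..., x_n); no Koszul sign occurs because the boxes *)
(* are in standard order.                                                     *)
Fixpoint mu_st (k : fieldType) (B : boxop k) (S : stacking) (xs : seq B) : B :=
  match S with
  | Eta => one B
  | Node a p0 ss =>
      mu (head 0 xs) p0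
        ((fix row (ss : seq stacking) (ys : seq B) : seq B :=
            if ss is s :: ss' then
              mu_st s (take (size (boxes s)) ys)
                :: row ss' (drop (size (boxes s)) ys)
            else [::]) ss (behead xs))
  end.

(* The wiring graph.  A wire starts at the i-th incoming end (inl i, counted  *)
(* from the bottom) or at the j-th box in preorder (inr j).  [wiring S j ins],*)
(* where j is the number of the first box of S and ins lists the sources of   *)
(* the incoming wires of S, returns the wires that end in a box of S, and the *)
(* sources of the outgoing wires of S.                                        *)
Definition wire_end := (nat + nat)%type.

Fixpoint wiring (S : stacking) (j : nat) (ins : seq wire_end) :
    seq (wire_end * wire_end) * seq wire_end :=
  match S with
  | Eta => ([::], ins)
  | Node a p0 ss =>
      let upper :=
        (fix row (ss : seq stacking) (j : nat) (ins : seq wire_end) :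
             seq (wire_end * wire_end) * seq wire_end :=
           if ss is s :: ss' then
             let w := wiring s j ins in
             let w' := row ss' (j + size (boxes s))%N w.2 in
             (w.1 ++ w'.1, w'.2)
           else ([::], ins)) ss j.+1 (drop (ar_in a) ins) in
      ([seq (u, inr j) | u <- take (ar_in a) ins] ++ upper.1,
       nseq (ar_out a) (inr j) ++ upper.2)
  end.

(* An outgoing end never joins two components, so the components are those of *)
(* the graph on the incoming ends and the boxes; an incoming wire that passes *)
(* straight through is an isolated vertex of it.                              *)
Definition st_vertex (S : stacking) : finType :=
  ('I_(ar_in (st_ar S)) + 'I_(size (boxes S)))%type.

Definition vertex_end (S : stacking) (u : st_vertex S) : wire_end :=
  match u with inl i => inl (nat_of_ord i) | inr j => inr (nat_of_ord j) end.

Definition st_adj (S : stacking) : rel (st_vertex S) := fun u v =>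
  let E := (wiring S 0 [seq inl i | i <- iota 0 (ar_in (st_ar S))]).1 in
  ((vertex_end u, vertex_end v) \in E) || ((vertex_end v, vertex_end u) \in E).

Definition st_ncomp (S : stacking) : nat := n_comp (@st_adj S) predT.

Definition thin (a : arity) : bool := (ar_in a == 0%N) && (ar_out a == 0%N).
Definition semi_thin (a : arity) : bool :=
  (ar_in a == 0%N) (+) (ar_out a == 0%N).
Definition non_thin (a : arity) : bool := (0 < ar_in a)%N && (0 < ar_out a)%N.

Definition type_I (S : stacking) : bool :=
  if boxes S is [:: a; b] then thin a && thin b else false.
Definition type_II (S : stacking) : bool :=
  if boxes S is [:: a; b] then non_thin a && thin b else false.
Definition type_III (S : stacking) : bool :=
  if boxes S is a :: s then [&& thin a, all non_thin s & ~~ thin (st_ar S)]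
  else false.

Definition thin_quadratic (S : stacking) : bool :=
  [&& st_wf S, ~~ has semi_thin (boxes S), st_ncomp S == 2%N
    & [|| type_I S, type_II S | type_III S]].

(* An integer representative of the class S^d in Z/2.                         *)
Fixpoint st_desusp (S : stacking) : int :=
  match S with
  | Eta => 0
  | Node a p0 ss =>
      let s := map st_ar ss in
      (p0%:Z + (top p0 s)%:Z) * (ar_out a)%:Z
      + \sum_(i < size s)
          ((ar_up (nth (0, 0, 0)%N s i))%:Z - 1) *
          ((ar_up a)%:Z - (i.+1)%:Z + (ar_in a)%:Z - (ar_out a)%:Z
             + p0%:Z - (ar_in (nth (0, 0, 0)%N s i))%:Z)
      + \sum_(d <- map st_desusp ss) d
  end.

(* The operations of the coloured operad Box are the formal composites of the *)
(* generators C and eta modulo [tm_eq].  Inputs are left unnumbered, a        *)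
(* stacking in standard order being numbered by the preorder of its tree.     *)
(* [stackingP] identifies these operations with the well-formed stackings.    *)
Inductive box_term :=
  | Input of arity
  | Unit
  | Comp of box_term & nat & seq box_term.

Fixpoint tm_ar (t : box_term) : arity :=
  match t with
  | Input a => a
  | Unit => (0, 1, 0)%N
  | Comp x p0 xs => comp_arity (tm_ar x) p0 (map tm_ar xs)
  end.

Fixpoint tm_wf (t : box_term) : bool :=
  match t with
  | Input _ | Unit => true
  | Comp x p0 xs =>
      [&& tm_wf x, all tm_wf xs & composable (tm_ar x) p0 (map tm_ar xs)]
  end.

Inductive tm_eq : box_term -> box_term -> Prop :=
  | tm_refl t : tm_eq t t
  | tm_sym t u : tm_eq t u -> tm_eq u t
  | tm_trans t u v : tm_eq t u -> tm_eq u v -> tm_eq t v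
  | tm_comp x x' p0 xs xs' : tm_eq x x' -> tms_eq xs xs' ->
      tm_eq (Comp x p0 xs) (Comp x' p0 xs')
  | tm_assoc x p0 xs q0 yss : tm_wf (Comp x p0 xs) ->
      shape yss = [seq ar_up (tm_ar y) | y <- xs] ->
      all tm_wf (flatten yss) -> chained q0 (map tm_ar (flatten yss)) ->
      tm_eq (Comp x (p0 + q0) (comp_row Comp q0 xs yss (map (map tm_ar) yss)))
            (Comp (Comp x p0 xs) q0 (flatten yss))
  | tm_1r x : tm_wf x -> tm_eq (Comp x 0 (nseq (ar_up (tm_ar x)) Unit)) x
  | tm_1l x : tm_wf x -> tm_eq (Comp Unit (ar_in (tm_ar x)) [:: x]) x
with tms_eq : seq box_term -> seq box_term -> Prop :=
  | tms_nil : tms_eq [::] [::]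
  | tms_cons t u ts us : tm_eq t u -> tms_eq ts us ->
      tms_eq (t :: ts) (u :: us).

Fixpoint st_term (S : stacking) : box_term :=
  match S with
  | Eta => Unit
  | Node a p0 ss => Comp (Input a) p0 (map st_term ss)
  end.

Lemma stacking_mem_ind (P : stacking -> Prop) : P Eta ->
  (forall a p0 ss, {in ss, forall s, P s} -> P (Node a p0 ss)) ->
  forall S, P S.
Proof.
move=> PE PN; elim/stacking_rect' => // a p0 ss IH; apply: PN => s.
by move=> /(nthP Eta)[i _ <-]; apply: IH.
Qed.

Fixpoint graft (S : stacking) (q0 : nat) (Ts : seq stacking) : stacking :=
  match S with
  | Eta => head Eta Ts
  | Node a p0 ss => Node a (p0 + q0)
      ((fix row (ss : seq stacking) (q0 : nat) (Ts : seq stacking) :=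
          if ss is s :: ss' then
            let Ts1 := take (ar_up (st_ar s)) Ts in
            graft s q0 Ts1 :: row ss' (top q0 (map st_ar Ts1))
                                (drop (ar_up (st_ar s)) Ts)
          else [::]) ss q0 Ts)
  end.

Fixpoint graft_row (ss : seq stacking) (q0 : nat) (Ts : seq stacking) :=
  if ss is s :: ss' then
    let Ts1 := take (ar_up (st_ar s)) Ts in
    graft s q0 Ts1 :: graft_row ss' (top q0 (map st_ar Ts1))
                        (drop (ar_up (st_ar s)) Ts)
  else [::].

Lemma graft_node a p0 ss q0 Ts :
  graft (Node a p0 ss) q0 Ts = Node a (p0 + q0) (graft_row ss q0 Ts).
Proof. by []. Qed.

Lemma chained_cat p0 s1 s2 :
  chained p0 (s1 ++ s2) = chained p0 s1 && chained (top p0 s1) s2.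
Proof. by elim: s1 p0 => //= a s1 IH p0; rewrite IH andbA. Qed.

Lemma top_cat p0 s1 s2 : top p0 (s1 ++ s2) = top (top p0 s1) s2.
Proof. by rewrite /top map_cat last_cat. Qed.

Definition width (Ts : seq stacking) : nat := sumn (map ar_up (map st_ar Ts)).

Lemma width_cat s t : width (s ++ t) = (width s + width t)%N.
Proof. by rewrite /width !map_cat sumn_cat. Qed.

Lemma width_cons s t : width (s :: t) = (ar_up (st_ar s) + width t)%N.
Proof. by []. Qed.

Lemma top_cons p0 a s : top p0 (a :: s) = top (ar_out a) s.
Proof. by []. Qed.

Definition st_row (p0 : nat) (Ts : seq stacking) : bool :=
  chained p0 (map st_ar Ts) && all st_wf Ts.

Lemma st_row_cat p0 s t :
  st_row p0 (s ++ t) = st_row p0 s && st_row (top p0 (map st_ar s)) t.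
Proof. by rewrite /st_row map_cat chained_cat all_cat andbACA. Qed.

Lemma st_row1 p0 T :
  st_row p0 [:: T] = (ar_in (st_ar T) == p0) && st_wf T.
Proof. by rewrite /st_row /= !andbT. Qed.

Lemma st_row_cons p0 s t :
  st_row p0 (s :: t) = [&& ar_in (st_ar s) == p0, st_wf s &
                         st_row (ar_out (st_ar s)) t].
Proof. by rewrite -cat1s st_row_cat st_row1 /= andbA. Qed.

Definition graft_spec (S : stacking) : Prop := forall q0 Ts,
  st_wf S -> st_row q0 Ts -> size Ts = ar_up (st_ar S) ->
  st_wf (graft S q0 Ts) /\
  st_ar (graft S q0 Ts) = comp_arity (st_ar S) q0 (map st_ar Ts).

Lemma row_spec ss p0 q0 Ts : {in ss, forall s, graft_spec s} ->
  st_row p0 ss -> st_row q0 Ts -> size Ts = width ss ->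
  let R := graft_row ss q0 Ts in
  [/\ st_row (p0 + q0) R, size R = size ss, width R = width Ts &
      top (p0 + q0) (map st_ar R) =
        (top p0 (map st_ar ss) + top q0 (map st_ar Ts))%N].
Proof.
elim: ss p0 q0 Ts => [|s ss IH] p0 q0 Ts Hss /=.
  by move=> _ _ /size0nil ->; split.
rewrite st_row_cons => /and3P[/eqP ins ws wss] wT.
rewrite /width /= -[sumn _]/(width ss) => sT.
set n := ar_up (st_ar s) in sT *.
have szt : size (take n Ts) = n by rewrite size_takel // sT leq_addr.
have ET : Ts = take n Ts ++ drop n Ts by rewrite cat_take_drop.
move: wT; rewrite {1}ET st_row_cat => /andP[wT1 wT2].
have [wg ag] := Hss s (mem_head _ _) q0 (take n Ts) ws wT1 szt.
have Hss' : {in ss, forall s, graft_spec s}.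
  by move=> t t_ss; apply: Hss; rewrite inE t_ss orbT.
have szd : size (drop n Ts) = width ss by rewrite size_drop sT addKn.
have [R1 R2 R3 R4] := IH _ _ _ Hss' wss wT2 szd.
rewrite -/n in ag *; set G := graft s q0 _ in wg ag *.
have outG : ar_out (st_ar G) =
    (ar_out (st_ar s) + top q0 (map st_ar (take n Ts)))%N by rewrite ag.
have inG : ar_in (st_ar G) = (p0 + q0)%N by rewrite ag -ins.
split; first by rewrite st_row_cons inG wg outG eqxx.
- by rewrite R2.
- rewrite -/(width (graft_row _ _ _)) R3 ag -[RHS]/(width Ts) [in RHS]ET.
  by rewrite width_cat.
- by rewrite !top_cons outG R4 [in RHS]ET map_cat top_cat.
Qed.

Lemma graftP S : graft_spec S.
Proof.
elim/stacking_mem_ind: S => [|a p0 ss IH] q0 Ts.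
  case: Ts => [|T [|? ?]] //= _; rewrite st_row1 => /andP[/eqP inT wT] _.
  split=> //; rewrite /comp_arity /= add0n addn0 -inT.
  by case: (st_ar T) => -[].
rewrite graft_node [st_wf _]/= => /andP[/andP[/eqP szs chs] wss] wT sT.
have [|R1 R2 R3 R4] := row_spec (p0 := p0) IH _ wT sT.
  by rewrite /st_row chs.
move: R1 => /andP[ch wR]; split.
  rewrite [st_wf _]/= /composable size_map R2 -(size_map st_ar) szs eqxx.
  by apply/andP.
rewrite [st_ar (Node _ _ _)]/= -/(graft_row ss q0 Ts) /comp_arity R4.
rewrite -/(width (graft_row _ _ _)) R3.
by rewrite [ar_in (_, _, _)]/= [ar_out (_, _, _)]/= /ar_in /ar_out /= !addnA.
Qed.

Lemma graft_rowP ss p0 q0 Ts :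
  st_row p0 ss -> st_row q0 Ts -> size Ts = width ss ->
  let R := graft_row ss q0 Ts in
  [/\ st_row (p0 + q0) R, size R = size ss, width R = width Ts &
      top (p0 + q0) (map st_ar R) =
        (top p0 (map st_ar ss) + top q0 (map st_ar Ts))%N].
Proof. by apply: row_spec => s _; apply: graftP. Qed.

Lemma graft_row_cat s t q0 Ts :
  graft_row (s ++ t) q0 Ts =
  graft_row s q0 (take (width s) Ts) ++
  graft_row t (top q0 (map st_ar (take (width s) Ts))) (drop (width s) Ts).
Proof.
elim: s q0 Ts => [|x s IH] q0 Ts /=; first by rewrite take0 drop0.
rewrite /width /= -[sumn _]/(width s); set n := ar_up _.
have En : minn n (n + width s) = n by apply/minn_idPl/leq_addr.
rewrite IH -[in take n (take _ _)]take_min En; congr (_ :: (_ ++ _)).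
  by congr (graft_row _ _); rewrite take_drop addnC.
by rewrite drop_drop addnC takeD map_cat top_cat.
Qed.

Lemma graft_rowE ss q0 tss : shape tss = map (ar_up \o st_ar) ss ->
  graft_row ss q0 (flatten tss) =
  comp_row graft q0 ss tss (map (map st_ar) tss).
Proof.
elim: ss q0 tss => [|s ss IH] q0 [|ts tss] //= [<- sh].
by rewrite take_size_cat // drop_size_cat // IH.
Qed.

Definition graftA_spec (S : stacking) : Prop := forall p0 q0 Ts Us,
  st_wf S -> st_row p0 Ts -> size Ts = ar_up (st_ar S) ->
  st_row q0 Us -> size Us = width Ts ->
  graft (graft S p0 Ts) q0 Us = graft S (p0 + q0) (graft_row Ts q0 Us).

Lemma mem_tail (P : stacking -> Prop) s ss :
  {in s :: ss, forall t, P t} -> {in ss, forall t, P t}.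
Proof. by move=> H t t_ss; apply: H; rewrite inE t_ss orbT. Qed.

Lemma graftA S : graftA_spec S.
Proof.
elim/stacking_mem_ind: S => [|a b ss IH] p0 q0 Ts Us.
  case: Ts => [|T [|? ?]] //= _ _ _ _; rewrite /width /= addn0 => sU.
  by rewrite take_oversize ?sU.
rewrite [st_wf _]/= => /andP[/andP[_ chs] wss] wT sT wU sU.
rewrite !graft_node addnA; congr Node; rewrite -[ar_up _]/(width ss) in sT.
have {chs wss} : st_row b ss by apply/andP.
elim: ss b p0 q0 Ts Us IH sT wT wU sU => [|s ss IHs] b p0 q0 Ts Us IH //= sT.
rewrite st_row_cons => wT wU sU /and3P[_ ws wss].
rewrite width_cons in sT; set n := ar_up (st_ar s) in sT *.
have szt : size (take n Ts) = n by rewrite size_takel // sT leq_addr.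
have szd : size (drop n Ts) = width ss by rewrite size_drop sT addKn.
move: wT sU; rewrite -{1 2}(cat_take_drop n Ts) st_row_cat => /andP[wT1 wT2].
rewrite width_cat; set m := width _ => sU.
have szu : size (take m Us) = m by rewrite size_takel // sU leq_addr.
have szv : size (drop m Us) = width (drop n Ts) by rewrite size_drop sU addKn.
move: wU; rewrite -{1}(cat_take_drop m Us) st_row_cat => /andP[wU1 wU2].
have [_ ->] := graftP ws wT1 szt.
rewrite -[ar_up (comp_arity _ _ _)]/m.
have [_ R2 _ R4] := graft_rowP wT1 wU1 szu.
have -> : graft_row Ts q0 Us = graft_row (take n Ts ++ drop n Ts) q0 Us.
  by rewrite cat_take_drop.
rewrite graft_row_cat -/m take_size_cat ?R2 // drop_size_cat ?R2 // R4.
rewrite (IH s (mem_head _ _)) //; congr (_ :: _).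
by rewrite (IHs (ar_out (st_ar s))) //; apply: mem_tail IH.
Qed.

Lemma tm_ar_st S : tm_ar (st_term S) = st_ar S.
Proof.
elim/stacking_mem_ind: S => //= a p0 ss IH; congr comp_arity.
by rewrite -map_comp; apply/eq_in_map => s /IH.
Qed.

Lemma map_tm_ar_st ss : map tm_ar (map st_term ss) = map st_ar ss.
Proof. by rewrite -map_comp; apply: eq_map => s; apply: tm_ar_st. Qed.

Lemma tm_wf_st S : tm_wf (st_term S) = st_wf S.
Proof.
elim/stacking_mem_ind: S => //= a p0 ss IH; rewrite map_tm_ar_st andbC.
by congr andb; rewrite all_map; apply: eq_in_all => s /IH.
Qed.

Lemma all_tm_wf_st ss : all tm_wf (map st_term ss) = all st_wf ss.
Proof. by rewrite all_map; apply: eq_all => s; apply: tm_wf_st. Qed.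

Lemma tms_refl ts : tms_eq ts ts.
Proof. by elim: ts => [|t ts IH]; constructor=> //; apply: tm_refl. Qed.

Lemma tm_eq_graft S q0 Ts : st_wf S -> st_row q0 Ts ->
  size Ts = ar_up (st_ar S) ->
  tm_eq (Comp (st_term S) q0 (map st_term Ts)) (st_term (graft S q0 Ts)).
Proof.
elim/stacking_mem_ind: S q0 Ts => [|a b ss IH] q0 Ts.
  case: Ts => [|T [|? ?]] //= _; rewrite st_row1 => /andP[/eqP <- wT] _.
  by rewrite -tm_ar_st; apply: tm_1l; rewrite tm_wf_st.
move=> wS wT sT.
pose tss := reshape (map (ar_up \o st_ar) ss) Ts.
have Ew : sumn (map (ar_up \o st_ar) ss) = width ss by rewrite map_comp.
have sh : shape tss = map (ar_up \o st_ar) ss.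
  by apply: reshapeKl; rewrite Ew sT.
have Tsf : Ts = flatten tss by rewrite reshapeKr // Ew sT.
have /andP[cs wss] : composable a b (map st_ar ss) && all st_wf ss := wS.
rewrite graft_node Tsf map_flatten [st_term (Node _ _ ss)]/=.
apply: tm_trans (tm_sym (tm_assoc _ _ _ _)) _.
- by rewrite /= map_tm_ar_st all_tm_wf_st wss.
- rewrite /shape -!map_comp -[RHS]/(map _ ss) in sh *.
  rewrite (eq_map (g := size)) ?sh; last by move=> ts; apply: size_map.
  by apply: eq_map => s /=; rewrite tm_ar_st.
- by rewrite -map_flatten all_tm_wf_st -Tsf; case/andP: wT.
- by rewrite -map_flatten map_tm_ar_st -Tsf; case/andP: wT.
rewrite [st_term (Node _ _ _)]/=; apply: tm_comp; first exact: tm_refl.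
rewrite graft_rowE //; move: wT; rewrite Tsf.
elim: ss q0 tss IH sh wss {cs wS sT Ew Tsf} => [|s ss IHs] q0 [|ts tss] //=.
  by move=> *; constructor.
move=> IH [shs sh] /andP[ws wss]; rewrite st_row_cat => /andP[wT1 wT2].
rewrite map_tm_ar_st; constructor; first exact: IH (mem_head _ _) _ _ _ _ _.
by apply: IHs => //; apply: mem_tail IH.
Qed.

Fixpoint nf (t : box_term) : stacking :=
  match t with
  | Input a => st_id a
  | Unit => Eta
  | Comp x p0 xs => graft (nf x) p0 (map nf xs)
  end.

Fixpoint box_term_rect' (P : box_term -> Prop) (PI : forall a, P (Input a))
    (PU : P Unit)
    (PC : forall x p0 xs, P x -> (forall i, P (nth Unit xs i)) ->
       P (Comp x p0 xs)) (t : box_term) : P t :=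
  match t with
  | Input a => PI a
  | Unit => PU
  | Comp x p0 xs => PC x p0 xs (box_term_rect' PI PU PC x)
      ((fix row (xs : seq box_term) : forall i, P (nth Unit xs i) :=
         match xs return forall i, P (nth Unit xs i) with
         | [::] => fun i => match i with 0 => PU | _.+1 => PU end
         | y :: ys => fun i => match i with
             | 0 => box_term_rect' PI PU PC y
             | j.+1 => row ys j
             end
         end) xs)
  end.

Lemma st_id_wf a : st_wf (st_id a).
Proof.
rewrite /= /composable size_map size_nseq eqxx all_nseq orbT andbT /=.
by elim: (ar_up a).
Qed.

Lemma st_id_ar a : st_ar (st_id a) = a.
Proof.
case: a => -[p n r]; rewrite /= /comp_arity /ar_up /ar_in /ar_out /= addn0.
congr (_, _, _); first by elim: n => //= n ->.
by elim: n => [|n IH] //=; rewrite addn0.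
Qed.

Lemma nfP t : tm_wf t ->
  [/\ st_wf (nf t), st_ar (nf t) = tm_ar t & tm_eq t (st_term (nf t))].
Proof.
elim/box_term_rect': t => [a||x p0 xs IHx IHxs].
- move=> _; split; [exact: st_id_wf | exact: st_id_ar |].
  by apply: tm_sym; rewrite /= map_nseq; apply: (tm_1r (x := Input a)).
- by move=> _; split=> //; apply: tm_refl.
rewrite [tm_wf _]/= => /and3P[/IHx[w1 a1 e1] wxs /andP[/eqP sxs ch]].
have [w2 a2 e2] : [/\ all st_wf (map nf xs),
    map st_ar (map nf xs) = map tm_ar xs & tms_eq xs (map st_term (map nf xs))].
  elim: xs wxs IHxs {sxs ch} => [|y ys IH]; first by split=> //; constructor.
  case/andP=> wy wys H; have [w a e] := H 0%N wy.
  have [|w' a' e'] := IH wys; first by move=> i; apply: (H i.+1).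
  by split; rewrite /= ?w ?a ?a' //; constructor.
have wr : st_row p0 (map nf xs) by rewrite /st_row a2 ch w2.
have sr : size (map nf xs) = ar_up (st_ar (nf x)).
  by rewrite a1 -sxs !size_map.
have [wg ag] := graftP w1 wr sr; split=> //=; first by rewrite ag a1 a2.
by apply: tm_trans (tm_eq_graft w1 wr sr); apply: tm_comp.
Qed.

Lemma nf_rowP ts : all tm_wf ts ->
  all st_wf (map nf ts) /\ map st_ar (map nf ts) = map tm_ar ts.
Proof.
elim: ts => //= t ts IH /andP[/nfP[-> -> _] /IH[-> ->]]; by [].
Qed.

Lemma graft_1r S : st_wf S -> graft S 0 (nseq (ar_up (st_ar S)) Eta) = S.
Proof.
elim/stacking_mem_ind: S => // a b ss IH.
rewrite [st_wf _]/= => /andP[_ wss].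
rewrite graft_node addn0 -[ar_up _]/(width ss); congr Node.
elim: ss IH wss => //= s ss IHs IH /andP[ws wss].
rewrite width_cons nseqD.
rewrite take_size_cat ?size_nseq // drop_size_cat ?size_nseq //.
rewrite (IH s (mem_head _ _)) //; congr (_ :: _).
have -> : top 0 (map st_ar (nseq (ar_up (st_ar s)) Eta)) = 0%N.
  by elim: (ar_up _).
by apply: IHs => //; apply: mem_tail IH.
Qed.

Lemma nf_st_term S : st_wf S -> nf (st_term S) = S.
Proof.
elim/stacking_mem_ind: S => // a p0 ss IH.
rewrite [st_wf _]/= => /andP[/andP[/eqP sz _] wss].
rewrite [nf _]/= add0n; congr Node.
have -> : map nf (map st_term ss) = ss.
  rewrite -map_comp -[RHS]map_id; apply/eq_in_map => s s_ss /=.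
  by apply: IH; rewrite // (allP wss).
rewrite -/(graft_row _ _ _) -sz size_map.
by elim: ss p0 {IH sz wss} => //= s ss IH p0; rewrite take0 drop0 IH.
Qed.

Scheme tm_eq_mind := Induction for tm_eq Sort Prop
  with tms_eq_mind := Induction for tms_eq Sort Prop.

Lemma nf_tm_eq t u : tm_eq t u -> nf t = nf u.
Proof.
move: t u; apply: (tm_eq_mind (P := fun t u _ => nf t = nf u)
  (P0 := fun ts us _ => map nf ts = map nf us)) => //=.
- by move=> t u v _ -> _ ->.
- by move=> x x' p0 xs xs' _ -> _ ->.
- move=> x p0 xs q0 yss /and3P[wx wxs /andP[/eqP sz ch]] sh wys chy.
  have [w1 a1 _] := nfP wx; have [w2 a2] := nf_rowP wxs.
  have [w3 a3] := nf_rowP wys.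
  have wr : st_row p0 (map nf xs) by rewrite /st_row a2 ch w2.
  have wr' : st_row q0 (map nf (flatten yss)) by rewrite /st_row a3 chy w3.
  have Ew : map (ar_up \o st_ar) (map nf xs) = map (ar_up \o tm_ar) xs.
    by rewrite map_comp a2 -map_comp.
  rewrite graftA //; first last.
  - by rewrite size_map size_flatten sh /width -map_comp Ew.
  - by rewrite a1 -sz !size_map.
  congr graft; rewrite map_flatten graft_rowE; last first.
    rewrite Ew -sh /shape -map_comp; apply: eq_map => ys; exact: size_map.
  elim: xs yss q0 sh wys {sz ch wxs a2 w2 w3 a3 wr wr' Ew chy} =>
    [|y xs IH] [|ys yss] q0 //= [_ sh]; rewrite all_cat => /andP[wys wyss].
  by rewrite IH //; have [_ ->] := nf_rowP wys.
- by move=> x /nfP[w a _]; rewrite map_nseq -a graft_1r.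
- by move=> t u ts us _ -> _ ->.
Qed.

(* Every formal composite has a unique normal form [st_term S].               *)
Theorem stackingP t : tm_wf t ->
  exists S, [/\ st_wf S, st_ar S = tm_ar t, tm_eq t (st_term S) &
    forall S', st_wf S' -> tm_eq t (st_term S') -> S' = S].
Proof.
move=> wt; have [w a e] := nfP wt; exists (nf t); split=> // S' w' e'.
by rewrite (nf_tm_eq e') nf_st_term.
Qed.

Lemma pieces_split (k : fieldType) (M : grmod k) s (xs : seq M) i :
  pieces s xs -> (i < size xs)%N ->
  exists t, [/\ s = take i s ++ t :: drop i.+1 s, piece t.1 t.2 xs`_i,
    pieces (take i s) (take i xs) & pieces (drop i.+1 s) (drop i.+1 xs)].
Proof.
elim: i s xs => [|i IH] [|t s] [|x xs] //= [tx sxs] lti.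
  by exists t; rewrite !drop0 /=; split.
by have [u [Es ux s1 s2]] := IH s xs sxs lti; exists u; rewrite /= -Es; split.
Qed.

Lemma mu_set0 (k : fieldType) (B : boxop k) a e p0 s (x : B) xs i :
  composable a p0 (unzip1 s) -> piece a e x -> pieces s xs ->
  (i < size xs)%N -> mu x p0 (set_nth 0 xs i 0) = 0.
Proof.
move=> cs ax sxs lti; have [t [Es tx s1 s2]] := pieces_split sxs lti.
rewrite Es in cs; have t0 := piece0 B t.1 t.2.
rewrite set_nthE lti.
have := mu_linr (-1) cs ax s1 t0 t0 s2.
by rewrite scaler0 addr0 scaleN1r addNr.
Qed.

Section ZeroDifferential.
Variables (k : fieldType) (B : boxop k).

Let zero_diff : {linear B -> B} := GRing.null_fun B.

Fact zero_diff_piece a e x : piece a e x -> piece a (e - 1) (zero_diff x).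
Proof. by move=> _; apply: piece0. Qed.

Fact zero_diff_diff x : zero_diff (zero_diff x) = 0.
Proof. by []. Qed.

Fact zero_diff_mu a e p0 s x xs :
  composable a p0 (unzip1 s) -> piece a e x -> pieces s xs ->
  zero_diff (mu x p0 xs) = mu (zero_diff x) p0 xs +
    \sum_(i < size xs) sgn k (e + \sum_(d <- take i (unzip2 s)) d) *:
      mu x p0 (set_nth 0 xs i (zero_diff xs`_i)).
Proof.
move=> cs ax sxs; rewrite big1 => [|i _]; last first.
  by rewrite (mu_set0 cs ax sxs (ltn_ord i)) scaler0.
have a0 := piece0 B a e; rewrite addr0.
have := mu_linl (-1) cs a0 a0 sxs.
by rewrite scaler0 addr0 scaleN1r addNr => ->.
Qed.

Definition dg0 : dgboxop k := @DgBoxOp k B zero_diff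
  zero_diff_piece zero_diff_diff zero_diff_mu.
End ZeroDifferential.

Definition lax_relations (k : fieldType) (B : boxop k) (m f c : B) : Prop :=
  [/\ mu m 0 [:: m; one B] = mu m 0 [:: one B; m],
      mu m 1 [:: f; f] = mu f 0 [:: m],
      mu m 2 [:: c; f] = mu m 2 [:: mu f 1 [:: f]; c] &
      mu m 3 [:: mu c 1 [::]; c] = mu m 3 [:: mu f 2 [:: c]; c]].

Definition lax_elements (k : fieldType) (B : boxop k) (m f c : B) : Prop :=
  [/\ piece (0, 2, 0)%N 0 m, piece (1, 1, 1)%N 0 f, piece (2, 0, 1)%N 0 c &
      lax_relations m f c].

(* The presentation is expressed by its universal property.                   *)
Definition is_lax (k : fieldType) (L : boxop k) (m f c : L) : Prop :=
  lax_elements m f c /\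
  forall (B : boxop k) (m' f' c' : B), lax_elements m' f' c' ->
    exists phi : {linear L -> B},
      [/\ box_morphism phi, [/\ phi m = m', phi f = f' & phi c = c'] &
          forall psi : {linear L -> B}, box_morphism psi ->
            [/\ psi m = m', psi f = f' & psi c = c'] -> psi =1 phi].

Definition lax_arity (p q : nat) : arity := (p, q, (0 < p)%N : nat).

Definition is_lax_box (a : arity) : bool :=
  (2 <= ar_in a + ar_up a)%N && (a == lax_arity (ar_in a) (ar_up a)).

Definition lax_stacking (p q : nat) (S : stacking) : bool :=
  [&& thin_quadratic S, st_ar S == lax_arity p q & all is_lax_box (boxes S)].

Definition lax_sign (S : stacking) : int :=
  let a1 := head (0, 0, 0)%N (boxes S) in
  let e1 := (ar_up a1)%:Z - 1 + (ar_in a1)%:Z - (ar_out a1)%:Z in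
  if type_I S then st_desusp S + e1 + 1
  else if type_II S then st_desusp S + e1
  else st_desusp S + 1.

Definition lax_infty_elements (k : fieldType) (B : boxop k)
    (m : nat -> nat -> B) : Prop :=
  forall p q, (2 <= p + q)%N -> piece (lax_arity p q) (p%:Z + q%:Z - 2) (m p q).

(* M is the free graded box operad on the m_{p,q} (p + q >= 2), equipped with *)
(* the given differential; the existence of [s] expresses that the sum over   *)
(* [lax_stacking p q] is finite.  The values m p q with p + q < 2 are never   *)
(* used.                                                                      *)
Definition is_lax_infty (k : fieldType) (M : dgboxop k) (m : nat -> nat -> M) :
    Prop :=
  [/\ lax_infty_elements m,
      forall (B : boxop k) (b : nat -> nat -> B), lax_infty_elements b ->
        exists phi : {linear M -> B},
          [/\ box_morphism phi,
              forall p q, (2 <= p + q)%N -> phi (m p q) = b p q &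
              forall psi : {linear M -> B}, box_morphism psi ->
                (forall p q, (2 <= p + q)%N -> psi (m p q) = b p q) ->
                psi =1 phi] &
      forall p q, (2 <= p + q)%N ->
        exists s : seq stacking,
          [/\ uniq s, forall S, (S \in s) = lax_stacking p q S &
              diff M (m p q) =
                \sum_(S <- s) sgn k (lax_sign S) *:
                  mu_st S [seq m (ar_in a) (ar_up a) | a <- boxes S]]].

Definition is_free_boxop (k : fieldType) (X : grmod k) (T : boxop k)
    (i : {linear X -> T}) : Prop :=
  graded_map i /\
  forall (B : boxop k) (g : {linear X -> B}), graded_map g ->
    exists phi : {linear T -> B},
      [/\ box_morphism phi, forall x, phi (i x) = g x &
          forall psi : {linear T -> B}, box_morphism psi ->
            (forall x, psi (i x) = g x) -> psi =1 phi].

(* The projection of T(X) onto X: it kills all mu_S(x_1, ..., x_n) except     *)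
(* those for S an identity.                                                   *)
Definition is_gen_projection (k : fieldType) (X : grmod k) (T : boxop k)
    (i : {linear X -> T}) (pi : {linear T -> X}) : Prop :=
  (forall x, pi (i x) = x) /\
  forall S (s : seq (arity * int)) (xs : seq X),
    st_wf S -> (forall a, S <> st_id a) -> boxes S = unzip1 s ->
    pieces s xs -> pi (mu_st S (map i xs)) = 0.

Definition minimal_model (k : fieldType) (M B : dgboxop k)
    (phi : {linear M -> B}) : Prop :=
  [/\ dg_box_morphism phi, quasi_iso phi &
      exists (X : grmod k) (i : {linear X -> M}), is_free_boxop i /\
        exists2 pi : {linear M -> X}, is_gen_projection i pi &
          forall x, pi (diff M (i x)) = 0].

(* Main.v *)
(* Up to signs, the stackings of Lax boxes form a basis of the free box operad*)
(* T on the m_{p,q}, and the differential of a stacking replaces each of its  *)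
(* boxes by the thin-quadratic stackings of the same arity.  Lax is H_0(T):   *)
(* the differentials of m_{0,3}, m_{1,2}, m_{2,1} and m_{3,0} are the four    *)
(* relations of Lax, and all other generators of T have a positive degree.    *)
(* The homology of T vanishes in positive degrees by an algebraic Morse       *)
(* matching.  Without incoming wires a stacking is a planar tree, and moving  *)
(* all entries but the first one into a new thin box leaves as critical trees *)
(* only the m(K, 1).  With incoming wires, write c = m_{2,0}, F(K) = f(K) for *)
(* f = m_{1,1}, and match a non-thin box with entries K_1, ..., K_n with the  *)
(* thin box over the row c, ..., c, F(K_1), ..., F(K_n), and an adjacent pair *)
(* F(K), c in a thin box with the same pair grouped in a thin box of its own; *)
(* at most c, F(K) and m(F(K), c) are critical.  Since the differential of a  *)
(* critical stacking is that of K, induction on p + q concludes.              *)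

Require Import Defs.
From mathcomp Require Import all_boot all_order all_algebra.
From HB Require Import structures.
From mathcomp Require Import finmap monalg zify.
From mathcomp Require Import boolp.
From Stdlib Require Import Btauto.

Set Implicit Arguments.
Unset Strict Implicit.
Unset Printing Implicit Defensive.

Import GRing.Theory.
Local Open Scope ring_scope.

(** * The free module on stackings *)

(** The free graded box operad on the m_{p,q} has an explicit model [Tbox]: its basis consists of
    the [legit] stackings, and composition is grafting with the sign [sg]. By the universal
    properties every [M] is isomorphic to this model with the differential [dT], and every [L] to a
    quotient of it ([from_M], [to_L]), so the theorem becomes a computation in [Tbox].

    Signs. Modulo 2 the degree of a stacking is its number of thin boxes plus a function of its
    output arity ([pdegE]). One may therefore compute as if thin boxes were odd and all others even,
    with the Koszul sign [kap]; the arity part and the desuspended sign enter through the correction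
    [loc], and [sg_assoc] and [dT_muB] translate back to the true degrees. In these coordinates the
    terms of the differential of a generator have sign -1 for types I and III and +1 for type II
    ([tq_sign]).

    The differential squares to zero. It is a derivation ([dgr]), so only generators matter
    ([dgen2]). Two insertions of thin boxes side by side cancel, and the nested ones cancel against
    the splitting of the inserted box ([insert_insertE]). For type III one differentiates the sum of
    all rows of non-thin boxes at once: only thin boxes put on top of an input and consecutive
    columns grouped under a thin box remain ([claim_all]). This rests on a column being cut in a
    unique way above any number of its outgoing wires ([cut_both]).

    Homology. In degree 0 it is Lax: the quotient of [Tbox] by the ideal [bdry] kills the generators
    of positive degree, and the boundaries of the four generators of degree 1 are the four relations
    ([D_gen3], [lax_quotient]). In positive degrees an acyclic matching lets every cycle be moved by
    a boundary onto critical stackings ([elimination], with leading terms in [stD_all]). These are a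
    stacking K inside a fixed context m(K, 1), F(K) or m(F(K), c), whose differential is up to sign
    that of K, so induction on the number of wires and inputs makes the cycle a boundary
    ([acyclic_aux]).

    Minimality holds because the differential keeps the arity and lowers the degree, whereas the
    arity of a generator determines its degree ([genproj_D]). *)

Definition legit (S : stacking) : bool := st_wf S && all is_lax_box (boxes S).

Record lstk := LStk { lst :> stacking; _ : legit lst }.
HB.instance Definition _ := [isSub for lst].
HB.instance Definition _ := [Choice of lstk by <:].

Definition ndeg (S : stacking) : nat :=
  sumn [seq (ar_in a + ar_up a - 2)%N | a <- boxes S].

Section FreeModule.
Variable k : fieldType.
Implicit Types (W U : lmodType k) (S : stacking) (P Q : stacking -> Prop).

Definition fmod := {malg k[lstk]}.

(** The value 0 on illegitimate stackings lets formulas range over all stackings without carrying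
    proofs of legitimacy. *)
Definition bas S : fmod := if insub S is Some s then mkmalgU s 1 else 0.

Lemma bas_val (s : lstk) : bas (val s) = mkmalgU s 1.
Proof. by rewrite /bas valK. Qed.

Definition lin W (f : stacking -> W) (x : fmod) : W :=
  \sum_(s <- msupp x) x@_s *: f (val s).

Lemma lin_sub W (f : stacking -> W) (x : fmod) (D : {fset lstk}) :
  (msupp x `<=` D)%fset -> lin f x = \sum_(s <- D) x@_s *: f (val s).
Proof.
move=> sub; rewrite /lin (big_fset_incl _ sub) // => s _ /mcoeff_outdom ->.
by rewrite scale0r.
Qed.

Fact lin_is_linear W (f : stacking -> W) : linear (lin f).
Proof.
move=> c x y; pose D := (msupp x `|` msupp y)%fset.
have sx : (msupp x `<=` D)%fset by apply: fsubsetUl.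
have sy : (msupp y `<=` D)%fset by apply: fsubsetUr.
have sxy : (msupp (c *: x + y) `<=` D)%fset.
  apply: fsubset_trans (msuppD_le _ _) _.
  by rewrite fsubUset sy andbT; apply: fsubset_trans (msuppZ_le _ _) _.
rewrite (lin_sub f sx) (lin_sub f sy) (lin_sub f sxy) scaler_sumr -big_split.
by apply: eq_bigr => s _; rewrite mcoeffD mcoeffZ scalerDl scalerA.
Qed.
HB.instance Definition _ W (f : stacking -> W) :=
  GRing.isLinear.Build k fmod W *:%R (lin f) (lin_is_linear f).

Lemma lin_bas W (f : stacking -> W) S : legit S -> lin f (bas S) = f S.
Proof.
move=> lS; rewrite /bas insubT /lin msuppU oner_eq0 big_seq_fset1 mcoeffUU.
by rewrite scale1r.
Qed.

(** Being in the span of the basis elements that satisfy [P], expressed by the support. Homogeneity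
    and filtration arguments all take this form. *)
Definition inspan P (x : fmod) : Prop :=
  forall s : lstk, s \in msupp x -> P (val s).

Lemma lin_basE (x : fmod) : lin bas x = x.
Proof.
rewrite /lin [RHS]monalgE; apply: eq_bigr => s _; rewrite bas_val.
by apply/malgP => t; rewrite mcoeffZ !mcoeffU mulr_natr.
Qed.

Lemma eq_lin_in W (f g : stacking -> W) P (x : fmod) : inspan P x ->
  (forall S, legit S -> P S -> f S = g S) -> lin f x = lin g x.
Proof.
move=> Px fg; rewrite /lin !big_seq; apply: eq_bigr => s sx.
by rewrite fg ?(valP s) //; apply: Px.
Qed.

Lemma eq_lin W (f g : stacking -> W) (x : fmod) :
  (forall S, legit S -> f S = g S) -> lin f x = lin g x.
Proof. by move=> fg; apply: (@eq_lin_in _ _ _ (fun=> True)) => // S /fg. Qed.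

Lemma linE W (g : {linear fmod -> W}) (x : fmod) :
  g x = lin (fun S => g (bas S)) x.
Proof.
rewrite -{1}(lin_basE x) /lin linear_sum; apply: eq_bigr => s _.
by rewrite linearZ.
Qed.

Lemma lin_linE W U (g : {linear W -> U}) (f : stacking -> W) (x : fmod) :
  g (lin f x) = lin (fun S => g (f S)) x.
Proof. by rewrite /lin linear_sum; apply: eq_bigr => s _; rewrite linearZ. Qed.

Lemma lin0 W (f : stacking -> W) P x : inspan P x ->
  (forall S, legit S -> P S -> f S = 0) -> lin f x = 0.
Proof.
move=> Px f0; rewrite (eq_lin_in (g := fun=> 0) Px) //.
by rewrite /lin big1 // => s _; rewrite scaler0.
Qed.

Lemma lin_comb W (f g : stacking -> W) c x :
  lin (fun S => c *: f S + g S) x = c *: lin f x + lin g x.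
Proof.
rewrite /lin scaler_sumr -big_split; apply: eq_bigr => s _.
by rewrite scalerDr !scalerA mulrC.
Qed.

Lemma lin_scale W (f : stacking -> W) c x :
  lin (fun S => c *: f S) x = c *: lin f x.
Proof.
by rewrite /lin scaler_sumr; apply: eq_bigr => s _; rewrite !scalerA mulrC.
Qed.

Lemma lin_add W (f g : stacking -> W) x :
  lin (fun S => f S + g S) x = lin f x + lin g x.
Proof.
by rewrite /lin -big_split; apply: eq_bigr => s _; rewrite scalerDr.
Qed.

Lemma lin_sum W (I : Type) (r : seq I) (f : I -> stacking -> W) x :
  lin (fun S => \sum_(i <- r) f i S) x = \sum_(i <- r) lin (f i) x.
Proof.
rewrite /lin exchange_big; apply: eq_bigr => s _; exact: scaler_sumr.
Qed.

Lemma linC W (h : stacking -> stacking -> W) (x y : fmod) :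
  lin (fun S => lin (h S) y) x = lin (fun T => lin (fun S => h S T) x) y.
Proof.
rewrite /lin; under eq_bigr do rewrite scaler_sumr.
rewrite exchange_big; apply: eq_bigr => t _; rewrite scaler_sumr.
by apply: eq_bigr => s _; rewrite !scalerA mulrC.
Qed.

Lemma inspanS P Q x : (forall S, legit S -> P S -> Q S) ->
  inspan P x -> inspan Q x.
Proof. by move=> PQ Px s sx; apply: PQ; [apply: (valP s) | apply: Px]. Qed.

Lemma inspan0 P : inspan P 0.
Proof. by move=> s; rewrite msupp0 inE. Qed.

Lemma inspanD P x y : inspan P x -> inspan P y -> inspan P (x + y).
Proof.
move=> Px Py s sxy; have := fsubsetP (msuppD_le x y) _ sxy.
by rewrite in_fsetU => /orP[/Px|/Py].
Qed.

Lemma inspanZ P c x : inspan P x -> inspan P (c *: x).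
Proof. by move=> Px s sx; apply: Px; apply: (fsubsetP (msuppZ_le c x)). Qed.

Lemma inspanB P x y : inspan P x -> inspan P y -> inspan P (x - y).
Proof. by move=> Px Py; rewrite -scaleN1r; apply: inspanD => //; apply: inspanZ. Qed.

Lemma inspan_sum P (I : eqType) (r : seq I) (F : I -> fmod) :
  (forall i, i \in r -> inspan P (F i)) -> inspan P (\sum_(i <- r) F i).
Proof.
move=> PF; rewrite big_seq; elim/big_rec: _ => [|i x ir Px].
  exact: inspan0.
by apply: inspanD => //; apply: PF.
Qed.

Lemma inspan_bas P S : P S -> inspan P (bas S).
Proof.
move=> PS; rewrite /bas; case: insubP => [s _ <-|_] in PS *; last first.
  exact: inspan0.
by move=> t; rewrite msuppU oner_eq0 inE => /eqP ->.
Qed.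

Lemma inspan_basP P S : legit S -> inspan P (bas S) -> P S.
Proof.
move=> lS /(_ (LStk lS)); apply; rewrite /bas insubT.
by rewrite msuppU oner_eq0 inE; apply/eqP/val_inj.
Qed.

Lemma inspan_lin P Q (f : stacking -> fmod) x : inspan P x ->
  (forall S, legit S -> P S -> inspan Q (f S)) -> inspan Q (lin f x).
Proof.
move=> Px Qf; apply: inspan_sum => s sx; apply: inspanZ.
by apply: Qf; [apply: (valP s) | apply: Px].
Qed.

Definition cf (S : stacking) (x : fmod) : k :=
  lin (fun T => (T == S)%:R : k^o) x.

Lemma cfE (s : lstk) x : cf (val s) x = x@_s.
Proof.
rewrite /cf /lin; case: (boolP (s \in msupp x)) => sx; last first.
  rewrite big_seq big1 ?(mcoeff_outdom sx) // => t tx.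
  case: eqP => [/val_inj Ets|_]; first by rewrite -Ets tx in sx.
  by rewrite scaler0.
rewrite (big_fsetD1 s) //= eqxx /GRing.scale /= mulr1 big_seq big1 ?addr0 //.
move=> t; rewrite !inE => /andP[nts _].
by rewrite (inj_eq val_inj) (negPf nts) mulr0.
Qed.

Lemma inspan_cf P x : (forall S, legit S -> cf S x != 0 -> P S) -> inspan P x.
Proof.
move=> H s sx; apply: H; first exact: (valP s).
by rewrite cfE mcoeff_neq0.
Qed.

Lemma cf_inspan P S x : inspan P x -> ~ P S -> cf S x = 0.
Proof.
move=> Px nP; apply: (@lin0 k^o _ P x Px) => T _ PT; case: eqP => // ET.
by rewrite ET in PT.
Qed.

Lemma fmod_eqP x y : (forall S, legit S -> cf S x = cf S y) -> x = y.
Proof. by move=> H; apply/malgP => s; rewrite -!cfE H //; apply: (valP s). Qed.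

Definition fpiece (a : arity) (e : int) : fmod -> Prop :=
  inspan (fun S => st_ar S = a /\ (ndeg S)%:Z = e).

Lemma cf_sum S (I : Type) (r : seq I) (F : I -> fmod) :
  cf S (\sum_(i <- r) F i) = \sum_(i <- r) cf S (F i).
Proof. by rewrite /cf linear_sum. Qed.

Fact fpiece0 a e : fpiece a e 0. Proof. exact: inspan0. Qed.
Fact fpiece_lin a e (c : k) u v :
  fpiece a e u -> fpiece a e v -> fpiece a e (c *: u + v).
Proof. by move=> pu pv; apply: inspanD => //; apply: inspanZ. Qed.
Fact fpiece_span v : exists s : seq (arity * int * fmod),
  (forall t, t \in s -> fpiece t.1.1 t.1.2 t.2) /\ v = \sum_(t <- s) t.2.
Proof.
exists [seq (st_ar (val s), (ndeg (val s))%:Z, v@_s *: bas (val s)) | s <- msupp v].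
split; last by rewrite big_map /= -[LHS]lin_basE.
by move=> _ /mapP[s _ ->] /=; apply: inspanZ; apply: inspan_bas.
Qed.
Fact fpiece_direct (s : seq (arity * int * fmod)) :
  uniq [seq t.1 | t <- s] ->
  (forall t, t \in s -> fpiece t.1.1 t.1.2 t.2) ->
  \sum_(t <- s) t.2 = 0 -> forall t, t \in s -> t.2 = 0.
Proof.
move=> us ps s0 t ts; apply: fmod_eqP => S lS; rewrite [RHS]linear0.
case: (boolP ((st_ar S, (ndeg S)%:Z) == t.1)) => [|nt]; last first.
  by apply: (cf_inspan (ps t ts)) => -[Ea Ee]; rewrite Ea Ee -surjective_pairing eqxx in nt.
move=> /eqP Et; have := congr1 (cf S) s0; rewrite cf_sum [RHS]linear0.
rewrite (bigD1_seq t) //=; last exact: map_uniq us.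
rewrite big_seq_cond big1 ?addr0 // => u /andP[us' nut].
apply: (cf_inspan (ps u us')) => -[Ea Ee]; case/negP: nut; apply/eqP.
move: us; rewrite -[s]/(s) => us.
have Eu : u.1 = t.1 by rewrite -Et Ea Ee -surjective_pairing.
move: us ts us' Eu; elim: (s) => //= v r IH /andP[nv ur].
rewrite !inE => /orP[/eqP->|tr] /orP[/eqP->|ur'] // E.
- by move: nv; rewrite -E map_f.
- by move: nv; rewrite E map_f.
- exact: IH.
Qed.

Definition fgr : grmod k :=
  @GrMod k fmod fpiece fpiece0 fpiece_lin fpiece_span fpiece_direct.

(** * Multilinear extension from the basis *)

Section Multilinear.
Variable W : lmodType k.
Implicit Types (F G : seq stacking -> W).

Fixpoint ml F (xs : seq fmod) : W :=
  if xs is x :: xs' then lin (fun S => ml (fun Ss => F (S :: Ss)) xs') x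
  else F [::].

Lemma eq_ml F G xs :
  (forall Ss, size Ss = size xs -> all legit Ss -> F Ss = G Ss) ->
  ml F xs = ml G xs.
Proof.
elim: xs F G => [|x xs IH] F G FG /=; first exact: FG.
apply: eq_lin => S lS; apply: IH => Ss sS lSs; apply: FG; rewrite /= ?sS //.
by rewrite lS.
Qed.

Lemma ml_bas F Ss : all legit Ss -> ml F (map bas Ss) = F Ss.
Proof.
elim: Ss F => //= S Ss IH F /andP[lS lSs]; rewrite lin_bas //; exact: IH.
Qed.

Lemma ml_comb F G c xs :
  ml (fun Ss => c *: F Ss + G Ss) xs = c *: ml F xs + ml G xs.
Proof.
elim: xs F G => //= x xs IH F G; rewrite -lin_comb.
by apply: eq_lin => S _; rewrite IH.
Qed.

Lemma ml_scale F c xs : ml (fun Ss => c *: F Ss) xs = c *: ml F xs.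
Proof.
elim: xs F => //= x xs IH F; rewrite -lin_scale.
by apply: eq_lin => S _; rewrite IH.
Qed.

Lemma ml_cat F xs ys :
  ml F (xs ++ ys) = ml (fun Ss => ml (fun Ts => F (Ss ++ Ts)) ys) xs.
Proof. by elim: xs F => //= x xs IH F; apply: eq_lin => S _; rewrite IH. Qed.

Lemma ml_lin F l1 c x y l2 :
  ml F (l1 ++ (c *: x + y) :: l2) =
    c *: ml F (l1 ++ x :: l2) + ml F (l1 ++ y :: l2).
Proof.
rewrite !ml_cat -ml_comb; apply: eq_ml => Ss _ _ /=.
exact: linearP.
Qed.

Definition multilinear n (G : seq fmod -> W) : Prop :=
  forall l1 c x y l2, (size l1 + size l2).+1 = n ->
    G (l1 ++ (c *: x + y) :: l2) = c *: G (l1 ++ x :: l2) + G (l1 ++ y :: l2).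

Lemma multilinear_ml n (G : seq fmod -> W) xs : multilinear n G ->
  size xs = n -> G xs = ml (fun Ss => G (map bas Ss)) xs.
Proof.
elim: xs n G => [|x xs IH] [|n] G //= mG [sz].
have H : linear (fun y => G (y :: xs)).
  by move=> c y z; apply: (mG [::]); rewrite /= add0n sz.
pose h := GRing.isLinear.Build _ _ _ _ _ H.
pose g : {linear fmod -> W} := HB.pack (fun y => G (y :: xs)) h.
have := linE g x; rewrite /= => ->; apply: eq_lin => S _.
apply: (IH n (fun l => G (bas S :: l))) => // l1 c y z l2 sl.
by apply: (mG (bas S :: l1)); rewrite /= addSn sl.
Qed.

(** Expanding one argument after the other leaves only tuples of basis stackings with the prescribed
    arities and degrees. Associativity of composition is reduced in this way to a statement about
    grafting. *)
Lemma multilinear_eq n (G H : seq fmod -> W) (s : seq (arity * int)) xs :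
  multilinear n G -> multilinear n H -> size s = n ->
  pieces (M := fgr) s xs ->
  (forall Ss, all legit Ss -> map st_ar Ss = unzip1 s ->
     [seq (ndeg T)%:Z | T <- Ss] = unzip2 s ->
     G (map bas Ss) = H (map bas Ss)) ->
  G xs = H xs.
Proof.
move=> mG mH sn sxs GH; have sz : size xs = size s.
  by elim: (s) (xs) sxs => [|t s' IH] [|x xs'] //= [_ /IH ->].
rewrite (multilinear_ml mG) ?sz // (multilinear_ml mH) ?sz //.
elim: s xs (n) G H sxs GH {mG mH sn sz} => [|t s IH] [|x xs] n' G H //=.
  by move=> _ /(_ [::]) ->.
case=> px pxs GH; apply: (eq_lin_in px) => S lS [aS dS].
apply: (IH xs n' (fun l => G (bas S :: l)) (fun l => H (bas S :: l))) => //.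
move=> Ss lSs aSs dSs; apply: (GH (S :: Ss)); rewrite /= ?lS //.
  by rewrite aS aSs.
by rewrite dS dSs.
Qed.

End Multilinear.

End FreeModule.

Arguments bas {k} S.

(** * Grafting and its signs *)

(** Sign exponents live in Z/2 and are encoded as booleans with xor as addition. A sign identity is
    proved by abstracting the parities that occur in it and deciding the propositional identity that
    is left. *)
Ltac bool_atoms f := repeat match goal with
  | |- context [f ?x] => let b := fresh "b" in generalize (f x) => b
  end.
Ltac bool_atoms2 f := repeat match goal with
  | |- context [f ?x ?y] => let b := fresh "b" in generalize (f x y) => b
  end.
Lemma addb_xorb a b : a (+) b = xorb a b.
Proof. by case: a; case: b. Qed.

(** Adds a known sign identity to the goal, so that a long identity can be proved as a sum of
    simpler ones. *)
Lemma addb_transfer (a b c d : bool) : a = b -> c (+) d = a (+) b -> c = d.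
Proof. by move=> ->; rewrite addbb; case: c; case: d. Qed.

Ltac bool_cases := rewrite ?addb_xorb ?addTb ?addFb; btauto.

Notation up s := (ar_up (st_ar s)).

Lemma graft_cons s ss q0 Ts :
  graft_row (s :: ss) q0 Ts = graft s q0 (take (up s) Ts) ::
    graft_row ss (top q0 (map st_ar (take (up s) Ts))) (drop (up s) Ts).
Proof. by []. Qed.

Lemma perm_graft_row ss : {in ss, forall s, forall q0 Ts, size Ts = up s ->
    perm_eq (boxes (graft s q0 Ts)) (boxes s ++ flatten (map boxes Ts))} ->
  forall q0 Ts, size Ts = width ss ->
  perm_eq (flatten (map boxes (graft_row ss q0 Ts)))
    (flatten (map boxes ss) ++ flatten (map boxes Ts)).
Proof.
elim: ss => [|s ss IH] H q0 Ts; first by move/size0nil->.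
rewrite width_cons => sT; rewrite graft_cons /=.
have sT1 : size (take (up s) Ts) = up s by rewrite size_takel // sT leq_addr.
have sT2 : size (drop (up s) Ts) = width ss by rewrite size_drop sT addKn.
rewrite -[in X in perm_eq _ (_ ++ X)](cat_take_drop (up s) Ts) map_cat.
rewrite flatten_cat perm_sym perm_catACA perm_sym.
by apply: perm_cat; [apply: H; rewrite ?mem_head | apply: IH => //; apply: mem_tail H].
Qed.

(** Grafting interleaves the boxes of [Ts] with those of [S], so the preorder is only kept up to a
    permutation. The sign of that permutation is [kap]. *)
Lemma perm_graft S q0 Ts : size Ts = up S ->
  perm_eq (boxes (graft S q0 Ts)) (boxes S ++ flatten (map boxes Ts)).
Proof.
elim/stacking_mem_ind: S q0 Ts => [|a p0 ss IH] q0 Ts.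
  by case: Ts => [|T [|? ?]] //= _; rewrite cats0.
rewrite graft_node /= => sT; rewrite perm_cons.
exact: perm_graft_row.
Qed.

Lemma perm_graft_rowE ss q0 Ts : size Ts = width ss ->
  perm_eq (flatten (map boxes (graft_row ss q0 Ts)))
    (flatten (map boxes ss) ++ flatten (map boxes Ts)).
Proof. by apply: perm_graft_row => s _ q T; apply: perm_graft. Qed.

Lemma all_flattenE (T : Type) (p : pred T) ss :
  all p (flatten ss) = all (all p) ss.
Proof. by elim: ss => //= s ss <-; rewrite all_cat. Qed.

Lemma legit_graft S q0 Ts : legit S -> all legit Ts ->
  composable (st_ar S) q0 (map st_ar Ts) ->
  legit (graft S q0 Ts) /\
  st_ar (graft S q0 Ts) = comp_arity (st_ar S) q0 (map st_ar Ts).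
Proof.
move=> /andP[wS bS] lT /andP[]; rewrite size_map => /eqP sT ch.
have wT : st_row q0 Ts.
  by rewrite /st_row ch; apply/allP => T /(allP lT)/andP[].
have [wG ->] := graftP wS wT sT; split=> //; rewrite /legit wG.
rewrite (perm_all _ (perm_graft q0 sT)) all_cat bS all_flattenE.
by apply/allP => _ /mapP[T /(allP lT)/andP[_ bT] ->].
Qed.

Lemma legit_node a p0 ss : legit (Node a p0 ss) =
  [&& composable a p0 (map st_ar ss), is_lax_box a & all legit ss].
Proof.
rewrite /legit [st_wf _]/= [boxes _]/= [all _ (_ :: _)]/= all_flattenE all_map.
set b := is_lax_box a.
have -> : all legit ss = all st_wf ss && all (preim boxes (all is_lax_box)) ss.
  by rewrite -all_predI; apply: eq_all.
by case: b; case: (all st_wf ss); rewrite /= ?andbT ?andbF.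
Qed.

Lemma legit_row p0 ss : all legit ss -> chained p0 (map st_ar ss) ->
  st_row p0 ss.
Proof.
by move=> lss ch; rewrite /st_row ch; apply/allP => s /(allP lss)/andP[].
Qed.

(** * Parities and Koszul signs of grafting *)

Definition pt S : bool := odd (count thin (boxes S)).
(** The parity of q - 1 + p - r, the exponent e_1 of the differential when [a] is the root box. It
    is additive under composition ([pa_comp]). *)
Definition pa (a : arity) : bool := odd (ar_up a + ar_in a + ar_out a).+1.
Definition pdeg S : bool := pt S (+) pa (st_ar S).

Fixpoint xr (w : stacking -> bool) (Ts : seq stacking) : bool :=
  if Ts is T :: Ts' then w T (+) xr w Ts' else false.

Lemma xr_cat w s t : xr w (s ++ t) = xr w s (+) xr w t.
Proof. by elim: s => //= x s ->; rewrite addbA. Qed.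

Lemma pt_node a p0 ss : pt (Node a p0 ss) = thin a (+) xr pt ss.
Proof.
rewrite /pt /= oddD oddb; congr addb.
by elim: ss => //= s ss IH; rewrite count_cat oddD IH.
Qed.

Lemma xr_ptE Ts : xr pt Ts = odd (count thin (flatten (map boxes Ts))).
Proof. by elim: Ts => //= T Ts ->; rewrite count_cat oddD. Qed.

Lemma pt_graft S q0 Ts : size Ts = up S ->
  pt (graft S q0 Ts) = pt S (+) xr pt Ts.
Proof.
move=> sT; rewrite {1}/pt (permP (perm_graft q0 sT)) count_cat oddD.
by rewrite xr_ptE.
Qed.

Lemma ptr_graft_row ss q0 Ts : size Ts = width ss ->
  xr pt (graft_row ss q0 Ts) = xr pt ss (+) xr pt Ts.
Proof.
move=> sT; rewrite !xr_ptE (permP (perm_graft_rowE q0 sT)) count_cat.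
by rewrite oddD.
Qed.

Lemma ndeg_node a p0 ss : ndeg (Node a p0 ss) =
  ((ar_in a + ar_up a - 2) + sumn (map ndeg ss))%N.
Proof.
rewrite /ndeg /=; congr addn.
by elim: ss => //= s ss IH; rewrite map_cat sumn_cat IH.
Qed.

Lemma ndeg_graft S q0 Ts : size Ts = up S ->
  ndeg (graft S q0 Ts) = (ndeg S + sumn (map ndeg Ts))%N.
Proof.
move=> sT; rewrite /ndeg (perm_sumn (perm_map _ (perm_graft q0 sT))).
rewrite map_cat sumn_cat; congr addn.
by elim: (Ts) => //= T Ts' IH; rewrite map_cat sumn_cat IH.
Qed.

Lemma xr_pa p0 Ts : chained p0 (map st_ar Ts) ->
  xr (fun T => pa (st_ar T)) Ts =
    odd (width Ts + size Ts + p0 + top p0 (map st_ar Ts))%N.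
Proof.
elim: Ts p0 => [|T Ts IH] p0 /=; first by rewrite /width !add0n addnn odd_double.
case/andP=> /eqP <- /IH ->; rewrite top_cons width_cons /pa.
by rewrite ?oddS /= !oddD /=; bool_atoms odd; bool_cases.
Qed.

Lemma pa_comp a p0 Ts : composable a p0 (map st_ar Ts) ->
  pa (comp_arity a p0 (map st_ar Ts)) =
    pa a (+) xr (fun T => pa (st_ar T)) Ts.
Proof.
case/andP; rewrite size_map => /eqP sT /xr_pa ->; rewrite /pa sT.
rewrite -[ar_up (comp_arity _ _ _)]/(width Ts).
rewrite -[ar_in (comp_arity _ _ _)]/(ar_in a + p0)%N.
rewrite -[ar_out (comp_arity _ _ _)]/(ar_out a + top p0 (map st_ar Ts))%N.
rewrite ?oddS /= !oddD.
by bool_atoms odd; bool_cases.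
Qed.

(** A non-thin Lax box (p, q, 1) has degree p + q - 2, of parity [pa]; for a thin box (0, q, 0) the
    two parities differ by one. Since [pa] is additive under composition, the discrepancy of a
    stacking is its number of thin boxes. *)
Lemma pdegE S : legit S -> odd (ndeg S) = pdeg S.
Proof.
elim/stacking_mem_ind: S => // a p0 ss IH.
rewrite legit_node => /and3P[cs /andP[a2 /eqP aE] lss].
rewrite /pdeg pt_node ndeg_node /= pa_comp // oddD.
have -> : odd (sumn (map ndeg ss)) = xr pt ss (+) xr (fun T => pa (st_ar T)) ss.
  elim: ss IH lss {cs} => //= s ss IHs IH /andP[ls lss].
  rewrite oddD IH ?mem_head // IHs //; last exact: mem_tail IH.
  by rewrite /pdeg -!addbA; congr addb; rewrite addbCA.
have -> : odd (ar_in a + ar_up a - 2) = thin a (+) pa a.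
  move: a2; rewrite aE /thin /pa /lax_arity /ar_in /ar_up /ar_out /=.
  case: (a.1.1) => [|p] h /=; first by rewrite !addn0 oddB //; case: (odd _).
  by rewrite oddB // addn1 /= !oddD /=; bool_atoms odd; bool_cases.
by move: (thin a) (pa a) => b c; bool_atoms2 xr; bool_cases.
Qed.

(** The Koszul exponent for moving the boxes of [Ts] from behind those of [S] to their places in the
    grafted stacking, thin boxes being odd and all others even: each block [T1] passes the siblings
    [ss'] on its right. *)
Fixpoint kap (S : stacking) (Ts : seq stacking) : bool :=
  match S with
  | Eta => false
  | Node _ _ ss =>
      (fix row (ss Ts : seq stacking) : bool :=
         if ss is s :: ss' then
           let T1 := take (up s) Ts in
           kap s T1 (+) (xr pt T1 && xr pt ss') (+) row ss' (drop (up s) Ts)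
         else false) ss Ts
  end.

Fixpoint kap_row (ss Ts : seq stacking) : bool :=
  if ss is s :: ss' then
    let T1 := take (up s) Ts in
    kap s T1 (+) (xr pt T1 && xr pt ss') (+) kap_row ss' (drop (up s) Ts)
  else false.

Lemma kap_node a p0 ss Ts : kap (Node a p0 ss) Ts = kap_row ss Ts.
Proof. by []. Qed.

Lemma take_width n (U1 U2 : seq stacking) m : size U1 = (n + m)%N ->
  [/\ take n (U1 ++ U2) = take n U1, drop n (U1 ++ U2) = drop n U1 ++ U2,
      size (take n U1) = n & size (drop n U1) = m].
Proof.
move=> sU; have ln : (n <= size U1)%N by rewrite sU leq_addr.
rewrite takel_cat // size_takel // size_drop sU addKn; split=> //.
by rewrite -{1}(cat_take_drop n U1) -catA drop_size_cat ?size_takel.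
Qed.

Lemma kap_row_cat s t U1 U2 : size U1 = width s ->
  kap_row (s ++ t) (U1 ++ U2) =
    kap_row s U1 (+) (xr pt U1 && xr pt t) (+) kap_row t U2.
Proof.
elim: s U1 => [|x s IH] U1; first by move/size0nil->.
rewrite width_cons => sU; have [E1 E2 s1 s2] := take_width U2 sU.
rewrite /= E1 E2 IH // xr_cat.
rewrite -[in xr pt U1](cat_take_drop (up x) U1) xr_cat.
by bool_atoms2 kap; bool_atoms2 kap_row; bool_atoms2 xr; bool_cases.
Qed.

Definition kapsum : seq stacking -> seq stacking -> bool :=
  fix row Ts Us := if Ts is T :: Ts' then
    kap T (take (up T) Us) (+) row Ts' (drop (up T) Us) else false.

(** The Koszul exponent for sorting T_1, U_1, T_2, U_2, ... into the T_i followed by the U_i, with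
    parities given by [w]; compare [koszul] and [koszul_kosw]. *)
Fixpoint kosw (w : stacking -> bool) (Ts Us : seq stacking) : bool :=
  if Ts is T :: Ts' then
    (xr w (take (up T) Us) && xr w Ts') (+) kosw w Ts' (drop (up T) Us)
  else false.

Lemma kap_rowE Ts Us : kap_row Ts Us = kapsum Ts Us (+) kosw pt Ts Us.
Proof.
elim: Ts Us => //= T Ts IH Us; rewrite IH.
move: (kosw _ _ _) => b; bool_atoms2 kap; bool_atoms2 kapsum; bool_atoms2 xr.
by bool_cases.
Qed.

(** Both sides are the exponent of one and the same shuffle of the boxes of [S], [Ts] and [Us],
    performed in two ways. *)
Lemma kap_assoc S p0 q0 Ts Us : st_wf S ->
  st_row p0 Ts -> size Ts = up S -> st_row q0 Us -> size Us = width Ts ->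
  kap S (graft_row Ts q0 Us) (+) kap_row Ts Us =
    kap S Ts (+) kap (graft S p0 Ts) Us.
Proof.
elim/stacking_mem_ind: S p0 q0 Ts Us => [|a b ss IH] p0 q0 Ts Us.
  case: Ts => [|T [|? ?]] //= _ _ _ _; rewrite /width /= addn0 => sU.
  by rewrite take_oversize ?sU //= andbF !addbF.
rewrite [st_wf _]/= => /andP[/andP[_ chs] wss] wT sT wU sU.
rewrite graft_node !kap_node -[up _]/(width ss) in sT *.
have {chs wss} : st_row b ss by apply/andP.
elim: ss b p0 q0 Ts Us IH sT wT wU sU => [|s ss IHs] b p0 q0 Ts Us IH.
  by move/size0nil->.
rewrite width_cons => sT wT wU sU; rewrite st_row_cons => /and3P[_ ws wss].
have [_ _ szt szd] := take_width [::] sT.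
set n := up s in sT szt szd *.
move: wT sU; rewrite -{1 2}(cat_take_drop n Ts) st_row_cat => /andP[wT1 wT2].
rewrite width_cat => sU; have [_ _ szu szv] := take_width [::] sU.
set m := width _ in sU szu szv.
move: wU; rewrite -{1}(cat_take_drop m Us) st_row_cat => /andP[wU1 wU2].
have [_ aG] := graftP ws wT1 szt.
have [_ R2 _ R4] := graft_rowP wT1 wU1 szu.
have -> : graft_row Ts q0 Us = graft_row (take n Ts ++ drop n Ts) q0 Us.
  by rewrite cat_take_drop.
rewrite graft_row_cat -/m graft_cons -/n /= aG -[ar_up (comp_arity _ _ _)]/m -/n.
rewrite take_size_cat ?R2 // drop_size_cat ?R2 //.
rewrite -[in kap_row Ts Us](cat_take_drop n Ts) -[in kap_row _ Us](cat_take_drop m Us).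
rewrite kap_row_cat // !ptr_graft_row //.
have := IH s (mem_head _ _) p0 q0 (take n Ts) (take m Us) ws wT1 szt wU1 szu.
have := IHs (ar_out (st_ar s)) _ _ (drop n Ts) (drop m Us) (mem_tail IH) szd wT2 wU2 szv wss.
move=> E1 E2; apply: (addb_transfer E1); apply: (addb_transfer E2).
bool_atoms2 kap; bool_atoms2 kap_row; bool_atoms2 xr; bool_cases.
Qed.

Fixpoint thr (K : bool) (l : seq arity) : bool :=
  if l is x :: l' then
    (~~ odd (ar_up x) && (odd (size l') (+) K (+) odd (ar_in x))) (+) thr K l'
  else false.

(** The summand of the desuspended sign S^d at one generator, modulo 2. The parameter [K] of [thr]
    is p - r + p_0, and q_i - 1 is odd when q_i is even. *)
Definition theta (a : arity) (p0 : nat) (l : seq arity) : bool :=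
  ((odd p0 (+) odd (top p0 l)) && odd (ar_out a))
  (+) thr (odd (ar_in a) (+) odd (ar_out a) (+) odd p0) l.

Definition wpa S := pa (st_ar S).

(** The sum over i < j of the shift [wpa] of the i-th factor times the thin parity [pt] of the j-th
    one. *)
Fixpoint mix (Ss : seq stacking) : bool :=
  if Ss is T :: Ss' then (wpa T && xr pt Ss') (+) mix Ss' else false.

(** The correction from composition with thin boxes odd to composition in true degrees. In contrast
    to [kap] it depends only on the arities and thin parities of the factors. *)
Definition loc S p0 Ts := theta (st_ar S) p0 (map st_ar Ts) (+) mix (S :: Ts).

Definition sg S p0 Ts : bool := kap S Ts (+) loc S p0 Ts.

Fixpoint rsum (f : stacking -> nat -> seq stacking -> bool) q0 Ts Us : bool :=
  if Ts is T :: Ts' then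
    let U1 := take (up T) Us in
    f T q0 U1 (+) rsum f (top q0 (map st_ar U1)) Ts' (drop (up T) Us)
  else false.

Lemma rsum_kap q0 Ts Us : rsum (fun T _ => kap T) q0 Ts Us = kapsum Ts Us.
Proof. by elim: Ts q0 Us => //= T Ts IH q0 Us; rewrite IH. Qed.

Lemma rsumD f g q0 Ts Us :
  rsum (fun T q Us => f T q Us (+) g T q Us) q0 Ts Us =
    rsum f q0 Ts Us (+) rsum g q0 Ts Us.
Proof. by elim: Ts q0 Us => //= T Ts IH q0 Us; rewrite IH addbACA. Qed.

Lemma mix_cat s t : mix (s ++ t) = mix s (+) mix t (+) (xr wpa s && xr pt t).
Proof.
elim: s => [|x s IH] /=; first by rewrite addbF.
by rewrite IH xr_cat; bool_atoms2 xr; bool_atoms mix; bool_atoms wpa; bool_cases.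
Qed.

Definition row_ok p0 Ts q0 Us := [&& st_row p0 Ts, st_row q0 Us &
  size Us == width Ts].

Lemma row_okP p0 T Ts q0 Us : row_ok p0 (T :: Ts) q0 Us ->
  let U1 := take (up T) Us in let U2 := drop (up T) Us in
  [/\ ar_in (st_ar T) = p0, [/\ st_wf T, st_row q0 U1 & size U1 = up T],
    row_ok (ar_out (st_ar T)) Ts (top q0 (map st_ar U1)) U2 &
    Us = U1 ++ U2].
Proof.
case/and3P; rewrite st_row_cons => /and3P[/eqP pT wT wTs] wU /eqP.
rewrite width_cons => sU.
have [_ _ s1 s2] := take_width [::] sU.
move: wU; rewrite -{1}(cat_take_drop (up T) Us) st_row_cat => /andP[w1 w2].
by split; rewrite ?cat_take_drop //; apply/and3P; rewrite s2.
Qed.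

Lemma kosw_cons w T Ts Us : kosw w (T :: Ts) Us =
  (xr w (take (up T) Us) && xr w Ts) (+) kosw w Ts (drop (up T) Us).
Proof. by []. Qed.

Lemma rsum_cons f q0 T Ts Us : rsum f q0 (T :: Ts) Us =
  f T q0 (take (up T) Us) (+)
  rsum f (top q0 (map st_ar (take (up T) Us))) Ts (drop (up T) Us).
Proof. by []. Qed.

Lemma mix_cons T Ts : mix (T :: Ts) = (wpa T && xr pt Ts) (+) mix Ts.
Proof. by []. Qed.

Lemma xr_cons w T Ts : xr w (T :: Ts) = w T (+) xr w Ts.
Proof. by []. Qed.

(** As [pdeg] is the sum of [pt] and [wpa], its Koszul exponent differs from the sum of theirs by
    cross terms. These are what [mix] changes by when two rows are composed vertically. *)
Lemma mix_row p0 Ts q0 Us : row_ok p0 Ts q0 Us ->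
  mix Ts (+) mix Us (+) (xr wpa Ts && xr pt Us) (+) kosw pt Ts Us =
    mix (graft_row Ts q0 Us) (+) rsum (fun T _ Us => mix (T :: Us)) q0 Ts Us
    (+) kosw pdeg Ts Us (+) kosw wpa Ts Us.
Proof.
elim: Ts p0 q0 Us => [|T Ts IH] p0 q0 Us.
  by case/and3P=> _ _ /eqP/size0nil->.
case/row_okP; set U1 := take _ _; set U2 := drop _ _.
move=> _ [wT wU1 s1] ok EU; have /and3P[_ _ /eqP s2] := ok.
have := IH _ _ _ ok; rewrite graft_cons -/U1 -/U2.
have EM : mix Us = mix U1 (+) mix U2 (+) (xr wpa U1 && xr pt U2).
  by rewrite {1}EU mix_cat.
have EX : xr pt Us = xr pt U1 (+) xr pt U2 by rewrite {1}EU xr_cat.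
rewrite rsum_cons !kosw_cons !mix_cons !xr_cons -/U1 -/U2 EM EX.
rewrite ptr_graft_row //.
have -> : wpa (graft T q0 U1) = wpa T (+) xr wpa U1.
  have [_] := graftP wT wU1 s1; rewrite /wpa => ->; apply: pa_comp.
  by rewrite /composable size_map s1 eqxx; case/andP: wU1.
have D s : xr pdeg s = xr pt s (+) xr wpa s.
  by elim: s => //= x s ->; rewrite /pdeg -/(wpa x); case: pt; case: wpa; case: xr; case: xr.
rewrite !D; move: (kosw pt _ _) (kosw pdeg _ _) (kosw wpa _ _) => k1 k2 k3.
move: (rsum _ _ _ _) => r E; apply: (addb_transfer E).
bool_atoms2 xr; bool_atoms mix; bool_atoms wpa; bool_cases.
Qed.

Lemma thr_cat K s t :
  thr K (s ++ t) = thr (K (+) odd (size t)) s (+) thr K t.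
Proof.
elim: s => //= x s ->; rewrite size_cat oddD.
by bool_atoms odd; bool_atoms2 thr; bool_cases.
Qed.

Lemma thrD K c Ts : thr (K (+) c) (map st_ar Ts) =
  thr K (map st_ar Ts) (+) (c && odd (width Ts + size Ts)).
Proof.
elim: Ts => [|T Ts IH] /=; first by rewrite andbF.
rewrite IH size_map width_cons !oddD /=.
by bool_atoms odd; bool_atoms2 thr; bool_cases.
Qed.

(** The counterpart of [mix_row] for the desuspended sign: its change under vertical composition
    absorbs the exponent [kosw wpa]. The parity [z] is free because the induction along the row
    changes [q0]; the application has [z] equal to [odd q0]. *)
Lemma theta_row p0 Ts q0 Us (K z : bool) : row_ok p0 Ts q0 Us ->
  let pn := odd (top p0 (map st_ar Ts)) in
  let qn := odd (top q0 (map st_ar Us)) in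
  thr K (map st_ar Ts) (+) thr (K (+) z (+) pn) (map st_ar Us)
  (+) kosw wpa Ts Us =
    thr (K (+) z) (map st_ar (graft_row Ts q0 Us))
    (+) rsum (fun T q Us => theta (st_ar T) q (map st_ar Us)) q0 Ts Us
    (+) ((odd q0 (+) qn) && pn)
    (+) ((odd q0 (+) z) && odd (width Ts + size Ts)).
Proof.
elim: Ts p0 q0 Us => [|T Ts IH] p0 q0 Us.
  case/and3P=> _ _ /eqP/size0nil-> /=.
  by rewrite /top /= addbb /= andbF.
case/row_okP; set U1 := take _ _; set U2 := drop _ _.
move=> EP [wT wU1 s1] ok EU; have /and3P[wTs wU2 /eqP s2] := ok.
have := IH _ _ _ ok; cbv zeta.
rewrite graft_cons -/U1 -/U2.
have ET : thr (K (+) z (+) odd (top p0 (map st_ar (T :: Ts)))) (map st_ar Us) =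
  thr (K (+) z (+) odd (top p0 (map st_ar (T :: Ts))) (+) odd (size U2))
    (map st_ar U1) (+)
  thr (K (+) z (+) odd (top p0 (map st_ar (T :: Ts)))) (map st_ar U2).
  by rewrite {1}EU map_cat thr_cat size_map.
rewrite ET {ET} ![map _ (_ :: _)]/= top_cons.
set q1 := top q0 (map st_ar U1).
have -> : top q0 (map st_ar Us) = top q1 (map st_ar U2).
  by rewrite {1}EU map_cat top_cat.
rewrite rsum_cons !kosw_cons -/U1 -/U2 -/q1 ![thr _ (_ :: _)]/=.
have [_ aG] := graftP wT wU1 s1; rewrite aG.
have xT := xr_pa (proj1 (andP wTs)); have xU := xr_pa (proj1 (andP wU1)).
rewrite -/wpa -/q1 in xT xU.
have -> : xr wpa U1 = xr (fun T => pa (st_ar T)) U1 by [].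
have -> : xr wpa Ts = xr (fun T => pa (st_ar T)) Ts by [].
rewrite xT xU width_cons -[ar_up (comp_arity _ _ _)]/(width U1).
rewrite -[ar_in (comp_arity _ _ _)]/(ar_in (st_ar T) + q0)%N.
have [_ Rs _ _] := graft_rowP wTs wU2 s2.
rewrite !size_map -/q1 in Rs *; rewrite Rs s2 s1.
have -> : K (+) z (+) odd (top (ar_out (st_ar T)) (map st_ar Ts)) (+) odd (width Ts)
  = (odd (ar_in (st_ar T)) (+) odd (ar_out (st_ar T)) (+) odd q0) (+)
   (K (+) z (+) odd (top (ar_out (st_ar T)) (map st_ar Ts)) (+) odd (width Ts) (+)
    odd (ar_in (st_ar T)) (+) odd (ar_out (st_ar T)) (+) odd q0).
  by move: (K) (z) => k' z'; bool_atoms odd; bool_cases.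
rewrite [thr _ (map st_ar U1)]thrD /theta -/q1 s1.
move: (rsum _ _ _ _) (kosw _ _ _) => t5 t6 E; apply: (addb_transfer E) => {E}.
rewrite /= !oddD /= ?oddD; move: (K) (z) => k' z'.
bool_atoms2 thr; bool_atoms odd; bool_cases.
Qed.

(** The sum of [kap_assoc], [mix_row] and [theta_row]. This cocycle identity is associativity of
    composition with the Koszul sign of the true degrees. *)
Lemma sg_assoc S p0 q0 Ts Us : st_wf S -> row_ok p0 Ts q0 Us ->
  size Ts = up S ->
  rsum sg q0 Ts Us (+) sg S (p0 + q0) (graft_row Ts q0 Us) =
    kosw pdeg Ts Us (+) sg S p0 Ts (+) sg (graft S p0 Ts) q0 Us.
Proof.
move=> wS ok sT; have /and3P[wT wU /eqP sU] := ok.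
have E1 := kap_assoc wS wT sT wU sU; rewrite kap_rowE in E1.
have E2 := mix_row ok.
have E3 := theta_row (odd (ar_in (st_ar S)) (+) odd (ar_out (st_ar S)) (+) odd p0)
   (odd q0) ok; cbv zeta in E3.
have [_ aG] := graftP wS wT sT.
have [_ Rs Rw Rt] := graft_rowP wT wU sU.
have EA : rsum sg q0 Ts Us = kapsum Ts Us
  (+) (rsum (fun T q Us => theta (st_ar T) q (map st_ar Us)) q0 Ts Us
  (+) rsum (fun T _ Us => mix (T :: Us)) q0 Ts Us).
  by rewrite -(rsum_kap q0) -!rsumD.
rewrite EA {EA} /sg /loc !mix_cons ptr_graft_row // [wpa (graft _ _ _)]/wpa aG.
rewrite pa_comp; last by rewrite /composable size_map sT eqxx; case/andP: wT.
rewrite -/(wpa S) -/wpa /theta Rt.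
rewrite -[ar_in (comp_arity _ _ _)]/(ar_in (st_ar S) + p0)%N.
rewrite -[ar_out (comp_arity _ _ _)]/(ar_out (st_ar S) + top p0 (map st_ar Ts))%N.
have -> : odd (ar_in (st_ar S) + p0) (+)
    odd (ar_out (st_ar S) + top p0 (map st_ar Ts)) (+) odd q0 =
  odd (ar_in (st_ar S)) (+) odd (ar_out (st_ar S)) (+) odd p0 (+) odd q0 (+)
    odd (top p0 (map st_ar Ts)) by rewrite !oddD; bool_atoms odd; bool_cases.
have -> : odd (ar_in (st_ar S)) (+) odd (ar_out (st_ar S)) (+) odd (p0 + q0) =
  odd (ar_in (st_ar S)) (+) odd (ar_out (st_ar S)) (+) odd p0 (+) odd q0.
  by rewrite !oddD; bool_atoms odd; bool_cases.
apply: (addb_transfer E1); apply: (addb_transfer E2); apply: (addb_transfer E3).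
move: E1 E2 E3 => _ _ _; rewrite !oddD.
move: (rsum _ _ _ _) (rsum _ _ _ _) (kosw _ _ _) (kosw _ _ _) (kosw _ _ _) => r1 r2 k1 k2 k3.
move: (kapsum _ _) => k4.
bool_atoms2 xr; bool_atoms mix; bool_atoms wpa; bool_atoms2 kap; bool_atoms2 thr.
bool_atoms odd; bool_cases.
Qed.

(** * The derivation *)

Section Derivation.
Variable k : fieldType.
Variable tq : arity -> seq (bool * stacking).
Notation V := (fmod k).
Notation sn b := ((-1) ^+ (nat_of_bool b) : k).

Definition gr p0 Ts : V -> V :=
  lin (fun S => sn (kap S Ts) *: bas (graft S p0 Ts)).
HB.instance Definition _ p0 Ts := GRing.Linear.on (gr p0 Ts).

Lemma gr_bas p0 Ts c S : legit S ->
  gr p0 Ts (c *: bas S) = c *: (sn (kap S Ts) *: bas (graft S p0 Ts)).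
Proof. by move=> lS; rewrite linearZ; congr (_ *: _); apply: lin_bas. Qed.

Lemma gr_bas1 p0 Ts S : legit S ->
  gr p0 Ts (bas S) = sn (kap S Ts) *: bas (graft S p0 Ts).
Proof. exact: lin_bas. Qed.

Definition dgen a : V := \sum_(q <- tq a) sn q.1 *: bas q.2.

Section Row.
Variable dS : stacking -> V.
(** The derivation along a row in continuation style: [F] turns each modified row into an element of
    a module. Abstracting from [dS] makes the recursion available inside the fixpoint [dS]. *)
Definition drow_ := fix row (W : lmodType k) (F : seq stacking -> W)
    (ss : seq stacking) : W :=
  if ss is s :: ss' then
    lin (fun s' => F (s' :: ss')) (dS s)
      + sn (pt s) *: row W (fun r => F (s :: r)) ss'
  else 0.
End Row.

Fixpoint dS (S : stacking) : V :=
  match S with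
  | Eta => 0
  | Node a p0 ss => gr p0 ss (dgen a) +
      sn (thin a) *: drow_ dS (fun r => bas (Node a p0 r)) ss
  end.

Notation drow := (drow_ dS).

Lemma drow_cons (W : lmodType k) (F : seq stacking -> W) s ss :
  drow F (s :: ss) = lin (fun s' => F (s' :: ss)) (dS s)
      + sn (pt s) *: drow (fun r => F (s :: r)) ss.
Proof. by []. Qed.

Lemma dS_node a p0 ss : dS (Node a p0 ss) = gr p0 ss (dgen a) +
  sn (thin a) *: drow (fun r => bas (Node a p0 r)) ss.
Proof. by []. Qed.

Lemma lin_drow (W U : lmodType k) (g : {linear W -> U})
  (F : seq stacking -> W) ss : g (drow F ss) = drow (fun r => g (F r)) ss.
Proof.
elim: ss F => [|s ss IH] F; first exact: linear0.
by rewrite !drow_cons linearD linearZ lin_linE IH.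
Qed.

Lemma drowD (W : lmodType k) (F G : seq stacking -> W) ss :
  drow (fun r => F r + G r) ss = drow F ss + drow G ss.
Proof.
elim: ss F G => [|s ss IH] F G; first by rewrite addr0.
by rewrite !drow_cons IH lin_add scalerDr addrACA.
Qed.

Lemma drowZ (W : lmodType k) (F : seq stacking -> W) c ss :
  drow (fun r => c *: F r) ss = c *: drow F ss.
Proof.
elim: ss F => [|s ss IH] F; first by rewrite scaler0.
by rewrite !drow_cons IH lin_scale scalerDr !scalerA mulrC.
Qed.

Lemma lin_drowC (W : lmodType k) (F : stacking -> seq stacking -> W) ss x :
  lin (fun s => drow (F s) ss) x = drow (fun r => lin (F^~ r) x) ss.
Proof.
elim: ss F => [|s ss IH] F.
  by rewrite /= /lin big1 // => t _; rewrite scaler0.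
rewrite !drow_cons lin_add lin_scale IH linC //.
Qed.

Hypothesis tqP : forall a, is_lax_box a -> forall q, q \in tq a ->
  [/\ legit q.2, st_ar q.2 = a, pt q.2 = ~~ thin a &
      (ndeg q.2).+1 = (ar_in a + ar_up a - 2)%N].

Definition dterm S S' := [/\ st_ar S' = st_ar S, pt S' = ~~ pt S &
  (ndeg S').+1 = ndeg S].
Definition drterm ss ss' := [/\ all legit ss', map st_ar ss' = map st_ar ss,
  xr pt ss' = ~~ xr pt ss & (sumn (map ndeg ss')).+1 = sumn (map ndeg ss)].

Lemma eq_drow_in (W : lmodType k) (F G : seq stacking -> W) ss :
  all legit ss -> {in ss, forall s, inspan (dterm s) (dS s)} ->
  (forall ss', drterm ss ss' -> F ss' = G ss') -> drow F ss = drow G ss.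
Proof.
elim: ss F G => //= s ss IH F G /andP[ls lss] H FG.
congr (_ + _ *: _).
  apply: (eq_lin_in (H s (mem_head _ _))) => s' ls' [a' p' n']; apply: FG.
  by split; rewrite /= ?ls' ?a' ?p' -?n' // ?addNb ?addSn.
apply: IH => // [t ts|ss' [l' a' p' n']]; first by apply: H; rewrite inE ts orbT.
by apply: FG; split; rewrite /= ?ls ?a' ?p' -?n' // ?addbN ?addnS.
Qed.

Lemma inspan_drow P (F : seq stacking -> V) ss :
  all legit ss -> {in ss, forall s, inspan (dterm s) (dS s)} ->
  (forall ss', drterm ss ss' -> inspan P (F ss')) -> inspan P (drow F ss).
Proof.
elim: ss F => [|s ss IH] F /=; first by move=> *; apply: inspan0.
move=> /andP[ls lss] H PF; apply: inspanD.
  apply: (inspan_lin (H s (mem_head _ _))) => s' ls' [a' p' n']; apply: PF.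
  by split; rewrite /= ?ls' ?a' ?p' -?n' // ?addNb ?addSn.
apply: inspanZ; apply: IH => // [t ts|ss' [l' a' p' n']].
  by apply: H; rewrite inE ts orbT.
by apply: PF; split; rewrite /= ?ls ?a' ?p' -?n' // ?addbN ?addnS.
Qed.

Lemma dgen_span a : is_lax_box a ->
  inspan (fun S => [/\ st_ar S = a, pt S = ~~ thin a &
     (ndeg S).+1 = (ar_in a + ar_up a - 2)%N]) (dgen a).
Proof.
move=> la; apply: inspan_sum => q qa; apply: inspanZ; apply: inspan_bas.
by have [] := tqP la qa.
Qed.

Lemma composable_up a p0 ss : composable a p0 (map st_ar ss) ->
  size ss = ar_up a.
Proof. by rewrite /composable size_map => /andP[/eqP]. Qed.

Lemma dS_span S : legit S -> inspan (dterm S) (dS S).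
Proof.
elim/stacking_mem_ind: S => [_|a p0 ss IH]; first exact: inspan0.
rewrite legit_node => /and3P[cs la lss]; have sz := composable_up cs.
have H : {in ss, forall s, inspan (dterm s) (dS s)}.
  by move=> s ss_s; apply: IH => //; apply: (allP lss).
rewrite dS_node; apply: inspanD.
  apply: (inspan_lin (dgen_span la)) => S lS [aS pS nS].
  apply: inspanZ; apply: inspan_bas; rewrite /dterm pt_node ndeg_node -nS.
  rewrite pt_graft ?ndeg_graft ?aS // pS.
  by have [] := legit_graft (S := S) (q0 := p0) lS lss; rewrite aS // addNb addSn.
apply: inspanZ; apply: inspan_drow => // ss' [l' a' p' n'].
apply: inspan_bas; rewrite /dterm !pt_node !ndeg_node -n' p' addbN addnS.
by rewrite /= a'.
Qed.

Lemma dS_spanr ss : all legit ss ->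
  {in ss, forall s, inspan (dterm s) (dS s)}.
Proof. by move=> lss s ss_s; apply: dS_span; apply: (allP lss). Qed.

Definition dgr_spec S := forall p0 Ts, all legit Ts ->
  composable (st_ar S) p0 (map st_ar Ts) ->
  sn (kap S Ts) *: dS (graft S p0 Ts) = gr p0 Ts (dS S)
    + sn (pt S) *: drow (fun r => sn (kap S r) *: bas (graft S p0 r)) Ts.

Lemma sn_addb b c : sn (b (+) c) = sn b * sn c.
Proof. exact: signr_addb. Qed.

Lemma sn_sq b : sn b * sn b = 1.
Proof. by rewrite -sn_addb addbb. Qed.

Lemma drow_cat (W : lmodType k) (F : seq stacking -> W) s t :
  drow F (s ++ t) = drow (fun r => F (r ++ t)) s
    + sn (xr pt s) *: drow (fun r => F (s ++ r)) t.
Proof.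
elim: s F => [|x s IH] F; first by rewrite /= add0r scale1r.
by rewrite cat_cons !drow_cons IH /= sn_addb scalerDr addrA scalerA.
Qed.

Lemma size_map_ar (Ts Us : seq stacking) : map st_ar Ts = map st_ar Us ->
  size Ts = size Us.
Proof. by move=> /(congr1 size); rewrite !size_map. Qed.

(** The Leibniz rule along a row. The continuation [F] allows the head column and the tail to be
    treated separately; what is left is the sign of the block [T1] passing [ss]. *)
Lemma dgr_row (W : lmodType k) (F : seq stacking -> W) ss p0 Ts b :
  {in ss, forall s, dgr_spec s} -> all legit ss -> all legit Ts ->
  chained b (map st_ar ss) -> chained p0 (map st_ar Ts) ->
  size Ts = width ss ->
  sn (kap_row ss Ts) *: drow F (graft_row ss p0 Ts) =
    drow (fun r => sn (kap_row r Ts) *: F (graft_row r p0 Ts)) ss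
    + sn (xr pt ss) *:
        drow (fun r => sn (kap_row ss r) *: F (graft_row ss p0 r)) Ts.
Proof.
elim: ss b p0 Ts F => [|s ss IH] b p0 Ts F H.
  by move=> _ _ _ _ /size0nil->; rewrite /= !scaler0 addr0.
move=> /andP[ls lss] lT /andP[_ chs] chT; rewrite width_cons => sT.
have [_ _ s1 s2] := take_width [::] sT.
set T1 := take _ _ in s1 *; set T2 := drop _ _ in s2 *.
have ET : Ts = T1 ++ T2 by rewrite cat_take_drop.
have /andP[lT1 lT2] : all legit T1 && all legit T2 by rewrite -all_cat -ET.
move: chT; rewrite ET map_cat chained_cat => /andP[ch1 ch2].
set p1 := top p0 (map st_ar T1) in ch2.
have cs1 : composable (st_ar s) p0 (map st_ar T1).
  by rewrite /composable size_map s1 eqxx.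
have [lg ag] := legit_graft ls lT1 cs1.
set R := graft_row ss p1 T2.
have IH2 := fun F => IH _ p1 T2 F (mem_tail H) lss lT2 chs ch2 s2.

set c := xr pt T1 && xr pt ss; set K := kap_row ss T2.
have EA : drow (fun r => sn (kap_row r Ts) *: F (graft_row r p0 Ts)) (s :: ss)
  = sn (c (+) K) *:
      lin (fun s' => sn (kap s' T1) *: F (graft s' p0 T1 :: R)) (dS s)
    + sn (pt s (+) kap s T1 (+) c (+) xr pt T1) *:
      drow (fun r => sn (kap_row r T2) *: F (graft s p0 T1 :: graft_row r p1 T2))
        ss.
  rewrite drow_cons -lin_scale; congr (_ + _).
    apply: (eq_lin_in (dS_span ls)) => s' ls' [a' _ _].
    rewrite scalerA -sn_addb /= a' -/T1 -/T2; congr (sn _ *: _); rewrite /c /K.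
    bool_atoms2 kap; bool_atoms2 kap_row; bool_atoms2 xr; bool_cases.
  rewrite -!addbA (sn_addb (pt s)) -scalerA; congr (_ *: _); rewrite -drowZ.
  apply: eq_drow_in => //; first exact: dS_spanr.
  move=> r [_ _ pr _]; rewrite scalerA -sn_addb /= -/T1 -/T2 pr; congr (sn _ *: _).
  rewrite /c; bool_atoms2 kap; bool_atoms2 kap_row; bool_atoms2 xr; bool_cases.
have EB : drow (fun r => sn (kap_row (s :: ss) r) *:
     F (graft_row (s :: ss) p0 r)) Ts =
   sn (c (+) xr pt ss (+) K) *:
     drow (fun r => sn (kap s r) *: F (graft s p0 r :: R)) T1
   + sn (xr pt T1 (+) kap s T1 (+) c) *:
     drow (fun r => sn (kap_row ss r) *: F (graft s p0 T1 :: graft_row ss p1 r)) T2.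
  rewrite {1}ET drow_cat; congr (_ + _).
    rewrite -drowZ; apply: eq_drow_in => //; first exact: dS_spanr.
    move=> r [_ ar pr _]; have sr : size r = up s by rewrite (size_map_ar ar).
    rewrite /= take_size_cat // drop_size_cat // ar -/p1 -/R -/K pr.
    rewrite scalerA -sn_addb; congr (sn _ *: _).
    rewrite /c /K; bool_atoms2 kap; bool_atoms2 kap_row; bool_atoms2 xr.
    bool_cases.
  rewrite -addbA sn_addb -scalerA; congr (_ *: _); rewrite -drowZ.
  apply: eq_drow_in => //; first exact: dS_spanr.
  move=> r _; rewrite /= take_size_cat // drop_size_cat // -/p1.
  by rewrite scalerA -sn_addb.
have E1 := H s (mem_head _ _) p0 T1 lT1 cs1.
have {}E1 (f : stacking -> W) : sn (kap s T1) *: lin f (dS (graft s p0 T1)) =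
    lin (fun s' => sn (kap s' T1) *: f (graft s' p0 T1)) (dS s)
    + sn (pt s) *: drow (fun r => sn (kap s r) *: f (graft s p0 r)) T1.
  have := congr1 (lin f) E1; rewrite linearZ linearD linearZ => ->.
  rewrite lin_drow /gr lin_linE; congr (_ + _ *: _).
    apply: (eq_lin_in (dS_span ls)) => s' ls' [a' _ _].
    by rewrite linearZ /= lin_bas //; have [] := legit_graft (q0 := p0) ls' lT1; rewrite ?a'.
  apply: eq_drow_in => //; first exact: dS_spanr.
  move=> r [lr ar _ _]; rewrite linearZ /= lin_bas //.
  by have [] := legit_graft (q0 := p0) ls lr; rewrite ?ar.

have EL (x : W) : sn (kap_row (s :: ss) Ts) *: x =
    sn (c (+) K) *: (sn (kap s T1) *: x).
  rewrite scalerA -sn_addb /= -/T1 -/T2 -/c -/K; congr (sn _ *: _).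
  rewrite /c /K; bool_atoms2 kap; bool_atoms2 kap_row; bool_atoms2 xr; bool_cases.
rewrite -?ET.
rewrite [X in _ = X + _]EA EB {EA EB}.
rewrite graft_cons -/T1 -/T2 -/p1 -/R drow_cons [LHS]scalerDr EL E1 scalerDr.
rewrite -!addrA; congr (_ + _); rewrite scalerDr [RHS]addrCA; congr (_ + _).
  rewrite !scalerA -!sn_addb /=; congr (sn _ *: _).
  by rewrite /c /K; bool_atoms2 kap; bool_atoms2 kap_row; bool_atoms pt; bool_atoms2 xr; bool_cases.
have -> : sn (kap_row (s :: ss) Ts) = sn (c (+) kap s T1) * sn K.
  rewrite -sn_addb /= -/T1 -/T2 -/c -/K; congr (sn _).
  rewrite /c /K; bool_atoms2 kap; bool_atoms2 kap_row; bool_atoms2 xr; bool_cases.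
rewrite pt_graft // scalerA mulrAC -scalerA -/K IH2 scalerDr !scalerA -!sn_addb.
congr (sn _ *: _ + sn _ *: _); rewrite /c /=; bool_atoms2 kap; bool_atoms pt;
  bool_atoms2 xr; bool_cases.
Qed.

(** The Leibniz rule for grafting, by induction on the tree. At the root, associativity of grafting
    with its sign [kap_assoc] lets the new row pass the differentiated box; the entries are handled
    by [dgr_row]. *)
Lemma dgr S : legit S -> dgr_spec S.
Proof.
elim/stacking_mem_ind: S => [_ p0 Ts|a b ss IH lS p0 Ts].
  case: Ts => [|T [|? ?]] //= /andP[lT _] /andP[_] _.
  rewrite linear0 add0r !scale1r !scaler0 addr0.
  rewrite (eq_lin (g := bas)) ?lin_basE // => S _.
  by rewrite scale1r.
move: lS; rewrite legit_node => /and3P[cs la lss] lTs cT.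
have sz := composable_up cs; have sT : size Ts = width ss by case/andP: cT; rewrite size_map => /eqP.
have wss : st_row b ss by case/andP: cs => _ ch; apply: legit_row.
have wTs : st_row p0 Ts by case/andP: cT => _ ch; apply: legit_row.
have chs := proj1 (andP wss); have chT := proj1 (andP wTs).
rewrite kap_node graft_node !dS_node scalerDr.
have EG x c y : gr p0 Ts (x + c *: y) = gr p0 Ts x + c *: gr p0 Ts y.
  by rewrite linearD linearZ.
rewrite EG {EG}.
set R := graft_row ss p0 Ts; rewrite pt_node sn_addb -scalerA.
rewrite -addrA; congr (_ + _).
  rewrite {1 3}/gr -lin_scale lin_linE.
  apply: (eq_lin_in (dgen_span la)) => Q lQ [aQ _ _].
  have cQ : composable (st_ar Q) b (map st_ar ss) by rewrite aQ.
  have [lG aG] := legit_graft lQ lss cQ.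
  have -> : graft Q (b + p0) R = graft (graft Q b ss) p0 Ts.
    by rewrite (graftA (p0 := b) (proj1 (andP lQ)) wss _ wTs sT) // aQ.
  rewrite [RHS](gr_bas _ _ _ lG) !scalerA. rewrite -!sn_addb.
  congr (sn _ *: _).
  have := kap_assoc (p0 := b) (proj1 (andP lQ)) wss _ wTs sT; rewrite aQ => /(_ sz) <-.
  by rewrite addbC.
rewrite (lin_drow (gr p0 Ts)).
have SC (c d : k) (x : V) : c *: (d *: x) = d *: (c *: x).
  by rewrite !scalerA mulrC.
rewrite [LHS]SC.
rewrite (@dgr_row _ _ ss p0 Ts b) //; last by move=> s ss_s; apply: IH => //; apply: (allP lss).
rewrite scalerDr.
have E0 : drow (fun r => sn (kap_row r Ts) *:
    bas (Node a (b + p0) (graft_row r p0 Ts))) ss =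
    drow (fun r => gr p0 Ts (bas (Node a b r))) ss.
  apply: eq_drow_in => //; first exact: dS_spanr.
  move=> r [lr ar _ _]; rewrite gr_bas1 ?kap_node //.
  by rewrite legit_node ar cs la.
have E1 : drow (fun r => sn (kap_row ss r) *:
    bas (Node a (b + p0) (graft_row ss p0 r))) Ts =
    drow (fun r => sn (kap (Node a b ss) r) *: bas (graft (Node a b ss) p0 r)) Ts.
  apply: eq_drow_in => //; first exact: dS_spanr.
by rewrite E0 E1.
Qed.

Hypothesis dgen2 : forall a, is_lax_box a -> lin dS (dgen a) = 0.

(** The square of an odd derivation is a derivation, so it vanishes once it vanishes on generators.
    Explicitly, the mixed terms, where root and row are hit once each, cancel by the Leibniz
    rule. *)
Lemma dS_dS S : legit S -> lin dS (dS S) = 0.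
Proof.
elim/stacking_mem_ind: S => [_|a p0 ss IH]; first exact: linear0.
rewrite legit_node => /and3P[cs la lss].
have sz := composable_up cs.
rewrite dS_node linearD linearZ /= lin_drow.
(* Differentials of two different entries of a row anticommute; two differentials of the same entry
   vanish by induction. *)
have D2 (W : lmodType k) (F : seq stacking -> W) : drow (drow F) ss = 0.
  elim: ss F IH lss {cs sz} => // s ss IHs F IH /= /andP[ls lss].
  rewrite -/drow.
  have -> : lin (fun s' => lin (fun s'' => F (s'' :: ss)) (dS s')
      + sn (pt s') *: drow (fun r => F (s' :: r)) ss) (dS s)
    = - sn (pt s) *: drow (fun r => lin (fun s' => F (s' :: r)) (dS s)) ss.
    rewrite -lin_drowC -lin_scale lin_add -lin_linE IH ?mem_head //.
    rewrite linear0 add0r; apply: (eq_lin_in (dS_span ls)) => s' _ [_ -> _].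
    by rewrite -signrN.
  have -> : drow (fun r => lin (fun s' => F (s' :: r)) (dS s) +
       sn (pt s) *: drow (fun r' => F (s :: r')) r) ss =
       drow (fun r => lin (fun s' => F (s' :: r)) (dS s)) ss.
    rewrite drowD drowZ (IHs (fun r => F (s :: r))) ?scaler0 ?addr0 //.
    by move=> t ts; apply: IH; rewrite inE ts orbT.
  by rewrite scaleNr addNr.
have -> : drow (fun r => lin dS (bas (Node a p0 r))) ss =
    drow (fun r => gr p0 r (dgen a)) ss.
  rewrite (eq_drow_in (G := fun r => gr p0 r (dgen a) +
     sn (thin a) *: drow (fun r => bas (Node a p0 r)) r)) //.
  - by rewrite drowD drowZ D2 scaler0 addr0.
  - exact: dS_spanr.
  by move=> r [lr ar _ _]; rewrite lin_bas // legit_node ar cs la.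
rewrite /gr lin_linE.
rewrite (eq_lin_in (g := fun Q => gr p0 ss (dS Q) - sn (thin a) *:
   drow (fun r => sn (kap Q r) *: bas (graft Q p0 r)) ss) (dgen_span la)); last first.
  move=> Q lQ [aQ pQ _]; have cQ : composable (st_ar Q) p0 (map st_ar ss) by rewrite aQ.
  have [lG aG] := legit_graft lQ lss cQ.
  by rewrite linearZ /= lin_bas // (dgr lQ) // pQ signrN scaleNr.
rewrite -[X in X + _]/(lin (fun Q => gr p0 ss (dS Q) + - (sn (thin a) *:
   drow (fun r => sn (kap Q r) *: bas (graft Q p0 r)) ss)) (dgen a)).
rewrite lin_add -lin_linE dgen2 // linear0 add0r.
rewrite (eq_lin (g := fun Q => (- sn (thin a)) *: drow (fun r => sn (kap Q r) *: bas (graft Q p0 r)) ss)).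
  by rewrite lin_scale -lin_drowC scaleNr addNr.
by move=> Q _; rewrite scaleNr.
Qed.

End Derivation.

(** * Rows and columns of non-thin boxes *)

(** For a legitimate stacking the first condition makes all boxes non-thin; the bound [B] makes the
    enumerations below finite. *)
Definition pureb (B : nat) (S : stacking) : bool :=
  all (fun a => (0 < ar_in a)%N && (ar_up a < B)%N) (boxes S).

Lemma pureb_node B a p0 ss : pureb B (Node a p0 ss) =
  [&& (0 < ar_in a)%N, (ar_up a < B)%N & all (pureb B) ss].
Proof.
rewrite /pureb /= -andbA; congr [&& _, _ & _].
by elim: ss => //= s ss IH; rewrite all_cat IH.
Qed.

Lemma lax_box_in a : is_lax_box a -> (0 < ar_in a)%N -> ar_out a = 1%N.
Proof. by move=> /andP[_ /eqP->] /=; rewrite /ar_in /ar_out /= => ->. Qed.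

Lemma pure_row_bound p0 (Ts : seq stacking) : {in Ts, forall S,
    (ar_out (st_ar S) <= ar_in (st_ar S))%N &&
    (ar_out (st_ar S) < ar_in (st_ar S) + up S)%N} ->
  chained p0 (map st_ar Ts) ->
  (top p0 (map st_ar Ts) <= p0)%N &&
  (top p0 (map st_ar Ts) + size Ts <= p0 + width Ts)%N.
Proof.
elim: Ts p0 => [|T Ts IH] p0 H /=.
  by rewrite /top /width /= !addn0 leqnn.
case/andP=> /eqP <- ch; rewrite top_cons width_cons.
have /andP[h1 h2] := H T (mem_head _ _).
have /andP[h3 h4] := IH _ (mem_tail H) ch.
lia.
Qed.

(** A non-thin Lax box takes at least one wire, emits exactly one, and has at least two wires and
    inputs together. Both inequalities add up along rows and columns. *)
Lemma pure_bound B S : legit S -> pureb B S ->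
  (ar_out (st_ar S) <= ar_in (st_ar S))%N &&
  (ar_out (st_ar S) < ar_in (st_ar S) + up S)%N.
Proof.
elim/stacking_mem_ind: S => // a p0 ss IH.
rewrite legit_node pureb_node => /and3P[cs la lss] /and3P[a0 _ pss].
have /andP[b1 b2] := @pure_row_bound p0 ss (fun s sss => IH s sss (allP lss s sss) (allP pss s sss)) (proj2 (andP cs)).
have sz := composable_up cs.
rewrite -[ar_in (st_ar _)]/(ar_in a + p0)%N -[up _]/(width ss).
rewrite -[ar_out (st_ar _)]/(ar_out a + top p0 (map st_ar ss))%N.
rewrite (lax_box_in la a0); move: la => /andP[a2 _]; lia.
Qed.

Lemma row_bound B p0 (Ts : seq stacking) : all legit Ts -> all (pureb B) Ts ->
  chained p0 (map st_ar Ts) ->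
  (top p0 (map st_ar Ts) <= p0)%N &&
  (top p0 (map st_ar Ts) + size Ts <= p0 + width Ts)%N.
Proof.
move=> lT pT ch.
exact: (pure_row_bound (fun s sT => pure_bound (allP lT s sT) (allP pT s sT)) ch).
Qed.

Lemma pure_thin B S : legit S -> pureb B S -> ar_in (st_ar S) = 0%N -> S = Eta.
Proof.
case: S => // a p0 ss; rewrite pureb_node => _ /and3P[a0 _ _].
rewrite -[ar_in (st_ar _)]/(ar_in a + p0)%N; lia.
Qed.

(* The lists below are indexed by the numbers of incoming and outgoing wires; *)
(* [B] bounds the arities of the boxes, so that they are finite.              *)
Fixpoint rows_of (cl : nat -> nat -> seq stacking) n p r : seq (seq stacking) :=
  if n is n'.+1 then
    [seq cR | s <- iota 0 p.+1,
       cR <- [seq c :: R | c <- cl p s, R <- rows_of cl n' s r]]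
  else if p == r then [:: [::]] else [::].

Fixpoint cols_fuel (B f p r : nat) : seq stacking :=
  (if (p == 0%N) && (r == 0%N) then [:: Eta] else [::]) ++
  if f is f'.+1 then
    if r is r'.+1 then
      [seq X | p1 <- iota 1 p,
         X <- [seq Node (p1, n, 1%N) (p - p1)%N R |
                n <- [seq n <- iota 0 B | (2 <= p1 + n)%N],
                R <- rows_of (cols_fuel B f') n (p - p1)%N r']]
    else [::]
  else [::].

Definition pcol B p r := cols_fuel B p p r.
Definition prow B := rows_of (pcol B).

Lemma rows_ofS cl n p r : rows_of cl n.+1 p r =
    [seq cR | s <- iota 0 p.+1,
       cR <- [seq c :: R | c <- cl p s, R <- rows_of cl n s r]].
Proof. by []. Qed.

Lemma cols_fuelS B f p r : cols_fuel B f.+1 p r =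
  (if (p == 0%N) && (r == 0%N) then [:: Eta] else [::]) ++
    if r is r'.+1 then
      [seq X | p1 <- iota 1 p,
         X <- [seq Node (p1, n, 1%N) (p - p1)%N R |
                n <- [seq n <- iota 0 B | (2 <= p1 + n)%N],
                R <- rows_of (cols_fuel B f) n (p - p1)%N r']]
    else [::].
Proof. by []. Qed.

Lemma eq_rows_of cl cl' n p r :
  (forall p' s, (p' <= p)%N -> cl p' s = cl' p' s) ->
  rows_of cl n p r = rows_of cl' n p r.
Proof.
elim: n p => // n IH p H; rewrite !rows_ofS; congr flatten; apply/eq_in_map => s.
rewrite mem_iota add0n ltnS => /andP[_ sp]; rewrite H //; congr map.
congr flatten; apply: eq_map => c; congr map; apply: IH => p' t pp.
by apply: H; apply: leq_trans pp sp.
Qed.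

(** The root takes at least one wire, so the stackings above it receive fewer wires, and the number
    of incoming wires is enough fuel. *)
Lemma cols_fuelE B f g p r : (p <= f)%N -> (p <= g)%N ->
  cols_fuel B f p r = cols_fuel B g p r.
Proof.
elim: f g p r => [|f IH] [|g] p r //.
- by rewrite leqn0 => /eqP-> _; case: r.
- by move=> _; rewrite leqn0 => /eqP->; case: r.
move=> pf pg; rewrite !cols_fuelS; congr cat; case: r => // r; congr flatten.
apply/eq_in_map => p1; rewrite mem_iota => p1p; congr map; congr flatten.
apply/eq_map => n; congr map; apply: eq_rows_of => p' s pp; apply: IH; lia.
Qed.

Lemma colE B p r : pcol B p r =
  (if (p == 0%N) && (r == 0%N) then [:: Eta] else [::]) ++
  if r is r'.+1 then
      [seq X | p1 <- iota 1 p,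
         X <- [seq Node (p1, n, 1%N) (p - p1)%N R |
                n <- [seq n <- iota 0 B | (2 <= p1 + n)%N],
                R <- prow B n (p - p1)%N r']]
    else [::].
Proof.
rewrite /pcol; case: p => [|p]; first by case: r.
rewrite cols_fuelS; case: r => // r; congr cat; congr flatten; apply/eq_in_map => p1.
rewrite mem_iota => p1p; congr map; congr flatten.
apply/eq_map => n; congr map; apply: eq_rows_of => p' s pp.
apply: cols_fuelE; lia.
Qed.

Lemma rowS B n p r : prow B n.+1 p r =
  [seq cR | s <- iota 0 p.+1,
       cR <- [seq c :: R | c <- pcol B p s, R <- prow B n s r]].
Proof. by []. Qed.

Definition cspec B p r S := [&& legit S, pureb B S, ar_in (st_ar S) == p &
  ar_out (st_ar S) == r].
Definition rspec B n p r R := [&& size R == n, all legit R, all (pureb B) R,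
  chained p (map st_ar R) & top p (map st_ar R) == r].

Lemma mem_rows_of cl B n p r R :
  (forall p' s S, (p' <= p)%N -> (S \in cl p' s) = cspec B p' s S) ->
  (R \in rows_of cl n p r) = rspec B n p r R.
Proof.
elim: n p R => [|n IH] p R H; last rewrite rows_ofS.
  case: R => [|S R] /=; last by case: ifP; rewrite ?inE.
  by rewrite /rspec /top /=; case: ifP; rewrite ?inE.
apply/allpairsPdep/idP => [[s [cR [sp]]]|].
  move=> /allpairsPdep[c [R' [cp R'p ->]]] ->.
  move: sp cp R'p; rewrite mem_iota add0n ltnS => /andP[_ sp].
  rewrite H // IH; last by move=> p' t S pp; apply: H; apply: leq_trans pp sp.
  case/and4P=> lc pc /eqP <- /eqP E /and5P[/eqP sR lR pR chR tR].
  by rewrite /rspec /= sR eqxx lc pc lR pR eqxx E chR top_cons E.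
case: R => [|c R]; rewrite /rspec //=.
case/and5P=> sR /andP[lc lR] /andP[pc pR] /andP[inc chR] tR.
have /andP[ocp _] := pure_bound lc pc; rewrite (eqP inc) in ocp.
exists (ar_out (st_ar c)), (c :: R); rewrite -[(0 :: _)%N]/(iota 0 p.+1) mem_iota.
rewrite add0n ltnS ocp; split=> //.
apply/allpairsPdep; exists c, R; rewrite H // IH; last first.
  by move=> p' t S pp; apply: H; apply: leq_trans pp ocp.
rewrite top_cons in tR; rewrite /cspec /rspec lc pc inc lR pR chR (eqP tR) !eqxx.
by rewrite -eqSS sR; split.
Qed.

Lemma mem_col B p r S : (S \in pcol B p r) = cspec B p r S.
Proof.
elim/ltn_ind: p r S => p IH r S; rewrite colE mem_cat.
case: S => [|a p0 ss].
  have -> : (Eta \in (if (p == 0%N) && (r == 0%N) then [:: Eta] else [::])) =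
      cspec B p r Eta.
    by case: (p) => [|p0]; case: (r) => [|r0].
  rewrite orbC; case: r => //= r; case: (boolP (Eta \in _)) => //.
  by case/allpairsPdep => p1 [S [_ /allpairsPdep[n [R [_ _ ->]]]]].
have -> : (Node a p0 ss \in (if (p == 0%N) && (r == 0%N) then [:: Eta] else [::]))
   = false by case: ifP; rewrite // inE.
rewrite /= /cspec legit_node pureb_node.
rewrite -[ar_in (st_ar _)]/(ar_in a + p0)%N.
rewrite -[ar_out (st_ar _)]/(ar_out a + top p0 (map st_ar ss))%N.
have M n p1 r' R : (0 < p1)%N -> (p1 <= p)%N ->
    (R \in prow B n (p - p1)%N r') = rspec B n (p - p1)%N r' R.
  move=> h1 h2; apply: mem_rows_of => p' s S pp; apply: IH; lia.
apply/idP/idP.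
  case: r => // r /allpairsPdep[p1 [S [p1p]]].
  move: p1p; rewrite mem_iota add1n ltnS => /andP[p1_gt0 p1p].
  move=> /allpairsPdep[n [R [nB]]]; rewrite M //.
  move: nB; rewrite mem_filter mem_iota => /andP[pn /andP[_ nB]].
  case/and5P=> sR lR pR chR tR -> [-> -> ->].
  rewrite /composable size_map sR chR lR pR /is_lax_box /lax_arity.
  rewrite /ar_in /ar_up /ar_out /= pn p1_gt0 eqxx /= -/(ar_out _) (eqP tR).
  by rewrite nB /= subnKC // add1n !eqxx.
case/and4P=> /and3P[/andP[sz ch] la lss] /and3P[a0 aB pss] /eqP Ep.
rewrite (lax_box_in la a0); case: r => [|r] Er; first by lia.
apply/allpairsPdep; exists (ar_in a), (Node a p0 ss).
split=> //; first by rewrite mem_iota a0; lia.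
apply/allpairsPdep; exists (ar_up a), ss; split.
- by rewrite mem_filter mem_iota; case/andP: la => -> _.
- rewrite M //; last by lia.
  rewrite /rspec lss pss -(size_map st_ar) sz.
  have -> : (p - ar_in a = p0)%N by lia.
  by rewrite ch /=; move: Er; rewrite add1n eqSS.
congr Node; last by lia.
by rewrite -(lax_box_in la a0); case: (a) => -[].
Qed.

Lemma mem_row B n p r R : (R \in prow B n p r) = rspec B n p r R.
Proof. by apply: mem_rows_of => *; apply: mem_col. Qed.

Lemma uniq_flatten_key (T R : eqType) (g : R -> T) (f : T -> seq R) s :
  uniq s -> {in s, forall x, uniq (f x)} ->
  {in s, forall x, {in f x, forall y, g y = x}} ->
  uniq (flatten (map f s)).
Proof.
elim: s => //= x s IH /andP[xs us] U K; rewrite cat_uniq U ?mem_head //=.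
rewrite IH //; last 2 first.
- by move=> y ys; apply: U; rewrite inE ys orbT.
- by move=> y ys; apply: K; rewrite inE ys orbT.
rewrite andbT; apply/hasPn => y /flattenP[_ /mapP[z zs ->] yz].
apply/negP => yx; case/negP: xs; rewrite -(K x (mem_head _ _) y yx).
by rewrite (K z _ y yz) // inE zs orbT.
Qed.

Lemma uniq_rows_of cl n p r :
  (forall p' s, (p' <= p)%N -> uniq (cl p' s)) ->
  (forall p' s S, (p' <= p)%N -> S \in cl p' s -> ar_out (st_ar S) = s) ->
  uniq (rows_of cl n p r).
Proof.
elim: n p => [|n IH] p U O; first by rewrite /=; case: ifP.
apply: (uniq_flatten_key (g := fun y => ar_out (st_ar (head Eta y)))).
- exact: iota_uniq.
- move=> s; rewrite mem_iota add0n ltnS => /andP[_ sp]; rewrite map_id.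
  apply: (uniq_flatten_key (g := head Eta)); first exact: U.
    move=> c cs; rewrite map_inj_uniq; last by move=> x y [].
    apply: IH => p' t; first by move=> pp; apply: U; apply: leq_trans sp.
    by move=> S pp; apply: O; apply: leq_trans sp.
  by move=> c _ y /mapP[R _ ->].
move=> s _ y; rewrite map_id => /allpairsPdep[c [R [cs _ ->]]] /=.
exact: O cs.
Qed.

Lemma uniq_col B p r : uniq (pcol B p r).
Proof.
elim/ltn_ind: p r => p IH r; rewrite colE cat_uniq.
apply/and3P; split; first by case: ifP.
  case: r => // r; apply/hasPn => S /allpairsPdep[p1 [T [_ ]]].
  by move=> /allpairsPdep[n [R [_ _ ->]]] ->; case: ifP; rewrite // inE.
case: r => // r.
apply: (uniq_flatten_key
  (g := fun S => if S is Node a _ _ then ar_in a else 0%N)).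
- exact: iota_uniq.
- move=> p1; rewrite mem_iota => p1p; rewrite map_id.
  apply: (uniq_flatten_key
    (g := fun S => if S is Node a _ _ then ar_up a else 0%N)).
  + by rewrite filter_uniq ?iota_uniq.
  + move=> n _; rewrite map_inj_uniq; last by move=> x y [].
    apply: uniq_rows_of => p' s; first by move=> pp; apply: IH; lia.
    by move=> S _; rewrite mem_col => /and4P[_ _ _ /eqP].
  by move=> n _ y /mapP[R _ ->].
by move=> p1 _ y; rewrite map_id => /allpairsPdep[n [R [_ _ ->]]].
Qed.

Lemma uniq_row B n p r : uniq (prow B n p r).
Proof.
apply: uniq_rows_of => p' s; first by move=> _; apply: uniq_col.
by move=> S _; rewrite mem_col => /and4P[_ _ _ /eqP].
Qed.

Lemma col_empty B p r : (p < r)%N -> pcol B p r = [::].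
Proof.
move=> pr; case E: (pcol B p r) => [//|S l]; have := mem_head S l.
rewrite -E mem_col => /and4P[lS pS /eqP iS /eqP oS].
have /andP[] := pure_bound lS pS; lia.
Qed.

Lemma row_empty B n p r : (p < r)%N -> prow B n p r = [::].
Proof.
move=> pr; case E: (prow B n p r) => [//|R l]; have := mem_head R l.
rewrite -E mem_row => /and5P[_ lR pR ch /eqP tR].
have /andP[] := row_bound lR pR ch; lia.
Qed.

Lemma big_seq0 (W : nmodType) (T : eqType) (l : seq T) (F : T -> W) :
  {in l, forall x, F x = 0} -> \sum_(x <- l) F x = 0.
Proof. by move=> F0; rewrite big_seq big1. Qed.

(** * Sums over rows and columns, and how these are cut *)

Section Sums.
Variables (W : nmodType) (B N : nat).

Lemma sum_ordE (F : nat -> W) n : \sum_(s < n) F s = \sum_(s <- iota 0 n) F s.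
Proof. by rewrite -(big_mkord xpredT F) /index_iota subn0. Qed.

Lemma sum_iota (F : nat -> W) a n : (a + n <= N)%N ->
  (forall s, ~~ (a <= s < a + n)%N -> F s = 0) ->
  \sum_(s <- iota a n) F s = \sum_(s < N) F s.
Proof.
move=> nN F0; rewrite sum_ordE.
have -> : N = (a + (n + (N - (a + n))))%N by lia.
rewrite !iotaD !big_cat /= add0n (big_seq0 (l := iota 0 a)) ?add0r.
  rewrite (big_seq0 (l := iota (a + n) _)) ?addr0 // => s.
  by rewrite mem_iota => /andP[h _]; apply: F0; lia.
by move=> s; rewrite mem_iota => /andP[_ h]; apply: F0; lia.
Qed.

Lemma sum_rowS (F : seq stacking -> W) n p r : (p < N)%N ->
  \sum_(R <- prow B n.+1 p r) F R =
    \sum_(s < N) \sum_(c <- pcol B p s) \sum_(R <- prow B n s r) F (c :: R).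
Proof.
move=> pN; rewrite rowS big_allpairs_dep -(@sum_iota (fun s =>
    \sum_(c <- pcol B p s) \sum_(R <- prow B n s r) F (c :: R)) 0 p.+1) //.
  by apply: eq_bigr => s _; rewrite big_allpairs_dep.
by move=> s h; rewrite col_empty ?big_nil //; lia.
Qed.

Lemma sum_colS (F : stacking -> W) p r : (p < N)%N ->
  \sum_(S <- pcol B p r.+1) F S =
    \sum_(p1 < N) if (0 < p1 <= p)%N then
       \sum_(n < B | (2 <= p1 + n)%N) \sum_(R <- prow B n (p - p1)%N r)
         F (Node (nat_of_ord p1, nat_of_ord n, 1%N) (p - p1)%N R)
     else 0.
Proof.
move=> pN; rewrite colE andbF cat0s big_allpairs_dep.
rewrite -(@sum_iota (fun p1 => if (0 < p1 <= p)%N then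
   \sum_(n < B | (2 <= p1 + n)%N) \sum_(R <- prow B n (p - p1)%N r)
         F (Node (p1, nat_of_ord n, 1%N) (p - p1)%N R) else 0) 1 p) //; last first.
  by move=> s; case: ifP => //; lia.
rewrite !big_seq; apply: eq_bigr => p1; rewrite mem_iota => p1p.
rewrite ifT; last by lia.
rewrite big_allpairs_dep big_filter -(big_mkord (fun n => 2 <= p1 + n)%N
  (fun n => \sum_(R <- prow B n (p - p1)%N r) F (Node (p1, n, 1%N) (p - p1)%N R))).
by rewrite /index_iota subn0.
Qed.

Lemma pcol0 p : pcol B p 0 = if p == 0%N then [:: Eta] else [::].
Proof. by rewrite colE andbT cats0. Qed.

Lemma sum_tri (f : nat -> nat -> W) :
  (forall s t, (N <= s + t)%N -> f s t = 0) ->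
  \sum_(u < N) \sum_(s < N) (if (s <= u)%N then f s (u - s)%N else 0) =
    \sum_(s < N) \sum_(t < N) f s t.
Proof.
move=> f0; rewrite exchange_big; apply: eq_bigr => s _.
rewrite !(sum_ordE (fun u => if (s <= u)%N then f s (u - s)%N else 0)).
rewrite (sum_ordE (f s)).
have E := iotaD 0 s (N - s); rewrite subnKC ?(ltnW (ltn_ord s)) // add0n in E.
have E2 := iotaD 0 (N - s) s; rewrite subnK ?(ltnW (ltn_ord s)) // add0n in E2.
rewrite [in LHS]E [in RHS]E2 !big_cat /= (big_seq0 (l := iota 0 s)) ?add0r; last first.
  by move=> u; rewrite mem_iota => h; rewrite ifF //; lia.
rewrite (big_seq0 (l := iota (N - s) s)).
  rewrite addr0.
  rewrite -{1}(addn0 s) iotaDl big_map; apply: eq_bigr => t _.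
  by rewrite leq_addr addKn.
by move=> t; rewrite mem_iota => h; apply: f0; lia.
Qed.

Lemma sum_row_cat (F : seq stacking -> W) m n p r : (p < N)%N ->
  \sum_(R <- prow B (m + n)%N p r) F R =
    \sum_(t < N) \sum_(R1 <- prow B m p t) \sum_(R2 <- prow B n t r) F (R1 ++ R2).
Proof.
elim: m p F => [|m IH] p F pN.
  rewrite add0n (bigD1 (Ordinal pN)) //= /prow /= eqxx big_seq1.
  rewrite [X in _ = _ + X]big1 ?addr0 //.
  by move=> t; rewrite -val_eqE eq_sym /= => /negPf ->; rewrite big_nil.
rewrite addSn sum_rowS //.
have IH' (s : 'I_N) c : \sum_(R <- prow B (m + n)%N s r) F (c :: R) =
   \sum_(t < N) \sum_(R1 <- prow B m s t) \sum_(R2 <- prow B n t r) F (c :: R1 ++ R2).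
  exact: IH.
under eq_bigr do under eq_bigr do rewrite IH'.
under [RHS]eq_bigr do rewrite sum_rowS //.
rewrite [RHS]exchange_big; apply: eq_bigr => s _.
by rewrite [RHS]exchange_big.
Qed.

(** A column is cut above its [a] lowest outgoing wires, in exactly one way, into a lower column
    that emits these and an upper row that emits the others. The root emits the lowest wire, so a
    cut above [a + 1] wires is a cut above [a] wires in the row over the root. *)
Definition cut_col p := forall r a (F : stacking -> W), (a <= r)%N ->
  \sum_(S <- pcol B p r) F S = \sum_(p1 < N) if (p1 <= p)%N then
    \sum_(S <- pcol B p1 a) \sum_(u <- prow B (up S) (p - p1)%N (r - a)%N)
      F (graft S (p - p1)%N u) else 0.

Definition cut_row p := forall m r a (F : seq stacking -> W), (a <= r)%N ->
  \sum_(R <- prow B m p r) F R = \sum_(p1 < N) if (p1 <= p)%N then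
    \sum_(R <- prow B m p1 a) \sum_(u <- prow B (width R) (p - p1)%N (r - a)%N)
      F (graft_row R (p - p1)%N u) else 0.

Lemma cut_colP p : (p < N)%N -> (forall p', (p' < p)%N -> cut_row p') ->
  cut_col p.
Proof.
move=> pN IH r [|a] F ar.
  have N0 : (0 < N)%N by apply: leq_ltn_trans pN.
  rewrite (bigD1 (Ordinal N0)) //= [X in _ = _ + X]big1 ?addr0; last first.
    move=> i; rewrite -val_eqE /= => i0; case: ifP => // _.
    by rewrite pcol0 (negPf i0) big_nil.
  rewrite !subn0 pcol0 eqxx big_seq1 -[up Eta]/1%N sum_rowS //.
  have [rp|pr] := leqP r p; last first.
    rewrite (col_empty _ pr) big_nil big1 // => s _.
    have [ps|sp] := leqP s p; last by rewrite (col_empty _ sp) big_nil.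
    apply: big_seq0 => c _; rewrite /prow /= ifF ?big_nil //.
    by apply/negbTE; rewrite neq_ltn (leq_ltn_trans ps pr).
  rewrite (bigD1 (Ordinal (leq_ltn_trans rp pN))) //= [X in _ = _ + X]big1.
    rewrite addr0; apply: eq_bigr => c _.
    by rewrite /prow /= eqxx big_seq1.
  move=> s; rewrite -val_eqE /= => /negPf sr; apply: big_seq0 => c _.
  by rewrite /prow /= sr big_nil.
case: r ar => // r ar; rewrite sum_colS //.
pose f p1 p2 := if (0 < p1)%N && (p1 + p2 <= p)%N then
  \sum_(n < B | (2 <= p1 + n)%N) \sum_(R <- prow B n p2 a)
    \sum_(u <- prow B (width R) (p - p1 - p2)%N (r - a)%N)
      F (Node (p1, nat_of_ord n, 1%N) (p - p1)%N
           (graft_row R (p - p1 - p2)%N u)) else 0.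
transitivity (\sum_(p1 < N) \sum_(p2 < N) f p1 p2).
  apply: eq_bigr => p1 _; case: ifP => p1p; last first.
    by rewrite big1 // => p2 _; rewrite /f ifF //; apply: contraFF p1p; lia.
  rewrite [LHS](eq_bigr (fun n : 'I_B => \sum_(p2 < N) if (p2 <= p - p1)%N then
    \sum_(R <- prow B n p2 a) \sum_(u <- prow B (width R) (p - p1 - p2)%N (r - a)%N)
    F (Node (nat_of_ord p1, nat_of_ord n, 1%N) (p - p1)%N
       (graft_row R (p - p1 - p2)%N u)) else 0)).
    rewrite exchange_big; apply: eq_bigr => p2 _; rewrite /f.
    have -> : (0 < p1)%N && (p1 + p2 <= p)%N = (p2 <= p - p1)%N by lia.
    by case: ifP => // _; rewrite big1.
  by move=> n _; apply: IH => //; lia.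
rewrite -sum_tri; last by move=> s t st; rewrite /f ifF //; lia.
apply: eq_bigr => P _; case: ifP => PN; last first.
  by rewrite big1 // => p1 _; case: ifP => // h; rewrite /f ifF //; lia.
rewrite sum_colS ?(leq_ltn_trans PN pN) //; apply: eq_bigr => p1 _.
rewrite /f; case: (leqP p1 P) => h; last by rewrite andbF.
have -> : (p1 + (P - p1) <= p)%N by lia.
rewrite !andbT; case: ifP => // _; apply: eq_bigr => n _.
have -> : (p - p1 - (P - p1) = p - P)%N by lia.
apply: eq_bigr => R _; apply: eq_bigr => u _.
by rewrite graft_node; congr (F (Node _ _ _)); lia.
Qed.

(** The tail of the row is cut before its head: the number [s1] of wires that the lower part of the
    tail receives tells where the head column has to be cut. *)
Lemma cut_rowP p : (p < N)%N -> (forall p', (p' <= p)%N -> cut_col p') ->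
  cut_row p.
Proof.
move=> pN IH m; elim: m p pN IH => [|m IHm] p pN IH r a F ar.
  pose b := (p == a) && (p == r).
  have [/eqP pr|pr] := boolP (p == r); last first.
    rewrite {1}/prow /= (negPf pr) big_nil big1 // => p1 _; case: ifP => // h.
    rewrite /prow /=; case: eqP => [E|_]; last by rewrite big_nil.
    rewrite big_seq1 /width /= ifF ?big_nil //.
    by apply: contraNF pr => /eqP E'; apply/eqP; lia.
  rewrite -pr in ar *; have aN : (a < N)%N by apply: leq_ltn_trans pN.
  rewrite {1}/prow /= eqxx big_seq1 (bigD1 (Ordinal aN)) //= ar /prow /= eqxx.
  rewrite big_seq1 /width /= eqxx big_seq1 [X in _ = _ + X]big1 ?addr0 // => p1.
  rewrite -val_eqE /= => /negPf p1a.
  by rewrite p1a; case: ifP => // _; rewrite big_nil.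
rewrite sum_rowS //.
pose f s1 t := \sum_(R <- prow B m s1 a) \sum_(u <- prow B (width R) t (r - a)%N)
  \sum_(p1 < N) if (p1 <= p)%N then \sum_(c <- pcol B p1 s1)
   \sum_(v <- prow B (up c) (p - p1)%N t)
     F (graft c (p - p1)%N v :: graft_row R t u) else 0.
transitivity (\sum_(s1 < N) \sum_(t < N) f s1 t).
  rewrite -sum_tri; last first.
    move=> s t st; apply: big_seq0 => R _; apply: big_seq0 => u _.
    rewrite big1 // => p1 _; case: ifP => // h.
    have [sp|ps] := leqP s p1; last by rewrite col_empty // big_nil.
    by apply: big_seq0 => c _; rewrite row_empty ?big_nil //; lia.
  apply: eq_bigr => s _.
  have [sp|ps] := leqP s p; last first.
    rewrite col_empty // big_nil big1 // => s1 _; case: ifP => // h.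
    apply: big_seq0 => R _; apply: big_seq0 => u _; rewrite big1 // => p1 _.
    case: ifP => // h'.
    have [sp1|ps1] := leqP s1 p1; last by rewrite col_empty // big_nil.
    by apply: big_seq0 => c _; rewrite row_empty ?big_nil //; lia.
  rewrite (eq_bigr (fun c => \sum_(s1 < N) if (s1 <= s)%N then
     \sum_(R <- prow B m s1 a) \sum_(u <- prow B (width R) (s - s1)%N (r - a)%N)
        F (c :: graft_row R (s - s1)%N u) else 0)); last first.
    move=> c _; apply: (IHm s) => //.
    by move=> p' p's; apply: IH; apply: leq_trans sp.
  rewrite exchange_big; apply: eq_bigr => s1 _; case: ifP => h; last by rewrite big1.
  rewrite exchange_big; apply: eq_bigr => R _; rewrite exchange_big.
  by apply: eq_bigr => u _; apply: (IH p (leqnn p) s s1).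
rewrite /f.
transitivity (\sum_(p1 < N) \sum_(s1 < N) if (p1 <= p)%N then
   \sum_(c <- pcol B p1 s1) \sum_(R <- prow B m s1 a) \sum_(t < N)
   \sum_(v <- prow B (up c) (p - p1)%N t) \sum_(u <- prow B (width R) t (r - a)%N)
     F (graft c (p - p1)%N v :: graft_row R t u) else 0).
  rewrite [RHS]exchange_big; apply: eq_bigr => s1 _.
  under [LHS]eq_bigr do under eq_bigr do rewrite exchange_big.
  under [LHS]eq_bigr do rewrite exchange_big.
  rewrite [LHS]exchange_big; apply: eq_bigr => p1 _.
  case: ifP => h; last by rewrite big1 // => t _; rewrite big1 // => R _; rewrite big1.
  under [LHS]eq_bigr do under eq_bigr do rewrite exchange_big.
  under [LHS]eq_bigr do rewrite exchange_big.
  rewrite [LHS]exchange_big; apply: eq_bigr => c _.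
  rewrite [LHS]exchange_big; apply: eq_bigr => R _; apply: eq_bigr => t _.
  by rewrite [LHS]exchange_big.
apply: eq_bigr => p1 _; case: ifP => h; last by rewrite big1.
rewrite sum_rowS; last exact: leq_ltn_trans h pN.
apply: eq_bigr => s1 _; apply: eq_big_seq => c cp; apply: eq_big_seq => R Rp.
rewrite width_cons sum_row_cat; last by apply: leq_ltn_trans pN; apply: leq_subr.
apply: eq_bigr => t _; apply: eq_big_seq => v vp; apply: eq_big_seq => u us.
move: vp; rewrite mem_row => /and5P[/eqP sv _ _ _ /eqP tv].
by rewrite graft_cons take_size_cat // drop_size_cat // tv.
Qed.

Lemma cut_both p : (p < N)%N -> cut_col p /\ cut_row p.
Proof.
elim/ltn_ind: p => p IH pN.
have C p' : (p' <= p)%N -> cut_col p'.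
  move=> pp; apply: cut_colP; first exact: leq_ltn_trans pN.
  by move=> q qp; apply: (IH q _ _).2; lia.
by split; [apply: C | apply: cut_rowP].
Qed.

End Sums.

(** * The thin-quadratic terms of a Lax box *)

Definition beta b := st_id (lax_arity 0 b).

Definition erow n i b := nseq i Eta ++ beta b :: nseq (n - i.+1) Eta.

(** The terms of the differential of a generator, with a flag for a minus sign in the thin-parity
    convention: types I and II in the upper list, type III in the lower one. A box of a type III
    term has at most [ar_in a + ar_up a] inputs, whence the bound in [prow]. The comparison with the
    definition is in [mem_tq] and [tq_sign]. *)
Definition tq (a : arity) : seq (bool * stacking) :=
  [seq (ar_in a == 0%N, Node (lax_arity (ar_in a) n) 0 (erow n i ((ar_up a).+1 - n)))
    | n <- [seq n <- iota 0 (ar_up a) | (2 <= ar_in a + n)%N], i <- iota 0 n]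
  ++ (if ar_in a == 0%N then [::] else
  [seq (true, Node (lax_arity 0 m) (ar_in a) R)
    | m <- iota 2 (ar_in a + ar_up a),
      R <- [seq R <- prow (ar_in a + ar_up a).+1 m (ar_in a) 1 | width R == ar_up a]]).

Lemma pure_box_ndeg a : is_lax_box a -> (0 < ar_in a)%N ->
  (ar_in a + ar_up a - 2 + ar_out a + 1 = ar_in a + ar_up a)%N.
Proof. by move=> la a0; rewrite (lax_box_in la a0); case/andP: la; lia. Qed.

Lemma row_ndeg_in p0 (ss : seq stacking) : {in ss, forall s,
    (ndeg s + ar_out (st_ar s) + 1 = ar_in (st_ar s) + up s)%N} ->
  chained p0 (map st_ar ss) ->
  (sumn (map ndeg ss) + top p0 (map st_ar ss) + size ss = p0 + width ss)%N.
Proof.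
elim: ss p0 => [|s ss IHs] p0 H /=; first by rewrite /top /width /= !addn0.
move=> /andP[/eqP <- ch]; rewrite top_cons width_cons.
have h1 := H s (mem_head _ _); have h2 := IHs _ (mem_tail H) ch.
by move: h1 h2; lia.
Qed.

(** Additive over the boxes: a non-thin Lax box has degree p + q - 2 and one outgoing wire. *)
Lemma pure_ndeg B S : legit S -> pureb B S ->
  (ndeg S + ar_out (st_ar S) + 1 = ar_in (st_ar S) + up S)%N.
Proof.
elim/stacking_mem_ind: S => // a p0 ss IH.
rewrite legit_node pureb_node => /and3P[/andP[/eqP sz ch] la lss] /and3P[a0 _ pss].
rewrite ndeg_node -[ar_in (st_ar _)]/(ar_in a + p0)%N -[up _]/(width ss).
rewrite -[ar_out (st_ar _)]/(ar_out a + top p0 (map st_ar ss))%N.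
rewrite size_map in sz; have h1 := pure_box_ndeg la a0.
have := @row_ndeg_in p0 ss (fun s sss => IH s sss (allP lss s sss) (allP pss s sss)) ch.
rewrite sz; move: h1; clear; lia.
Qed.

Lemma row_ndeg B p0 (ss : seq stacking) : all legit ss -> all (pureb B) ss ->
  chained p0 (map st_ar ss) ->
  (sumn (map ndeg ss) + top p0 (map st_ar ss) + size ss = p0 + width ss)%N.
Proof.
move=> lss pss; apply: row_ndeg_in => s sss.
exact: pure_ndeg (allP lss s sss) (allP pss s sss).
Qed.

Lemma pure_pt B S : pureb B S -> pt S = false.
Proof.
move=> pS; rewrite /pt (_ : count _ _ = 0%N) //; apply/eqP.
rewrite -leqn0 leqNgt -has_count; apply/hasPn => a aS.
by have /andP[] := allP pS a aS; rewrite /thin lt0n => /negPf->.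
Qed.

Lemma xr_pt0 B R : all (pureb B) R -> xr pt R = false.
Proof. by elim: R => //= T R IH /andP[/pure_pt-> /IH ->]. Qed.

Lemma kap_pure B S R : all (pureb B) R -> kap S R = false.
Proof.
elim/stacking_mem_ind: S R => // a p0 ss IH R; rewrite kap_node.
elim: ss IH R => //= s ss IHs IH R pR.
rewrite IH ?mem_head //; last by apply/allP => x /mem_take /(allP pR).
have pd : all (pureb B) (drop (up s) R) by apply/allP => x /mem_drop /(allP pR).
rewrite (IHs (mem_tail IH) _ pd).
by rewrite (@xr_pt0 B) //; apply/allP => x /mem_take /(allP pR).
Qed.

Lemma beta_ar b : st_ar (beta b) = lax_arity 0 b.
Proof. exact: st_id_ar. Qed.

Lemma beta_legit b : (2 <= b)%N -> legit (beta b).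
Proof.
move=> b2; rewrite /legit st_id_wf /= /is_lax_box /lax_arity /= /ar_in /ar_up /= b2.
by elim: b {b2}.
Qed.

Lemma nseq_eta_ar n : map st_ar (nseq n Eta) = nseq n (0, 1, 0)%N.
Proof. by rewrite map_nseq. Qed.

Lemma chained_eta n : chained 0 (nseq n (0, 1, 0)%N) /\ top 0 (nseq n (0, 1, 0)%N) = 0%N.
Proof. by elim: n => //= n [-> e]; rewrite top_cons e. Qed.

Lemma width_eta n : width (nseq n Eta) = n.
Proof. by rewrite /width; elim: n => //= n ->. Qed.

Lemma erow_spec n i b : (i < n)%N -> (2 <= b)%N ->
  [/\ all legit (erow n i b), chained 0 (map st_ar (erow n i b)) /\
      top 0 (map st_ar (erow n i b)) = 0%N,
      size (erow n i b) = n, width (erow n i b) = (n + b - 1)%N &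
      xr pt (erow n i b) = true /\ sumn (map ndeg (erow n i b)) = (b - 2)%N].
Proof.
move=> lin b2.
have pn m : xr pt (nseq m Eta) = false by elim: m.
have ne m : sumn (map ndeg (nseq m Eta)) = 0%N by elim: m.
split; rewrite /erow.
- by rewrite all_cat /= beta_legit // !all_nseq !orbT.
- rewrite map_cat map_cons beta_ar !nseq_eta_ar chained_cat top_cat.
  have [-> ->] := chained_eta i; rewrite /= top_cons /=.
  exact: chained_eta.
- by rewrite size_cat /= !size_nseq; lia.
- by rewrite width_cat width_cons beta_ar !width_eta /ar_up /=; lia.
rewrite xr_cat /= pn pn addbF map_cat /= sumn_cat /= !ne /pt /= /ndeg /=.
have -> : flatten (map boxes (nseq b Eta)) = [::] by elim: (b).
by rewrite /= /ar_in /ar_up /=; lia.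
Qed.

Lemma tqP a : is_lax_box a -> forall q, q \in tq a ->
  [/\ legit q.2, st_ar q.2 = a, pt q.2 = ~~ thin a &
      (ndeg q.2).+1 = (ar_in a + ar_up a - 2)%N].
Proof.
case: a => -[p q] r /andP[a2 /eqP ->].
move: a2; rewrite /ar_in /ar_up /= => a2 x.
rewrite /tq /ar_in /ar_up /= mem_cat => /orP[].
  move=> /allpairsPdep[n [i [+ + ->]]] /=.
  rewrite mem_filter !mem_iota !add0n => /andP[pn /andP[_ nq]] /andP[_ lin].
  have b2 : (2 <= q.+1 - n)%N by lia.
  have [lE [cE tE] sE wE [pE nE]] := erow_spec lin b2.
  have cs : composable (lax_arity p n) 0 (map st_ar (erow n i (q.+1 - n))).
    by rewrite /composable size_map sE cE /lax_arity /ar_up /= eqxx.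
  rewrite legit_node cs lE pt_node pE ndeg_node nE addbT andbT.
  split.
  - by rewrite /is_lax_box /lax_arity /ar_in /ar_up /= pn eqxx.
  - rewrite /= /comp_arity tE -/(width _) wE /lax_arity /ar_in /ar_out /= !addn0.
    by congr (_, _, _); lia.
  - by rewrite /thin /ar_in /ar_out /=; case: (p).
  by rewrite /lax_arity /ar_in /ar_up /=; lia.
case: eqP => // /eqP p0 /allpairsPdep[m [R [+ + ->]]] /=.
rewrite mem_filter mem_iota mem_row => m2.
case/and5P=> /eqP wR /eqP sR lR pR /andP[ch /eqP tR].
have cs : composable (lax_arity 0 m) p (map st_ar R).
  by rewrite /composable size_map sR ch /lax_arity /ar_up /= eqxx.
have := row_ndeg lR pR ch; rewrite tR sR wR => nR.
rewrite legit_node cs lR pt_node (xr_pt0 pR) ndeg_node; split.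
- by rewrite andbT /is_lax_box /lax_arity /ar_in /ar_up /= eqxx andbT; lia.
- rewrite /= /comp_arity tR -/(width _) wR /lax_arity /ar_in /ar_out /= add0n.
  by rewrite lt0n p0.
- by rewrite addbF /thin /ar_in /ar_out /= (negPf p0).
by rewrite /lax_arity /ar_in /ar_up /=; lia.
Qed.

Lemma top_drop_eta m : top 0 (map st_ar (nseq m Eta)) = 0%N.
Proof. by rewrite nseq_eta_ar; case: (chained_eta m). Qed.

Lemma graft_row_1r R : all st_wf R -> graft_row R 0 (nseq (width R) Eta) = R.
Proof.
elim: R => //= s R IH /andP[ws wR]; rewrite width_cons nseqD.
rewrite take_size_cat ?size_nseq // drop_size_cat ?size_nseq //.
by rewrite top_drop_eta graft_1r // IH.
Qed.

Lemma graft_row_1l p R : graft_row (nseq (size R) Eta) p R = R.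
Proof. by elim: R p => //= s R IH p; rewrite take0 drop0 IH. Qed.

Lemma prow0 B m r : prow B m 0 r = if r == 0%N then [:: nseq m Eta] else [::].
Proof.
elim: m r => [|m IH] r; first by rewrite /prow /= eq_sym.
rewrite rowS /= cats0 /pcol /= IH; case: (r == 0%N) => //.
Qed.

Lemma prow_pos B m p : (0 < p)%N -> prow B m p 0 = [::].
Proof.
move=> p0; case E: (prow B m p 0) => [//|R l]; have := mem_head R l.
rewrite -E mem_row => /and5P[_ lR pR ch tR]; exfalso.
elim: R p p0 lR pR ch tR {E} => [|s R IH] p p0 /=.
  by rewrite /top /= => _ _ _ /eqP E; rewrite E in p0.
move=> /andP[ls lR] /andP[ps pR] /andP[/eqP E ch]; rewrite top_cons.
apply: IH => //; case: s ls ps E {ch} => [_ _ E|a b ss]; first by rewrite -E in p0.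
rewrite legit_node pureb_node => /and3P[_ la _] /and3P[a0 _ _] _.
by rewrite -[ar_out (st_ar _)]/(ar_out a + _)%N (lax_box_in la a0).
Qed.

Lemma st_wf_legit R : all legit R -> all st_wf R.
Proof. by move=> lR; apply/allP => x /(allP lR)/andP[]. Qed.

Lemma graft_erow n j m s r B R : (n < m)%N -> (j < n)%N -> R \in prow B m s r ->
  let G := graft_row (erow n j (m.+1 - n)) s R in
  [/\ st_row s G, size G = n, width G = width R & top s (map st_ar G) = r].
Proof.
move=> nm jn; rewrite mem_row => /and5P[/eqP sR lR pR ch /eqP tR].
have b2 : (2 <= m.+1 - n)%N by lia.
have [lE [cE tE] sE wE _] := erow_spec jn b2.
have wr : st_row 0 (erow n j (m.+1 - n)) by rewrite /st_row cE st_wf_legit.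
have wR : st_row s R by rewrite /st_row ch st_wf_legit.
have [|w1 w2 w3 w4] := graft_rowP wr wR; first by rewrite sR wE; lia.
by split; rewrite // ?w2 // ?w4 ?tE ?add0n.
Qed.

Lemma graft_erow_width n j m s r B R : (n < m)%N -> (j < n)%N ->
  R \in prow B m s r ->
  width (graft_row (erow n j (m.+1 - n)) s R) = width R.
Proof. by move=> nm jn Rm; have [] := graft_erow nm jn Rm. Qed.

Lemma big_shift1 (W : nmodType) (B n : nat) (G H : nat -> W) :
  (forall m, (n < m)%N -> (B <= m.+1)%N -> G m = 0) ->
  (forall m, (n < m)%N -> H m.+1 = G m) ->
  \sum_(m < B | (n < m)%N) G m = \sum_(m < B | (n.+1 < m)%N) H m.
Proof.
case: B => [|B] G0 HG; first by rewrite !big_ord0.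
rewrite big_mkcond [RHS]big_mkcond big_ord_recr big_ord_recl /=.
have -> : (if (n < B)%N then G B else 0) = 0 by case: ifP => // /G0->.
rewrite addr0 add0r; apply: eq_bigr => m _.
by rewrite /bump leq0n add1n ltnS; case: ifP => // /HG.
Qed.

(** * The differential of the sum of all rows of non-thin boxes *)

Section Claim.
Variables (k : fieldType) (B P : nat).
Notation D := (dS k tq).
Notation drow := (drow_ D).
Notation N := P.+1.
Notation K := (2 * P + 3)%N.

(** All sums are truncated at [B]. A function that vanishes on rows of width at least [B - K] does
    not see the truncation; the slack [K] depends on the bound [P] for the number of wires. *)
Definition okF (W : lmodType k) (F : seq stacking -> W) :=
  forall R, (B <= width R + K)%N -> F R = 0.
Definition okf (W : lmodType k) (F : stacking -> W) :=
  forall S, (B <= up S + K)%N -> F S = 0.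

Definition ins (W : lmodType k) (F : seq stacking -> W) R : W :=
  \sum_(b < B | (2 <= b)%N) \sum_(i < width R)
    F (graft_row R 0 (erow (width R) i b)).
Definition insc (W : lmodType k) (F : stacking -> W) S : W :=
  \sum_(b < B | (2 <= b)%N) \sum_(i < up S) F (graft S 0 (erow (up S) i b)).
Definition thn (W : lmodType k) n p r (F : seq stacking -> W) : W :=
  \sum_(m < B | (n < m)%N) \sum_(R <- prow B m p r) \sum_(j < n)
    F (graft_row (erow n j (m.+1 - n)) p R).

(** In the sum over all rows the differentials inside the columns cancel. There remain thin boxes
    put on top of an input ([ins]) and, with a minus sign, consecutive columns of a longer row
    grouped under a thin box ([thn]). In the square of the differential these meet the terms of
    types II and I. *)
Definition claim_row p := forall (W : lmodType k) n r (F : seq stacking -> W),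
  okF F -> \sum_(R <- prow B n p r) drow F R =
    \sum_(R <- prow B n p r) ins F R - thn n p r F.
Definition claim_col p := forall (W : lmodType k) r (F : stacking -> W),
  okf F -> \sum_(S <- pcol B p r) lin F (D S) =
    \sum_(S <- pcol B p r) insc F S -
    \sum_(m < B | (2 <= m)%N) \sum_(R <- prow B m p r)
       F (Node (lax_arity 0 m) p R).

Lemma ins_cons (W : lmodType k) (F : seq stacking -> W) c R : st_wf c ->
  all st_wf R ->
  ins F (c :: R) = insc (fun S => F (S :: R)) c + ins (fun R => F (c :: R)) R.
Proof.
move=> wc wR; rewrite /ins /insc -big_split; apply: eq_bigr => b b2 /=.
rewrite width_cons (sum_ordE (fun i => F (graft c 0 (take (up c)
   (erow (up c + width R) i b)) :: graft_row R (top 0 (map st_ar (take (up c)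
   (erow (up c + width R) i b)))) (drop (up c) (erow (up c + width R) i b))))).
rewrite iotaD big_cat /= add0n; congr (_ + _).
  rewrite (sum_ordE (fun i => F (graft c 0 (erow (up c) i b) :: R))).
  rewrite !big_seq; apply: eq_bigr => i; rewrite mem_iota add0n => /andP[_ ic].
  have -> : erow (up c + width R) i b = erow (up c) i b ++ nseq (width R) Eta.
    rewrite /erow -catA /= -nseqD; congr (_ ++ _ :: nseq _ _); lia.
  have [_ [_ tE] sE _ _] := erow_spec ic b2.
  by rewrite take_size_cat // drop_size_cat // tE graft_row_1r.
rewrite (sum_ordE (fun i => F (c :: graft_row R 0 (erow (width R) i b)))).
rewrite -{1}(addn0 (up c)) iotaDl big_map; apply: eq_bigr => i _.
have -> : erow (up c + width R) (up c + i) b = nseq (up c) Eta ++ erow (width R) i b.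
  rewrite /erow catA -nseqD; congr (_ ++ _ :: nseq _ _); lia.
rewrite take_size_cat ?size_nseq // drop_size_cat ?size_nseq //.
by rewrite top_drop_eta graft_1r.
Qed.

Lemma graft_beta b p R : size R = b ->
  graft (beta b) p R = Node (lax_arity 0 b) p R.
Proof.
move=> sR; rewrite /beta /st_id graft_node add0n -[ar_up _]/b -sR.
by rewrite graft_row_1l.
Qed.

Lemma big_reindex_shift (W : nmodType) (G : nat -> nat -> W) n :
  (forall b, (B <= b + n)%N -> G (b + n)%N b = 0) ->
  \sum_(m < B | (n.+1 < m)%N) G m (m - n)%N = \sum_(b < B | (2 <= b)%N) G (b + n)%N b.
Proof.
move=> G0; rewrite big_mkcond [RHS]big_mkcond.
rewrite (sum_ordE (fun m => if (n.+1 < m)%N then G m (m - n)%N else 0)).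
rewrite (sum_ordE (fun b => if (2 <= b)%N then G (b + n)%N b else 0)).
have [nB|Bn] := leqP n B; last first.
  rewrite !big_seq0 // => b; rewrite mem_iota => h; case: ifP => // h2.
    by rewrite G0 //; lia.
  by lia.
have E := iotaD 0 n (B - n); rewrite subnKC // add0n in E.
have E2 := iotaD 0 (B - n) n; rewrite subnK // add0n in E2.
rewrite [in LHS]E [in RHS]E2 !big_cat /= (big_seq0 (l := iota 0 n)) ?add0r.
  rewrite (big_seq0 (l := iota (B - n) n)) ?addr0.
    rewrite -{1}(addn0 n) iotaDl big_map; apply: eq_bigr => i _.
    by rewrite addKn addnC; have -> : (n.+1 < i + n)%N = (2 <= i)%N by lia.
  move=> i; rewrite mem_iota => h; case: ifP => // _; apply: G0; lia.
by move=> i; rewrite mem_iota => h; rewrite ifF //; lia.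
Qed.

(** Induction on the length of the row: the differential hits the head or the tail. Groupings that
    begin at the head come from [claim_col], the later ones from the tail with the position shifted
    by one. *)
Lemma claim_rowP p : (p <= P)%N -> (forall p', (p' <= p)%N -> claim_col p') ->
  claim_row p.
Proof.
move=> pP HC W n; elim: n p pP HC => [|n IH] p pP HC r F oF.
  have -> : thn 0 p r F = 0.
    by rewrite /thn big1 // => m _; rewrite big1 // => R _; rewrite big_ord0.
  rewrite subr0.
  apply: eq_big_seq => R; rewrite mem_row => /and5P[/eqP/size0nil-> _ _ _ _].
  by rewrite /ins big1 // => b _; rewrite big_ord0.
have pN : (p < N)%N by [].
rewrite !(sum_rowS _ _ _ _ pN).
have oFc c : okF (fun R => F (c :: R)).
  by move=> R h; apply: oF; rewrite width_cons; lia.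
have oFr R : okf (fun c => F (c :: R)).
  by move=> c h; apply: oF; rewrite width_cons; lia.
transitivity (\sum_(s < N) \sum_(c <- pcol B p s) \sum_(R <- prow B n s r) ins F (c :: R)
  - (\sum_(s < N) \sum_(R <- prow B n s r) \sum_(m < B | (2 <= m)%N)
      \sum_(R1 <- prow B m p s) F (Node (lax_arity 0 m) p R1 :: R)
    + \sum_(s < N) \sum_(c <- pcol B p s) thn n s r (fun R => F (c :: R)))).
  rewrite opprD addrA -!sumrB; apply: eq_bigr => s _.
  have [sp|ps] := leqP s p; last first.
    rewrite col_empty // !big_nil subr0 sub0r big1 ?oppr0 // => R _.
    by rewrite big1 // => m _; rewrite row_empty ?big_nil.
  transitivity (\sum_(c <- pcol B p s) (\sum_(R <- prow B n s r) lin (fun S => F (S :: R)) (D c)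
     + \sum_(R <- prow B n s r) drow (fun R => F (c :: R)) R)).
    apply: eq_big_seq => c; rewrite mem_col => /and4P[_ pc _ _].
    rewrite -big_split; apply: eq_bigr => R _ /=.
    by rewrite (pure_pt pc) scale1r.
  rewrite big_split /= exchange_big /=.
  under [X in X + _]eq_bigr do rewrite (HC p (leqnn p)) //.
  rewrite sumrB.
  have HC' p' : (p' <= s)%N -> claim_col p' by move=> h; apply: HC; apply: leq_trans sp.
  under [X in _ + X]eq_bigr do rewrite (IH s (leq_trans sp pP) HC') //.
  rewrite sumrB addrACA addrA; congr (_ - _ - _).
  rewrite exchange_big -big_split /=.
  apply: eq_big_seq => c; rewrite mem_col => /and4P[/andP[wc _] _ _ _].
  rewrite -big_split; apply: eq_big_seq => R.
  rewrite mem_row => /and5P[_ lR _ _ _] /=; rewrite ins_cons //.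
  by apply/allP => x /(allP lR)/andP[].
congr (_ - _); rewrite /thn.
under [RHS]eq_bigr do under eq_bigr do rewrite big_ord_recl.
under [RHS]eq_bigr do rewrite big_split.
rewrite [RHS]big_split; congr (_ + _).
  (* Groupings at position 0: a thin box over the first b = m - n of m columns, which leaves n
     further entries. *)
  pose G m b := \sum_(R <- prow B m p r) F (Node (lax_arity 0 b) p (take b R) :: drop b R).
  rewrite [RHS](eq_bigr (fun m : 'I_B => G m (m - n)%N)); last first.
    move=> m nm; apply: eq_big_seq => R; rewrite mem_row => /and5P[/eqP sR _ _ _ _].
    have -> : erow n.+1 (@ord0 n) (m.+1 - n.+1) = beta (m - n) :: nseq n Eta.
      by rewrite /erow subSS subn1.
    rewrite graft_cons beta_ar -[ar_up _]/(m - n)%N.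
    rewrite graft_beta ?size_takel ?sR ?leq_subr //.
    congr (F (_ :: _)); rewrite -[in RHS](graft_row_1l (top p
      (map st_ar (take (m - n) R))) (drop (m - n) R)) size_drop sR.
    by congr (graft_row (nseq _ Eta)); lia.
  rewrite (@big_reindex_shift _ G) /G; last first.
    move=> b Bb; apply: big_seq0 => R.
    rewrite mem_row => /and5P[/eqP sR lR pR ch /eqP tR]; apply: oF.
    rewrite width_cons -[up (Node _ _ _)]/(width (take b R)) -width_cat cat_take_drop.
    by have /andP[_] := row_bound lR pR ch; rewrite tR sR; lia.
  under [LHS]eq_bigr do rewrite exchange_big.
  rewrite exchange_big; apply: eq_bigr => b b2.
  rewrite (@sum_row_cat _ B N) //; apply: eq_bigr => s _.
  rewrite exchange_big; apply: eq_big_seq => R1; rewrite mem_row.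
  case/andP=> /eqP s1 _; apply: eq_bigr => R2 _.
  by rewrite take_size_cat // drop_size_cat.
pose G m := \sum_(s < N) \sum_(c <- pcol B p s) \sum_(R <- prow B m s r)
  \sum_(j < n) F (c :: graft_row (erow n j (m.+1 - n)) s R).
pose H m := \sum_(R <- prow B m p r) \sum_(j < n)
  F (graft_row (erow n.+1 (lift ord0 j) (m.+1 - n.+1)) p R).
transitivity (\sum_(m < B | (n < m)%N) G m).
  under [LHS]eq_bigr do rewrite exchange_big.
  by rewrite exchange_big.
rewrite (big_shift1 (H := H)) //.
  move=> m nm Bm; rewrite /G big1 // => s _; apply: big_seq0 => c.
  rewrite mem_col => /and4P[lc pc /eqP ic /eqP oc]; apply: big_seq0 => R.
  move=> Rm; move: (Rm); rewrite mem_row => /and5P[/eqP sR lR pR ch /eqP tR].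
  rewrite big1 // => j _; apply: oF.
  have /andP[_ b1] := row_bound lR pR ch; have /andP[b2 b3] := pure_bound lc pc.
  rewrite width_cons (graft_erow_width nm (ltn_ord j) Rm).
  by move: b1 b2 b3; rewrite ic oc tR sR; move: Bm pP; clear; lia.
move=> m nm; rewrite /H (@sum_rowS _ B N) //; apply: eq_bigr => s _.
apply: eq_big_seq => c; rewrite mem_col => /and4P[_ _ _ /eqP oc].
apply: eq_bigr => R _; apply: eq_bigr => j _.
rewrite subSS; have -> : erow n.+1 (lift ord0 j) (m.+1 - n) = Eta :: erow n j (m.+1 - n) by [].
by rewrite graft_cons /= take0 drop0 top_cons /top /= oc.
Qed.

End Claim.

Lemma mem_sumn (x : nat) s : x \in s -> (x <= sumn s)%N.
Proof.
elim: s => //= y s IH; rewrite inE => /orP[/eqP->|/IH]; first exact: leq_addr.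
by move=> h; apply: leq_trans h (leq_addl _ _).
Qed.

(** [tq] bounds the boxes by [p1 + n], the claims use one common [B]. The degree of a row is
    determined by its wires and inputs and bounds the size of its boxes, so both enumerations
    contain the same rows; for m at least [p1 + n] there are none. *)
Lemma sum_typeIII (W : nmodType) B p1 n (G : nat -> seq stacking -> W) :
  (0 < p1)%N -> (p1 + n < B)%N ->
  \sum_(m <- iota 2 (p1 + n))
    \sum_(R <- [seq R <- prow (p1 + n).+1 m p1 1 | width R == n]) G m R =
  \sum_(m < B | (2 <= m)%N) \sum_(R <- prow B m p1 1 | width R == n) G m R.
Proof.
move=> p10 nB.
have E m : perm_eq [seq R <- prow (p1 + n).+1 m p1 1 | width R == n]
   [seq R <- prow B m p1 1 | width R == n].
  apply: uniq_perm; rewrite ?filter_uniq ?uniq_row // => R.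
  rewrite !mem_filter !mem_row; case: eqP => //= wR; rewrite /rspec.
  case: (size R == m) => //=; case lR: (all legit R) => //=.
  case ch: (chained p1 (map st_ar R)) => //=; last by rewrite !andbF.
  rewrite ![_ && (_ == _)]andbC; congr andb.
  have pw C : all (pureb C) R -> all (pureb (p1 + n).+1) R.
    move=> pR; have nR := row_ndeg lR pR ch.
    apply/allP => T TR; apply/allP => a aT.
    have /andP[a0 _] := allP (allP pR T TR) a aT; rewrite a0 /= ltnS.
    have h1 := mem_sumn (map_f ndeg TR).
    have h2 := mem_sumn (map_f (fun a => ar_in a + ar_up a - 2)%N aT).
    have h3 : (0 < @size stacking R)%N by case: (R) TR.
    by move: h1 h2 h3 nR a0; rewrite -/(ndeg T) wR /=; clear; lia.
  apply/idP/idP => [h|]; last exact: pw.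
  apply: sub_all h => T; apply: sub_all => a /andP[-> /=] h; apply: leq_trans h _.
  by lia.
pose H m := \sum_(R <- [seq R <- prow B m p1 1 | width R == n]) G m R.
have H0 m : (p1 + n <= m)%N -> H m = 0.
  move=> h; rewrite /H big_filter big_seq_cond big1 // => R.
  rewrite mem_row => /andP[/and5P[/eqP sR lR pR ch /eqP tR] /eqP wR].
  by have /andP[_] := row_bound lR pR ch; rewrite tR sR wR; move: h; clear; lia.
transitivity (\sum_(m <- iota 2 (p1 + n)) H m).
  by apply: eq_bigr => m _; apply: perm_big.
transitivity (\sum_(m < B + (p1 + n)) if (2 <= m)%N then H m else 0).
  rewrite -(@sum_iota _ _ (fun m => if (2 <= m)%N then H m else 0) 2 (p1 + n)) //.
  - by rewrite !big_seq; apply: eq_bigr => m; rewrite mem_iota => /andP[->].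
  - by move: nB p10; clear; lia.
  by move=> m h; case: ifP => // h2; apply: H0; move: h h2; clear; lia.
pose H' m := if (2 <= m)%N then \sum_(R <- prow B m p1 1 | width R == n) G m R else 0.
rewrite [RHS]big_mkcond [RHS](sum_ordE H') (@sum_iota _ (B + (p1 + n))%N H' 0 B).
- by apply: eq_bigr => m _; rewrite /H /H' big_filter.
- by rewrite leq_addr.
move=> m h; rewrite /H'; case: ifP => // h2; rewrite -big_filter; apply: H0.
by move: h h2 nB; clear; lia.
Qed.

Section Claim.
Variables (k : fieldType) (B P : nat).
Notation D := (dS k tq).
Notation drow := (drow_ D).
Notation N := P.+1.

Lemma sum_tq (W : lmodType k) a (G : stacking -> W) :
  \sum_(q <- tq a) (-1) ^+ (nat_of_bool q.1) *: G q.2 =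
  (-1) ^+ (nat_of_bool (ar_in a == 0%N)) *:
    (\sum_(n < ar_up a | (2 <= ar_in a + n)%N) \sum_(i < n)
      G (Node (lax_arity (ar_in a) n) 0 (erow n i ((ar_up a).+1 - n))))
  - (if ar_in a == 0%N then 0 else \sum_(m <- iota 2 (ar_in a + ar_up a))
      \sum_(R <- [seq R <- prow (ar_in a + ar_up a).+1 m (ar_in a) 1 |
         width R == ar_up a]) G (Node (lax_arity 0 m) (ar_in a) R)).
Proof.
rewrite /tq big_cat /= big_allpairs_dep /= big_filter; congr (_ + _).
  rewrite scaler_sumr -(big_mkord (fun n => 2 <= ar_in a + n)%N (fun n =>
   (-1) ^+ (nat_of_bool (ar_in a == 0%N)) *: \sum_(i < n)
      G (Node (lax_arity (ar_in a) n) 0 (erow n i ((ar_up a).+1 - n))))).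
  rewrite /index_iota subn0; apply: eq_bigr => n _; rewrite scaler_sumr.
  by rewrite (sum_ordE (fun i => (-1) ^+ (nat_of_bool (ar_in a == 0%N)) *:
      G (Node (lax_arity (ar_in a) n) 0 (erow n i ((ar_up a).+1 - n))))).
case: ifP => _; first by rewrite big_nil oppr0.
rewrite big_allpairs_dep -sumrN; apply: eq_bigr => m _; rewrite -sumrN.
by apply: eq_bigr => R _; rewrite /= scaleN1r.
Qed.

(** The differential of a column hits the root or the row above it. Type II terms of the root cancel
    the groupings that [claim_row] yields for that row. Type III terms of the root put a lower row
    under a thin box, and by [cut_both] they assemble to all rows under a thin box. Only thin boxes
    on top remain. *)
Lemma claim_colP p : (p <= P)%N -> (forall p', (p' < p)%N -> claim_row k B P p') ->
  claim_col k B P p.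
Proof.
move=> pP HR W r F oF.
case: p pP HR => [|p] pP HR.
  case: r => [|r]; last first.
    rewrite col_empty // !big_nil sub0r big1 ?oppr0 // => m _.
    by rewrite prow0 big_nil.
  rewrite pcol0 !big_seq1 linear0 /insc -sumrB big1 // => b _.
  rewrite prow0 eqxx big_seq1 big_ord_recl big_ord0 addr0.
  by rewrite (_ : graft _ 0 _ = Node (lax_arity 0 b) 0 (nseq b Eta)) ?subrr.
case: r => [|r].
  rewrite pcol0 !big_nil sub0r big1 ?oppr0 // => m _.
  by rewrite prow_pos // big_nil.
have pN : (p.+1 < N)%N by [].
move: (p.+1) (ltn0Sn p) pP HR pN => {}p p_gt0 pP HR pN.
pose nd p1 n (R : seq stacking) := Node (p1, n, 1%N) (p - p1)%N R.
have oF' p1 n : okF B P (fun R => F (nd p1 n R)).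
  by move=> R h; apply: oF; rewrite -[up _]/(width R).
pose A p1 := \sum_(n < B | (2 <= p1 + n)%N) \sum_(R <- prow B n (p - p1)%N r)
  \sum_(n2 < n | (2 <= p1 + n2)%N) \sum_(i < n2)
    F (nd p1 n2 (graft_row (erow n2 i (n.+1 - n2)) (p - p1)%N R)).
pose T p1 := \sum_(n < B | (2 <= p1 + n)%N) \sum_(R <- prow B n (p - p1)%N r)
  \sum_(m < B | (2 <= m)%N) \sum_(low <- prow B m p1 1 | width low == n)
    F (Node (lax_arity 0 m) p (graft_row low (p - p1)%N R)).
have E1 p1 n R : (0 < p1 <= p)%N -> (2 <= p1 + n)%N -> R \in prow B n (p - p1)%N r ->
  lin F (D (nd p1 n R)) =
    (\sum_(n2 < n | (2 <= p1 + n2)%N) \sum_(i < n2)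
       F (nd p1 n2 (graft_row (erow n2 i (n.+1 - n2)) (p - p1)%N R)))
    - (\sum_(m < B | (2 <= m)%N) \sum_(low <- prow B m p1 1 | width low == n)
        F (Node (lax_arity 0 m) p (graft_row low (p - p1)%N R)))
    + drow (fun R => F (nd p1 n R)) R.
  move=> /andP[p10 p1p] pn; rewrite mem_row => /and5P[/eqP sR lR pR ch /eqP tR].
  have la : is_lax_box (p1, n, 1%N).
    by rewrite /is_lax_box /lax_arity /ar_in /ar_up /= pn p10 eqxx.
  rewrite /nd dS_node linearD linearZ /=; congr (_ + _); last first.
    rewrite /thin /ar_in /= -[(p1 == 0)%N]negbK -lt0n p10 scale1r lin_drow.
    apply: eq_drow_in => // [|R' [lR' aR' _ _]]; first exact: (dS_spanr tqP).
    by rewrite [LHS]lin_bas // legit_node /composable aR' size_map sR eqxx ch la.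
  rewrite /gr lin_linE /dgen linear_sum /=.
  transitivity (\sum_(q <- tq (p1, n, 1%N)) (-1) ^+ (nat_of_bool q.1) *:
     F (graft q.2 (p - p1) R)).
    apply: eq_big_seq => q qa; have [lq aq _ _] := tqP la qa.
    rewrite linearZ /= lin_bas // linearZ /= lin_bas; last first.
      by have [] := legit_graft (q0 := (p - p1)%N) lq lR;
        rewrite // aq /composable size_map sR eqxx.
    by rewrite (@kap_pure B) // scale1r.
  rewrite (sum_tq (p1, n, 1%N) (fun S => F (graft S (p - p1)%N R))) /ar_in /ar_up /=.
  have -> : (p1 == 0%N) = false by rewrite eqn0Ngt p10.
  have lax1 m : lax_arity p1 m = (p1, m, 1%N) by rewrite /lax_arity p10.
  rewrite scale1r; congr (_ - _).
    by apply: eq_bigr => n2 _; apply: eq_bigr => i _; rewrite lax1.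
  (* If [p1 + n] reaches [B], the rows concerned are too wide for [F], and both sums vanish. *)
  have [nB|Bn] := ltnP (p1 + n) B.
    rewrite (@sum_typeIII _ B p1 n (fun m low => F (graft (Node (lax_arity 0 m) p1 low)
       (p - p1) R))) //.
    apply: eq_bigr => m _; apply: eq_bigr => low _.
    by rewrite graft_node subnKC.
  have wR : (n + r <= p - p1 + width R)%N.
    by have /andP[_] := row_bound lR pR ch; rewrite tR sR addnC.
  have Z C m low : low \in prow C m p1 1 -> width low = n ->
      F (Node (lax_arity 0 m) p (graft_row low (p - p1)%N R)) = 0.
    rewrite mem_row => /and5P[_ ll _ cl _] wl; apply: oF.
    have wlow : st_row p1 low by rewrite /st_row cl st_wf_legit.
    have wR' : st_row (p - p1) R by rewrite /st_row ch st_wf_legit.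
    have [|_ _ w3 _] := graft_rowP wlow wR'; first by rewrite sR wl.
    rewrite -[up _]/(width (graft_row low (p - p1)%N R)) w3.
    by move: wR Bn pP p1p; clear; lia.
  transitivity (0 : W); last symmetry; rewrite big1 // => m _.
    rewrite big_filter big_seq_cond big1 // => low /andP[ll /eqP wl].
    suff: F (Node (lax_arity 0 m) (p1 + (p - p1))%N (graft_row low (p - p1)%N R)) = 0.
      by [].
    by rewrite subnKC //; apply: (Z _ _ _ ll wl).
  by rewrite big_seq_cond big1 // => low /andP[ll /eqP wl]; apply: (Z _ _ _ ll wl).
have E2 p1 : (0 < p1 <= p)%N ->
  \sum_(n < B | (2 <= p1 + n)%N) \sum_(R <- prow B n (p - p1)%N r) lin F (D (nd p1 n R))
  = \sum_(n < B | (2 <= p1 + n)%N) \sum_(R <- prow B n (p - p1)%N r) insc B F (nd p1 n R)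
    - T p1.
  move=> p1p; transitivity (A p1 - T p1 +
    \sum_(n < B | (2 <= p1 + n)%N) \sum_(R <- prow B n (p - p1)%N r)
      drow (fun R => F (nd p1 n R)) R).
    rewrite -sumrB -big_split; apply: eq_bigr => n pn /=.
    by rewrite -sumrB -big_split; apply: eq_big_seq => R Rp /=; apply: E1.
  have HR' : claim_row k B P (p - p1)%N by apply: HR; move: p1p; clear; lia.
  rewrite (eq_bigr (fun n : 'I_B => \sum_(R <- prow B n (p - p1)%N r) insc B F (nd p1 n R)
     - thn B n (p - p1)%N r (fun R => F (nd p1 n R)))); last first.
    move=> n _; rewrite HR'; last exact: oF'.
    congr (_ - _); apply: eq_big_seq => R Rp; rewrite /ins /insc.
    apply: eq_bigr => b _; rewrite -[up _]/(width R); apply: eq_bigr => i _.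
    by rewrite /nd graft_node addn0.
  (* The same stackings arise as type II terms of the root and as groupings in the row above it,
     with opposite signs. *)
  have EA : A p1 = \sum_(n < B | (2 <= p1 + n)%N)
      thn B n (p - p1)%N r (fun R => F (nd p1 n R)); last first.
    by rewrite sumrB -EA addrC addrA subrK.
  rewrite /A /thn; rewrite (eq_bigr (fun n : 'I_B =>
    \sum_(n2 < B | (2 <= p1 + n2)%N && (n2 < n)%N) \sum_(R <- prow B n (p - p1)%N r)
     \sum_(i < n2) F (nd p1 n2 (graft_row (erow n2 i (n.+1 - n2)) (p - p1)%N R)))).
    rewrite (exchange_big_dep (fun n2 : 'I_B => 2 <= p1 + n2)%N) /=; last first.
      by move=> n n2 _ /andP[].
    apply: eq_bigr => n2 h2; apply: eq_bigl => n; rewrite h2 /=.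
    by case: (ltnP n2 n) => h; rewrite ?andbF // andbT; move: h2 h; clear; lia.
  move=> n _; rewrite exchange_big /=.
  rewrite (big_ord_widen_cond B (fun n2 => (2 <= p1 + n2)%N) (fun n2 =>
    \sum_(R <- prow B n (p - p1)%N r) \sum_(i < n2)
     F (nd p1 n2 (graft_row (erow n2 i (n.+1 - n2)) (p - p1)%N R)))) //.
  exact: ltnW.
rewrite (@sum_colS _ B N) // (@sum_colS _ B N) //.
(* Cutting above the lowest outgoing wire separates [low], which comes from a type III term of the
   root, from the row [u] that sat above the root. *)
have ET : \sum_(m < B | (2 <= m)%N) \sum_(R <- prow B m p r.+1)
    F (Node (lax_arity 0 m) p R) = \sum_(p1 < N) if (0 < p1 <= p)%N then T p1 else 0.
  rewrite (eq_bigr (fun m : 'I_B => \sum_(p1 < N) if (p1 <= p)%N then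
    \sum_(low <- prow B m p1 1) \sum_(u <- prow B (width low) (p - p1)%N r)
      F (Node (lax_arity 0 m) p (graft_row low (p - p1)%N u)) else 0)); last first.
    move=> m _; have [_ H] := cut_both W B pN.
    by rewrite (H m r.+1 1%N (fun R => F (Node (lax_arity 0 m) p R)) isT) subn1.
  rewrite exchange_big; apply: eq_bigr => p1 _.
  case: (posnP p1) => [->|p10]; rewrite ?leq0n /=.
    rewrite big1 // => m m2; rewrite prow0 /= big_nil //.
  case: ifP => p1p; last by rewrite big1.
  rewrite /T; under [RHS]eq_bigr do rewrite exchange_big.
  rewrite [RHS]exchange_big /=; apply: eq_bigr => m m2.
  under [RHS]eq_bigr do rewrite exchange_big /=.
  rewrite (exchange_big_dep xpredT) //=; apply: eq_big_seq => low lowp.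
  have := lowp; rewrite mem_row => /and5P[/eqP sl ll pl cl /eqP tl].
  have /andP[_ bl] := row_bound ll pl cl.
  have [wB|Bw] := ltnP (width low) B.
    rewrite (bigD1 (Ordinal wB)) /= ?eqxx ?andbT; last first.
      by move: bl m2; rewrite tl sl; clear; lia.
    rewrite [X in _ = _ + X]big1 ?addr0 // => n /andP[/andP[_ /eqP wn]].
    by rewrite -val_eqE /= wn eqxx.
  rewrite [RHS]big1; last first.
    by move=> n /andP[_ /eqP wn]; have := ltn_ord n; rewrite -wn ltnNge Bw.
  apply: big_seq0 => u; rewrite mem_row => /and5P[/eqP su lu pu cu /eqP tu].
  apply: oF; have wlow : st_row p1 low by rewrite /st_row cl st_wf_legit.
  have wR' : st_row (p - p1) u by rewrite /st_row cu st_wf_legit.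
  have [|_ _ w3 _] := graft_rowP wlow wR'; first by rewrite su.
  rewrite -[up _]/(width (graft_row low (p - p1)%N u)) w3.
  have /andP[_] := row_bound lu pu cu; rewrite tu su.
  by move: Bw pP; clear; lia.
rewrite ET -sumrB; apply: eq_bigr => p1 _.
by case: ifP => p1p; [apply: E2 | rewrite subr0].
Qed.

Lemma claim_all p : (p <= P)%N -> claim_row k B P p.
Proof.
elim/ltn_ind: p => p IH pP; apply: claim_rowP => // p' p'p.
apply: claim_colP => [|q qp']; first exact: leq_trans pP.
by apply: IH; move: p'p qp' pP; clear; lia.
Qed.

End Claim.

(** * The differential squares to zero *)

Lemma graft_row_catE s t q0 U1 U2 : size U1 = width s ->
  graft_row (s ++ t) q0 (U1 ++ U2) =
    graft_row s q0 U1 ++ graft_row t (top q0 (map st_ar U1)) U2.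
Proof. by move=> sU; rewrite graft_row_cat take_size_cat // drop_size_cat. Qed.

Lemma graft_row_eta n q0 U : size U = n -> graft_row (nseq n Eta) q0 U = U.
Proof. by move=> <-; apply: graft_row_1l. Qed.

Lemma xr_pt_eta n : xr pt (nseq n Eta) = false.
Proof. by elim: n. Qed.

Lemma kap_row_eta n U : kap_row (nseq n Eta) U = false.
Proof. by elim: n U => //= n IH U; rewrite IH xr_pt_eta andbF. Qed.

Lemma pt_beta b : pt (beta b) = true.
Proof. by rewrite /beta /st_id pt_node xr_pt_eta. Qed.

Lemma kap_beta b U : kap (beta b) U = false.
Proof. by rewrite /beta kap_node kap_row_eta. Qed.

Notation eta n := (nseq n Eta).

Lemma kap_row_beta b U : kap_row [:: beta b] U = false.
Proof.
rewrite (_ : kap_row _ _ = kap (beta b) (take (up (beta b)) U)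
  (+) (xr pt (take (up (beta b)) U) && false) (+) false) //.
by rewrite kap_beta andbF.
Qed.

Lemma xr_pt_beta b s : xr pt (beta b :: s) = ~~ xr pt s.
Proof. by rewrite -[xr pt _]/(pt (beta b) (+) xr pt s) pt_beta. Qed.

Section Insert2.
Variables (n2 i2 b2 : nat).
Hypothesis i2n : (i2 < n2)%N.
Let n := (n2 + b2 - 1)%N.

(** The inserted thin box has to pass the thin box already present, and both are odd. Insertion
    inside that box or to its right gives no sign. *)
Lemma insert_left i b : (i < i2)%N -> (0 < b2)%N ->
  graft_row (erow n2 i2 b2) 0 (erow n i b) =
    eta i ++ beta b :: eta (i2 - i.+1) ++ beta b2 :: eta (n2 - i2.+1)
  /\ kap_row (erow n2 i2 b2) (erow n i b) = true.
Proof.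
move=> ii b0.
have -> : erow n i b = (eta i ++ beta b :: eta (i2 - i.+1)) ++
    (eta b2 ++ eta (n2 - i2.+1)).
  by rewrite /erow -catA cat_cons -!nseqD; congr (_ ++ _ :: nseq _ _);
    move: ii b0 i2n; rewrite /n; clear; lia.
have sz : size (eta i ++ beta b :: eta (i2 - i.+1)) = i2.
  by rewrite size_cat /= !size_nseq; move: ii; clear; lia.
have E : erow n2 i2 b2 = eta i2 ++ ([:: beta b2] ++ eta (n2 - i2.+1)) by [].
have s2 : size (eta b2) = width [:: beta b2].
  by rewrite size_nseq width_cons beta_ar /width /= /ar_up /= addn0.
rewrite E graft_row_catE ?width_eta // graft_row_eta // graft_row_catE //.
rewrite (graft_row_eta _ (size_nseq _ _)) kap_row_cat ?width_eta // kap_row_cat //.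
have t0 : top 0 (map st_ar (eta i ++ beta b :: eta (i2 - i.+1))) = 0%N.
  rewrite map_cat top_cat top_drop_eta map_cons beta_ar top_cons.
  exact: top_drop_eta.
split.
  rewrite graft_cons take_oversize ?size_nseq ?beta_ar // t0 graft_beta ?size_nseq //.
  by rewrite -catA.
by rewrite !kap_row_eta kap_row_beta !xr_cat !xr_pt_beta !xr_pt_eta.
Qed.

Lemma insert_mid j b : (j < b2)%N ->
  graft_row (erow n2 i2 b2) 0 (erow n (i2 + j) b) =
    eta i2 ++ Node (lax_arity 0 b2) 0 (erow b2 j b) :: eta (n2 - i2.+1)
  /\ kap_row (erow n2 i2 b2) (erow n (i2 + j) b) = false.
Proof.
move=> jb.
have -> : erow n (i2 + j) b = eta i2 ++ (erow b2 j b ++ eta (n2 - i2.+1)).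
  by rewrite /erow -catA cat_cons -!nseqD catA -nseqD; congr (_ ++ _ :: nseq _ _);
    move: jb i2n; rewrite /n; clear; lia.
have sz : size (erow b2 j b) = b2.
  by rewrite size_cat /= !size_nseq; move: jb; clear; lia.
have E : erow n2 i2 b2 = eta i2 ++ ([:: beta b2] ++ eta (n2 - i2.+1)) by [].
have s2 : size (erow b2 j b) = width [:: beta b2].
  by rewrite sz width_cons beta_ar /width /= /ar_up /= addn0.
rewrite E graft_row_catE ?width_eta ?size_nseq // graft_row_eta ?size_nseq //.
rewrite graft_row_catE // (graft_row_eta _ (size_nseq _ _)).
rewrite kap_row_cat ?width_eta ?size_nseq // kap_row_cat //.
split.
  rewrite graft_cons take_oversize ?sz ?beta_ar // top_drop_eta.
  by rewrite graft_beta.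
by rewrite !kap_row_eta kap_row_beta !xr_pt_eta andbF.
Qed.

Lemma insert_right t b : (i2.+1 + t < n2)%N -> (0 < b2)%N ->
  graft_row (erow n2 i2 b2) 0 (erow n (i2 + b2 + t) b) =
    eta i2 ++ beta b2 :: eta t ++ beta b :: eta (n2 - (i2.+1 + t).+1)
  /\ kap_row (erow n2 i2 b2) (erow n (i2 + b2 + t) b) = false.
Proof.
move=> tn b0.
have -> : erow n (i2 + b2 + t) b = eta i2 ++ (eta b2 ++
    (eta t ++ beta b :: eta (n2 - (i2.+1 + t).+1))).
  by rewrite /erow !catA -!nseqD; congr (_ ++ _ :: nseq _ _);
    move: tn b0 i2n; rewrite /n; clear; lia.
have E : erow n2 i2 b2 = eta i2 ++ ([:: beta b2] ++ eta (n2 - i2.+1)) by [].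
have s2 : size (eta b2) = width [:: beta b2].
  by rewrite size_nseq width_cons beta_ar /width /= /ar_up /= addn0.
have s3 : size (eta t ++ beta b :: eta (n2 - (i2.+1 + t).+1)) = (n2 - i2.+1)%N.
  by rewrite size_cat /= !size_nseq; move: tn; clear; lia.
rewrite E graft_row_catE ?width_eta ?size_nseq // graft_row_eta ?size_nseq //.
rewrite graft_row_catE // (graft_row_eta _ s3).
rewrite kap_row_cat ?width_eta ?size_nseq // kap_row_cat //.
split.
  rewrite graft_cons take_oversize ?size_nseq ?beta_ar // top_drop_eta.
  by rewrite graft_beta ?size_nseq.
by rewrite !kap_row_eta kap_row_beta !xr_pt_eta.
Qed.

End Insert2.

(** * Cancellation of double insertions *)

Section RR.
Variables (W : zmodType) (p q : nat).

Lemma sum_range (F : nat -> W) n2 :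
  \sum_(n < q | (n2 < n)%N) F n = \sum_(n2.+1 <= n < q) F n.
Proof. by rewrite big_geq_mkord. Qed.

(** Reversing the summation over n exchanges the sizes of the two inserted boxes, whose sum is
    fixed. *)
Lemma sum_reflect (F : nat -> nat -> W) n2 :
  \sum_(n < q | (n2 < n)%N) F (q.+1 - n)%N (n.+1 - n2)%N =
  \sum_(n < q | (n2 < n)%N) F (n.+1 - n2)%N (q.+1 - n)%N.
Proof.
rewrite (sum_range (fun n => F (q.+1 - n)%N (n.+1 - n2)%N)).
rewrite (sum_range (fun n => F (n.+1 - n2)%N (q.+1 - n)%N)).
rewrite big_nat_rev !big_nat; apply: eq_bigr => n /andP[h1 h2].
by congr F; move: h1 h2; clear; lia.
Qed.

Lemma sum_shift (F : nat -> nat -> W) n2 : (n2 < q)%N ->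
  \sum_(n < q | (n2 < n)%N) F (n.+1 - n2)%N (q.+1 - n)%N =
  \sum_(c < q.+1 - n2 | (2 <= c)%N) F c ((q.+1 - n2).+1 - c)%N.
Proof.
move=> n2q; rewrite (sum_range (fun n => F (n.+1 - n2)%N (q.+1 - n)%N)).
rewrite -(big_geq_mkord 2 (q.+1 - n2) xpredT (fun c => F c ((q.+1 - n2).+1 - c)%N)).
rewrite -[n2.+1]add0n -[2%N in RHS]add0n !big_addn.
have -> : (q.+1 - n2 - 2 = q - n2.+1)%N by move: n2q; clear; lia.
rewrite !big_nat; apply: eq_bigr => c /andP[_ h].
by congr F; move: h n2q; clear; lia.
Qed.

Lemma sum_above (F : nat -> W) n i :
  \sum_(t < n - i.+1) F (i.+1 + t)%N = \sum_(j < n | (i < j)%N) F j.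
Proof.
rewrite -(big_geq_mkord i.+1 n xpredT F) -[i.+1 in RHS]add0n big_addn big_mkord.
by apply: eq_bigr => t _; rewrite addnC.
Qed.

Lemma sum_ord_cat3 (F : nat -> W) a b c :
  \sum_(i < a + b + c) F i = \sum_(i < a) F i + \sum_(j < b) F (a + j)%N
     + \sum_(t < c) F (a + b + t)%N.
Proof. by rewrite !big_split_ord. Qed.

(** Insertions to the left and to the right of a thin box yield the same stackings [H] with opposite
    signs and cancel; the insertions into that box, counted by [M], survive. *)
Lemma rebracket (g : nat -> nat -> nat -> nat -> nat -> W)
    (H : nat -> nat -> nat -> nat -> nat -> W)
    (M : nat -> nat -> nat -> nat -> nat -> W) :
  (forall n2 i2 b2 i b, (i2 < n2)%N -> (2 <= b2)%N -> (i < i2)%N ->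
     g n2 i2 b2 i b = - H n2 i i2 b b2) ->
  (forall n2 i2 b2 j b, (i2 < n2)%N -> (2 <= b2)%N -> (j < b2)%N ->
     g n2 i2 b2 (i2 + j)%N b = M n2 i2 b2 j b) ->
  (forall n2 i2 b2 t b, (i2.+1 + t < n2)%N -> (2 <= b2)%N ->
     g n2 i2 b2 (i2 + b2 + t)%N b = H n2 i2 (i2.+1 + t)%N b2 b) ->
  \sum_(n < q | (2 <= p + n)%N) \sum_(i < n)
    \sum_(n2 < n | (2 <= p + n2)%N) \sum_(i2 < n2)
      g n2 i2 (n.+1 - n2)%N i (q.+1 - n)%N =
  \sum_(n < q | (2 <= p + n)%N) \sum_(i < n)
    \sum_(c < q.+1 - n | (2 <= c)%N) \sum_(j < c)
      M n i c j ((q.+1 - n).+1 - c)%N.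
Proof.
move=> gl gm gr.
transitivity (\sum_(n2 < q | (2 <= p + n2)%N) \sum_(i2 < n2)
    \sum_(n < q | (n2 < n)%N) \sum_(i < n)
      g n2 i2 (n.+1 - n2)%N i (q.+1 - n)%N).
  transitivity (\sum_(n < q) \sum_(n2 < q | (2 <= p + n2)%N && (n2 < n)%N)
      \sum_(i2 < n2) \sum_(i < n) g n2 i2 (n.+1 - n2)%N i (q.+1 - n)%N).
    rewrite big_mkcond; apply: eq_bigr => n _.
    case: ifP => [pn|/negP pn]; last first.
      rewrite big1 // => n2 /andP[h1 h2]; case: pn.
      by move: h1 h2; clear; lia.
    rewrite exchange_big /=.
    rewrite (big_ord_widen_cond q (fun n2 => (2 <= p + n2)%N) (fun n2 =>
      \sum_(i < n) \sum_(i2 < n2) g n2 i2 (n.+1 - n2)%N i (q.+1 - n)%N)) 1?ltnW //.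
    by apply: eq_bigr => n2 _; apply: exchange_big.
  rewrite (exchange_big_dep (fun n2 : 'I_q => (2 <= p + n2)%N)) /=; last first.
    by move=> n n2 _ /andP[].
  apply: eq_bigr => n2 h; rewrite exchange_big /=; apply: eq_bigr => i2 _.
  by apply: eq_bigl => n; rewrite h.
apply: eq_bigr => n2 _.
pose K i j := \sum_(n < q | (n2 < n)%N) H n2 i j (n.+1 - n2)%N (q.+1 - n)%N.
transitivity (\sum_(i2 < n2) (- (\sum_(i < i2) K i i2) +
    \sum_(c < q.+1 - n2 | (2 <= c)%N) \sum_(j < c)
      M n2 i2 c j ((q.+1 - n2).+1 - c)%N +
    \sum_(j < n2 | (i2 < j)%N) K i2 j)).
  apply: eq_bigr => i2 _.
  have i2n := ltn_ord i2; have n2q := ltn_ord n2.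
  rewrite -(sum_shift (fun c d => \sum_(j < c) M n2 i2 c j d)) //.
  have -> : \sum_(i < i2) K i i2 = \sum_(n < q | (n2 < n)%N) \sum_(i < i2)
       H n2 i i2 (q.+1 - n)%N (n.+1 - n2)%N.
    rewrite [RHS]exchange_big; apply: eq_bigr => i _ /=.
    by rewrite (sum_reflect (fun x y => H n2 i i2 x y)).
  have -> : \sum_(j < n2 | (i2 < j)%N) K i2 j =
     \sum_(n < q | (n2 < n)%N) \sum_(t < n2 - i2.+1)
       H n2 i2 (i2.+1 + t)%N (n.+1 - n2)%N (q.+1 - n)%N.
    by rewrite [RHS]exchange_big -(sum_above (K i2)); apply: eq_bigr.
  rewrite -sumrN -!big_split; apply: eq_bigr => n n2n /=.
  have E : (nat_of_ord n = i2 + (n.+1 - n2) + (n2 - i2.+1))%N.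
    by move: i2n n2n; clear; lia.
  rewrite (sum_ordE (fun i => g n2 i2 (n.+1 - n2)%N i (q.+1 - n)%N)) {1}E -sum_ordE.
  have b2 : (2 <= n.+1 - n2)%N by move: n2n; clear; lia.
  rewrite (sum_ord_cat3 (fun i => g n2 i2 (n.+1 - n2)%N i (q.+1 - n)%N)) -sumrN.
  congr (_ + _ + _); apply: eq_bigr => i _.
  - exact: gl.
  - exact: gm.
  - by apply: gr => //; have := ltn_ord i; move: i2n; clear; lia.
rewrite !big_split /= addrAC -[RHS]add0r; congr (_ + _).
rewrite sumrN; apply/eqP; rewrite addrC subr_eq0; apply/eqP.
transitivity (\sum_(i2 < n2) \sum_(i < n2 | (i < i2)%N) K i i2).
  rewrite (exchange_big_dep xpredT) //=.
apply: eq_bigr => i2 _.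
by rewrite (big_ord_widen n2 (fun i => K i i2)) // ltnW.
Qed.
End RR.

Section Dgen2.
Variable k : fieldType.
Notation V := (fmod k).
Notation D := (dS k tq).
Notation drow := (drow_ D).
Notation sn b := ((-1) ^+ (nat_of_bool b) : k).

Lemma pureb_eta n : all (pureb 0) (eta n).
Proof. by elim: n. Qed.

Lemma kap_row_pureL B R U : all (pureb B) R -> kap_row R U = false.
Proof.
have HS S : pureb B S -> forall U, kap S U = false.
  elim/stacking_mem_ind: S => // a p0 ss IH.
  rewrite pureb_node => /and3P[_ _ pss] {}U; rewrite kap_node.
  elim: ss IH pss U => //= s ss IHs IH /andP[ps pss] U.
  by rewrite IH ?mem_head // IHs ?(xr_pt0 pss) ?andbF //; exact: mem_tail IH.
elim: R U => //= s R IH U /andP[ps pR].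
by rewrite HS // IH // (xr_pt0 pR) andbF.
Qed.

Lemma drow0 (W : lmodType k) (ss : seq stacking) :
  drow (fun=> 0 : W) ss = 0.
Proof.
elim: ss => // s ss IH; rewrite drow_cons IH scaler0 addr0.
by rewrite /lin big1 // => t _; rewrite scaler0.
Qed.

Lemma drow_eta (W : lmodType k) (F : seq stacking -> W) n : drow F (eta n) = 0.
Proof.
elim: n F => //= n IH F; rewrite IH scaler0 addr0; exact: linear0.
Qed.

Lemma drow_erow (W : lmodType k) (F : seq stacking -> W) n i b :
  drow F (erow n i b) =
    lin (fun S => F (eta i ++ S :: eta (n - i.+1))) (D (beta b)).
Proof.
rewrite /erow drow_cat drow_eta add0r xr_pt_eta scale1r drow_cons.
by rewrite drow_eta scaler0 addr0.
Qed.

Lemma lax_arity_box p q : (2 <= p + q)%N -> is_lax_box (lax_arity p q).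
Proof. by move=> h; rewrite /is_lax_box /lax_arity /ar_in /ar_up /= h eqxx. Qed.

Lemma gr_dgen (a : arity) p0 ss : is_lax_box a ->
  gr p0 ss (dgen k tq a) = \sum_(x <- tq a) sn x.1 *:
    (sn (kap x.2 ss) *: bas (graft x.2 p0 ss)).
Proof.
move=> la; rewrite /dgen linear_sum !big_seq; apply: eq_bigr => x xa.
by have [lx _ _ _] := tqP la xa; apply: gr_bas.
Qed.

Lemma lin_dgen (W : lmodType k) (f : stacking -> W) (a : arity) :
  is_lax_box a -> lin f (dgen k tq a) = \sum_(x <- tq a) sn x.1 *: f x.2.
Proof.
move=> la; rewrite /dgen linear_sum !big_seq; apply: eq_bigr => x xa.
by have [lx _ _ _] := tqP la xa; rewrite linearZ /= lin_bas.
Qed.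

Lemma D_beta b : (2 <= b)%N -> D (beta b) = dgen k tq (lax_arity 0 b).
Proof.
move=> b2; have lb : is_lax_box (lax_arity 0 b) by apply: lax_arity_box.
rewrite /beta /st_id dS_node drow_eta scaler0 addr0 gr_dgen //.
rewrite /dgen !big_seq; apply: eq_bigr => x xa.
have [/andP[wx _] ax _ _] := tqP lb xa.
rewrite (kap_pure x.2 (pureb_eta _)) scale1r.
by rewrite -[ar_up _](congr1 ar_up ax) graft_1r.
Qed.

Definition insert_insert p q : V :=
  \sum_(n < q | (2 <= p + n)%N) \sum_(i < n)
    \sum_(n2 < n | (2 <= p + n2)%N) \sum_(i2 < n2)
      sn (kap_row (erow n2 i2 (n.+1 - n2)) (erow n i (q.+1 - n))) *:
      bas (Node (lax_arity p n2) 0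
        (graft_row (erow n2 i2 (n.+1 - n2)) 0 (erow n i (q.+1 - n)))).

Definition insert_nested p q : V :=
  \sum_(n < q | (2 <= p + n)%N) \sum_(i < n)
    \sum_(c < q.+1 - n | (2 <= c)%N) \sum_(j < c)
      bas (Node (lax_arity p n) 0 (eta i ++
        Node (lax_arity 0 c) 0 (erow c j ((q.+1 - n).+1 - c)) :: eta (n - i.+1))).

Lemma insert_insertE p q : insert_insert p q = insert_nested p q.
Proof.
rewrite /insert_insert /insert_nested.
pose g n2 i2 b2 i b : V :=
  sn (kap_row (erow n2 i2 b2) (erow (n2 + b2 - 1)%N i b)) *:
    bas (Node (lax_arity p n2) 0
      (graft_row (erow n2 i2 b2) 0 (erow (n2 + b2 - 1)%N i b))).
pose H n2 i j b b' : V := bas (Node (lax_arity p n2) 0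
  (eta i ++ beta b :: eta (j - i.+1) ++ beta b' :: eta (n2 - j.+1))).
pose M n i c j d : V := bas (Node (lax_arity p n) 0 (eta i ++
        Node (lax_arity 0 c) 0 (erow c j d) :: eta (n - i.+1))).
rewrite -(@rebracket _ p q g H M).
- apply: eq_bigr => n _; apply: eq_bigr => i _; apply: eq_bigr => n2 _.
  apply: eq_bigr => i2 _; rewrite /g.
  by have -> : (n2 + (n.+1 - n2) - 1 = n)%N by have := ltn_ord n2; clear; lia.
- move=> n2 i2 b2 i b h1 h2 h3; rewrite /g /H.
  by have [-> ->] := insert_left h1 b h3 (ltnW h2); rewrite scaleN1r.
- move=> n2 i2 b2 j b h1 h2 h3; rewrite /g /M.
  by have [-> ->] := insert_mid h1 b h3; rewrite scale1r.
- move=> n2 i2 b2 t b h1 h2; rewrite /g /H.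
  have h3 : (i2 < n2)%N by move: h1; clear; lia.
  have [-> ->] := insert_right h3 b h1 (ltnW h2); rewrite scale1r.
  by rewrite addKn.
Qed.

Lemma D_erow p n i b : (2 <= p + n)%N -> (2 <= b)%N -> (i < n)%N ->
  D (Node (lax_arity p n) 0 (erow n i b)) =
    sn (p == 0%N) *: (\sum_(n2 < n | (2 <= p + n2)%N) \sum_(i2 < n2)
      sn (kap_row (erow n2 i2 (n.+1 - n2)) (erow n i b)) *:
      bas (Node (lax_arity p n2) 0
        (graft_row (erow n2 i2 (n.+1 - n2)) 0 (erow n i b))))
  - (if p == 0%N then 0 else \sum_(m <- iota 2 (p + n))
      \sum_(R <- [seq R <- prow (p + n).+1 m p 1 | width R == n])
         bas (graft (Node (lax_arity 0 m) p R) 0 (erow n i b)))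
  - sn (p == 0%N) *: (\sum_(c < b | (2 <= c)%N) \sum_(j < c)
      bas (Node (lax_arity p n) 0 (eta i ++
        Node (lax_arity 0 c) 0 (erow c j (b.+1 - c)) :: eta (n - i.+1)))).
Proof.
move=> pn b2 ltin; have la := lax_arity_box pn.
have lb : is_lax_box (lax_arity 0 b) by apply: lax_arity_box.
rewrite dS_node gr_dgen //; congr (_ + _); last first.
  rewrite drow_erow D_beta // lin_dgen //.
  rewrite (sum_tq _ (fun S => bas (Node (lax_arity p n) 0
    (eta i ++ S :: eta (n - i.+1))) : V)).
  rewrite -[ar_in (lax_arity 0 b)]/0%N -[ar_up (lax_arity 0 b)]/b eqxx.
  rewrite subr0 scaleN1r scalerN; congr (- (_ *: _)).
  by rewrite /thin /lax_arity /ar_in /ar_out /=; case: (p).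
rewrite (sum_tq _ (fun S => sn (kap S (erow n i b)) *:
  bas (graft S 0 (erow n i b)))).
rewrite -[ar_in (lax_arity p n)]/p -[ar_up (lax_arity p n)]/n.
congr (_ *: _ - _); case: ifP => // _.
rewrite !big_seq; apply: eq_bigr => m _; rewrite !big_seq; apply: eq_bigr => R.
rewrite mem_filter mem_row => /andP[_ /and5P[_ _ pR _ _]].
by rewrite kap_node (kap_row_pureL _ pR) scale1r.
Qed.

Lemma gr_pure m p q R : (2 <= m)%N -> all (pureb (p + q).+1) R ->
  gr p R (dgen k tq (lax_arity 0 m)) = - \sum_(n < m | (2 <= n)%N) \sum_(i < n)
    bas (graft (Node (lax_arity 0 n) 0 (erow n i (m.+1 - n))) p R).
Proof.
move=> m2 pR; rewrite gr_dgen; last exact: lax_arity_box.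
rewrite (sum_tq _ (fun S => sn (kap S R) *: bas (graft S p R))).
rewrite -[ar_in (lax_arity 0 m)]/0%N -[ar_up (lax_arity 0 m)]/m eqxx.
rewrite subr0 scaleN1r; congr (- _); apply: eq_bigr => n _; apply: eq_bigr => i _.
by rewrite (kap_pure _ pR) scale1r.
Qed.

Lemma D_typeIII m p q R : (0 < p)%N -> (2 <= m)%N ->
  R \in prow (p + q).+1 m p 1 ->
  D (Node (lax_arity 0 m) p R) = - drow (fun r => bas (Node (lax_arity 0 m) p r)) R
  - \sum_(n < m | (2 <= n)%N) \sum_(i < n)
      bas (Node (lax_arity 0 n) p (graft_row (erow n i (m.+1 - n)) p R)).
Proof.
move=> p0 m2; rewrite mem_row => /and5P[_ _ pR _ _].
by rewrite dS_node scaleN1r (gr_pure m2 pR) addrC.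
Qed.

Section Total.
Variables (p q : nat).
Hypothesis p0 : (0 < p)%N.
(** Chosen so that p + q < B and that a function supported on rows of width q satisfies [okF] for at
    most p wires. *)
Let B := (p + q + (2 * p + 3)).+1.

(** [claim_all] for one outgoing wire, restricted to rows of width q. Insertions on top are type III
    terms of the root of a type II term; groupings are type III terms whose thin root has been
    split. *)
Lemma sum_drow_typeIII :
  \sum_(m <- iota 2 (p + q))
    \sum_(R <- [seq R <- prow (p + q).+1 m p 1 | width R == q])
      drow (fun r => bas (Node (lax_arity 0 m) p r) : V) R =
  \sum_(n < q | (2 <= p + n)%N) \sum_(i < n) \sum_(m <- iota 2 (p + n))
      \sum_(R <- [seq R <- prow (p + n).+1 m p 1 | width R == n])
         bas (graft (Node (lax_arity 0 m) p R) 0 (erow n i (q.+1 - n)))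
  - \sum_(m' <- iota 2 (p + q))
    \sum_(R <- [seq R <- prow (p + q).+1 m' p 1 | width R == q])
      \sum_(n < m' | (2 <= n)%N) \sum_(i < n)
      bas (Node (lax_arity 0 n) p (graft_row (erow n i (m'.+1 - n)) p R)).
Proof.
have pqB : (p + q < B)%N by rewrite /B; clear; lia.
rewrite (sum_typeIII _ p0 pqB).
rewrite (sum_typeIII (fun m' R => \sum_(n < m' | (2 <= n)%N) \sum_(i < n)
      bas (Node (lax_arity 0 n) p (graft_row (erow n i (m'.+1 - n)) p R)) : V)
  p0 pqB).
pose F m R : V := if width R == q then bas (Node (lax_arity 0 m) p R) else 0.
have oF m : okF B p (F m).
  by move=> R h; rewrite /F; case: eqP => // E; move: h; rewrite E /B; clear; lia.
have -> : \sum_(m < B | (2 <= m)%N) \sum_(R <- prow B m p 1 | width R == q)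
     drow (fun r => bas (Node (lax_arity 0 m) p r) : V) R =
   \sum_(m < B | (2 <= m)%N) \sum_(R <- prow B m p 1) drow (F m) R.
  apply: eq_bigr => m m2; rewrite big_mkcond !big_seq; apply: eq_bigr => R.
  rewrite mem_row => /and5P[_ lR pR ch tR].
  have wE r : drterm R r -> width r = width R.
    by case=> _ E _ _; rewrite /width E.
  case: ifP => wR.
    apply: eq_drow_in => //; first exact: (dS_spanr tqP).
    by move=> r /wE E; rewrite /F E wR.
  rewrite -[LHS](drow0 _ R); apply: eq_drow_in => //.
    exact: (dS_spanr tqP).
  by move=> r /wE E; rewrite /F E wR.
under eq_bigr => m _ do rewrite (@claim_all k B p p (leqnn p) V m 1 (F m) (oF m)).
rewrite big_split /= sumrN; congr (_ - _).
  rewrite (eq_bigr (fun n : 'I_q => \sum_(i < n) \sum_(m < B | (2 <= m)%N)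
     \sum_(R <- prow B m p 1 | width R == n)
       bas (graft (Node (lax_arity 0 m) p R) 0 (erow n i (q.+1 - n))))); last first.
    move=> n pn; apply: eq_bigr => i _.
    rewrite (@sum_typeIII _ B p n (fun m R =>
       bas (graft (Node (lax_arity 0 m) p R) 0 (erow n i (q.+1 - n))) : V)) //.
    by have := ltn_ord n; rewrite /B; clear; lia.
  rewrite (eq_bigr (fun m : 'I_B => \sum_(n < q | (2 <= p + n)%N)
      \sum_(R <- prow B m p 1 | width R == n) \sum_(i < n)
        bas (graft (Node (lax_arity 0 m) p R) 0 (erow n i (q.+1 - n))))).
    rewrite exchange_big /=; apply: eq_bigr => n _.
    by rewrite exchange_big /=; apply: eq_bigr => m _; apply: exchange_big.
  move=> m m2.
  under [RHS]eq_bigr => n _ do rewrite big_mkcond /=.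
  rewrite [RHS]exchange_big /= !big_seq; apply: eq_bigr => R.
  rewrite mem_row => /and5P[_ lR pR ch tR].
  have gF i b : (i < width R)%N -> (2 <= b)%N ->
      F m (graft_row R 0 (erow (width R) i b)) = if (width R + b - 1 == q)%N then
        bas (graft (Node (lax_arity 0 m) p R) 0 (erow (width R) i b)) else 0.
    move=> iw b2; rewrite /F graft_node addn0.
    have [lE [cE tE] sE wE _] := erow_spec iw b2.
    have wr : st_row 0 (erow (width R) i b) by rewrite /st_row cE st_wf_legit.
    have wR : st_row p R by rewrite /st_row ch st_wf_legit.
    by have [|_ _ -> _] := graft_rowP wR wr; rewrite ?sE ?wE.
  rewrite /ins; have [wq|qw] := ltnP (width R) q; last first.
    rewrite big1 => [|b b2].
      by rewrite big1 // => n _; case: eqP => // E; have := ltn_ord n; rewrite -E ltnNge qw.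
    rewrite big1 // => i _; rewrite gF //; case: eqP => // E.
    by move: E qw b2; clear; lia.
  have [w0|w0] := posnP (width R).
    rewrite big1 => [|b b2]; last by rewrite w0 big_ord0.
    rewrite big1 // => n _; case: eqP => // E; rewrite -E w0.
    by apply: big1 => -[].
  have bB : (q.+1 - width R < B)%N by rewrite /B; clear; lia.
  rewrite (bigD1 (Ordinal bB)) /=; last by move: wq; clear; lia.
  rewrite [X in _ + X]big1 ?addr0; last first.
    move=> b /andP[b2 nb]; rewrite big1 // => i _; rewrite gF //.
    case: eqP => // E; case/negP: nb; rewrite -val_eqE /=; apply/eqP.
    by move: E wq b2; clear; lia.
  rewrite (bigD1 (Ordinal wq)) /=; last by move: p0 w0; clear; lia.
  rewrite [X in _ = _ + X]big1 ?addr0; last first.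
    move=> n /andP[_ nn]; case: eqP => // E; case/negP: nn.
    by rewrite -val_eqE /= E.
  rewrite eqxx; apply: eq_bigr => i _; rewrite gF //; last by move: wq; clear; lia.
  by rewrite ifT //; apply/eqP; move: wq; clear; lia.
rewrite (exchange_big_dep (fun m' : 'I_B => (2 <= m')%N)) /=; last first.
  by move=> m m' m2 mm'; apply: ltnW; apply: leq_ltn_trans mm'.
apply: eq_bigr => m' m'2.
rewrite (eq_bigr (fun m : 'I_B => \sum_(R <- prow B m' p 1 | width R == q)
   \sum_(j < m) bas (Node (lax_arity 0 m) p (graft_row (erow m j (m'.+1 - m)) p R)))).
  rewrite exchange_big /=; apply: eq_bigr => R _.
  by rewrite (big_ord_widen_cond B (fun m => (2 <= m)%N) (fun m => \sum_(j < m)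
    bas (Node (lax_arity 0 m) p (graft_row (erow m j (m'.+1 - m)) p R)))) // ltnW.
move=> m /andP[m2 mm']; rewrite [RHS]big_mkcond !big_seq; apply: eq_bigr => R Rm.
case: ifP => wR; last first.
  by rewrite big1 // => j _; rewrite /F (graft_erow_width mm' _ Rm) // wR.
by apply: eq_bigr => j _; rewrite /F (graft_erow_width mm' _ Rm) // wR.
Qed.
End Total.

(** Pairs of insertions cancel by [insert_insertE]. If p > 0, the terms that use type III once
    (before or after an insertion, before a splitting of the thin root, or together with a
    differential in the row) cancel by [sum_drow_typeIII]. *)
Lemma dgen2 a : is_lax_box a -> lin D (dgen k tq a) = 0.
Proof.
case: a => -[p q] r /andP[pq /eqP ->].
rewrite -[ar_in _]/p -[ar_up _]/q in pq *.
rewrite lin_dgen; last exact: lax_arity_box.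
rewrite (sum_tq _ D) -[ar_in (lax_arity p q)]/p -[ar_up (lax_arity p q)]/q.
have -> : \sum_(n < q | (2 <= p + n)%N) \sum_(i < n)
    D (Node (lax_arity p n) 0 (erow n i (q.+1 - n))) =
  - (if p == 0%N then 0 else \sum_(n < q | (2 <= p + n)%N) \sum_(i < n)
      \sum_(m <- iota 2 (p + n))
      \sum_(R <- [seq R <- prow (p + n).+1 m p 1 | width R == n])
         bas (graft (Node (lax_arity 0 m) p R) 0 (erow n i (q.+1 - n)))).
  under eq_bigr => n pn.
    under eq_bigr => i _.
      rewrite D_erow //; last by have := ltn_ord n; clear; lia.
      over.
    rewrite !big_split /= !sumrN; over.
  rewrite !big_split /= !sumrN.
  under eq_bigr do rewrite -scaler_sumr.
  under [X in _ - _ - X]eq_bigr do rewrite -scaler_sumr.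
  rewrite -!scaler_sumr -/(insert_insert p q) -/(insert_nested p q).
  rewrite insert_insertE addrAC subrr add0r; congr (- _).
  case: (p == 0%N) => //; rewrite big1 // => n _; exact: big1.
case: eqP => [_|/eqP pn0]; first by rewrite oppr0 scaler0 addr0.
have p0 : (0 < p)%N by rewrite lt0n.
rewrite scale1r.
have -> : \sum_(m <- iota 2 (p + q))
      \sum_(R <- [seq R <- prow (p + q).+1 m p 1 | width R == q])
         D (Node (lax_arity 0 m) p R) =
   - \sum_(m <- iota 2 (p + q))
      \sum_(R <- [seq R <- prow (p + q).+1 m p 1 | width R == q])
        drow (fun r => bas (Node (lax_arity 0 m) p r)) R
   - \sum_(m' <- iota 2 (p + q))
    \sum_(R <- [seq R <- prow (p + q).+1 m' p 1 | width R == q])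
      \sum_(n < m' | (2 <= n)%N) \sum_(i < n)
      bas (Node (lax_arity 0 n) p (graft_row (erow n i (m'.+1 - n)) p R)).
  rewrite -!sumrN -big_split !big_seq; apply: eq_bigr => m.
  rewrite mem_iota => /andP[m2 _].
  rewrite -!sumrN -big_split !big_seq; apply: eq_bigr => R.
  rewrite mem_filter => /andP[_ Rm]; rewrite (D_typeIII p0 m2 Rm) //.
by rewrite sum_drow_typeIII // -!opprD subrK subrr oppr0.
Qed.
End Dgen2.

(** * The free dg box operad *)

Lemma sg_1r S n : sg S 0 (eta n) = false.
Proof.
rewrite /sg (kap_pure S (pureb_eta n)) /loc /theta nseq_eta_ar (proj2 (chained_eta n)).
have -> K : thr K (nseq n (0, 1, 0)%N) = false by elim: n => //= n ->.
rewrite /= xr_pt_eta andbF.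
by elim: n => //= n ->; rewrite xr_pt_eta andbF.
Qed.

Lemma sg_1l S : sg Eta (ar_in (st_ar S)) [:: S] = false.
Proof. by rewrite /sg /loc /theta /= !andbF /= addbb !andbF. Qed.

Section FreeBox.
Variable k : fieldType.
Notation V := (fmod k).
Notation sn b := ((-1) ^+ (nat_of_bool b) : k).

(* Non-composable arguments are sent to 0, so that the span of the basis      *)
(* elements of positive degree absorbs products without side conditions.      *)
Definition muB S p0 Ts : V :=
  if composable (st_ar S) p0 (map st_ar Ts)
  then sn (sg S p0 Ts) *: bas (graft S p0 Ts) else 0.

Definition muT (x : V) p0 (xs : seq V) : V :=
  lin (fun S => ml (fun Ts => muB S p0 Ts) xs) x.

Lemma muT_bas S p0 Ts : legit S -> all legit Ts ->
  muT (bas S) p0 (map bas Ts) = muB S p0 Ts.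
Proof. by move=> lS lTs; rewrite /muT lin_bas // ml_bas. Qed.

Lemma muTl p0 zs : linear (fun x => muT x p0 zs).
Proof. by move=> c x y; rewrite /muT linearP. Qed.

Lemma muTZ p0 zs c x : muT (c *: x) p0 zs = c *: muT x p0 zs.
Proof. by rewrite /muT linearZ. Qed.

Lemma muTr x p0 l1 c y z l2 : muT x p0 (l1 ++ (c *: y + z) :: l2) =
  c *: muT x p0 (l1 ++ y :: l2) + muT x p0 (l1 ++ z :: l2).
Proof. by rewrite /muT -lin_comb; apply: eq_lin => S _; apply: ml_lin. Qed.

Lemma pieces_size (M : grmod k) s (xs : seq M) : pieces s xs -> size xs = size s.
Proof. by elim: s xs => [|t s IH] [|x xs] //= [_ /IH ->]. Qed.

Definition ndegz S : int := (ndeg S)%:Z.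

Lemma inspan_ml P (F : seq stacking -> V) s xs :
  pieces (M := fgr k) s xs ->
  (forall Ss, all legit Ss -> map st_ar Ss = unzip1 s ->
     map ndegz Ss = unzip2 s -> inspan P (F Ss)) ->
  inspan P (ml F xs).
Proof.
elim: s xs F => [|t s IH] [|x xs] F //=; first by move=> _; apply.
case=> px pxs PF; apply: (inspan_lin px) => S lS [aS dS]; apply: IH => //.
by move=> Ss lSs aSs dSs; apply: PF; rewrite /= ?lS ?aS ?aSs /ndegz ?dS -?dSs.
Qed.

Lemma sumz_ndeg Ss : \sum_(d <- map ndegz Ss) d = (sumn (map ndeg Ss))%:Z.
Proof.
elim: Ss => [|S Ss IH] /=; first by rewrite big_nil.
by rewrite big_cons IH PoszD.
Qed.

Fact muT_piece a e p0 s (x : fgr k) (xs : seq (fgr k)) :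
  composable a p0 (unzip1 s) -> piece a e x -> pieces s xs ->
  piece (g := fgr k) (comp_arity a p0 (unzip1 s)) (e + \sum_(d <- unzip2 s) d)
    (muT x p0 xs).
Proof.
move=> cs px pxs; apply: (inspan_lin px) => S lS [aS dS].
apply: (inspan_ml pxs) => Ts lTs aTs dTs; rewrite /muB aS aTs cs.
apply: inspanZ; apply: inspan_bas.
have cs' : composable (st_ar S) p0 (map st_ar Ts) by rewrite aS aTs.
have [lg ->] := legit_graft lS lTs cs'; rewrite aS aTs; split=> //.
have sz := composable_up cs'.
by rewrite ndeg_graft // PoszD -dTs sumz_ndeg -dS.
Qed.

Lemma comp_row_linx (W : lmodType k) (F : seq stacking -> W) q0 l1 c x y l2 yss tss :
  (size l1 < size yss)%N -> size yss = size tss ->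
  ml F (comp_row muT q0 (l1 ++ (c *: x + y) :: l2) yss tss) =
    c *: ml F (comp_row muT q0 (l1 ++ x :: l2) yss tss) +
    ml F (comp_row muT q0 (l1 ++ y :: l2) yss tss).
Proof.
elim: l1 yss tss q0 F => [|z l1 IH] [|ys yss] [|ts tss] q0 F //= lt1 [sz].
  rewrite muTl; exact: linearP.
by rewrite -lin_comb; apply: eq_lin => S _; apply: IH.
Qed.

Lemma comp_row_liny (W : lmodType k) (F : seq stacking -> W) q0 xs sh tss l1 c x y l2 :
  sumn sh = (size l1 + size l2).+1 -> size xs = size sh -> size tss = size sh ->
  ml F (comp_row muT q0 xs (reshape sh (l1 ++ (c *: x + y) :: l2)) tss) =
    c *: ml F (comp_row muT q0 xs (reshape sh (l1 ++ x :: l2)) tss) +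
    ml F (comp_row muT q0 xs (reshape sh (l1 ++ y :: l2)) tss).
Proof.
elim: sh xs tss l1 q0 F => [|n sh IH] [|z xs] [|ts tss] l1 q0 F //= sm [sx] [st].
have [nl|ln] := leqP n (size l1).
  have E u : take n (l1 ++ u :: l2) = take n l1 /\
      drop n (l1 ++ u :: l2) = drop n l1 ++ u :: l2.
    rewrite take_cat drop_cat; move: nl; rewrite leq_eqVlt => /orP[/eqP->|->//].
    by rewrite ltnn subnn take0 drop0 cats0 take_size drop_size.
  rewrite !(proj1 (E _)) !(proj2 (E _)) -lin_comb; apply: eq_lin => S _.
  apply: IH => //; rewrite size_drop; move: (size l1) (size l2) sm nl; clear; lia.
have E u : take n (l1 ++ u :: l2) = l1 ++ u :: take (n - size l1).-1 l2 /\
      drop n (l1 ++ u :: l2) = drop (n - size l1).-1 l2.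
  rewrite take_cat drop_cat ltnNge (ltnW ln) /=.
  by case: (n - size l1)%N (subn_gt0 (size l1) n) => //; rewrite ln.
rewrite !(proj1 (E _)) !(proj2 (E _)) muTr; exact: linearP.
Qed.

Lemma comp_row_bas (W : lmodType k) (F : seq stacking -> W) p0 q0 Ts Us :
  row_ok p0 Ts q0 Us -> all legit Ts -> all legit Us ->
  ml F (comp_row muT q0 (map bas Ts) (reshape (map (ar_up \o st_ar) Ts) (map bas Us))
     (reshape (map (ar_up \o st_ar) Ts) (map st_ar Us))) =
  sn (rsum sg q0 Ts Us) *: F (graft_row Ts q0 Us).
Proof.
elim: Ts p0 q0 Us F => [|T Ts IH] p0 q0 Us F; first by rewrite /= scale1r.
move=> ok /= /andP[lT lTs] lUs; have := row_okP ok; rewrite /=.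
rewrite -!map_take -!map_drop; set U1 := take _ _; set U2 := drop _ _.
case=> _ [wT wU1 s1] ok' EU.
have /andP[lU1 lU2] : all legit U1 && all legit U2 by rewrite -all_cat -EU.
have cU : composable (st_ar T) q0 (map st_ar U1).
  by rewrite /composable size_map s1 eqxx; case/andP: wU1.
have [lg _] := legit_graft lT lU1 cU.
rewrite muT_bas // /muB cU linearZ /= lin_bas //.
by rewrite (IH _ _ _ _ ok') // scalerA -signr_addb.
Qed.

(** A sign depends only on the parities of the degrees, which [pdegE] provides. *)
Lemma koszul_kosw Ts Us : all legit Ts -> all legit Us ->
  size Us = width Ts ->
  sgn k (koszul (map ndegz Ts) (reshape (map (ar_up \o st_ar) Ts) (map ndegz Us))) =
  sn (kosw pdeg Ts Us).
Proof.
move=> lTs lUs sU.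
suff [n -> <-] : exists2 n : nat,
    koszul (map ndegz Ts) (reshape (map (ar_up \o st_ar) Ts) (map ndegz Us)) = n%:Z
    & odd n = kosw pdeg Ts Us.
  by rewrite /sgn -exprnP signr_odd.
have oddE l : all legit l -> odd (sumn (map ndeg l)) = xr pdeg l.
  by elim: l => //= T l IH /andP[lT ll]; rewrite oddD pdegE // IH.
elim: Ts Us lTs lUs sU => [|T Ts IH] Us; first by exists 0%N.
move=> /= /andP[lT lTs] lUs; rewrite width_cons => sU.
have [_ _ s1 s2] := take_width [::] sU.
rewrite -map_take -map_drop; set U1 := take _ _ in s1 *; set U2 := drop _ _ in s2 *.
have /andP[lU1 lU2] : all legit U1 && all legit U2.
  by rewrite -all_cat cat_take_drop.
have [m -> oE] := IH U2 lTs lU2 s2.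
exists (sumn (map ndeg U1) * sumn (map ndeg Ts) + m)%N.
  by rewrite !sumz_ndeg PoszD PoszM.
by rewrite oddD oddM !oddE // oE.
Qed.

(** Both sides are multilinear in [x] and [xs], and then in the entries of [yss], so two
    applications of [multilinear_eq] leave basis stackings. For these it is [graftA] with the sign
    identity [sg_assoc]. *)
Fact muT_assoc a e p0 s (x : fgr k) (xs : seq (fgr k)) q0
    (tss : seq (seq (arity * int))) (yss : seq (seq (fgr k))) :
  composable a p0 (unzip1 s) -> piece a e x -> pieces s xs ->
  shape tss = [seq ar_up t.1 | t <- s] -> chained q0 (unzip1 (flatten tss)) ->
  shape yss = shape tss -> pieces (M := fgr k) (flatten tss) (flatten yss) ->
  muT x (p0 + q0)%N (comp_row muT q0 xs yss (map unzip1 tss)) =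
    sgn k (koszul (unzip2 s) (map unzip2 tss)) *:
      muT (muT x p0 xs) q0 (flatten yss).
Proof.
move=> cs px pxs sht ch shy py.
have sxs := pieces_size pxs.
have syt : size yss = size tss by rewrite -(size_map size) -/(shape yss) shy size_map.
have sts : size tss = size s by rewrite -(size_map size) -/(shape tss) sht size_map.
pose K := sgn k (koszul (unzip2 s) (map unzip2 tss)).
pose G (l : seq V) := muT (head 0 l) (p0 + q0)%N
  (comp_row muT q0 (behead l) yss (map unzip1 tss)).
pose H (l : seq V) := K *: muT (muT (head 0 l) p0 (behead l)) q0 (flatten yss).
apply: (@multilinear_eq _ _ (size s).+1 G H ((a, e) :: s) (x :: xs)) => //.
- move=> [|z l1] c y y' l2 /= [sl]; rewrite /G /=; first exact: muTl.
  rewrite /muT -lin_comb; apply: eq_lin => S _; apply: comp_row_linx.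
    by rewrite syt sts -sl addSn ltnS leq_addr.
  by rewrite size_map.
- move=> [|z l1] c y y' l2 /= [sl]; rewrite /H /=.
    by rewrite !muTl scalerDr !scalerA [c * K]mulrC.
  by rewrite muTr muTl scalerDr !scalerA [c * K]mulrC.
move=> [|S Ts] //= /andP[lS lTs] [aS aTs] [dS dTs] {x px xs pxs sxs}.
rewrite /G /H /= {G H}.
have upT : map (ar_up \o st_ar) Ts = shape tss.
  by rewrite sht [RHS]map_comp -/(unzip1 s) -aTs -map_comp.
have cS : composable (st_ar S) p0 (map st_ar Ts) by rewrite aS aTs.
have wTs : st_row p0 Ts by apply: legit_row => //; case/andP: cS.
pose n := size (flatten tss).
pose G (l : seq V) := muT (bas S) (p0 + q0)%N
  (comp_row muT q0 (map bas Ts) (reshape (shape tss) l) (map unzip1 tss)).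
pose H (l : seq V) := K *: muT (muT (bas S) p0 (map bas Ts)) q0 l.
(* The nested list is flattened so that its entries become one list of multilinear arguments. *)
have -> : yss = reshape (shape tss) (flatten yss) by rewrite -shy flattenK.
rewrite (reshapeKr (s := flatten yss)) ?(pieces_size py) ?size_flatten //.
apply: (@multilinear_eq _ _ n G H (flatten tss) (flatten yss)) => //.
- move=> l1 c y y' l2 sl; rewrite /G /muT !lin_bas //; apply: comp_row_liny.
  + by rewrite -size_flatten -/n sl.
  + by rewrite -upT !size_map.
  + by rewrite !size_map.
- by move=> l1 c y y' l2 sl; rewrite /H muTr scalerDr !scalerA [c * K]mulrC.
move=> Us lUs aUs dUs; rewrite /G /H {G H py shy syt yss}.
have sU : size Us = width Ts.
  by rewrite -(size_map st_ar) aUs size_map size_flatten -upT /width -map_comp.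
have wUs : st_row q0 Us by apply: legit_row; rewrite // aUs.
have ok : row_ok p0 Ts q0 Us by rewrite /row_ok wTs wUs sU eqxx.
have E1 : map unzip1 tss = reshape (map (ar_up \o st_ar) Ts) (map st_ar Us).
  by rewrite aUs upT -map_reshape flattenK.
have E2 : map unzip2 tss = reshape (map (ar_up \o st_ar) Ts) (map ndegz Us).
  by rewrite [map ndegz _]dUs upT -map_reshape flattenK.
rewrite /K E1 E2 -upT -dTs koszul_kosw // muT_bas // /muB cS {1}/muT lin_bas //.
rewrite (comp_row_bas _ ok) // /muB.
have [lg ag] := legit_graft lS lTs cS.
have sT := composable_up cS; have wS := proj1 (andP lS).
have [R1 R2 R3 R4] := graft_rowP wTs wUs sU.
have cG : composable (st_ar S) (p0 + q0) (map st_ar (graft_row Ts q0 Us)).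
  by rewrite /composable size_map R2 sT eqxx; case/andP: R1.
have cU : composable (st_ar (graft S p0 Ts)) q0 (map st_ar Us).
  rewrite /composable size_map ag -[ar_up _]/(width Ts) sU eqxx.
  by case/andP: wUs.
rewrite cG muTZ muT_bas // /muB cU !scalerA.
rewrite -!signr_addb sg_assoc // addbA.
by rewrite -(graftA (p0 := p0) wS wTs sT wUs sU).
Qed.

Fact muT_1r a e (x : fgr k) : piece a e x ->
  muT x 0%N (nseq (ar_up a) (bas Eta)) = x.
Proof.
move=> px; rewrite -[RHS]lin_basE; apply: (eq_lin_in px) => S lS [aS dS].
rewrite -map_nseq ml_bas; last by rewrite all_nseq orbT.
have cS : composable (st_ar S) 0 (map st_ar (eta (ar_up a))).
  by rewrite /composable size_map size_nseq aS eqxx nseq_eta_ar; case: (chained_eta (ar_up a)).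
rewrite /muB cS -aS graft_1r; last by case/andP: lS.
by rewrite sg_1r scale1r.
Qed.

Fact muT_1l a e (x : fgr k) : piece a e x -> muT (bas Eta) (ar_in a) [:: x] = x.
Proof.
move=> px; rewrite /muT lin_bas // -[RHS]lin_basE /=.
apply: (eq_lin_in px) => S lS [aS dS].
have cS : composable (0, 1, 0)%N (ar_in a) [:: st_ar S].
  by rewrite /composable /= -aS eqxx.
by rewrite /muB cS -aS sg_1l scale1r.
Qed.

Lemma bas_Eta_piece : piece (g := fgr k) (0, 1, 0)%N 0 (bas Eta).
Proof. by apply: inspan_bas. Qed.

Definition Tbox : boxop k := @BoxOp k (fgr k) muT (bas Eta) bas_Eta_piece muT_piece
  (fun a e p0 s c x y zs _ _ _ _ => muTl p0 zs c x y)
  (fun a e p0 s1 t s2 c x zs1 y z zs2 _ _ _ _ _ _ => muTr x p0 zs1 c y z zs2)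
  muT_assoc muT_1r muT_1l.
End FreeBox.

(** * The Leibniz rule in true degrees *)

Section FreeDg.
Variable k : fieldType.
Notation V := (fmod k).
Notation D := (dS k tq).
Notation drow := (drow_ D).
Notation sn b := ((-1) ^+ (nat_of_bool b) : k).

Fixpoint drowz (W : lmodType k) (e : int) (F : seq stacking -> W) Ts : W :=
  if Ts is T :: Ts' then
    sgn k e *: lin (fun T' => F (T' :: Ts')) (D T)
    + drowz (e + ndegz T) (fun r => F (T :: r)) Ts'
  else 0.

Lemma ml_linC (W : lmodType k) (F : stacking -> seq stacking -> W) (y : V) xs :
  ml (fun Ts => lin (F^~ Ts) y) xs = lin (fun T => ml (F T) xs) y.
Proof.
elim: xs F => [|x xs IH] F //=; rewrite linC; apply: eq_lin => S _.
by rewrite (IH (fun T Ts => F T (S :: Ts))).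
Qed.

Lemma lin_ml (W U : lmodType k) (g : {linear W -> U}) (F : seq stacking -> W) xs :
  g (ml F xs) = ml (fun Ts => g (F Ts)) xs.
Proof.
by elim: xs F => //= x xs IH F; rewrite lin_linE; apply: eq_lin => S _; rewrite IH.
Qed.

Lemma eq_ml_pieces (W : lmodType k) (F G : seq stacking -> W) s (xs : seq V) :
  pieces (M := fgr k) s xs ->
  (forall Ts, all legit Ts -> map st_ar Ts = unzip1 s ->
     map ndegz Ts = unzip2 s -> F Ts = G Ts) -> ml F xs = ml G xs.
Proof.
elim: s xs F G => [|t s IH] [|x xs] F G //=; first by move=> _ ->.
case=> px pxs FG; apply: (eq_lin_in px) => S lS [aS dS]; apply: IH => //.
by move=> Ts lTs aTs dTs; apply: FG; rewrite /= ?lS ?aS ?aTs /ndegz ?dS -?dTs.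
Qed.

Lemma ml_drowz (W : lmodType k) (F : seq stacking -> W) e s (xs : seq V) :
  pieces (M := fgr k) s xs ->
  \sum_(i < size xs) sgn k (e + \sum_(d <- take i (unzip2 s)) d) *:
    ml F (set_nth 0 xs i (lin D xs`_i)) = ml (drowz e F) xs.
Proof.
elim: s xs e F => [|t s IH] [|x xs] e F //=; first by rewrite big_ord0.
case=> px pxs; rewrite big_ord_recl /= big_nil addr0.
transitivity (lin (fun T => ml (fun Ts => sgn k e *:
    lin (fun T' => F (T' :: Ts)) (D T)) xs) x +
  lin (fun T => ml (drowz (e + ndegz T) (fun r => F (T :: r))) xs) x).
  congr (_ + _).
    rewrite [X in _ *: X]lin_linE -lin_scale; apply: eq_lin => T _.
    by rewrite ml_scale (ml_linC (fun T' Ts => F (T' :: Ts))).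
  rewrite (eq_lin_in (g := fun T => \sum_(i < size xs)
     sgn k (e + ndegz T + \sum_(d <- take i (unzip2 s)) d) *:
       ml (fun r => F (T :: r)) (set_nth 0 xs i (lin D xs`_i))) px); last first.
    by move=> T lT [_ dT]; rewrite (IH _ _ _ pxs).
  rewrite (eq_lin_in (g := fun T => \sum_(i < size xs)
     sgn k (e + (t.2 + \sum_(d <- take i (unzip2 s)) d)) *:
       ml (fun r => F (T :: r)) (set_nth 0 xs i (lin D xs`_i))) px); last first.
    by move=> T lT [_ dT]; rewrite /ndegz dT; apply: eq_bigr => i _; rewrite addrA.
  rewrite lin_sum; apply: eq_bigr => i _.
  by rewrite lin_scale /= big_cons.
rewrite -lin_add; apply: eq_lin => T _.
rewrite -[LHS]scale1r -[X in X + _]scale1r.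
have := ml_comb (fun Ts => sgn k e *: lin (fun T' => F (T' :: Ts)) (D T))
  (drowz (e + ndegz T) (fun r => F (T :: r))) 1 xs.
by rewrite !scale1r => <-; apply: eq_ml => Ts _ _; rewrite scale1r.
Qed.

Lemma drowz_cons (W : lmodType k) e (F : seq stacking -> W) T Ts :
  drowz e F (T :: Ts) = sgn k e *: lin (fun T' => F (T' :: Ts)) (D T)
    + drowz (e + ndegz T) (fun r => F (T :: r)) Ts.
Proof. by []. Qed.

Lemma pdeg_pt S : pdeg S = pt S (+) wpa S.
Proof. by []. Qed.

(** Passing an entry [T] costs [pdeg T] in [drowz] but only [pt T] in [drow]; the difference [wpa T]
    is accounted for by the sign in front of [F]. The exponents [b], [c] and [h] accumulate what the
    induction has passed. *)
Lemma drowzE (W : lmodType k) (F G : seq stacking -> W) e b c h Ts :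
  sgn k e = sn b -> all legit Ts ->
  (forall r, G r = sn (mix r (+) (c && xr pt r) (+) h) *: F r) ->
  drowz e G Ts = sn (b (+) c (+) (mix Ts (+) (c && xr pt Ts) (+) h)) *: drow F Ts.
Proof.
elim: Ts F G e b c h => [|T Ts IH] F G e b c h Ee; first by rewrite scaler0.
move=> /andP[lT lTs] GF; rewrite drow_cons drowz_cons scalerDr; congr (_ + _).
  rewrite Ee -!lin_scale; apply: (eq_lin_in (dS_span tqP lT)) => T' lT' [aT' pT' _].
  rewrite GF scalerA -sn_addb; congr (sn _ *: _); rewrite /= /wpa aT' pT'.
  by bool_atoms2 xr; bool_atoms mix; bool_atoms pt; bool_atoms pa; bool_cases.
rewrite scalerA -sn_addb (IH (fun r => F (T :: r)) (fun r => G (T :: r)) _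
   (b (+) pdeg T) (c (+) wpa T) (h (+) (c && pt T))) //.
- congr (sn _ *: _); rewrite /= pdeg_pt.
  by bool_atoms2 xr; bool_atoms mix; bool_atoms wpa; bool_atoms pt; bool_cases.
- have -> : sgn k (e + ndegz T) = sgn k e * sgn k (ndegz T).
    by rewrite /sgn expfzDr // oppr_eq0 oner_eq0.
  by rewrite Ee sn_addb -(pdegE lT) /sgn -exprnP signr_odd.
- move=> r; rewrite GF; congr (sn _ *: _); rewrite /=.
  by bool_atoms2 xr; bool_atoms mix; bool_atoms wpa; bool_atoms pt; bool_cases.
Qed.

(** [dgr] multiplied by the correction [loc]. The differential keeps arities and flips a thin
    parity, so [loc] changes by the difference of the two Koszul conventions. *)
Lemma dT_muB S p0 Ts : legit S -> all legit Ts ->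
  composable (st_ar S) p0 (map st_ar Ts) ->
  lin D (muB k S p0 Ts) = lin (fun S' => muB k S' p0 Ts) (D S)
    + drowz (ndegz S) (muB k S p0) Ts.
Proof.
move=> lS lTs cS; have [lg _] := legit_graft lS lTs cS.
rewrite {1}/muB cS linearZ /= lin_bas //.
have := @dgr k _ tqP _ lS _ _ lTs cS.
move=> /(congr1 (fun x => sn (loc S p0 Ts) *: x)).
rewrite scalerA -sn_addb addbC -/(sg S p0 Ts) => ->.
rewrite scalerDr; congr (_ + _).
  rewrite /gr -lin_scale; apply: (eq_lin_in (dS_span tqP lS)) => S' _ [aS' pS' _].
  rewrite /muB aS' cS scalerA -sn_addb; congr (sn _ *: _).
  by rewrite /sg /loc /= /wpa aS' addbC.
pose F r : V := if composable (st_ar S) p0 (map st_ar r)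
  then sn (kap S r (+) theta (st_ar S) p0 (map st_ar r)) *: bas (graft S p0 r) else 0.
rewrite (@drowzE _ F (muB k S p0) _ (pdeg S) (wpa S) false Ts) //; last 2 first.
- by rewrite -(pdegE lS) /sgn -exprnP signr_odd.
- move=> r; rewrite /muB /F; case: ifP; rewrite ?scaler0 // => _.
  rewrite scalerA -sn_addb; congr (sn _ *: _); rewrite /sg /loc /=.
  by bool_atoms2 xr; bool_atoms mix; bool_atoms wpa; bool_atoms2 kap; bool_cases.
rewrite (@eq_drow_in k tq _ F (fun r => sn (theta (st_ar S) p0 (map st_ar Ts)) *:
  (sn (kap S r) *: bas (graft S p0 r)))) //; last 2 first.
- exact: (dS_spanr tqP).
- by move=> r [_ ar _ _]; rewrite /F ar cS scalerA -sn_addb addbC.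
rewrite drowZ !scalerA -!sn_addb; congr (sn _ *: _).
rewrite /loc /= pdeg_pt.
bool_atoms2 xr; bool_atoms mix; bool_atoms wpa; bool_atoms pt.
by case: (theta _ _ _); bool_cases.
Qed.

Definition dT : {linear Tbox k -> Tbox k} := lin D.

Fact dT_piece a e (x : Tbox k) : piece a e x -> piece a (e - 1) (dT x).
Proof.
move=> px; apply: (inspan_lin px) => S lS [aS dS].
apply: inspanS (dS_span tqP lS) => S' _ [-> _ n']; split=> //.
by rewrite -dS -n'; lia.
Qed.

Fact dT_dT (x : Tbox k) : dT (dT x) = 0.
Proof.
rewrite [dT (dT x)]lin_linE; apply: (@lin0 _ _ _ (fun=> True)) => // S lS _.
exact: (@dS_dS k _ tqP (@dgen2 k) _ lS).
Qed.

Fact dT_mu a e p0 s (x : Tbox k) (xs : seq (Tbox k)) :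
  composable a p0 (unzip1 s) -> piece a e x -> pieces s xs ->
  dT (mu x p0 xs) = mu (dT x) p0 xs +
    \sum_(i < size xs) sgn k (e + \sum_(d <- take i (unzip2 s)) d) *:
      mu x p0 (set_nth 0 xs i (dT xs`_i)).
Proof.
move=> cs px pxs.
rewrite -[mu x p0 xs]/(muT x p0 xs) -[mu (dT x) p0 xs]/(muT (dT x) p0 xs).
rewrite (eq_bigr (fun i : 'I_(size xs) => lin (fun S => sgn k (ndegz S +
    \sum_(d <- take i (unzip2 s)) d) *:
  ml (muB k S p0) (set_nth 0 xs i (lin D xs`_i))) x)); last first.
  move=> i _; rewrite -[mu _ _ _]/(muT _ _ _) /muT -lin_scale.
  by apply: (eq_lin_in px) => S _ [_ dS]; rewrite /ndegz dS.
rewrite -lin_sum {1 2}/muT lin_linE lin_linE -lin_add.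
apply: (eq_lin_in px) => S lS [aS dS]; rewrite (ml_drowz _ _ pxs).
rewrite lin_ml; have := ml_linC (fun S' => muB k S' p0) (D S) xs.
rewrite /= => <-.
rewrite [LHS](eq_ml_pieces (G := fun Ts => 1 *: lin (fun S' => muB k S' p0 Ts) (D S)
    + drowz (ndegz S) (muB k S p0) Ts) pxs).
  by rewrite ml_comb scale1r.
by move=> Ts lTs aTs _; rewrite scale1r dT_muB // aS aTs.
Qed.

Definition Tdg : dgboxop k := @DgBoxOp k (Tbox k) dT dT_piece dT_dT dT_mu.
End FreeDg.

Section BoxLinear.
Variables (k : fieldType) (B : boxop k).

Lemma piece_sum (M : grmod k) a e (I : eqType) (r : seq I) (F : I -> M) :
  (forall i, i \in r -> piece a e (F i)) -> piece a e (\sum_(i <- r) F i).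
Proof.
move=> PF; rewrite big_seq; elim/big_rec: _ => [|i x ir px]; first exact: piece0.
by rewrite -[F i]scale1r; apply: piece_lin => //; apply: PF.
Qed.

Lemma pieceZ (M : grmod k) a e (c : k) (x : M) : piece a e x -> piece a e (c *: x).
Proof. by move=> px; rewrite -[_ *: _]addr0; apply: piece_lin => //; apply: piece0. Qed.

Lemma pieces_cat (M : grmod k) s1 s2 (l1 l2 : seq M) :
  pieces s1 l1 -> pieces s2 l2 -> pieces (s1 ++ s2) (l1 ++ l2).
Proof. by elim: s1 l1 => [|t s1 IH] [|x l1] //= [px p1] p2; split=> //; apply: IH. Qed.

Lemma mu_0l a (e : int) p0 s (zs : seq B) : composable a p0 (unzip1 s) ->
  pieces s zs -> mu (0 : B) p0 zs = 0.
Proof.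
move=> cs ps; have z0 := piece0 B a e.
have := mu_linl (-1) cs z0 z0 ps; by rewrite scaler0 addr0 scaleN1r addNr.
Qed.

Lemma mu_scalel a e p0 s (c : k) (x : B) zs : composable a p0 (unzip1 s) ->
  piece a e x -> pieces s zs -> mu (c *: x) p0 zs = c *: mu x p0 zs.
Proof.
move=> cs px ps; have := mu_linl c cs px (piece0 B a e) ps.
by rewrite addr0 (mu_0l e cs ps) addr0.
Qed.

Lemma mu_0r a e p0 s1 t s2 (x : B) zs1 zs2 :
  composable a p0 (unzip1 (s1 ++ t :: s2)) -> piece a e x ->
  pieces s1 zs1 -> pieces s2 zs2 -> mu x p0 (zs1 ++ 0 :: zs2) = 0.
Proof.
move=> cs px p1 p2; have z0 := piece0 B t.1 t.2.
have := mu_linr (-1) cs px p1 z0 z0 p2.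
by rewrite scaler0 addr0 scaleN1r addNr.
Qed.

Lemma mu_scaler a e p0 s1 t s2 (c : k) (x : B) zs1 y zs2 :
  composable a p0 (unzip1 (s1 ++ t :: s2)) -> piece a e x ->
  pieces s1 zs1 -> piece t.1 t.2 y -> pieces s2 zs2 ->
  mu x p0 (zs1 ++ (c *: y) :: zs2) = c *: mu x p0 (zs1 ++ y :: zs2).
Proof.
move=> cs px p1 py p2.
have := mu_linr c cs px p1 py (piece0 B t.1 t.2) p2.
by rewrite addr0 (mu_0r cs px p1 p2) addr0.
Qed.

Notation V := (fmod k).

Lemma piece_lin_f (f : stacking -> B) a e a' e' (x : V) : fpiece a e x ->
  (forall S, legit S -> st_ar S = a -> ndegz S = e -> piece a' e' (f S)) ->
  piece a' e' (lin f x).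
Proof.
move=> px pf; apply: piece_sum => s sx; apply: pieceZ.
by have [? ?] := px s sx; apply: pf => //; apply: (valP s).
Qed.

Lemma mu_lin_l (f : stacking -> B) a0 e0 a e p0 s (x : V) zs : fpiece a0 e0 x ->
  (forall S, legit S -> st_ar S = a0 -> ndegz S = e0 -> piece a e (f S)) ->
  composable a p0 (unzip1 s) -> pieces s zs ->
  mu (lin f x) p0 zs = lin (fun S => mu (f S) p0 zs) x.
Proof.
move=> px pf cs ps; rewrite /lin.
have ps' t : t \in (msupp x : seq _) -> piece a e (f (val t)).
  by move=> tx; have [? ?] := px t tx; apply: pf => //; apply: (valP t).
elim: (msupp x : seq _) ps' => [|t l IH] pl; first by rewrite !big_nil (mu_0l e cs ps).
have pl' u : u \in l -> piece a e (f (val u)).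
  by move=> ul; apply: pl; rewrite inE ul orbT.
rewrite !big_cons (@mu_linl _ B a e p0 s _ _ _ _ cs _ _ ps) ?IH //;
  first exact: (pl t (mem_head _ _)).
by apply: piece_sum => u ul; apply: pieceZ; apply: pl'.
Qed.

Lemma mu_lin_r (f : stacking -> B) a0 e0 a e p0 s1 t s2 (x : V) y zs1 zs2 :
  fpiece a0 e0 x ->
  (forall S, legit S -> st_ar S = a0 -> ndegz S = e0 -> piece t.1 t.2 (f S)) ->
  composable a p0 (unzip1 (s1 ++ t :: s2)) -> piece a e y ->
  pieces s1 zs1 -> pieces s2 zs2 ->
  mu y p0 (zs1 ++ lin f x :: zs2) = lin (fun S => mu y p0 (zs1 ++ f S :: zs2)) x.
Proof.
move=> px pf cs py p1 p2; rewrite /lin.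
have ps' u : u \in (msupp x : seq _) -> piece t.1 t.2 (f (val u)).
  by move=> tx; have [? ?] := px u tx; apply: pf => //; apply: (valP u).
elim: (msupp x : seq _) ps' => [|u l IH] pl.
  by rewrite !big_nil (mu_0r cs py p1 p2).
have pl' v : v \in l -> piece t.1 t.2 (f (val v)).
  by move=> ul; apply: pl; rewrite inE ul orbT.
rewrite !big_cons (@mu_linr _ B a e p0 s1 t s2 _ _ _ _ _ _ cs py p1 _ _ p2) ?IH //;
  first exact: (pl u (mem_head _ _)).
by apply: piece_sum => v ul; apply: pieceZ; apply: pl'.
Qed.

Lemma mu_ml (f : stacking -> B) a e p0 s1 s y zs1 (xs : seq V) :
  (forall S, legit S -> piece (st_ar S) (ndegz S) (f S)) ->
  pieces (M := fgr k) s xs ->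
  composable a p0 (unzip1 (s1 ++ s)) -> piece a e y -> pieces s1 zs1 ->
  mu y p0 (zs1 ++ map (lin f) xs) = ml (fun Ts => mu y p0 (zs1 ++ map f Ts)) xs.
Proof.
move=> pf; elim: s s1 zs1 xs => [|t s IH] s1 zs1 [|x xs] //= [px pxs] cs py p1.
have pf' S : legit S -> st_ar S = t.1 -> ndegz S = t.2 -> piece t.1 t.2 (f S).
  by move=> lS <- <-; apply: pf.
have pm : pieces s (map (lin f) xs).
  elim: (s) (xs) pxs => [|u s' IHs] [|z zs] //= [pz pzs]; split; last exact: IHs.
  by apply: (piece_lin_f pz) => S lS <- <-; apply: pf.
rewrite (mu_lin_r px pf' cs py p1 pm); apply: (eq_lin_in px) => S lS [aS dS].
rewrite -cat_rcons (IH (rcons s1 t)) ?cat_rcons //.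
  by apply: eq_ml => Ts _ _; rewrite cat_rcons.
by rewrite -!cats1; apply: pieces_cat => //=; split=> //; apply: pf'.
Qed.

End BoxLinear.

Definition gen {k : fieldType} p q : Tbox k := bas (st_id (lax_arity p q)).

Lemma legit_graft_row p0 ss q0 Ts : row_ok p0 ss q0 Ts ->
  all legit ss -> all legit Ts -> all legit (graft_row ss q0 Ts).
Proof.
elim: ss p0 q0 Ts => //= s ss IH p0 q0 Ts ok /andP[ls lss] lTs.
have := row_okP ok; set U1 := take _ _; set U2 := drop _ _.
case=> _ [ws wU1 sU1] ok' EU.
have /andP[lU1 lU2] : all legit U1 && all legit U2 by rewrite -all_cat -EU.
have cU : composable (st_ar s) q0 (map st_ar U1).
  by rewrite /composable size_map sU1 eqxx; case/andP: wU1.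
by have [-> _] := legit_graft ls lU1 cU; apply: IH ok' lss lU2.
Qed.

(** * The universal property of the free box operad *)

Section FreeUniversal.
Variables (k : fieldType) (B : boxop k) (b : nat -> nat -> B).
Hypothesis eb : lax_infty_elements b.
Notation V := (fmod k).
Notation sn b := ((-1) ^+ (nat_of_bool b) : k).

(** The sign is forced, since in [Tbox] the composite of the corolla of [a] with the row [ss] is the
    basis element of the node up to the exponent [loc] ([bas_node]). *)
Fixpoint free_st (S : stacking) : B :=
  match S with
  | Eta => Defs.one B
  | Node a p0 ss => sn (loc (st_id a) p0 ss) *:
      mu (b (ar_in a) (ar_up a)) p0 (map free_st ss)
  end.

Lemma b_piece a : is_lax_box a ->
  piece a ((ar_in a)%:Z + (ar_up a)%:Z - 2) (b (ar_in a) (ar_up a)).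
Proof. by case/andP=> h /eqP E; rewrite {1}E; apply: eb. Qed.

Definition st_pieces Ts := [seq (st_ar T, ndegz T) | T <- Ts].

Lemma unzip1_st Ts : unzip1 (st_pieces Ts) = map st_ar Ts.
Proof. by rewrite /unzip1 -map_comp. Qed.

Lemma unzip2_st Ts : unzip2 (st_pieces Ts) = map ndegz Ts.
Proof. by rewrite /unzip2 -map_comp. Qed.

Lemma pieces_in Ts : {in Ts, forall T, piece (st_ar T) (ndegz T) (free_st T)} ->
  pieces (st_pieces Ts) (map free_st Ts).
Proof.
elim: Ts => //= T Ts IH H; split; first exact: H (mem_head _ _).
by apply: IH => S SS; apply: H; rewrite inE SS orbT.
Qed.

Lemma free_st_piece S : legit S -> piece (st_ar S) (ndegz S) (free_st S).
Proof.
elim/stacking_mem_ind: S => [_|a p0 ss IH]; first exact: one_piece.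
rewrite legit_node => /and3P[cs la lss] /=; apply: pieceZ.
have ps : pieces (st_pieces ss) (map free_st ss).
  by apply: pieces_in => s sss; apply: IH => //; apply: (allP lss).
have := mu_piece _ (b_piece la) ps; rewrite unzip1_st unzip2_st sumz_ndeg.
move=> /(_ _ cs); congr (piece _ _ _); rewrite /ndegz ndeg_node.
by case/andP: la; lia.
Qed.

Lemma pieces_free Ts : all legit Ts -> pieces (st_pieces Ts) (map free_st Ts).
Proof. by move=> lTs; apply: pieces_in => T TT; apply/free_st_piece/(allP lTs). Qed.

Definition free_spec S := forall p0 Ts, all legit Ts ->
  composable (st_ar S) p0 (map st_ar Ts) ->
  mu (free_st S) p0 (map free_st Ts) = sn (sg S p0 Ts) *: free_st (graft S p0 Ts).

Lemma free_row a e P (x : B) (ss : seq stacking) p0 q0 Ts s1 (zs1 : seq B) :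
  {in ss, forall s, free_spec s} -> piece a e x -> pieces s1 zs1 ->
  row_ok p0 ss q0 Ts -> all legit ss -> all legit Ts ->
  composable a P (unzip1 s1 ++ map st_ar (graft_row ss q0 Ts)) ->
  mu x P (zs1 ++ comp_row (@mu k B) q0 (map free_st ss)
     (reshape (map (ar_up \o st_ar) ss) (map free_st Ts))
     (reshape (map (ar_up \o st_ar) ss) (map st_ar Ts))) =
  sn (rsum sg q0 ss Ts) *: mu x P (zs1 ++ map free_st (graft_row ss q0 Ts)).
Proof.
elim: ss p0 q0 Ts s1 zs1 => [|s ss IH] p0 q0 Ts s1 zs1 H px p1 ok.
  by rewrite /= scale1r.
move=> /andP[ls lss] lTs; rewrite graft_cons rsum_cons.
have := row_okP ok; rewrite /= -!map_take -!map_drop.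
set U1 := take _ _; set U2 := drop _ _ => -[_ [ws wU1 sU1] ok' EU] cs.
have /andP[lU1 lU2] : all legit U1 && all legit U2 by rewrite -all_cat -EU.
have cU : composable (st_ar s) q0 (map st_ar U1).
  by rewrite /composable size_map sU1 eqxx; case/andP: wU1.
have [lg _] := legit_graft ls lU1 cU.
rewrite H ?mem_head //.
set G := graft s q0 U1 in lg cs *; set q1 := top _ _ in ok' cs *.
have pG := free_st_piece lg.
have lR := legit_graft_row ok' lss lU2.
rewrite -cat_rcons (IH _ _ _ (rcons s1 (st_ar G, ndegz G)) _ (mem_tail H) px _ ok') //; first last.
- by rewrite /unzip1 map_rcons cat_rcons.
- by rewrite -!cats1; apply: pieces_cat => //=; split=> //; apply: pieceZ.
rewrite cat_rcons (@mu_scaler _ B a e P s1 (st_ar G, ndegz G) _ _ _ _ _ _ _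
  px p1 _ (pieces_free lR)).
- by rewrite scalerA -sn_addb addbC.
- by rewrite /unzip1 map_cat /= -/(unzip1 s1) -/(unzip1 _) unzip1_st.
exact: pG.
Qed.

(** Associativity in [B] moves the row [Ts] past the root, the entries are covered by induction
    ([free_row]), and the signs agree by [sg_assoc] applied to the corolla [st_id a], onto which
    [ss] is grafted. *)
Lemma free_stE S : legit S -> free_spec S.
Proof.
elim/stacking_mem_ind: S => [_|a p0 ss IH] => [q0 Ts|].
  move=> lTs cT; have := composable_up cT; case: Ts lTs cT => [|T [|? ?]] //=.
  move=> /andP[lT _] /andP[_ /andP[/eqP <- _]] _.
  by rewrite sg_1l scale1r; apply: mu_1l (free_st_piece lT).
rewrite legit_node => /and3P[cs la lss] q0 Ts lTs cT.
have H : {in ss, forall s, free_spec s} by move=> s sss; apply: IH => //; apply: (allP lss).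
have wss : st_row p0 ss by apply: legit_row => //; case/andP: cs.
have wT : st_row q0 Ts by apply: legit_row => //; case/andP: cT.
have sT : size Ts = width ss by rewrite (composable_up cT).
have ok : row_ok p0 ss q0 Ts by rewrite /row_ok wss wT sT eqxx.
have pb := b_piece la; have pss := pieces_free lss; have pT := pieces_free lTs.
have szs := composable_up cs.
have cs' : composable a p0 (unzip1 (st_pieces ss)) by rewrite unzip1_st.
have pm := mu_piece cs' pb pss.
have cT' : composable (comp_arity a p0 (unzip1 (st_pieces ss))) q0 (unzip1 (st_pieces Ts)).
  by rewrite !unzip1_st.
rewrite [free_st (Node a p0 ss)]/= -/(map free_st ss) (mu_scalel _ cT' pm pT).
pose sh := map (ar_up \o st_ar) ss.
pose tss := reshape sh (st_pieces Ts).
have shE : sumn sh = size Ts by rewrite sT /width /sh map_comp.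
have sht : shape tss = sh by rewrite /tss reshapeKl // size_map shE.
have flt : flatten tss = st_pieces Ts by rewrite /tss reshapeKr // size_map shE.
have sh2 : sh = [seq ar_up t.1 | t <- st_pieces ss] by rewrite -map_comp.
have := @mu_assoc _ B _ _ p0 _ _ _ q0 tss (reshape sh (map free_st Ts)) cs' pb pss.
rewrite sht flt unzip1_st reshapeKl ?size_map ?shE // reshapeKr ?size_map ?shE //.
move=> /(_ sh2 (proj1 (andP wT)) erefl pT).
have -> : map unzip1 tss = reshape sh (map st_ar Ts).
  by rewrite /tss -unzip1_st map_reshape.
have -> : map unzip2 tss = reshape sh (map ndegz Ts).
  by rewrite /tss -unzip2_st map_reshape.
rewrite unzip2_st koszul_kosw // => EA.
have [R1 R2 R3 R4] := graft_rowP wss wT sT.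
have cR : composable a (p0 + q0) (map st_ar (graft_row ss q0 Ts)).
  by rewrite /composable size_map R2 szs eqxx; case/andP: R1.
have := @free_row a _ (p0 + q0)%N _ ss p0 q0 Ts [::] [::] H pb I ok lss lTs cR.
rewrite !cat0s => E2; rewrite -/sh EA in E2.
have -> : mu (mu (b (ar_in a) (ar_up a)) p0 (map free_st ss)) q0 (map free_st Ts) =
   sn (kosw pdeg ss Ts (+) rsum sg q0 ss Ts) *:
     mu (b (ar_in a) (ar_up a)) (p0 + q0) (map free_st (graft_row ss q0 Ts)).
  by rewrite sn_addb -scalerA -E2 scalerA sn_sq scale1r.
rewrite graft_node [free_st (Node a (p0 + q0) _)]/= -/(map free_st _) !scalerA -!sn_addb.
congr (sn _ *: _).
have Eg : graft (st_id a) p0 ss = Node a p0 ss.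
  by rewrite /st_id graft_node add0n -szs graft_row_1l.
have := sg_assoc (S := st_id a) (st_id_wf a) ok; rewrite Eg st_id_ar => /(_ szs).
have sgE p R : sg (st_id a) p R = loc (st_id a) p R.
  by rewrite /sg kap_node kap_row_eta.
rewrite !sgE; set x1 := rsum _ _ _ _; set x2 := loc _ _ _; set x3 := kosw _ _ _.
set x4 := loc _ _ _; set x5 := sg _ _ _.
by move: x1 x2 x3 x4 x5 {E2}; do 5 case.
Qed.

Definition freeT : {linear Tbox k -> B} := lin free_st.

Lemma freeT_bas S : legit S -> freeT (bas S) = free_st S.
Proof. exact: lin_bas. Qed.

Lemma freeT_morphism : box_morphism freeT.
Proof.
split.
- move=> a e x px; apply: (piece_lin_f px) => S lS <- <-; exact: free_st_piece.
- exact: freeT_bas.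
move=> a e p0 s x xs cs px pxs.
rewrite -[mu x p0 xs]/(muT x p0 xs) /muT [LHS]lin_linE.
have pm : pieces s (map freeT xs).
  elim: (s) (xs) pxs => [|u s' IHs] [|z zs] //= [pz pzs]; split; last exact: IHs.
  by apply: (piece_lin_f pz) => S lS <- <-; apply: free_st_piece.
rewrite (mu_lin_l (a := a) (e := e) px _ cs pm); last first.
  by move=> S lS <- <-; apply: free_st_piece.
apply: (eq_lin_in px) => S lS [aS dS].
have pS : piece a e (free_st S) by rewrite -aS -dS; apply: free_st_piece.
have := @mu_ml k B free_st a e p0 [::] s _ [::] xs free_st_piece pxs cs pS I.
rewrite /= => ->; rewrite lin_ml; apply: (eq_ml_pieces pxs) => Ts lTs aTs dTs.
have cT : composable (st_ar S) p0 (map st_ar Ts) by rewrite aS aTs.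
have [lg _] := legit_graft lS lTs cT.
by rewrite (free_stE lS lTs cT) /muB cT linearZ freeT_bas.
Qed.

Lemma freeT_gen p q : (2 <= p + q)%N -> freeT (gen p q) = b p q.
Proof.
move=> pq; have la := lax_arity_box pq.
rewrite freeT_bas; last by rewrite /legit st_id_wf /= la; elim: (ar_up _).
rewrite /= -/(map free_st _) -[ar_in _]/p -[ar_up _]/q.
have -> : loc (st_id (lax_arity p q)) 0 (eta q) = false.
  by rewrite -(sg_1r (st_id (lax_arity p q)) q) /sg kap_node kap_row_eta.
by rewrite scale1r map_nseq; apply: (mu_1r (eb pq)).
Qed.

Lemma freeT_unique (psi : {linear Tbox k -> B}) : box_morphism psi ->
  (forall p q, (2 <= p + q)%N -> psi (gen p q) = b p q) -> psi =1 freeT.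
Proof.
case=> pg p1 pm pb x; rewrite (linE psi) (linE freeT); apply: eq_lin => S.
elim/stacking_mem_ind: S {x} => [_|a p0 ss IH]; first by rewrite freeT_bas.
move=> lN; have := lN; rewrite legit_node => /and3P[cs la lss].
rewrite freeT_bas // /= -/(map free_st _).
have lid : legit (st_id a) by rewrite /legit st_id_wf /= la; elim: (ar_up _).
have cid : composable (st_ar (st_id a)) p0 (map st_ar ss) by rewrite st_id_ar.
have sz := composable_up cs.
have Eg : graft (st_id a) p0 ss = Node a p0 ss.
  by rewrite /st_id graft_node add0n -sz graft_row_1l.
have -> : bas (Node a p0 ss) = sn (loc (st_id a) p0 ss) *:
    mu (bas (st_id a) : Tbox k) p0 (map bas ss).
  rewrite -[mu _ _ _]/(muT _ _ _) muT_bas // /muB cid Eg scalerA -sn_addb.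
  by rewrite /sg kap_node kap_row_eta addbb scale1r.
rewrite linearZ; congr (_ *: _).
have ps : pieces (st_pieces ss) (map bas ss : seq (Tbox k)).
  elim: (ss) lss => //= s ss' IHs /andP[ls lss']; split; last exact: IHs.
  by apply: inspan_bas.
have cs' : composable a p0 (unzip1 (st_pieces ss)) by rewrite unzip1_st.
have pid : piece (g := Tbox k) a (ndegz (st_id a)) (bas (st_id a)).
  by apply: inspan_bas; rewrite st_id_ar.
rewrite /= (pm _ _ _ _ _ _ cs' pid ps); congr (mu _ _ _).
  case/andP: la => a2 /eqP Ea.
  by rewrite {1}Ea; apply: pb.
rewrite -map_comp; apply/eq_in_map => s sss /=.
by rewrite IH ?freeT_bas //; apply: (allP lss).
Qed.
End FreeUniversal.

Lemma gen_elements (k : fieldType) : lax_infty_elements (@gen k).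
Proof.
move=> p q pq; apply: inspan_bas; rewrite st_id_ar; split=> //.
rewrite /ndeg /= (_ : flatten _ = [::]) ?addn0; last by elim: q {pq}.
by rewrite /lax_arity /ar_in /ar_up /=; move: pq; clear; lia.
Qed.

(** * Wiring graphs and thin-quadratic stackings *)

Fixpoint wiring_row (ss : seq stacking) (j : nat) (ins : seq wire_end) :
    seq (wire_end * wire_end) * seq wire_end :=
  if ss is s :: ss' then
    let w := wiring s j ins in
    let w' := wiring_row ss' (j + size (boxes s))%N w.2 in
    (w.1 ++ w'.1, w'.2)
  else ([::], ins).

Lemma wiring_node a p0 ss j ins :
  wiring (Node a p0 ss) j ins =
    let upper := wiring_row ss j.+1 (drop (ar_in a) ins) in
    ([seq (u, inr j) | u <- take (ar_in a) ins] ++ upper.1,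
       nseq (ar_out a) (inr j) ++ upper.2).
Proof. by []. Qed.

Lemma wiring_row_cons s ss j ins : wiring_row (s :: ss) j ins =
  ((wiring s j ins).1 ++ (wiring_row ss (j + size (boxes s)) (wiring s j ins).2).1,
   (wiring_row ss (j + size (boxes s)) (wiring s j ins).2).2).
Proof. by []. Qed.

Definition box_end (L : seq arity) (j : nat) (x : wire_end) :=
  exists i, [/\ x = inr (j + i)%N, (i < size L)%N & ~~ thin (nth (0, 0, 0)%N L i)].

Lemma box_end_catl L L' j x : box_end L j x -> box_end (L ++ L') j x.
Proof.
case=> i [-> lti nt]; exists i; rewrite size_cat nth_cat lti; split=> //.
exact: ltn_addr.
Qed.

Lemma box_end_catr L L' j x : box_end L' (j + size L) x -> box_end (L ++ L') j x.
Proof.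
case=> i [-> lti nt]; exists (size L + i)%N; rewrite addnA size_cat ltn_add2l.
rewrite nth_cat (_ : (size L + i < size L)%N = false) ?addKn //.
by clear; lia.
Qed.

Lemma box_end_cat L L' j x : box_end (L ++ L') j x ->
  box_end L j x \/ box_end L' (j + size L) x.
Proof.
case=> i [-> lti]; rewrite nth_cat; case: ltnP => [h nt|h nt]; first by left; exists i.
right; exists (i - size L)%N; split=> //; first by rewrite -addnA subnKC.
by rewrite -(ltn_add2l (size L)) subnKC // -size_cat.
Qed.

(* Every incoming wire and every non-thin box is connected to an outgoing     *)
(* wire, and thin boxes are not connected to anything.                        *)
Definition wiring_spec (L : seq arity) (m j : nat) (ins : seq wire_end)
    (w : seq (wire_end * wire_end) * seq wire_end) : Prop :=
  [/\ size w.2 = m,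
      forall R : wire_end -> wire_end -> Prop, (forall x, R x x) ->
        (forall x y z, R x y -> R y z -> R x z) ->
        (forall x y, (x, y) \in w.1 -> R x y /\ R y x) ->
        forall x, x \in ins \/ box_end L j x -> exists2 u, u \in w.2 & R x u,
      forall x y, (x, y) \in w.1 -> (x \in ins \/ box_end L j x) /\ box_end L j y &
      forall x, x \in w.2 -> x \in ins \/ box_end L j x].

Lemma thin_lax a : is_lax_box a -> thin a = (ar_in a == 0%N).
Proof.
case/andP=> _ /eqP ->; rewrite /thin /lax_arity /ar_in /ar_out /=.
by case: (a.1.1).
Qed.

Lemma lax_out a : is_lax_box a -> ar_out a = (0 < ar_in a)%N.
Proof. by case/andP=> _ /eqP {1}->. Qed.

Lemma wiring_rowP ss p0 j ins : {in ss, forall s, forall j ins,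
    size ins = ar_in (st_ar s) ->
    wiring_spec (boxes s) (ar_out (st_ar s)) j ins (wiring s j ins)} ->
  chained p0 (map st_ar ss) -> size ins = p0 ->
  wiring_spec (flatten (map boxes ss)) (top p0 (map st_ar ss)) j ins
    (wiring_row ss j ins).
Proof.
elim: ss p0 j ins => [|s ss IH] p0 j ins H.
  move=> _ sz; split=> //=; last by left.
  by move=> R rR _ _ x [xi|[i []//]]; exists x.
move=> /andP[/eqP Ep ch] sz; rewrite wiring_row_cons top_cons.
have [E1 C1 G1 O1] := H s (mem_head _ _) j ins (etrans sz (esym Ep)).
have [E2 C2 G2 O2] := IH _ (j + size (boxes s))%N _ (mem_tail H) ch E1.
split=> //=.
- move=> R rR tR eR x Hx.
  have e1 y z : (y, z) \in (wiring s j ins).1 -> R y z /\ R z y.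
    by move=> yz; apply: eR; rewrite mem_cat yz.
  have e2 y z : (y, z) \in (wiring_row ss (j + size (boxes s)) (wiring s j ins).2).1 ->
      R y z /\ R z y.
    by move=> yz; apply: eR; rewrite mem_cat yz orbT.
  have {Hx} : (x \in ins \/ box_end (boxes s) j x) \/
      box_end (flatten (map boxes ss)) (j + size (boxes s)) x.
    by case: Hx => [|/box_end_cat[]]; tauto.
  case=> [Hx|Hx]; last by apply: (C2 R rR tR e2); right.
  have [u uw xu] := C1 R rR tR e1 x Hx.
  have [v vw uv] := C2 R rR tR e2 u (or_introl uw).
  by exists v => //; apply: tR uv.
- move=> x y; rewrite mem_cat => /orP[/G1[Hx Hy]|/G2[Hx Hy]].
    split; last exact: box_end_catl.
    by case: Hx; [left | right; apply: box_end_catl].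
  split; last exact: box_end_catr.
  case: Hx => [/O1[]|]; first by left.
    by right; apply: box_end_catl.
  by right; apply: box_end_catr.
move=> x /O2[/O1[]|]; first by left.
  by right; apply: box_end_catl.
by right; apply: box_end_catr.
Qed.

Lemma wiringP S j ins : legit S -> size ins = ar_in (st_ar S) ->
  wiring_spec (boxes S) (ar_out (st_ar S)) j ins (wiring S j ins).
Proof.
elim/stacking_mem_ind: S j ins => [|a p0 ss IH] j ins.
  move=> _ sz; split=> //=; last by left.
  by move=> R rR _ _ x [xi|[i []//]]; exists x.
rewrite legit_node => /and3P[/andP[_ ch] la lss] sz; rewrite wiring_node.
have sz' : size (drop (ar_in a) ins) = p0 by rewrite size_drop sz addKn.
have [|E C G O] := @wiring_rowP ss p0 j.+1 _ _ ch sz'.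
  by move=> s sss j' ins'; apply: IH => //; apply: (allP lss).
have lo := lax_out la; have ta := thin_lax la.
have B0 : (0 < ar_in a)%N -> box_end (a :: flatten (map boxes ss)) j (inr j).
  by move=> a0; exists 0%N; rewrite addn0 /= ta -lt0n.
have BS x : box_end (flatten (map boxes ss)) j.+1 x ->
    box_end (a :: flatten (map boxes ss)) j x.
  by rewrite -addn1; apply: (@box_end_catr [:: a]).
split=> /=.
- by rewrite size_cat size_nseq E.
- move=> R rR tR eR x Hx.
  have e2 y z : (y, z) \in (wiring_row ss j.+1 (drop (ar_in a) ins)).1 ->
      R y z /\ R z y.
    by move=> yz; apply: eR; rewrite mem_cat yz orbT.
  have {Hx} : ((0 < ar_in a)%N /\ R x (inr j)) \/
     (x \in drop (ar_in a) ins \/ box_end (flatten (map boxes ss)) j.+1 x).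
    case: Hx => [|/(@box_end_cat [:: a])[[[|i] [-> //= _]]|]].
    + rewrite -{1}(cat_take_drop (ar_in a) ins) mem_cat => /orP[xt|]; last by right; left.
      left; split; first by case: (ar_in a) xt => //; rewrite take0.
      by apply: (eR _ _ _).1; rewrite mem_cat map_f.
    + by rewrite ta addn0 -lt0n => a0; left.
    by rewrite addn1; right; right.
  case=> [[a0 xj]|Hx].
    by exists (inr j) => //; rewrite lo a0 mem_cat mem_head.
  have [u uw xu] := C R rR tR e2 x Hx; exists u => //.
  by rewrite mem_cat uw orbT.
- move=> x y; rewrite mem_cat => /orP[/mapP[u ut [-> ->]]|/G[Hx Hy]].
    split; first by left; apply: mem_take ut.
    by apply: B0; case: (ar_in a) ut => //; rewrite take0.
  split; last exact: BS.
  by case: Hx => [/mem_drop|]; [left | right; apply: BS].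
move=> x; rewrite mem_cat => /orP[|/O[/mem_drop|]]; [|by left|by right; apply: BS].
rewrite mem_nseq lo => /andP[]; case a0: (0 < ar_in a)%N => // _ /eqP ->.
by right; apply: B0.
Qed.

Lemma n_comp2 (T : finType) (e : rel T) (t u : T) : connect_sym e ->
  ~~ connect e t u -> (forall v, connect e t v || connect e u v) ->
  n_comp e predT = 2%N.
Proof.
move=> se ntu H.
have ct : closed e (connect e t).
  by move=> x y exy; apply/idP/idP => h; apply: connect_trans h _;
    rewrite ?[connect e y x]se; apply: connect1.
rewrite (n_compC (connect e t)) //.
rewrite (n_comp_connect se).
have -> : n_comp e [predC connect e t] = n_comp e (connect e u).
  apply: eq_n_comp_r => v; rewrite inE; change (~~ connect e t v = connect e u v).
  apply/idP/idP => [ntv|uv]; first by have := H v; rewrite (negPf ntv).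
  by apply: contra ntu => tv; apply: connect_trans tv _; rewrite se.
by rewrite (n_comp_connect se).
Qed.

Lemma vertex_end_inj S : injective (@vertex_end S).
Proof.
by move=> [x|x] [y|y] //= [E]; congr (_ _); apply: val_inj.
Qed.

Lemma st_adj_sym S : connect_sym (@st_adj S).
Proof. by apply: sym_connect_sym => x y; rewrite /st_adj orbC. Qed.

Lemma connect_isolated (T : finType) (e : rel T) t :
  (forall v, ~~ e t v) -> forall v, connect e t v -> v = t.
Proof.
by move=> H v /connectP[[|u p] //=]; rewrite (negPf (H u)).
Qed.

(** The thin box carries no wires and is an isolated vertex; everything else is connected to the
    only outgoing wire. *)
Lemma ncomp_one_thin S t : legit S -> ar_out (st_ar S) = 1%N ->
  (t < size (boxes S))%N -> thin (nth (0, 0, 0)%N (boxes S) t) ->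
  (forall i, (i < size (boxes S))%N -> i != t ->
     ~~ thin (nth (0, 0, 0)%N (boxes S) i)) ->
  st_ncomp S = 2%N.
Proof.
move=> lS o1 tL tt nt.
pose ins : seq wire_end := [seq inl i | i <- iota 0 (ar_in (st_ar S))].
have [] := @wiringP S 0 ins lS; first by rewrite size_map size_iota.
rewrite o1; set w := wiring S 0 ins; case Ew : w.2 => [|u0 [|? ?]] // _ C G O.
have vP x : x \in ins \/ box_end (boxes S) 0 x -> exists v : st_vertex S, vertex_end v = x.
  case=> [/mapP[i]|[i [-> lti _]]]; last by exists (inr (Ordinal lti)).
  by rewrite mem_iota add0n /= => lti ->; exists (inl (Ordinal lti)).
have [u Eu] : exists u : st_vertex S, vertex_end u = u0.
  by apply: vP; apply: O; rewrite mem_head.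
(* Connectivity carried over from vertices to wire ends. Reflexivity is added by hand because not
   every element of [wire_end] comes from a vertex. *)
pose R x y := x = y \/ exists a b : st_vertex S,
  [/\ vertex_end a = x, vertex_end b = y & connect (@st_adj S) a b].
have Rt x y z : R x y -> R y z -> R x z.
  case=> [->//|[a [b [<- Eb ab]]]] [<-|[c [d [Ec <- cd]]]].
    by right; exists a, b.
  right; exists a, d; split=> //; apply: connect_trans ab _.
  by have -> : b = c by apply: vertex_end_inj; rewrite Eb Ec.
have eR x y : (x, y) \in w.1 -> R x y /\ R y x.
  move=> xy; have [Hx Hy] := G x y xy.
  have [a Ea] := vP x Hx; have [b Eb] := vP y (or_intror Hy).
  have ab : connect (@st_adj S) a b.
    by apply: connect1; rewrite /st_adj -/ins -/w Ea Eb xy.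
  split; right; first by exists a, b.
  by exists b, a; split=> //; rewrite st_adj_sym.
pose tv : st_vertex S := inr (Ordinal tL).
have iso v : ~~ st_adj tv v.
  apply/negP; rewrite /st_adj -/ins -/w => /orP[/G[Hx _]|/G[_ Hx]].
    case: Hx => [/mapP[//]|[i [/= [E] _]]]; by rewrite add0n in E; rewrite -E tt.
  by case: Hx => i [/= [E] _]; rewrite add0n in E; rewrite -E tt.
apply: (@n_comp2 _ _ tv u (@st_adj_sym S)).
  apply/negP => /(connect_isolated iso) E.
  have : u0 \in ins \/ box_end (boxes S) 0 u0 by apply: O; rewrite mem_head.
  rewrite -Eu E; case=> [/mapP[//]|[i [/= [Ei] _]]].
  by rewrite add0n in Ei; rewrite -Ei tt.
move=> v; have [->|vt] := eqVneq v tv; first by rewrite connect0.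
have Hv : vertex_end v \in ins \/ box_end (boxes S) 0 (vertex_end v).
  case: v vt => [i _|i it].
    by left; apply/mapP; exists (i : nat); rewrite ?mem_iota ?add0n /=.
  right; exists (i : nat); have ni : (i : nat) != t.
    by apply: contra it => /eqP E; apply/eqP; congr inr; apply: val_inj.
  by split; [| apply: ltn_ord | apply: nt (ltn_ord i) ni].
have [z] := C R (fun x => or_introl erefl) Rt eR _ Hv.
rewrite inE => /eqP -> [Ev|[a [b [Ea Eb ab]]]].
  have -> : v = u by apply: vertex_end_inj; rewrite Ev Eu.
  by rewrite connect0 orbT.
have -> : v = a by apply: vertex_end_inj.
have -> : u = b by apply: vertex_end_inj; rewrite Eu.
by rewrite [connect _ b a]st_adj_sym ab orbT.
Qed.

Lemma ncomp_two_thin S a b : legit S -> ar_in (st_ar S) = 0%N ->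
  boxes S = [:: a; b] -> thin a -> thin b -> st_ncomp S = 2%N.
Proof.
move=> lS i0 EL ta tb.
have [|_ _ G _] := @wiringP S 0 [::] lS; first by rewrite i0.
have iso (t v : st_vertex S) : ~~ st_adj t v.
  apply/negP; rewrite /st_adj i0 => /orP[/G[_]|/G[_]];
    by case=> [[|[|i]] [_]]; rewrite EL /= ?ta ?tb.
have s2 : size (boxes S) = 2%N by rewrite EL.
have l0 : (0 < size (boxes S))%N by rewrite s2.
have l1 : (1 < size (boxes S))%N by rewrite s2.
apply: (@n_comp2 _ _ (inr (Ordinal l0)) (inr (Ordinal l1)) (@st_adj_sym S)).
  by apply/negP => /(connect_isolated (iso _)).
move=> [[i hi]|[[|[|i]] hi]].
- by exfalso; rewrite i0 in hi.
- by apply/orP; left; apply: eq_connect0; congr inr; apply: val_inj.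
- by apply/orP; right; apply: eq_connect0; congr inr; apply: val_inj.
- by exfalso; rewrite s2 in hi.
Qed.

(** The degree of a row is fixed by its wires and inputs, and it bounds p + q - 2 for each of its
    boxes. *)
Lemma pure_rebound C p n R : all legit R -> all (pureb C) R ->
  chained p (map st_ar R) -> width R = n -> all (pureb (p + n).+1) R.
Proof.
move=> lR pR ch wR; have nR := row_ndeg lR pR ch.
apply/allP => T TR; apply/allP => a aT.
have /andP[a0 _] := allP (allP pR T TR) a aT; rewrite a0 /= ltnS.
have h1 := mem_sumn (map_f ndeg TR).
have h2 := mem_sumn (map_f (fun a => ar_in a + ar_up a - 2)%N aT).
have h3 : (0 < @size stacking R)%N by case: (R) TR.
by move: h1 h2 h3 nR a0; rewrite -/(ndeg T) wR /=; clear; lia.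
Qed.

Lemma boxes_eta n : flatten (map boxes (eta n)) = [::].
Proof. by elim: n. Qed.

Lemma row_noboxes ss : flatten (map boxes ss) = [::] -> ss = eta (size ss).
Proof. by elim: ss => //= -[|? ? ?] ss IH //= /IH <-. Qed.

Lemma row_onebox ss b : flatten (map boxes ss) = [:: b] ->
  exists i p0 ts, [/\ (i < size ss)%N,
    ss = eta i ++ Node b p0 ts :: eta (size ss - i.+1) &
    flatten (map boxes ts) = [::]].
Proof.
elim: ss => //= -[|a p0 ts] ss IH /=.
  move=> /IH[i [p0 [ts [lti E Ets]]]]; exists i.+1, p0, ts; split=> //.
  by rewrite {1}E.
case=> -> /eqP; rewrite -size_eq0 size_cat addn_eq0 !size_eq0 => /andP[/eqP E1 /eqP E2].
exists 0%N, p0, ts; split=> //=; rewrite subn1 /=.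
by rewrite {1}(row_noboxes E2).
Qed.

Lemma has_semi_thin S : legit S -> has semi_thin (boxes S) = false.
Proof.
case/andP=> _ lb; apply/negbTE/hasPn => a /(allP lb)/lax_out E.
by rewrite /semi_thin E; case: (ar_in a).
Qed.

Lemma boxes_erow n i b : flatten (map boxes (erow n i b)) = [:: lax_arity 0 b].
Proof. by rewrite /erow map_cat flatten_cat boxes_eta /= !boxes_eta. Qed.

Lemma beta_inv p0 b ts : legit (Node b p0 ts) -> thin b ->
  flatten (map boxes ts) = [::] -> Node b p0 ts = beta (ar_up b).
Proof.
rewrite legit_node => /and3P[cs lb _] tb /row_noboxes E.
have sz := composable_up cs; move: (tb); rewrite (thin_lax lb) => /eqP b0.
case/andP: lb => b2 /eqP Eb; rewrite b0 add0n in b2.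
have Eb' : lax_arity 0 (ar_up b) = b by rewrite {2}Eb b0.
case/andP: cs => _; rewrite E sz /beta Eb' /st_id nseq_eta_ar.
by case: (ar_up b) b2 => //= n _ /andP[/eqP <- _].
Qed.

(** For Lax boxes the types describe the tree: a single thin box above the root, whence a row
    [erow], or a pure row above a thin root. That these stackings have two components is
    [ncomp_two_thin] and [ncomp_one_thin]. *)
Lemma mem_tq p q S : (2 <= p + q)%N ->
  (S \in map snd (tq (lax_arity p q))) = lax_stacking p q S.
Proof.
move=> pq; have la := lax_arity_box pq; apply/mapP/and3P.
  case=> x xin ->{S}; have [lx ax _ _] := tqP la xin.
  split; [| by apply/eqP | by case/andP: lx].
  rewrite /thin_quadratic (proj1 (andP lx)) has_semi_thin //=.
  move: xin; rewrite /tq -[ar_in (lax_arity p q)]/p -[ar_up (lax_arity p q)]/q.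
  rewrite mem_cat => /orP[|].
    case/allpairsPdep => n [i [nin iin Ex]].
    have bE : boxes x.2 = [:: lax_arity p n; lax_arity 0 (q.+1 - n)].
      by rewrite Ex /= -/(map boxes _) boxes_erow.
    have tb b : thin (lax_arity 0 b) by [].
    have [p0|p0] := posnP p.
      have tp : thin (lax_arity p n) by rewrite p0.
      rewrite (ncomp_two_thin lx _ bE tp (tb _)) ?ax ?p0 // eqxx /=.
      by rewrite /type_I bE p0.
    have tp : thin (lax_arity p n) = false.
      by rewrite /thin /lax_arity /ar_in /ar_out /= p0; case: (p) p0.
    rewrite (@ncomp_one_thin x.2 1) //; first last.
    - by move=> [|[|i']]; rewrite bE //= tp.
    - by rewrite bE.
    - by rewrite bE.
    - by rewrite ax /lax_arity /ar_out /= p0.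
    rewrite eqxx /=; apply/orP; right; apply/orP; left.
    by rewrite /type_II bE tb /non_thin /lax_arity /ar_in /ar_out /= p0.
  have [_ //|p0] := posnP p.
  case/allpairsPdep => m [R [min]]; rewrite mem_filter mem_row => /andP[_].
  case/and5P => sR lR pR ch tR Ex.
  have bE : boxes x.2 = lax_arity 0 m :: flatten (map boxes R) by rewrite Ex.
  have nt : all non_thin (flatten (map boxes R)).
    apply/allP => a /flattenP[_ /mapP[T TR ->] aT].
    have /andP[a0 _] := allP (allP pR T TR) a aT.
    have [_ /allP lT] := andP (allP lR T TR).
    by rewrite /non_thin a0 (lax_out (lT a aT)) a0.
  rewrite (@ncomp_one_thin x.2 0) //.
  - rewrite eqxx /=; apply/orP; right; apply/orP; right.
    by rewrite /type_III bE nt ax /thin /lax_arity /ar_in /ar_out /= p0; case: (p) p0.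
  - by rewrite ax /lax_arity /ar_out /= p0.
  - by rewrite bE.
  - by rewrite bE.
  move=> [|i] //; rewrite bE /= => lti _.
  have /andP[a0 _] := allP nt _ (mem_nth (0, 0, 0)%N lti).
  by rewrite /thin -leqn0 leqNgt a0.
case=> /and4P[wS _ _ ty] /eqP aS lb.
have lS : legit S by rewrite /legit wS.
case: S wS ty aS lb lS => [|a p0 ss] _ ty aS lb lS; first by move: ty.
have := lS; rewrite legit_node => /and3P[cs lx lss].
have sz := composable_up cs.
have {ty} [[b [Eb tb]]|[ta nt ntS]] : (exists b, flatten (map boxes ss) = [:: b] /\ thin b) \/
    [/\ thin a, all non_thin (flatten (map boxes ss)) & ~~ thin (st_ar (Node a p0 ss))].
  case/or3P: ty; rewrite ?/type_I ?/type_II ?/type_III [boxes _]/= -/(map boxes ss).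
  - by case: (flatten _) => [|b [|? ?]] // /andP[_ tb]; left; exists b.
  - by case: (flatten _) => [|b [|? ?]] // /andP[_ tb]; left; exists b.
  by case/and3P; right.
  have [i [p1 [ts [lti E Ets]]]] := row_onebox Eb.
  have lN : legit (Node b p1 ts).
    by apply: (allP lss); rewrite E mem_cat mem_head orbT.
  rewrite (beta_inv lN tb Ets) in E; set b' := ar_up b in E.
  have lb' : is_lax_box b by move: lN; rewrite legit_node => /and3P[].
  have b2 : (2 <= b')%N.
    by move: tb; rewrite (thin_lax lb') => /eqP b0; case/andP: lb'; rewrite b0.
  rewrite sz -/(erow (ar_up a) i b') in E lti.
  have [lE [cE tE] sE wE _] := erow_spec lti b2.
  have p00 : p0 = 0%N.
    case/andP: cs => _; rewrite E /erow.
    by case: (i) => [|i'] /=; rewrite ?beta_ar => /andP[/eqP <- _].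
  move: aS; rewrite [st_ar _]/= /comp_arity p00 E tE !addn0 -/(width _) wE.
  case=> Ep Eq _.
  exists ((p == 0%N), Node a p0 ss); last by rewrite /= p00 E.
  rewrite /tq mem_cat; apply/orP; left.
  apply/allpairsPdep; exists (ar_up a), i.
  rewrite mem_filter mem_iota -[ar_in (lax_arity p q)]/p -[ar_up (lax_arity p q)]/q.
  case/andP: (lx) => a2 /eqP Ea; rewrite -Ep -Eq a2 mem_iota lti.
  split=> //; first by move: lti b2; clear; lia.
  congr (_, _); rewrite p00 -Ea {1}E; congr (Node _ _ (erow _ _ _)).
  by move: lti b2; clear; lia.
rewrite (thin_lax lx) in ta.
move: aS ntS; rewrite [st_ar _]/= /comp_arity (eqP ta) add0n (lax_out lx) (eqP ta) add0n.
case=> Ep Eq Et nS.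
have p_gt0 : (0 < p)%N.
  rewrite lt0n; apply: contra nS => /eqP p0'; apply/andP.
  by split; apply/eqP; [apply: etrans Ep p0' | apply: etrans Et _; rewrite p0'].
have pR : all (pureb (p + q).+1) ss.
  (* Any bound on the number of inputs will do; [pure_rebound] turns it into the one used in
     [tq]. *)
  pose C := (sumn (map ar_up (flatten (map boxes ss)))).+1.
  apply: (@pure_rebound C) => //; last by rewrite -Ep; case/andP: cs.
  apply/allP => T TR; apply/allP => x xT.
  have xf : x \in flatten (map boxes ss) by apply/flattenP; exists (boxes T); rewrite ?map_f.
  by have /andP[-> _] := allP nt x xf; rewrite ltnS; apply: mem_sumn; apply: map_f.
have ch : chained p (map st_ar ss) by rewrite -Ep; case/andP: cs.
have tR : top p (map st_ar ss) = 1%N by rewrite -Ep Et p_gt0.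
exists (true, Node a p0 ss) => //; rewrite /tq mem_cat; apply/orP; right.
rewrite -[ar_in (lax_arity p q)]/p -[ar_up (lax_arity p q)]/q gtn_eqF //.
have a2 : (2 <= ar_up a)%N by case/andP: lx; rewrite (eqP ta).
apply/allpairsPdep; exists (ar_up a), ss; rewrite mem_iota a2 mem_filter mem_row.
rewrite /rspec sz eqxx lss pR ch tR eqxx [width ss]Eq eqxx; split=> //.
  by have /andP[_] := row_bound lss pR ch; rewrite tR sz -Eq /width; clear; lia.
by congr (_, Node _ _ _) => //; case/andP: lx => _ /eqP; rewrite (eqP ta).
Qed.

Lemma find_erow n i b : find (fun S => S != Eta) (erow n i b) = i.
Proof.
rewrite /erow find_cat has_nseq /= andbF size_nseq.
by rewrite addn0.
Qed.

Lemma uniq_tq a : uniq (map snd (tq a)).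
Proof.
rewrite /tq map_cat cat_uniq; apply/and3P; split.
- rewrite map_flatten -map_comp.
  pose g S := if S is Node a' _ _ then ar_up a' else 0%N.
  apply: (@uniq_flatten_key _ _ g).
  + by apply: filter_uniq; apply: iota_uniq.
  + move=> n _ /=; rewrite -map_comp map_inj_uniq ?iota_uniq // => i j /= [] E.
    by rewrite -(find_erow n i ((ar_up a).+1 - n)) E find_erow.
  by move=> n _ S; rewrite /= -map_comp => /mapP[i _ ->].
- apply/hasPn => S; case: posnP => // a0 /mapP[x /allpairsPdep[m [R [_ _ ->]]] ->].
  apply/negP => /mapP[y /allpairsPdep[n [i [_ _ ->]]]].
  by move/(congr1 (fun S => if S is Node _ p _ then p else 0%N)) => /= E; rewrite E in a0.
case: posnP => // a0; rewrite map_flatten -map_comp.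
pose g S := if S is Node a' _ _ then ar_up a' else 0%N.
apply: (@uniq_flatten_key _ _ g); first exact: iota_uniq.
  move=> m _ /=; rewrite -map_comp map_inj_uniq; last by move=> R R' [].
  by apply: filter_uniq; apply: uniq_row.
by move=> n _ S; rewrite /= -map_comp => /mapP[i _ ->].
Qed.

(** * Comparison with the signs in the definition of the differential *)

Definition par (z : int) : bool := odd `|z|%N.

Lemma parD x y : par (x + y) = par x (+) par y.
Proof.
have H n m : par (n%:Z - m%:Z) = odd n (+) odd m.
  rewrite /par; case: (leqP m n) => h.
    by rewrite subzn // absz_nat oddB.
  by rewrite -opprB abszN subzn ?absz_nat ?oddB ?(ltnW h) // addbC.
case: x y => [n|n] [m|m]; rewrite ?NegzE.
- by rewrite -PoszD /par !absz_nat oddD.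
- by rewrite H /par abszN !absz_nat.
- by rewrite addrC H /par abszN !absz_nat addbC.
by rewrite -opprD -PoszD /par !abszN !absz_nat oddD.
Qed.

Lemma parN x : par (- x) = par x. Proof. by rewrite /par abszN. Qed.
Lemma parM x y : par (x * y) = par x && par y.
Proof. by rewrite /par abszM oddM. Qed.
Lemma par_nat (n : nat) : par n%:Z = odd n. Proof. by []. Qed.
Lemma par1 : par 1 = true. Proof. by []. Qed.

Definition parE := (parD, parN, parM, par_nat, par1).

Lemma sgn_par (k : fieldType) z : sgn k z = (-1) ^+ (nat_of_bool (par z)).
Proof.
rewrite /sgn /par signr_odd; case: z => n //.
by rewrite NegzE abszN absz_nat -invr_expz invr_sign.
Qed.

Lemma par_sum n (F : 'I_n -> int) :
  par (\sum_i F i) = \big[addb/false]_i par (F i).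
Proof. by elim/big_rec2: _ => // i y1 y2 _ <-; rewrite parD. Qed.

Lemma thrE K l : thr K l = \big[addb/false]_(i < size l)
  (~~ odd (ar_up (nth (0, 0, 0)%N l i)) &&
   (odd (size l - i.+1) (+) K (+) odd (ar_in (nth (0, 0, 0)%N l i)))).
Proof.
elim: l => [|x l IH] /=; first by rewrite big_ord0.
by rewrite big_ord_recl /= subn1 IH.
Qed.

Fixpoint thsum S : bool :=
  match S with
  | Eta => false
  | Node a p0 ss => theta a p0 (map st_ar ss) (+) foldr addb false (map thsum ss)
  end.

Lemma par_desusp S : st_wf S -> par (st_desusp S) = thsum S.
Proof.
elim/stacking_mem_ind: S => // a p0 ss IH.
rewrite [st_wf _]/= => /andP[/andP[/eqP sz _] wss].
rewrite [st_desusp _]/= [thsum _]/= !parD parM !parD !par_nat.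
congr (_ (+) _); last first.
  elim: ss IH wss {sz} => [|s ss IHs] IH; first by rewrite big_nil.
  move=> /= /andP[ws wss]; rewrite big_cons parD (IH s) ?mem_head // IHs //.
  exact: mem_tail IH.
rewrite /theta; congr (_ (+) _); rewrite par_sum thrE; apply: eq_bigr => i _.
rewrite -sz parM !parE addbT oddB //; congr (_ && _).
by case: (odd _); case: (odd _); case: (odd _); case: (odd _);
   case: (odd (ar_in a)); case: (odd p0).
Qed.

(** The exponent by which the composite of generators along [S] differs from the basis element of
    [S] ([mu_st_gen]): the corrections [loc] of all boxes. *)
Fixpoint omega S : bool :=
  match S with
  | Eta => false
  | Node a p0 ss => loc (st_id a) p0 ss (+) foldr addb false (map omega ss)
  end.

Lemma omega_pure B S : pureb B S -> omega S = thsum S.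
Proof.
elim/stacking_mem_ind: S => // a p0 ss IH.
rewrite pureb_node => /and3P[_ _ pss] /=.
have pmix R : all (pureb B) R -> mix R = false.
  by elim: R => //= T R IHR /andP[_ pR]; rewrite (xr_pt0 pR) andbF IHR.
have -> : map omega ss = map thsum ss.
  by apply/eq_in_map => s sss; apply: IH => //; apply: (allP pss).
by rewrite /loc st_id_ar -[mix (_ :: _)]/((_ && xr pt ss) (+) mix ss)
  (xr_pt0 pss) pmix // andbF /= addbF.
Qed.

Section MuSt.
Variable k : fieldType.
Notation V := (fmod k).
Notation D := (dS k tq).
Notation sn b := ((-1) ^+ (nat_of_bool b) : k).
Notation gens L := [seq (gen (ar_in a) (ar_up a) : Tbox k) | a <- L].

Fixpoint mu_row (ss : seq stacking) (ys : seq (Tbox k)) : seq (Tbox k) :=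
  if ss is s :: ss' then
    mu_st s (take (size (boxes s)) ys) :: mu_row ss' (drop (size (boxes s)) ys)
  else [::].

Lemma mu_st_node a p0 ss (xs : seq (Tbox k)) :
  mu_st (Node a p0 ss) xs = mu (head 0 xs) p0 (mu_row ss (behead xs)).
Proof. by []. Qed.

Lemma ml_signs (W : lmodType k) (F : seq stacking -> W) (w : stacking -> bool) ss :
  all legit ss ->
  ml F [seq sn (w s) *: (bas s : V) | s <- ss] = sn (foldr addb false (map w ss)) *: F ss.
Proof.
elim: ss F => [|s ss IH] F /=; first by rewrite scale1r.
move=> /andP[ls lss]; rewrite linearZ /= lin_bas // IH // scalerA -sn_addb.
by [].
Qed.

Lemma mu_st_gen S : legit S -> mu_st S (gens (boxes S)) = sn (omega S) *: (bas S : V).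
Proof.
elim/stacking_mem_ind: S => [_|a p0 ss IH]; first by rewrite scale1r.
rewrite legit_node => /and3P[cs la lss]; rewrite mu_st_node [boxes _]/= /=.
have -> : mu_row ss (gens (flatten (map boxes ss))) =
    [seq sn (omega s) *: (bas s : V) | s <- ss].
  elim: ss IH lss {cs} => //= s ss IHs IH /andP[ls lss].
  rewrite map_cat take_size_cat ?size_map // drop_size_cat ?size_map //.
  by rewrite IH ?mem_head // IHs //; exact: mem_tail IH.
have Ea : lax_arity (ar_in a) (ar_up a) = a by case/andP: la => _ /eqP <-.
have lid : legit (st_id a) by rewrite /legit st_id_wf /= la; elim: (ar_up _).
have sz := composable_up cs.
rewrite /gen Ea /muT lin_bas // ml_signs //.
rewrite /muB st_id_ar cs /sg kap_node kap_row_eta addFb scalerA -sn_addb addbC.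
by rewrite /st_id graft_node add0n -sz graft_row_1l.
Qed.

Lemma D_st_id a : is_lax_box a -> D (st_id a) = dgen k tq a.
Proof.
move=> la; rewrite /st_id dS_node drow_eta scaler0 addr0 gr_dgen //.
rewrite /dgen !big_seq; apply: eq_bigr => x xa.
have [/andP[wx _] ax _ _] := tqP la xa.
rewrite (kap_pure x.2 (pureb_eta _)) scale1r.
by rewrite -(congr1 ar_up ax) graft_1r.
Qed.

Lemma omega_eta n : foldr addb false (map omega (eta n)) = false.
Proof. by elim: n. Qed.

Lemma thsum_eta n : foldr addb false (map thsum (eta n)) = false.
Proof. by elim: n. Qed.

Lemma foldr_addb_cat s t : foldr addb false (s ++ t) =
  foldr addb false s (+) foldr addb false t.
Proof. by elim: s => //= x s ->; rewrite addbA. Qed.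

Lemma foldr_addb_cons x s : foldr addb false (x :: s) = x (+) foldr addb false s.
Proof. by []. Qed.

(** For types I and II the exponent [omega] is S^d + e_1, where e_1 comes from the root meeting the
    odd box above it; for type III it is S^d, as nothing odd lies above the root. Both cancel
    against the exponent in the definition and leave a minus sign for types I and III. *)
Lemma tq_sign a x : is_lax_box a -> x \in tq a ->
  par (lax_sign x.2) (+) omega x.2 = x.1.
Proof.
move=> la xa; have [/andP[wx _] _ _ _] := tqP la xa.
case: a la xa => -[p q] r /andP[pq /eqP ->]; rewrite -[ar_in _]/p -[ar_up _]/q in pq *.
rewrite /tq -[ar_in (lax_arity p q)]/p -[ar_up (lax_arity p q)]/q mem_cat => /orP[|].
  case/allpairsPdep => n [i [nin iin Ex]].
  have bE : boxes x.2 = [:: lax_arity p n; lax_arity 0 (q.+1 - n)].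
    by rewrite Ex /= -/(map boxes _) boxes_erow.
  have tb b : thin (lax_arity 0 b) by [].
  set E := erow n i (q.+1 - n) in Ex.
  have b2 : (2 <= q.+1 - n)%N by move: nin; rewrite mem_filter mem_iota; clear; lia.
  have ltin : (i < n)%N by move: iin; rewrite mem_iota.
  have [_ _ _ _ [xE _]] := erow_spec ltin b2.
  have mE : mix E = false.
    have m0 m : mix (eta m) = false by elim: m => //= m ->; rewrite xr_pt_eta.
    have w0 m : xr wpa (eta m) = false by elim: m.
    by rewrite /E /erow mix_cat m0 w0 mix_cons xr_pt_eta m0 andbF.
  have beta0 : omega (beta (q.+1 - n)) = false /\ thsum (beta (q.+1 - n)) = false.
    have := sg_1r (st_id (lax_arity 0 (q.+1 - n))) (q.+1 - n).
    rewrite /sg kap_node kap_row_eta addFb => l0; split.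
      by rewrite /= -/(map omega _) omega_eta l0.
    have := l0; rewrite /loc st_id_ar -[mix (_ :: _)]/((_ && xr pt (eta _)) (+) mix (eta _)).
    have m0 m : mix (eta m) = false by elim: m => //= m ->; rewrite xr_pt_eta.
    by rewrite xr_pt_eta m0 andbF addbF /= -/(map thsum _) -/(map st_ar _) thsum_eta => ->.
  have oE : foldr addb false (map omega E) = false.
    by rewrite /E /erow map_cat foldr_addb_cat omega_eta map_cons foldr_addb_cons omega_eta (proj1 beta0).
  have tE : foldr addb false (map thsum E) = false.
    by rewrite /E /erow map_cat foldr_addb_cat thsum_eta map_cons foldr_addb_cons thsum_eta (proj2 beta0).
  have Eo : omega x.2 = theta (lax_arity p n) 0 (map st_ar E) (+) pa (lax_arity p n).
    rewrite Ex /= -/(map omega _) oE /loc st_id_ar -[mix (_ :: _)]/((_ && xr pt E) (+) mix E).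
    by rewrite xE mE andbT /wpa st_id_ar !addbF.
  have Et : par (st_desusp x.2) = theta (lax_arity p n) 0 (map st_ar E).
    by rewrite par_desusp // Ex /= -/(map thsum _) tE addbF.
  pose e1 := (ar_up (lax_arity p n))%:Z - 1 + (ar_in (lax_arity p n))%:Z
     - (ar_out (lax_arity p n))%:Z.
  have Ee : par e1 = pa (lax_arity p n).
    rewrite /e1 !parE /pa; move: (ar_up _) (ar_in _) (ar_out _) => u v w.
    by rewrite -[(u + v + w).+1]addn1 !oddD; case: (odd u); case: (odd v); case: (odd w).
  have nE : non_thin (lax_arity p n) = ~~ thin (lax_arity p n).
    by rewrite /non_thin /thin /lax_arity /ar_in /ar_out /=; case: (p).
  have E1 : lax_sign x.2 = if thin (lax_arity p n) then st_desusp x.2 + e1 + 1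
      else st_desusp x.2 + e1.
    rewrite /lax_sign /type_I /type_II bE [head _ _]/= tb !andbT nE.
    by case: (thin _).
  have x1E : x.1 = thin (lax_arity p n).
    by rewrite Ex /= thin_lax //; apply: lax_arity_box; move: nin; rewrite mem_filter => /andP[].
  clearbody e1; rewrite Eo E1 x1E; case: (thin _); rewrite !parD ?par1 Et Ee;
    by case: (theta _ _ _); case: (pa _).
have [//|p0] := posnP p.
case/allpairsPdep => m [R [min]]; rewrite mem_filter mem_row => /andP[_].
case/and5P => sR lR pR ch tR Ex.
have bE : boxes x.2 = lax_arity 0 m :: flatten (map boxes R) by rewrite Ex.
have nt : all non_thin (flatten (map boxes R)).
  apply/allP => a /flattenP[_ /mapP[T TR ->] aT].
  have /andP[a0 _] := allP (allP pR T TR) a aT.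
  have [_ /allP lT] := andP (allP lR T TR).
  by rewrite /non_thin a0 (lax_out (lT a aT)) a0.
have Eo : omega x.2 = thsum x.2.
  have pmix Q : all (pureb (p + q).+1) Q -> mix Q = false.
    by elim: Q => //= T Q IHR /andP[_ pQ]; rewrite (xr_pt0 pQ) andbF IHR.
  have Em : map omega R = map thsum R.
    by apply/eq_in_map => s sss; apply: omega_pure; apply: (allP pR).
  rewrite Ex /= -/(map omega _) -/(map thsum _) Em /loc st_id_ar.
  by rewrite -[mix (_ :: _)]/((_ && xr pt R) (+) mix R) (xr_pt0 pR) pmix // andbF /= addbF.
have I0 : type_I x.2 = false.
  rewrite /type_I bE; case E: (flatten _) nt => [//|c [|? ?]] // /andP[nc _].
  by apply/negP => /andP[_]; case/andP: nc; rewrite /thin; case: (ar_in c).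
have II0 : type_II x.2 = false by rewrite /type_II bE; case: (flatten _) => [|? [|? ?]].
by rewrite /lax_sign I0 II0 parD par_desusp // par1 Eo; case: (thsum _); rewrite Ex.
Qed.

Lemma gen_diff p q : (2 <= p + q)%N ->
  D (st_id (lax_arity p q)) = \sum_(S <- map snd (tq (lax_arity p q)))
    sgn k (lax_sign S) *: mu_st S (gens (boxes S)).
Proof.
move=> pq; have la := lax_arity_box pq.
rewrite D_st_id // /dgen big_map !big_seq; apply: eq_bigr => x xa.
have [lx _ _ _] := tqP la xa.
rewrite mu_st_gen // scalerA sgn_par -sn_addb -[in LHS](tq_sign la xa).
by [].
Qed.

Lemma Tdg_lax_infty : is_lax_infty (M := Tdg k) (@gen k).
Proof.
split.
- exact: gen_elements.
- move=> B b eb; exists (freeT b); split.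
  + exact: freeT_morphism.
  + exact: freeT_gen.
  exact: freeT_unique.
move=> p q pq; exists (map snd (tq (lax_arity p q))); split.
- exact: uniq_tq.
- by move=> S; apply: mem_tq.
rewrite -gen_diff // -[diff _ _]/(lin D _) /gen lin_bas //.
by rewrite /legit st_id_wf /= lax_arity_box //; elim: (ar_up _).
Qed.
End MuSt.

(** * Acyclicity in positive degrees *)

Section Elimination.
Variable k : fieldType.
Notation V := (fmod k).
Notation D := (dS k tq).

Lemma cf_lin S (f : stacking -> V) x : cf S (lin f x) = lin (fun T => cf S (f T) : k^o) x.
Proof. by rewrite /cf [LHS]lin_linE. Qed.

Lemma cfB S (x y : V) : cf S (x - y) = cf S x - cf S y.
Proof. by rewrite /cf linearB. Qed.
Lemma cf0 S : cf S (0 : V) = 0. Proof. by rewrite /cf linear0. Qed.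
Lemma cfZ S c (x : V) : cf S (c *: x) = c * cf S x.
Proof. by rewrite /cf linearZ. Qed.

Lemma lin_single S (c : k) (x : V) :
  lin (fun T => (if T == S then c else 0) : k^o) x = cf S x * c.
Proof.
rewrite /cf (eq_lin (g := fun T => c *: ((T == S)%:R : k^o))).
  by rewrite lin_scale mulrC.
by move=> T _; case: eqP => _; rewrite ?scaler0 // /GRing.scale /= mulr1.
Qed.

Lemma inspan_bound (W : stacking -> nat) (x : V) :
  exists N, inspan (fun S => (W S < N)%N) x.
Proof.
exists (\max_(s <- (msupp x : seq _)) W (val s)).+1 => s sx.
by rewrite ltnS; apply: (leq_bigmax_seq (F := fun s : lstk => W (val s))).
Qed.

Lemma inspan_and P Q (x : V) : inspan P x -> inspan Q x ->
  inspan (fun S => P S /\ Q S) x.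
Proof. by move=> px qx s sx; split; [apply: px | apply: qx]. Qed.

(** A matching between [up] stackings and [dn] stackings of degree one higher, given by [pt] and its
    inverse [sp], with a weight [W] for which the partner is the leading [up] term. In this section
    [up] and [pt] hide the number of inputs and the thin parity. *)
Variables (Q : stacking -> Prop) (up dn : pred stacking).
Variables (sp pt : stacking -> stacking) (W : stacking -> nat).

Hypothesis QD : forall S, legit S -> Q S -> inspan Q (D S).
Hypothesis upP : forall S, legit S -> Q S -> up S ->
  [/\ legit (pt S), Q (pt S), dn (pt S), sp (pt S) = S & ndeg (pt S) = (ndeg S).+1].
Hypothesis dnP : forall T, legit T -> Q T -> dn T ->
  [/\ up (sp T), pt (sp T) = T, cf (sp T) (D T) != 0 &
   inspan (fun S => S = sp T \/ ~~ up S \/ (W S < W (sp T))%N) (D T)].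
Hypothesis critP : forall S, legit S -> Q S -> ~~ up S -> ~~ dn S ->
  inspan (fun S' => ~~ up S' /\ ~~ dn S') (D S).

(** The boundaries of the partners [pt S], divided by their leading coefficients, clear the [up]
    stackings of the largest weight and create only lighter ones. *)
Lemma elim_up N e (z : V) : inspan (fun S => Q S /\ ndeg S = e) z ->
  inspan (fun S => up S -> (W S < N)%N) z ->
  exists2 y, inspan (fun S => Q S /\ ndeg S = e.+1) y &
    inspan (fun S => (Q S /\ ndeg S = e) /\ ~~ up S) (z - lin D y).
Proof.
elim: N z => [|N IH] z qz uz.
  exists 0; first exact: inspan0.
  rewrite linear0 subr0; apply: (inspan_and qz) => s sx.
  by apply/negP => /(uz s sx).
pose f S : V := if up S && (W S == N)
  then (cf S (D (pt S)))^-1 *: bas (pt S) else 0.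
have qf : inspan (fun S => Q S /\ ndeg S = e.+1) (lin f z).
  apply: (inspan_lin qz) => S lS [qS nS]; rewrite /f.
  case: ifP => [/andP[uS _]|_]; last exact: inspan0.
  have [_ qp _ _ np] := upP lS qS uS.
  by apply: inspanZ; apply: inspan_bas; rewrite np nS.
have qDf : inspan (fun S => Q S /\ ndeg S = e) (lin D (lin f z)).
  apply: (inspan_lin qf) => S lS [qS nS]; apply: inspan_and; first exact: QD.
  by apply: inspanS (dS_span tqP lS) => S' _ [_ _]; rewrite nS => -[].
have [||y qy uy] := IH (z - lin D (lin f z)).
- exact: inspanB.
- apply: inspan_cf => S lS nz uS; rewrite ltnNge; apply/negP => NW.
  case/negP: nz; apply/eqP; rewrite cfB; apply/eqP; rewrite subr_eq0; apply/eqP.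
  (* For an [up] stacking of weight at least [N] only its own partner can contribute, and the
     normalization makes the contribution equal to the coefficient in [z]. *)
  have E : cf S (lin D (lin f z)) = cf S z * (W S == N)%:R.
    rewrite -lin_single (lin_linE (lin D)) cf_lin.
    apply: (@eq_lin_in k k^o _ _ _ _ qz) => T lT [qT nT]; rewrite /f.
    case: (boolP (up T && (W T == N))) => [/andP[uT /eqP WT]|nu]; last first.
      rewrite linear0 cf0; case: eqP => // ET; case: eqP => // WS.
      by move: nu; rewrite ET uS WS eqxx.
    have [lp qp dp spE _] := upP lT qT uT.
    rewrite linearZ /= lin_bas // cfZ; case: eqP => [<-|nTS].
      have [_ _ nz _] := dnP lp qp dp; rewrite spE in nz.
      by rewrite WT eqxx; apply: mulVf.
    have [_ _ _ sD] := dnP lp qp dp.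
    rewrite spE in sD; have -> : cf S (D (pt T)) = 0; last by rewrite mulr0.
    by apply: (cf_inspan sD) => -[/esym//|[|]]; rewrite ?uS // WT ltnNge NW.
  rewrite E; case: eqP => [_|nW]; first by rewrite mulr1.
  rewrite mulr0; apply: (cf_inspan uz) => /(_ uS); rewrite ltnS => h.
  by apply: nW; apply/eqP; rewrite eqn_leq h NW.
exists (lin f z + y); first exact: inspanD.
by rewrite linearD opprD addrA.
Qed.

(** In a cycle without [up] stackings, take a [dn] stacking whose partner has the largest weight. No
    other term has that partner in its differential, so a nonzero coefficient would contradict the
    cycle condition. *)
Lemma elim_dn N (z : V) : inspan (fun S => Q S /\ ~~ up S) z -> lin D z = 0 ->
  inspan (fun S => dn S -> (W (sp S) < N)%N) z -> inspan (fun S => ~~ dn S) z.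
Proof.
elim: N => [|N IH] qz Dz dz.
  by apply: inspanS dz => S _ h; apply/negP => /h.
apply: IH => //; apply: inspan_cf => T lT nz dT; rewrite ltnNge; apply/negP => NW.
have qT : Q T /\ ~~ up T.
  have := nz; rewrite -(_ : val (LStk lT) = T) // cfE => nz'.
  by apply: (qz (LStk lT)); rewrite -mcoeff_neq0.
have WT : W (sp T) = N.
  apply/eqP; rewrite eqn_leq NW andbT -ltnS.
  have := nz; rewrite -(_ : val (LStk lT) = T) // cfE => nz'.
  by apply: (dz (LStk lT)) dT; rewrite -mcoeff_neq0.
have [uT ptT nc _] := dnP lT qT.1 dT.
have : cf (sp T) (lin D z) = 0 by rewrite Dz cf0.
rewrite cf_lin (eq_lin_in (g := fun S => (if S == T then cf (sp T) (D T) else 0) : k^o)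
  (inspan_and qz dz)).
  by rewrite lin_single => /eqP; rewrite mulf_eq0 (negPf nz) (negPf nc).
move=> S lS [[qS nuS] WS]; case: eqP => [->//|nST].
case: (boolP (dn S)) => [dS'|ndS]; last first.
  by apply: (cf_inspan (critP lS qS nuS ndS)); rewrite uT => -[].
have [_ ptS _ sD] := dnP lS qS dS'.
apply: (cf_inspan sD) => -[E|[|]].
- by apply: nST; rewrite -ptS -E ptT.
- by rewrite uT.
by rewrite WT ltnNge -ltnS WS.
Qed.

Lemma elimination e (z : V) : inspan (fun S => Q S /\ ndeg S = e) z ->
  lin D z = 0 ->
  exists2 y, inspan (fun S => Q S /\ ndeg S = e.+1) y &
    inspan (fun S => [/\ Q S, ndeg S = e, ~~ up S & ~~ dn S]) (z - lin D y).
Proof.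
move=> qz Dz; have [N hN] := inspan_bound W z.
have [|y qy uy] := @elim_up N e z qz; first by apply: inspanS hN.
exists y => //; have [M hM] := inspan_bound (fun S => W (sp S)) (z - lin D y).
have DD : lin D (z - lin D y) = 0.
  rewrite linearB; have := dT_dT y; rewrite /= => ->; rewrite subr0; exact: Dz.
have uy' : inspan (fun S => Q S /\ ~~ up S) (z - lin D y).
  by apply: inspanS uy => S _ [[]].
have nd := elim_dn uy' DD (inspanS (fun S _ h _ => h) hM).
by move=> s sx; have [[? ?] ?] := uy s sx; split=> //; apply: nd.
Qed.

End Elimination.

Lemma legit_thin S : legit S -> ar_in (st_ar S) = 0%N ->
  ar_out (st_ar S) = 0%N /\ (0 < up S)%N.
Proof.
elim/stacking_mem_ind: S => // a p0 ss IH.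
rewrite legit_node => /and3P[cs la lss] /=; rewrite -[ar_in (_, _, _)]/(ar_in a + p0)%N.
move=> /eqP; rewrite addn_eq0 => /andP[/eqP a0 /eqP p00]; move: cs; rewrite p00 => cs.
have sz := composable_up cs; case/andP: cs => _.
change (chained 0 (map st_ar ss) ->
  (ar_out a + top 0 (map st_ar ss))%N = 0%N /\ (0 < width ss)%N).
rewrite (lax_out la) a0; case/andP: la => a2 _; rewrite a0 -sz in a2.
have H : chained 0 (map st_ar ss) -> top 0 (map st_ar ss) = 0%N /\ (size ss <= width ss)%N.
  elim: ss IH lss {a2 sz} => //= s ss IHs IH /andP[ls lss] /andP[/eqP s0 ch].
  have [o0 u0] := IH s (mem_head _ _) ls s0; rewrite o0 in ch; rewrite top_cons o0.
  by have [-> h] := IHs (mem_tail IH) lss ch; rewrite width_cons -add1n leq_add.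
by move=> /H[-> h]; split=> //; apply: leq_trans h; apply: leq_trans a2.
Qed.

Lemma legit_pos S : legit S -> (0 < ar_in (st_ar S))%N -> (0 < ar_out (st_ar S))%N.
Proof.
elim/stacking_mem_ind: S => // a p0 ss IH.
rewrite legit_node => /and3P[cs la lss].
change ((0 < ar_in a + p0)%N -> (0 < ar_out a + top p0 (map st_ar ss))%N).
rewrite (lax_out la); case: (posnP (ar_in a)) => [->|a0 _]; last by [].
rewrite !add0n => p00; case/andP: cs => _.
elim: ss p0 p00 IH lss => //= s ss IHs p0 p00 IH /andP[ls lss] /andP[/eqP s0 ch].
rewrite top_cons; apply: IHs ch => //; last exact: mem_tail IH.
by apply: IH (mem_head _ _) ls _; rewrite s0.
Qed.

Lemma node_neq_kid a p ss S : S \in ss -> Node a p ss <> S.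
Proof.
move=> Sss /(congr1 (size \o boxes)) /= E.
have : (size (boxes S) <= sumn (map (size \o boxes) ss))%N.
  by apply: mem_sumn; apply: (map_f (size \o boxes)).
by rewrite -E size_flatten /shape -map_comp ltnn.
Qed.

(* The term of the differential of a thin box above which [ss] sits that      *)
(* groups the [b] entries of [ss] from position [i] on.                       *)
Definition splitn p (ss : seq stacking) i b :=
  Node (lax_arity 0 (size ss - b).+1) p (take i ss ++
    Node (lax_arity 0 b) (top p (map st_ar (take i ss))) (take b (drop i ss)) ::
    drop (i + b) ss).

Section Splits.
Variable k : fieldType.
Notation V := (fmod k).
Notation D := (dS k tq).
Notation sn b := ((-1) ^+ (nat_of_bool b) : k).

Lemma graft_erow_split p ss n i : size ss = n -> forall n2, (n2 < n)%N -> (i < n2)%N ->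
  graft (Node (lax_arity 0 n2) 0 (erow n2 i (n.+1 - n2))) p ss =
    splitn p ss i (n.+1 - n2).
Proof.
move=> sz n2 n2n i2; set b := (n.+1 - n2)%N.
have ib : (i + b <= n)%N by rewrite /b; move: n2n i2; clear; lia.
have Ess : ss = take i ss ++ (take b (drop i ss) ++ drop (i + b) ss).
  by rewrite addnC -drop_drop !cat_take_drop.
have s1 : size (take i ss) = i by rewrite size_takel // sz; move: ib; clear; lia.
have s2 : size (take b (drop i ss)) = b.
  by rewrite size_takel // size_drop sz; move: ib; clear; lia.
have s3 : size (drop (i + b) ss) = (n2 - i.+1)%N.
  by rewrite size_drop sz /b; move: n2n i2; clear; lia.
rewrite graft_node add0n /splitn sz; congr (Node (lax_arity 0 _) _ _).
  by rewrite /b; move: n2n i2; clear; lia.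
rewrite {1}Ess /erow -[beta b :: _]cat1s graft_row_catE ?width_eta //.
rewrite graft_row_eta // graft_row_catE; last first.
  by rewrite s2 width_cons beta_ar /width /= /ar_up /= addn0.
rewrite (graft_row_eta _ s3) graft_cons beta_ar -[ar_up _]/b.
by rewrite (@take_oversize _ b (take b (drop i ss))) ?s2 // graft_beta.
Qed.

Lemma gr_thin p ss n : size ss = n -> (2 <= n)%N ->
  gr p ss (dgen k tq (lax_arity 0 n)) = - \sum_(n2 < n | (2 <= n2)%N) \sum_(i < n2)
    sn (kap (Node (lax_arity 0 n2) 0 (erow n2 i (n.+1 - n2))) ss) *:
      bas (splitn p ss i (n.+1 - n2)).
Proof.
move=> sz n2; rewrite gr_dgen; last exact: lax_arity_box.
rewrite (sum_tq _ (fun S => sn (kap S ss) *: bas (graft S p ss))).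
rewrite -[ar_in (lax_arity 0 n)]/0%N -[ar_up (lax_arity 0 n)]/n eqxx.
rewrite subr0 scaleN1r; congr (- _); apply: eq_bigr => m _; apply: eq_bigr => i _.
by rewrite (graft_erow_split _ sz).
Qed.

Lemma inspan_gr_thin P p ss n : size ss = n -> (2 <= n)%N ->
  (forall i b, (2 <= b < n)%N -> (i + b <= n)%N -> P (splitn p ss i b)) ->
  inspan P (gr p ss (dgen k tq (lax_arity 0 n))).
Proof.
move=> sz n2 H; rewrite gr_thin // -scaleN1r; apply: inspanZ.
rewrite -big_filter; apply: inspan_sum => m; rewrite mem_filter => /andP[m2 _].
apply: inspan_sum => i _; apply: inspanZ; apply: inspan_bas; apply: H.
  by move: m2 (ltn_ord m); clear; lia.
by move: m2 (ltn_ord m) (ltn_ord i); clear; lia.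
Qed.

Lemma legit_splitn p ss n i b : legit (Node (lax_arity 0 n) p ss) ->
  (2 <= b < n)%N -> (i + b <= n)%N -> legit (splitn p ss i b).
Proof.
rewrite legit_node => /and3P[cs la lss] bn ib; have sz := composable_up cs.
rewrite -[ar_up _]/n in sz.
have n2n : (n.+1 - b < n)%N by move: bn; clear; lia.
have i2 : (i < n.+1 - b)%N by move: bn ib; clear; lia.
have Eb : b = (n.+1 - (n.+1 - b))%N by move: bn; clear; lia.
rewrite Eb -(graft_erow_split p sz n2n i2).
set x := Node _ _ _; have xin : ((0 == 0)%N, x) \in tq (lax_arity 0 n).
  rewrite /tq mem_cat; apply/orP; left; apply/allpairsPdep.
  exists (n.+1 - b)%N, i; rewrite mem_filter !mem_iota /= add0n.
  split=> //; rewrite /lax_arity /ar_in /ar_up /=; move: bn; clear; lia.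
have [lx ax _ _] := tqP la xin.
by have [] := legit_graft (q0 := p) lx lss; rewrite ?ax.
Qed.

(** At the smaller of two positions one side has the new thin box and the other side a child of that
    box, which has fewer boxes. So different splittings are different stackings, and each has
    coefficient 1 or -1 ([cf_splitn]). *)
Lemma splitn_inj p ss i b i' b' : (i + b <= size ss)%N -> (i' + b' <= size ss)%N ->
  (2 <= b)%N -> (2 <= b')%N ->
  splitn p ss i b = splitn p ss i' b' -> i = i' /\ b = b'.
Proof.
move=> h h' b2 b2' [Eb]; have {}Eb : b = b' by move: h h' Eb; clear; lia.
rewrite -Eb {b' Eb b2'} in h' * => E; split=> //; apply/eqP.
have key j j' : (j < j')%N -> (j' + b <= size ss)%N ->
    take j ss ++ Node (lax_arity 0 b) (top p (map st_ar (take j ss))) (take b (drop j ss)) ::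
      drop (j + b) ss <>
    take j' ss ++ Node (lax_arity 0 b) (top p (map st_ar (take j' ss))) (take b (drop j' ss)) ::
      drop (j' + b) ss.
  move=> jj hj /(congr1 (fun s => nth Eta s j)).
  have sj : (j < size ss)%N by move: jj hj; clear; lia.
  have sj' : (j' <= size ss)%N by move: hj; clear; lia.
  rewrite !nth_cat !size_takel ?(ltnW sj) // ltnn jj subnn nth_take //=.
  apply: node_neq_kid; rewrite (drop_nth Eta sj).
  by case: (b) b2 => // b1 _; rewrite mem_head.
rewrite eqn_leq; apply/andP; split; rewrite leqNgt; apply/negP => lt.
  by apply: (key i' i) => //; rewrite E.
by apply: (key i i').
Qed.

Lemma cfD S (x y : V) : cf S (x + y) = cf S x + cf S y.
Proof. by rewrite /cf linearD. Qed.

Lemma cf_sumP S (I : Type) (r : seq I) (P : pred I) (F : I -> V) :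
  cf S (\sum_(i <- r | P i) F i) = \sum_(i <- r | P i) cf S (F i).
Proof. by rewrite /cf linear_sum. Qed.

Lemma cf_splitn p ss n i b : legit (Node (lax_arity 0 n) p ss) ->
  (2 <= b < n)%N -> (i + b <= n)%N ->
  cf (splitn p ss i b) (gr p ss (dgen k tq (lax_arity 0 n))) != 0.
Proof.
move=> lN bn ib; have := lN; rewrite legit_node => /and3P[cs la lss].
have sz := composable_up cs; rewrite -[ar_up _]/n in sz.
have n2 : (2 <= n)%N by case/andP: la.
rewrite gr_thin // -scaleN1r cfZ; apply: mulf_neq0; first by rewrite oppr_eq0 oner_eq0.
rewrite cf_sumP.
have n2n : (n.+1 - b < n)%N by move: bn; clear; lia.
have i2 : (i < n.+1 - b)%N by move: bn ib; clear; lia.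
have Eb : (n.+1 - (n.+1 - b) = b)%N by move: bn; clear; lia.
have cb i' b' : (2 <= b' < n)%N -> (i' + b' <= n)%N ->
   cf (splitn p ss i b) (bas (splitn p ss i' b')) = ((i' == i) && (b' == b))%:R.
  move=> bn' ib'; rewrite /cf lin_bas; last exact: legit_splitn lN bn' ib'.
  congr (_ %:R); congr nat_of_bool; apply/eqP/andP => [E|[/eqP -> /eqP -> //]].
  case: (splitn_inj _ _ _ _ E); rewrite ?sz //; first by case/andP: bn'.
    by case/andP: bn.
  by move=> -> ->.
rewrite (bigD1 (Ordinal n2n)) /=; last by move: bn; clear; lia.
rewrite cf_sumP (bigD1 (Ordinal i2)) //= cfZ Eb cb // !eqxx mulr1.
rewrite [X in _ + X + _]big1 => [|j nj]; last first.
  rewrite cfZ cb //; last by move: (ltn_ord j) bn; clear; lia.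
  by move: nj; rewrite -val_eqE /= => /negPf ->; rewrite mulr0.
rewrite [X in _ + X]big1 => [|m /andP[m2 nm]]; last first.
  rewrite cf_sumP big1 // => j _; rewrite cfZ cb.
  - have /negPf -> : (n.+1 - m != b)%N.
      by apply: contra nm; rewrite -val_eqE /=; move: bn (ltn_ord m); clear; lia.
    by rewrite andbF mulr0.
  - by move: (ltn_ord m) m2; clear; lia.
  by move: (ltn_ord m) (ltn_ord j); clear; lia.
by rewrite !addr0 signr_eq0.
Qed.

Lemma inspan_drow_bas P (F : seq stacking -> stacking) ss :
  (forall l s r, ss = l ++ s :: r -> inspan (fun s' => P (F (l ++ s' :: r))) (D s)) ->
  inspan P (drow_ D (fun r => bas (F r) : V) ss).
Proof.
elim: ss F => [|s ss IH] F H; first exact: inspan0.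
rewrite drow_cons; apply: inspanD.
  by apply: (inspan_lin (H [::] s ss erefl)) => s' _ Ps'; apply: inspan_bas.
apply: inspanZ; apply: (IH (fun r => F (s :: r))) => l s0 r E.
by apply: (H (s :: l)); rewrite E.
Qed.

Lemma dgen_deg0 a : is_lax_box a -> (ar_in a + ar_up a = 2)%N -> dgen k tq a = 0.
Proof.
move=> la a2; rewrite /dgen big_seq big1 // => x xa.
by have [_ _ _] := tqP la xa; rewrite a2.
Qed.
End Splits.

(** * No incoming wires: the matching on planar trees *)

Section ThinAcyclic.
Variable k : fieldType.
Notation V := (fmod k).
Notation D := (dS k tq).
Variable q : nat.

(** A root with entries K, r_1, ..., r_n, n > 1, is matched with the binary root over K and a thin
    box containing r_1, ..., r_n. Unmatched are the identity and the binary roots whose second entry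
    is the identity. The weight [W0] counts the inputs of the second entry. *)
Definition up0 S := if S is Node _ _ [:: _; Node _ _ _] then true else false.
Definition dn0 S := if S is Node _ _ ss then (3 <= size ss)%N else false.
Definition sp0 S := if S is Node a p (K :: r)
  then Node (lax_arity 0 2) 0 [:: K; Node (lax_arity 0 (size r)) 0 r] else S.
Definition pt0 S := if S is Node a p [:: K; Node a' p' r]
  then Node (lax_arity 0 (size r).+1) 0 (K :: r) else S.
Definition W0 S := if S is Node _ _ [:: _; K] then ar_up (st_ar K) else 0%N.
Definition Q0 S := st_ar S = (0, q, 0)%N.

Lemma thin_node a p ss : legit (Node a p ss) -> ar_in (st_ar (Node a p ss)) = 0%N ->
  [/\ a = lax_arity 0 (size ss), p = 0%N, (2 <= size ss)%N, all legit ss &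
      all (fun s => (ar_in (st_ar s) == 0%N) && (ar_out (st_ar s) == 0%N)) ss].
Proof.
rewrite legit_node => /and3P[cs la lss]; rewrite -[ar_in _]/(ar_in a + p)%N => /eqP.
rewrite addn_eq0 => /andP[/eqP a0 /eqP p00]; have sz := composable_up cs.
move: (la) => /andP[a2 /eqP Ea]; rewrite a0 -sz in a2 Ea; split=> //.
move: cs; rewrite p00 => /andP[_]; elim: (ss) lss => //= s ss' IH /andP[ls lss'].
move=> /andP[/eqP s0 ch]; have [o0 _] := legit_thin ls s0; rewrite s0 o0 /=.
by rewrite o0 in ch; apply: IH.
Qed.

Lemma thin_chain ss : all (fun s => (ar_in (st_ar s) == 0%N) && (ar_out (st_ar s) == 0%N)) ss ->
  chained 0 (map st_ar ss) /\ top 0 (map st_ar ss) = 0%N.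
Proof.
by elim: ss => //= s ss IH /andP[/andP[-> /eqP o0] /IH[c t]]; rewrite top_cons o0.
Qed.

Lemma acyclic0_elim e (z : V) : inspan (fun S => Q0 S /\ ndeg S = e) z ->
  lin D z = 0 ->
  exists2 y, inspan (fun S => Q0 S /\ ndeg S = e.+1) y &
    inspan (fun S => [/\ Q0 S, ndeg S = e, ~~ up0 S & ~~ dn0 S]) (z - lin D y).
Proof.
apply: (@elimination k Q0 up0 dn0 sp0 pt0 W0).
- by move=> S lS qS; apply: inspanS (dS_span tqP lS) => S' _ [E _ _]; rewrite /Q0 E.
- case=> // a p [|K [|[|a' p' r] [|? ?]]] // lS QS _.
  have i0 : ar_in (st_ar (Node a p [:: K; Node a' p' r])) = 0%N by rewrite QS.
  have [Ea Ep _ /and3P[lK lN _] /and3P[tK tN _]] := thin_node lS i0.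
  have i1 : ar_in (st_ar (Node a' p' r)) = 0%N by case/andP: tN => /eqP.
  have [Ea' Ep' r2 lr tr] := thin_node lN i1.
  have [ch tp] := @thin_chain (K :: r) (introT andP (conj tK tr)).
  have [ch' tp'] := thin_chain tr.
  have lpt : legit (Node (lax_arity 0 (size r).+1) 0 (K :: r)).
    rewrite legit_node /composable size_map ch eqxx /= lK lr.
    by rewrite lax_arity_box //; apply: ltnW.
  split=> //; rewrite /pt0.
  + move: QS; rewrite /Q0 Ea Ep Ea' Ep'.
    rewrite [LHS]/= [st_ar (Node _ 0 (K :: r))]/= -/(map st_ar r).
    rewrite /comp_arity /= !top_cons tp'.
    case/andP: tK => /eqP Ki /eqP Ko; rewrite Ko [top 0 _]tp' => -[<-].
    by rewrite /ar_up /= !addn0.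
  + by rewrite /sp0 Ea Ep Ea' Ep'.
  rewrite Ea Ep Ea' Ep' !ndeg_node /= !ndeg_node /lax_arity /ar_in /ar_up /=.
  by move: r2; clear; lia.
- case=> // a p ss lT QT dT; have i0 : ar_in (st_ar (Node a p ss)) = 0%N by rewrite QT.
  have [Ea Ep _ lss tss] := thin_node lT i0; move: dT lT QT lss tss; rewrite Ea Ep {a p Ea Ep i0}.
  case: ss => // K r; rewrite /dn0 => dT lT QT /andP[lK lr] tKr.
  have [tK tr] := andP tKr.
  have Esp : sp0 (Node (lax_arity 0 (size (K :: r))) 0 (K :: r)) = splitn 0 (K :: r) 1 (size r).
    rewrite /splitn /sp0 /= subSn // subnn take0 drop0 take_size drop_size.
    by rewrite top_cons; case/andP: tK => _ /eqP ->.
  have b1 : (2 <= size r < size (K :: r))%N by rewrite /= leqnn andbT.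
  have b2 : (1 + size r <= size (K :: r))%N by [].
  split=> //.
    rewrite Esp dS_node cfD cfZ.
    rewrite [X in _ + _ * X](cf_inspan (P := fun S => if S is Node a _ _ then ar_up a = size (K :: r) else False)).
    + by rewrite mulr0 addr0; apply: cf_splitn.
    + by apply: inspan_drow_bas => l s r' _ t _.
    rewrite /splitn /lax_arity /ar_up /= subSn // subnn => -[E].
    by move: b1; rewrite -E.
  rewrite dS_node; apply: inspanD.
    apply: inspan_gr_thin => // [|i b bn ib]; first by apply: ltnW; apply: leq_trans dT.
    (* Grouping a shorter run leaves three entries, so the result is not [up0]; grouping all entries
       but the last one gives a second entry with fewer inputs than that of the leading term. *)
    have [Eb|nb] := eqVneq b (size r); last first.
      right; left; rewrite /splitn /up0.
      set L := take i _ ++ _; have : (2 < size L)%N.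
        rewrite size_cat size_takel; last by apply: leq_trans ib; apply: leq_addr.
        rewrite [size (_ :: _)]/= size_drop; move: nb bn ib; rewrite -[size (K :: r)]/(size r).+1.
        by move: (size r); clear; lia.
      by case: L => [|x1 [|[|? ? ?] [|? ?]]].
    case: i ib => [|[|i]] ib; last first.
      by move: ib; rewrite Eb -[size (K :: r)]/(size r).+1; move: (size r); clear; lia.
      by left; rewrite Eb Esp.
    right; right; rewrite Eb -[X in (_ < X)%N]/(width r).
    have {}lr : all legit r := lr.
    have {}tr : all (fun s => (ar_in (st_ar s) == 0%N) && (ar_out (st_ar s) == 0%N)) r := tr.
    case/lastP: r b1 {dT lT QT tKr b2 Esp Eb ib bn} lr tr => // r x.
    rewrite size_rcons !all_rcons => r2 /andP[lx lr] /andP[/andP[/eqP xi _] tr].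
    have Ed : drop (size r).+1 (K :: rcons r x) = [:: x].
      by rewrite -rcons_cons -cats1 drop_size_cat.
    have [_ ux] := legit_thin lx xi.
    rewrite /splitn take0 drop0 cat0s add0n Ed -[X in (X < _)%N]/(up x).
    rewrite -cats1 width_cat width_cons -[X in (X < _)%N]add0n addn0 ltn_add2r.
    case: r r2 lr tr {Ed} => // y r _ /andP[ly _] /andP[/andP[/eqP yi _] _].
    by rewrite width_cons; have [_ uy] := legit_thin ly yi; apply: ltn_addr.
  apply: inspanZ; apply: inspan_drow_bas => l s r' E.
  have sE : (size l + size r' = size r)%N.
    by move/(congr1 size): E; rewrite size_cat /= addnS => -[].
  move=> t _; right; left; rewrite /up0; set L := _ ++ _.
  have : (2 < size L)%N by rewrite size_cat /= addnS sE.
  by case: L => [|x1 [|[|? ? ?] [|? ?]]].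
case=> [|a p ss] lS QS nu nd; first exact: inspan0.
have i0 : ar_in (st_ar (Node a p ss)) = 0%N by rewrite QS.
have [Ea Ep s2 lss tss] := thin_node lS i0.
case: ss s2 lss tss nu nd Ea lS {QS i0} => [|Y [|[|? ? ?] [|? ?]]] // _ _ _ _ _ Ea lS.
rewrite dS_node Ea dgen_deg0 // linear0 add0r; apply: inspanZ.
apply: inspan_drow_bas => -[|l0 [|l1 l]] s r' /= [].
- by move=> _ <- t _.
- by move=> _ <- _; apply: inspan0.
by case: l.
Qed.
End ThinAcyclic.

(** * Incoming wires: the matching by moves *)

Definition isc S := if S is Node a _ _ then a == (2, 0, 1)%N else false.
Definition isF S := if S is Node a _ _ then a == (1, 1, 1)%N else false.
Definition isg S := if S is Node a _ [:: x; y] then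
  [&& ar_in a == 0%N, isF x & isc y] else false.
Definition clet s := Node (2, 0, 1)%N s [::].
Definition Flet K := Node (1, 1, 1)%N (ar_in (st_ar K)) [:: K].
Definition gpair x y := Node (lax_arity 0 2) (ar_in (st_ar x)) [:: x; y].

(* The row c, ..., c, F(K_1), ..., F(K_n) whose corolla is the leading term   *)
(* of the differential of a letter with entries K_1, ..., K_n.                *)
Definition crow a b := [seq clet (a - 2 - i + b) | i <- iota 0 a.-1].
Definition corow a b Ks := crow a b ++ map Flet Ks.
Definition corolla a b Ks := Node (lax_arity 0 (a.-1 + size Ks)) (a + b) (corow a b Ks).

Definition mergeF S := if S is Node _ _ (K :: _) then K else Eta.
Definition merge_letter p ss :=
  Node (lax_arity (count isc ss).+1 (count isF ss)) (p - (count isc ss).+1)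
    (map mergeF (filter isF ss)).

(** A move is described by whether it lowers the degree, whether it expands or merges a non-thin box
    (rather than grouping or ungrouping a pair F(K), c), and the number of letters before it. *)
Definition mv := (bool * bool * nat)%type.

Definition scan_ (st : stacking -> option (mv * stacking)) :=
  fix scan (ss : seq stacking) : option (mv * seq stacking) :=
  match ss with
  | [::] => None
  | s :: r =>
    if isF s && isc (head Eta r) then
      Some ((true, false, 0%N), gpair s (head Eta r) :: behead r)
    else if isc s || isF s then
      if scan r is Some ((d, t, i), r') then Some ((d, t, i.+1), s :: r') else None
    else if isg s then
      Some ((false, false, 0%N), (if s is Node _ _ l then l else [::]) ++ r)
    else if st s is Some (m, s') then Some (m, s' :: r) else None
  end.

(** The partner of [S]. A non-thin root other than c and F is expanded to its corolla. Over a thin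
    root the entries are read until the pattern c, ..., c, F, ..., F breaks, and the break is
    changed; an unbroken row is merged into one box. The value [None] on stackings with incoming
    wires marks the critical ones. *)
Fixpoint st (S : stacking) : option (mv * stacking) :=
  match S with
  | Eta => None
  | Node a p ss =>
    if (0 < ar_in a)%N then
      if (a == (2, 0, 1)%N) || (a == (1, 1, 1)%N) then None
      else Some ((true, true, 0%N), corolla (ar_in a) p ss)
    else if isg S then None else
    match scan_ st ss with
    | None => Some ((false, true, 0%N), merge_letter p ss)
    | Some (m, ss') => Some (m, Node (lax_arity 0 (size ss')) p ss')
    end
  end.

Notation scan := (scan_ st).

Lemma st_thin a p ss : ar_in a = 0%N -> isg (Node a p ss) = false ->
  st (Node a p ss) = match scan ss with
    | None => Some ((false, true, 0%N), merge_letter p ss)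
    | Some (m, ss') => Some (m, Node (lax_arity 0 (size ss')) p ss')
    end.
Proof.
move=> a0 ng; transitivity (if (0 < ar_in a)%N then
      if (a == (2, 0, 1)%N) || (a == (1, 1, 1)%N) then None
      else Some ((true, true, 0%N), corolla (ar_in a) p ss)
    else if isg (Node a p ss) then None else match scan ss with
    | None => Some ((false, true, 0%N), merge_letter p ss)
    | Some (m, ss') => Some (m, Node (lax_arity 0 (size ss')) p ss')
    end); first by [].
by rewrite a0 ng.
Qed.

Lemma scan_cons s r : scan (s :: r) =
    if isF s && isc (head Eta r) then
      Some ((true, false, 0%N), gpair s (head Eta r) :: behead r)
    else if isc s || isF s then
      if scan r is Some ((d, t, i), r') then Some ((d, t, i.+1), s :: r') else None
    else if isg s then
      Some ((false, false, 0%N), (if s is Node _ _ l then l else [::]) ++ r)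
    else if st s is Some (m, s') then Some (m, s' :: r) else None.
Proof. by []. Qed.

(** The pattern c, ..., c, F, ..., F. For legitimate rows with incoming wires this says that the row
    is a [corow] ([pfx_inv]). *)
Definition pfx A := all (fun s => isc s || isF s) A &&
  sorted (fun x y => y ==> x) (map isc A).

Lemma isFc s : isF s -> isc s = false.
Proof. by case: s => // a p ss /eqP ->. Qed.

Lemma pfx_cons s A : pfx (s :: A) =
  [&& isc s || isF s, ~~ (isF s && isc (head Eta A)) & pfx A].
Proof.
rewrite /pfx /=; case E: (isc s || isF s) => //=.
case: A => [|y A] /=; first by rewrite andbF.
have -> : isF s = ~~ isc s.
  by case/orP: E => h; rewrite ?h ?isFc //; apply/negbTE; apply: contraL h => /isFc ->.
by case: (isc s); case: (isc y) => //=; rewrite ?andbF ?andbT.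
Qed.

Lemma pfx_cat A B : pfx (A ++ B) -> pfx A /\ pfx B.
Proof.
elim: A => //= s A IH; rewrite !pfx_cons => /and3P[-> h /IH[pA pB]]; split=> //=.
by rewrite pA andbT; case: A h {IH pA} => //=; rewrite andbF.
Qed.

Lemma scan_pfx A R : pfx A -> ~~ isc (head Eta R) ->
  scan (A ++ R) = if scan R is Some ((d, t, i), R')
    then Some ((d, t, (size A + i)%N), A ++ R') else None.
Proof.
elim: A => [|s A IH]; first by move=> _ _; case: (scan R) => [[[[]]]|].
rewrite pfx_cons => /and3P[ls nF pA] nc; rewrite cat_cons scan_cons.
have -> : isF s && isc (head Eta (A ++ R)) = false.
  by case: A nF {IH pA} => [|y A] /= nF; [rewrite (negPf nc) andbF | apply: negbTE].
by rewrite ls IH //; case: (scan R) => [[[[? ?] ?] ?]|].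
Qed.

Lemma scan_pfx0 A : pfx A -> scan A = None.
Proof. by move=> pA; rewrite -[A]cats0 scan_pfx. Qed.

Lemma st_none S : legit S -> (0 < ar_in (st_ar S))%N -> st S = None ->
  [|| isc S, isF S | isg S].
Proof.
case: S => // a p ss lS _; case: (posnP (ar_in a)) => a0; last first.
  by rewrite /= a0; case: (a == _) => //; case: (a == _).
case E: (isg _); first by rewrite !orbT.
by rewrite st_thin //; case: (scan ss) => [[]|].
Qed.

Lemma st_letter S : isc S || isF S -> st S = None.
Proof. by case: S => // a p ss /= h; rewrite h; case/orP: h => /eqP ->. Qed.

Lemma st_g S : isg S -> st S = None.
Proof.
case: S => // a p [|x [|y [|? ?]]] // h; have /and3P[/eqP a0 _ _] := h.
transitivity (if isg (Node a p [:: x; y]) then None else st (Node a p [:: x; y])).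
  by rewrite /= a0; case: ifP.
by rewrite h.
Qed.

(* A move changes the first break after a prefix [A] of c's followed by F's.  *)
Inductive scan_spec ss : option (mv * seq stacking) -> Prop :=
| ScanNone : pfx ss -> scan_spec ss None
| ScanFc A x y R : pfx A -> isF x -> isc y -> ss = A ++ x :: y :: R ->
   scan_spec ss (Some ((true, false, size A), A ++ gpair x y :: R))
| ScanG A x y R b : pfx A -> isF x -> isc y ->
   ss = A ++ Node (lax_arity 0 2) b [:: x; y] :: R -> b = ar_in (st_ar x) ->
   scan_spec ss (Some ((false, false, size A), A ++ x :: y :: R))
| ScanDeep A T T' R d t i : pfx A -> st T = Some ((d, t, i), T') ->
   legit T -> (0 < ar_in (st_ar T))%N -> ss = A ++ T :: R ->
   scan_spec ss (Some ((d, t, (size A + i)%N), A ++ T' :: R)).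

Lemma scanP ss p : all legit ss -> chained p (map st_ar ss) -> (0 < p)%N ->
  scan_spec ss (scan ss).
Proof.
elim: ss p => [|s r IH] p; first by move=> _ _ _; apply: ScanNone.
rewrite scan_cons => /= /andP[ls lr] /andP[/eqP sp ch] p0.
have s0 : (0 < ar_in (st_ar s))%N by rewrite sp.
case: ifP => [/andP[Fs]|nF].
  case: r {IH lr ch} => [//|y r] /= cy.
  by apply: (ScanFc (A := [::])).
case: ifP => [lets|nl].
  have pf A : pfx A -> isc (head Eta A) = isc (head Eta r) -> pfx (s :: A).
    by move=> pA hA; rewrite pfx_cons lets pA hA nF.
  have hd A R : r = A ++ R -> A != [::] -> isc (head Eta A) = isc (head Eta r).
    by move=> ->; case: A.
  have pf1 A R : pfx A -> r = A ++ R -> ~~ isc (head Eta R) -> pfx (s :: A).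
    case: A => [_ _ _|x A pA E _]; last by apply: pf => //; rewrite E.
    by rewrite pfx_cons lets /= andbF.
  case: (IH _ lr ch (legit_pos ls s0)) => [pr|A x y R pA Fx cy E|A x y R b pA Fx cy E Eb|
      A T T' R d t i pA sT lT T0 E].
  - by apply: ScanNone; apply: pf.
  - apply: (ScanFc (A := s :: A)) => //; last by rewrite E.
    by apply: pf1 pA E _; rewrite /= isFc.
  - apply: (ScanG (A := s :: A) (b := b)) => //; last by rewrite E.
    by apply: pf1 pA E _.
  apply: (ScanDeep (A := s :: A) (T := T) (T' := T')) => //; last by rewrite E.
  apply: pf1 pA E _; apply/negP => /= cT.
  by rewrite (st_letter (introT orP (or_introl cT))) in sT.
case: ifP => [gs|ng].
  case: s gs ls {sp s0 nF nl ch} => // a b [|x [|y [|? ?]]] // /and3P[/eqP a0 Fx cy].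
  rewrite legit_node => /and3P[/andP[/eqP sz chx] /andP[_ /eqP Ea] _].
  apply: (@ScanG _ [::] x y r b) => //=.
    by rewrite Ea a0 -sz.
  by move: chx => /= /andP[/eqP ->].
case E: (st s) => [[[[d t] i] s']|]; last first.
  by have := st_none ls s0 E; rewrite orbA nl ng.
by apply: (ScanDeep (A := [::]) (T := s) (T' := s')).
Qed.

Lemma scan_Fc A x y R : pfx A -> isF x -> isc y ->
  scan (A ++ x :: y :: R) = Some ((true, false, size A), A ++ gpair x y :: R).
Proof.
move=> pA Fx cy; rewrite scan_pfx //; last by rewrite /= isFc.
by rewrite scan_cons [head _ _]/= Fx cy /= addn0.
Qed.

Lemma scan_G A x y R b : pfx A -> isF x -> isc y ->
  scan (A ++ Node (lax_arity 0 2) b [:: x; y] :: R) =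
    Some ((false, false, size A), A ++ x :: y :: R).
Proof.
move=> pA Fx cy; rewrite scan_pfx // scan_cons.
by rewrite [isF (Node _ _ _)]/= [isc (Node _ _ _)]/= [isg _]/= Fx cy /= addn0.
Qed.

Lemma scan_deep A T R d t i T' : pfx A -> st T = Some ((d, t, i), T') ->
  scan (A ++ T :: R) = Some ((d, t, (size A + i)%N), A ++ T' :: R).
Proof.
move=> pA sT.
have nl : isc T || isF T = false by apply/negbTE/negP => /st_letter E; rewrite E in sT.
have ng : isg T = false by apply/negbTE/negP => /st_g E; rewrite E in sT.
have [nc nF] := norP (negbT nl).
by rewrite scan_pfx // scan_cons (negPf nF) (negPf nc) ng sT.
Qed.

Lemma crowS a b : crow a.+2 b = clet (a + b) :: crow a.+1 b.
Proof.
rewrite /crow [iota 0 a.+2.-1]/= map_cons; congr (clet _ :: _).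
  by clear; lia.
rewrite -[1%N]/(1 + 0)%N iotaDl -map_comp; apply: eq_map => i /=.
by congr clet; clear; lia.
Qed.

Lemma size_corow a b Ks : size (corow a b Ks) = (a.-1 + size Ks)%N.
Proof. by rewrite size_cat !size_map size_iota. Qed.

Lemma pfx_F Ks : pfx (map Flet Ks).
Proof. by elim: Ks => // K Ks IH; rewrite map_cons pfx_cons IH /=; case: Ks {IH}. Qed.

Lemma pfx_corow a b Ks : pfx (corow a b Ks).
Proof.
case: a => [|a]; first exact: pfx_F.
elim: a => [|a IH]; first exact: pfx_F.
by rewrite /corow crowS cat_cons pfx_cons IH.
Qed.

Lemma flet_facts K : legit K -> [/\ legit (Flet K),
  st_ar (Flet K) = ((ar_in (st_ar K)).+1, up K, (ar_out (st_ar K)).+1) &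
  ndeg (Flet K) = ndeg K].
Proof.
move=> lK; split.
- by rewrite legit_node /= lK /composable /= eqxx.
- by rewrite /= /comp_arity /top /= addn0 !add1n.
by rewrite ndeg_node /= addn0.
Qed.

Lemma flets_facts b Ks : all legit Ks -> chained b (map st_ar Ks) ->
  [/\ all legit (map Flet Ks), chained b.+1 (map st_ar (map Flet Ks)),
    top b.+1 (map st_ar (map Flet Ks)) = (top b (map st_ar Ks)).+1,
    width (map Flet Ks) = width Ks &
    sumn (map ndeg (map Flet Ks)) = sumn (map ndeg Ks)].
Proof.
elim: Ks b => // K Ks IH b /andP[lK lKs] /andP[/eqP Kb ch].
have [lF aF nF] := flet_facts lK; have [l c t w n] := IH _ lKs ch.
by rewrite !map_cons !width_cons !top_cons aF /= -/(map Flet _) lF l n nF c /= t Kb eqxx w.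
Qed.

Lemma corow_facts a b Ks : (0 < a)%N -> all legit Ks -> chained b (map st_ar Ks) ->
  [/\ all legit (corow a b Ks), chained (a + b) (map st_ar (corow a b Ks)),
    top (a + b) (map st_ar (corow a b Ks)) = (top b (map st_ar Ks)).+1,
    width (corow a b Ks) = width Ks &
    sumn (map ndeg (corow a b Ks)) = sumn (map ndeg Ks)].
Proof.
case: a => // a _ lK ch; elim: a => [|a [l c t w n]]; first exact: flets_facts.
rewrite /corow crowS cat_cons -/(corow a.+1 b Ks) map_cons width_cons top_cons.
have ac : st_ar (clet (a + b)) = ((a.+2 + b)%N, 0%N, (a.+1 + b)%N).
  by rewrite /= /comp_arity /top /= /ar_in /ar_out /= !addnA.
have lc : legit (clet (a + b)) by [].
rewrite ac; split.
- by apply/andP; split.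
- by apply/andP; split; [apply: eqxx | exact: c].
- exact: t.
- exact: w.
exact: n.
Qed.

Lemma merge_corow a b Ks : (0 < a)%N -> merge_letter (a + b)%N (corow a b Ks) =
  Node (lax_arity a (size Ks)) b Ks.
Proof.
case: a => // a _; rewrite /merge_letter.
have [-> [-> ->]] : count isc (corow a.+1 b Ks) = a /\
    count isF (corow a.+1 b Ks) = size Ks /\
    map mergeF (filter isF (corow a.+1 b Ks)) = Ks.
  elim: a => [|a [E1 [E2 E3]]].
    by rewrite /corow /=; elim: Ks => //= K Ks [-> [-> ->]].
  by rewrite /corow crowS cat_cons -/(corow a.+1 b Ks) /= E1 E2 E3.
by rewrite addKn.
Qed.

Lemma pfx_inv ss P : pfx ss -> all legit ss -> chained P (map st_ar ss) -> (0 < P)%N ->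
  exists a b Ks, [/\ (0 < a)%N, P = (a + b)%N, ss = corow a b Ks,
    all legit Ks & chained b (map st_ar Ks)].
Proof.
elim: ss P => [|s ss IH] P; first by exists 1%N, P.-1, [::]; rewrite add1n prednK.
rewrite pfx_cons => /and3P[ls nF pss] /andP[lS lss] /andP[/eqP sP ch] P0.
have o0 : (0 < ar_out (st_ar s))%N by apply: legit_pos; rewrite ?sP.
have [a [b [Ks [a0 Eo Ess lK cK]]]] := IH _ pss lss ch o0.
case: s ls nF lS sP o0 Eo {ch} => // x p0 l /=.
case/orP => /eqP Ex nF; rewrite Ex legit_node => /and3P[cs _ ll] sP o0 Eo.
  have := composable_up cs; case: l cs ll sP o0 Eo => // cs _ sP o0 Eo _.
  move: sP Eo; rewrite /comp_arity /top /ar_in /ar_out /= => sP Eo.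
  case: a a0 Eo Ess => // a _ Eo Ess.
  exists a.+2, b, Ks; split=> //; first by rewrite -sP; move: Eo; clear; lia.
  rewrite /corow crowS cat_cons -/(corow a.+1 b Ks) -Ess; congr (Node _ _ _ :: _).
  by move: Eo; clear; lia.
have := composable_up cs; case: l cs ll sP o0 Eo => // K [|? ?] //.
move=> /andP[_ /andP[/eqP Kp _]] /andP[lK' _] sP o0 Eo _.
move: sP Eo; rewrite /comp_arity /top /ar_in /ar_out /= -/(ar_in _) -/(ar_out _) => sP Eo.
have Ea : a = 1%N.
  by case: a a0 {Eo} Ess nF => [|[|a]] // _ ->; rewrite Ex /corow crowS.
exists 1%N, p0, (K :: Ks); split=> //.
- by rewrite Ess Ea /corow /= /Flet Kp.
- by rewrite /= lK'.
rewrite /= Kp eqxx /=; have -> : ar_out (st_ar K) = b by move: Eo; rewrite Ea; clear; lia.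
exact: cK.
Qed.

Definition st_inv_spec S := forall d t i S', st S = Some ((d, t, i), S') ->
  [/\ legit S', st_ar S' = st_ar S, st S' = Some ((~~ d, t, i), S) &
    if d then ndeg S = (ndeg S').+1 else ndeg S' = (ndeg S).+1].

Lemma gpair_facts x y : legit x -> legit y -> ar_in (st_ar y) = ar_out (st_ar x) ->
  [/\ legit (gpair x y), st_ar (gpair x y) =
     (ar_in (st_ar x), (up x + up y)%N, ar_out (st_ar y)) &
     ndeg (gpair x y) = (ndeg x + ndeg y)%N].
Proof.
move=> lx ly yx; split.
- by rewrite legit_node /composable /= lx ly yx !eqxx.
- by rewrite /= /comp_arity /top /= addn0.
by rewrite ndeg_node /= addn0.
Qed.

Lemma sumn_cons x s : sumn (x :: s) = (x + sumn s)%N.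
Proof. by []. Qed.

Lemma scan_inv ss p d t i ss' : all legit ss -> chained p (map st_ar ss) -> (0 < p)%N ->
  {in ss, forall s, legit s -> (0 < ar_in (st_ar s))%N -> st_inv_spec s} ->
  scan ss = Some ((d, t, i), ss') ->
  [/\ all legit ss', chained p (map st_ar ss') /\
      top p (map st_ar ss') = top p (map st_ar ss), width ss' = width ss,
      scan ss' = Some ((~~ d, t, i), ss) &
      (sumn (map ndeg ss) + size ss + ~~ d = sumn (map ndeg ss') + size ss' + d)%N].
Proof.
move=> lss ch p0 H; case: (scanP lss ch p0) => //.
- move=> A x y R pA Fx cy E [<- <- <- <-]; move: lss ch p0.
  rewrite scan_G // E !map_cat !all_cat !chained_cat !top_cat !sumn_cat !size_cat.
  rewrite ![all _ (_ :: _)]/= !map_cons => /andP[-> /and3P[lx ly ->]].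
  rewrite ![chained _ (_ :: _)]/= => /andP[-> /and3P[/eqP xA /eqP yx cR]] _.
  have [lg ag ng] := gpair_facts lx ly yx.
  rewrite !width_cat !width_cons !top_cons lg ag xA eqxx.
  rewrite -[ar_out (_, _, _)]/(ar_out (st_ar y)) cR.
  rewrite !sumn_cons ng -[ar_up (_, _, _)]/(up x + up y)%N !addnA; split=> //.
  by rewrite ![size (_ :: _)]/=; clear; lia.
- move=> A x y R b pA Fx cy E Eb [<- <- <- <-]; move: lss ch p0.
  rewrite scan_Fc // E -[Node _ _ _]/(Node (lax_arity 0 2) b [:: x; y]) Eb -/(gpair x y).
  rewrite !map_cat !all_cat !chained_cat !top_cat !sumn_cat !size_cat.
  rewrite ![all _ (_ :: _)]/= !map_cons => /andP[-> /andP[]].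
  rewrite -/(gpair x y) legit_node => /and3P[cs _ /and3P[lx ly _]] -> /andP[-> ].
  have yx : ar_in (st_ar y) = ar_out (st_ar x) by case/and3P: cs => _ _ /andP[/eqP].
  have [lg ag ng] := gpair_facts lx ly yx.
  rewrite ag ![chained _ (_ :: _)]/= => /andP[/eqP xA cR] _.
  have {}xA : ar_in (st_ar x) = top p (map st_ar A) := xA.
  rewrite !width_cat !width_cons !top_cons ?ag xA lx ly yx !eqxx.
  rewrite -[ar_out (_, _, _)]/(ar_out (st_ar y)) cR.
  rewrite !sumn_cons ng -[ar_up (_, _, _)]/(up x + up y)%N !addnA; split=> //.
  by rewrite ![size (_ :: _)]/=; clear; lia.
move=> A T T' R d' t' i' pA sT lT T0 E [<- <- <- <-]; move: lss ch p0.
have Tss : T \in ss by rewrite E mem_cat mem_head orbT.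
have [lT' aT' sT' nT'] := H T Tss lT T0 _ _ _ _ sT.
  rewrite (scan_deep R pA sT') E !map_cat !all_cat !chained_cat !top_cat !sumn_cat !size_cat.
  rewrite ![all _ (_ :: _)]/= !map_cons => /andP[-> /andP[_ ->]].
  rewrite !width_cat !width_cons !top_cons ![chained _ (_ :: _)]/= aT' lT'.
  move=> /andP[-> /andP[-> ->]] _; split=> //.
  by rewrite !sumn_cons ![size (_ :: _)]/=; move: nT'; case: (d') => /= ->; clear; lia.
Qed.

(** Expansion and merging are inverse to each other by [merge_corow] and [pfx_inv], grouping and
    ungrouping by their form. As a move leaves the prefix before the break untouched, the opposite
    move is found at the same place. *)
Lemma st_inv S : legit S -> (0 < ar_in (st_ar S))%N -> st_inv_spec S.
Proof.
elim/stacking_mem_ind: S => // a p ss IH lS S0 d t i S'.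
have := lS; rewrite legit_node => /and3P[cs la lss].
have sz := composable_up cs; have ch := proj2 (andP cs).
have [a0|a0] := posnP (ar_in a); last first.
  rewrite /= a0; case: ifP => // nl [<- <- <- <-].
  have [a2 /eqP Ea] := andP la.
  have [l c tp w n] := corow_facts a0 lss ch.
  have s3 : (2 <= (ar_in a).-1 + size ss)%N.
    move: a2 a0 nl; rewrite sz Ea /lax_arity /ar_in /ar_up /=.
    move: (a.1.1) (a.1.2) => x y; case: x => [|[|[|x]]] //; case: y => [|[|y]] //=;
    by rewrite ?eqxx.
  have ng : isg (corolla (ar_in a) p ss) = false.
    apply/negP; rewrite /isg /corolla; case E: (corow _ _ _) => [|x [|y [|? ?]]] //.
    case/and3P => _ Fx cy; have := scan_pfx0 (pfx_corow (ar_in a) p ss).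
    by rewrite E scan_cons /= Fx cy.
  rewrite /corolla in ng *; split.
  - rewrite legit_node /composable size_map size_corow eqxx c l.
    by rewrite lax_arity_box.
  - rewrite /= /comp_arity tp -/(width _) w -[ar_in (lax_arity 0 _)]/0%N add0n.
    by rewrite (lax_out la) a0.
  - by rewrite st_thin // (scan_pfx0 (pfx_corow _ _ _)) merge_corow // sz -Ea.
  rewrite !ndeg_node n sz /lax_arity /ar_in /ar_up /= -/(ar_in a).
  by move: s3 a0; rewrite sz /ar_up; clear; lia.
case Eg: (isg (Node a p ss)); first by rewrite (st_g Eg).
rewrite st_thin //; move: (la) => /andP[a2 /eqP Ea]; rewrite a0 -sz in a2 Ea.
have p0 : (0 < p)%N by move: S0; rewrite /= -[ar_in _]/(ar_in a + p)%N a0.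
case E: (scan ss) => [[[[d' t'] i'] ss']|] [<- <- <- <-].
  have H : {in ss, forall s, legit s -> (0 < ar_in (st_ar s))%N -> st_inv_spec s}.
    by move=> s sss ls s0; apply: IH.
  have [l [c tp] w sc n] := scan_inv lss ch p0 H E.
  (* Grouping shortens the row by one. Only the row F(K), c would become too short, and [Eg]
     excludes it. *)
  have s2 : (2 <= size ss')%N.
    case: (scanP lss ch p0) E => // [A x y R pA Fx cy Ess|A x y R b pA Fx cy Ess Eb|
      A T T' R d1 t1 i1 pA sT lT T0 Ess] [_ _ _ <-]; last first.
    + by move: a2; rewrite Ess !size_cat.
    + by rewrite size_cat /=; clear; lia.
    rewrite size_cat /=; case: A Ess {pA} => [|z A] Ess; last by rewrite /= !addnS.
    case: R Ess => [|z R] Ess; last by [].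
    by move: Eg; rewrite Ess /= a0 Fx cy.
  have ng : isg (Node (lax_arity 0 (size ss')) p ss') = false.
    apply/negP; rewrite /isg; case E': ss' => [|x [|y [|? ?]]] // /and3P[_ Fx cy].
    move: sc; rewrite E' (@scan_Fc [::]) // => -[_ _ _ Ess].
    by move: a2; rewrite -Ess.
  split.
  - by rewrite legit_node /composable size_map eqxx c l lax_arity_box.
  - rewrite /= /comp_arity tp -!/(width _) w [in RHS]Ea.
    by [].
  - by rewrite st_thin // sc -Ea.
  rewrite !ndeg_node a0 -sz /lax_arity /ar_in /ar_up /=.
  by move: n s2 a2; case: (d') => /=; clear; lia.
have pss : pfx ss by case: (scanP lss ch p0) E.
have [x [b [Ks [x0 Ep Ess lK cK]]]] := pfx_inv pss lss ch p0.
have sK : size ss = (x.-1 + size Ks)%N by rewrite Ess size_corow.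
have lx : is_lax_box (lax_arity x (size Ks)).
  by apply: lax_arity_box; move: a2 x0; rewrite sK; clear; lia.
have [l c tp w n] := corow_facts x0 lK cK.
rewrite Ess Ep merge_corow //; split.
- rewrite legit_node lx lK /composable size_map cK.
  by rewrite -[ar_up _]/(size Ks) eqxx.
- rewrite /= /comp_arity tp -!/(width _) w a0 (lax_out la) a0.
  by rewrite /lax_arity /ar_in /ar_out /= x0.
- rewrite /= -[ar_in (lax_arity _ _)]/x x0.
  have -> : ((lax_arity x (size Ks) == (2, 0, 1)%N) || (lax_arity x (size Ks) == (1, 1, 1)%N)) = false.
    apply/negP; move: a2; rewrite sK => h /orP[] /eqP[Ex En _]; move: h; by rewrite Ex En.
  by rewrite /corolla [in RHS]Ea sK.
rewrite !ndeg_node n /lax_arity /ar_in /ar_up /= -/(ar_in a) -/(ar_up a) a0 -sz sK.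
by move: a2 x0; rewrite sK; clear; lia.
Qed.

(** * An order on words of letters *)

Definition bv (v : nat) (w : seq bool) : nat :=
  foldl (fun v (c : bool) => (v.*2 + c)%N) v w.

Lemma bv_cat v w w' : bv v (w ++ w') = bv (bv v w) w'.
Proof. exact: foldl_cat. Qed.

Lemma bv_bounds v w : (v * 2 ^ size w <= bv v w < v.+1 * 2 ^ size w)%N.
Proof.
elim: w v => [|c w IH] v /=; first by rewrite !muln1 leqnn ltnSn.
have /andP[h1 h2] := IH (v.*2 + c)%N; rewrite expnS !mulnA !muln2.
rewrite (leq_trans _ h1) ?(leq_trans h2) //= leq_mul2r; apply/orP; right;
  by case: (c); clear; lia.
Qed.

Lemma bv_short v v' w w' : (v' < v)%N -> (size w' <= size w)%N ->
  (bv v' w' < bv v w)%N.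
Proof.
move=> vv ww; have /andP[_ h] := bv_bounds v' w'; have /andP[h' _] := bv_bounds v w.
apply: leq_trans h (leq_trans _ h'); apply: leq_mul => //.
by rewrite leq_exp2l.
Qed.

Lemma bv_shorter v w w' : (0 < v)%N -> (size w' < size w)%N -> (bv v w' < bv v w)%N.
Proof.
case: w => // c w v0; rewrite ltnS => ww.
by apply: (bv_short (w := w)) => //; case: (c); move: v0; clear; lia.
Qed.

Lemma bv_lt v v' w : (v' < v)%N -> (bv v' w < bv v w)%N.
Proof. by move=> h; apply: bv_short. Qed.

Lemma bv_linear v w : bv v w = (v * 2 ^ size w + bv 0 w)%N.
Proof.
elim: w v => [|c w IH] v /=; first by rewrite muln1 addn0.
rewrite (IH (v.*2 + c)%N) (IH (0.*2 + c)%N) expnS doubleE.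
by rewrite !mulnDl mulnA muln2 double0 add0n addnA -doubleE.
Qed.

Lemma bv_pre v w w' : (0 < v)%N -> (bv 1 w' < bv 1 w)%N -> (bv v w' < bv v w)%N.
Proof.
move=> v0 h; case: (ltngtP (size w') (size w)) => E.
- exact: bv_shorter.
- by move: (ltn_trans h (bv_shorter (isT : (0 < 1)%N) E)); rewrite ltnn.
by move: h; rewrite (bv_linear 1 w) (bv_linear 1 w') (bv_linear v w) (bv_linear v w')
  E !ltn_add2l.
Qed.

Lemma bv_eq v w w' : bv 1 w = bv 1 w' -> bv v w = bv v w'.
Proof.
move=> h; have Es : size w = size w'.
  have hs := bv_shorter (isT : (0 < 1)%N).
  by case: (ltngtP (size w) (size w')) => // /hs; rewrite h ltnn.
move: h; rewrite (bv_linear 1 w) (bv_linear 1 w') (bv_linear v w) (bv_linear v w') Es.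
by move=> /addnI ->.
Qed.

Lemma bv_gt0 v w : (0 < v)%N -> (0 < bv v w)%N.
Proof. by move=> v0; have /andP[h _] := bv_bounds v w; apply: leq_trans h; rewrite muln_gt0 v0 expn_gt0. Qed.

(** The order is compatible with contexts, so comparisons inside an entry carry over to the whole
    row. *)
Lemma bv_ctx a w w' b : (bv 1 w' < bv 1 w)%N ->
  (bv 1 (a ++ w' ++ b) < bv 1 (a ++ w ++ b))%N.
Proof.
by move=> h; rewrite !bv_cat; apply: bv_lt; apply: bv_pre h; apply: bv_gt0.
Qed.

(* The word of letters of the cluster of thin boxes at the root.              *)
Fixpoint lw (S : stacking) : seq bool :=
  match S with
  | Eta => [::]
  | Node a _ ss => if (0 < ar_in a)%N then [:: isc S] else flatten (map lw ss)
  end.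
Definition lwr ss := flatten (map lw ss).
(** The leading bit 1 makes longer words larger. Words of the same length are compared
    lexicographically, with c above every other letter. *)
Definition W1 S := bv 1 (lw S).

Lemma lwr_cat s t : lwr (s ++ t) = lwr s ++ lwr t.
Proof. by rewrite /lwr map_cat flatten_cat. Qed.

Lemma lwr_cons s t : lwr (s :: t) = lw s ++ lwr t. Proof. by []. Qed.

Lemma lw_thin a p ss : ar_in a = 0%N -> lw (Node a p ss) = lwr ss.
Proof. by move=> a0; rewrite /= a0. Qed.

Lemma lw_letter a p ss : (0 < ar_in a)%N -> lw (Node a p ss) = [:: isc (Node a p ss)].
Proof. by move=> a0; rewrite /= a0. Qed.

Lemma size_lwr_pfx A : pfx A -> size (lwr A) = size A.
Proof.
elim: A => // s A IH; rewrite pfx_cons => /and3P[ls _ /IH E].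
rewrite lwr_cons size_cat E; case: s ls => // a p ss ls.
by rewrite lw_letter //; case/orP: ls => /eqP ->.
Qed.

(** The harmless terms beside the leading term [S0]: those with a smaller word, those that are
    matched downwards, and those with the same word whose own move has lower priority, being a
    merging move or lying at a later position. *)
Definition low (t : bool) (i : nat) S0 S' : Prop :=
  [\/ (W1 S' < W1 S0)%N, exists t' i' S'', st S' = Some ((true, t', i'), S'') |
      [/\ t = false, W1 S' = W1 S0 & exists t' i' S'',
        st S' = Some ((false, t', i'), S'') /\ (t' || (i < i')%N)]].

Lemma nonletter T d t i T' : st T = Some ((d, t, i), T') ->
  (isc T || isF T = false) /\ isg T = false.
Proof.
move=> sT; split; apply/negbTE/negP.
  by move/st_letter => E; rewrite E in sT.
by move/st_g => E; rewrite E in sT.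
Qed.

Lemma isg_deep a p A T R d t i T' : st T = Some ((d, t, i), T') ->
  isg (Node a p (A ++ T :: R)) = false.
Proof.
case/nonletter => /norP[/negPf nc /negPf nF] _.
case: A => [|x [|y A]]; case: R => [|z R] //=; rewrite ?nc ?nF ?andbF //.
- by case: R => [|? ?]; rewrite ?nF ?andbF.
- by case: A.
by case: A.
Qed.

Lemma isg_size a p ss : (2 < size ss)%N -> isg (Node a p ss) = false.
Proof. by case: ss => [|x [|y [|? ?]]]. Qed.

Lemma isg_pfx a p ss : pfx ss -> isg (Node a p ss) = false.
Proof.
case: ss => [|x [|y [|? ?]]] //; rewrite pfx_cons => /and3P[_ h _].
by rewrite /isg /=; move: h => /= /negPf ->; rewrite andbF.
Qed.

Lemma st_deep a p A T R d t i T' : ar_in a = 0%N -> pfx A ->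
  st T = Some ((d, t, i), T') ->
  st (Node a p (A ++ T :: R)) = Some ((d, t, (size A + i)%N),
    Node (lax_arity 0 (size (A ++ T :: R))) p (A ++ T' :: R)).
Proof.
move=> a0 pA sT; rewrite st_thin ?(isg_deep _ _ _ _ sT) // (scan_deep R pA sT).
by rewrite !size_cat.
Qed.

Lemma st_Fc a p A x y R : ar_in a = 0%N -> pfx A -> isF x -> isc y ->
  (0 < size A + size R)%N ->
  st (Node a p (A ++ x :: y :: R)) = Some ((true, false, size A),
    Node (lax_arity 0 (size (A ++ gpair x y :: R))) p (A ++ gpair x y :: R)).
Proof.
move=> a0 pA Fx cy h; rewrite st_thin ?scan_Fc // isg_size // size_cat /=.
by move: h; clear; lia.
Qed.

Lemma st_pfx a p A : ar_in a = 0%N -> pfx A ->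
  st (Node a p A) = Some ((false, true, 0%N), merge_letter p A).
Proof. by move=> a0 pA; rewrite st_thin ?isg_pfx // scan_pfx0. Qed.

Lemma split3 (A : seq stacking) T R l1 B l3 : A ++ T :: R = l1 ++ B ++ l3 ->
  [\/ exists m, A = l1 ++ B ++ m /\ l3 = m ++ T :: R,
      exists m1 m2, [/\ A = l1 ++ m1, B = m1 ++ T :: m2 & R = m2 ++ l3] |
      exists m, l1 = A ++ T :: m /\ R = m ++ B ++ l3].
Proof.
elim: l1 A => [|x l1 IH] A.
  elim: B A => [|y B IHB] A E; first by apply: Or31; exists A.
  case: A E => [|x A] /= [<- E].
    by apply: Or32; exists [::], B.
  case: (IHB A E) => [[m [-> ->]]|[m1 [m2 [E1 -> ->]]]|[m []]].
  - by apply: Or31; exists m.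
  - by apply: Or32; exists (x :: m1), m2; rewrite E1.
  by case: (A).
case: A => [|y A] /= [<- E]; first by apply: Or33; exists l1.
case: (IH A E) => [[m [-> ->]]|[m1 [m2 [-> -> ->]]]|[m [-> ->]]].
- by apply: Or31; exists m.
- by apply: Or32; exists m1, m2.
by apply: Or33; exists m.
Qed.

Lemma split1 (A : seq stacking) T R l s r : A ++ T :: R = l ++ s :: r ->
  [\/ exists m, A = l ++ s :: m /\ r = m ++ T :: R,
      [/\ A = l, T = s & R = r] |
      exists m, l = A ++ T :: m /\ R = m ++ s :: r].
Proof.
move=> E; case: (@split3 A T R l [:: s] r E) => [[m [-> ->]]|[m1 [m2 [-> Es ->]]]|[m [-> ->]]].
- by apply: Or31; exists m.
- case: m1 Es => [[<- <-]|? [|? ?]] //; by apply: Or32; rewrite cats0.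
by apply: Or33; exists m.
Qed.

Lemma splitn_parts p ss i b : (i + b <= size ss)%N -> exists l1 B l3 q,
  [/\ ss = l1 ++ B ++ l3, size B = b, i = size l1 &
     splitn p ss i b = Node (lax_arity 0 (size ss - b).+1) p
       (l1 ++ Node (lax_arity 0 b) q B :: l3)].
Proof.
move=> h; exists (take i ss), (take b (drop i ss)), (drop (i + b) ss).
exists (top p (map st_ar (take i ss))); split=> //.
- by rewrite addnC -drop_drop !cat_take_drop.
- by rewrite size_takel // size_drop; move: h; move: (size ss); clear; lia.
by rewrite size_takel //; apply: leq_trans h; apply: leq_addr.
Qed.

(** Thin boxes do not show in the word, so grouping under a thin root keeps the weight. *)
Lemma W1_group a a' p q l1 B l3 n : ar_in a = 0%N -> ar_in a' = 0%N ->
  W1 (Node a p (l1 ++ Node (lax_arity 0 n) q B :: l3)) = W1 (Node a' p (l1 ++ B ++ l3)).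
Proof. by move=> a0 a0'; rewrite /W1 !lw_thin // !lwr_cat lwr_cons lw_thin. Qed.

(** * Leading terms of the differential *)

Section Leading.
Variable k : fieldType.
Notation V := (fmod k).
Notation D := (dS k tq).
Notation sn b := ((-1) ^+ (nat_of_bool b) : k).

Lemma D_letter s : legit s -> isc s || isF s ->
  inspan (fun s' => isc s' = isc s /\ isF s' = isF s) (D s).
Proof.
case: s => // a p ss; rewrite legit_node => /and3P[cs la _] ls.
have a2 : (ar_in a + ar_up a = 2)%N by case/orP: ls => /eqP ->.
rewrite dS_node dgen_deg0 // linear0 add0r; apply: inspanZ.
by apply: inspan_drow_bas => l s r _ t _.
Qed.

Lemma pfx_replace l s s' m : isc s' = isc s -> isF s' = isF s ->
  pfx (l ++ s :: m) -> pfx (l ++ s' :: m).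
Proof. by move=> Ec EF; rewrite /pfx !all_cat !map_cat /= Ec EF. Qed.

Lemma cf_drow_deep a p A T S R : legit (Node a p (A ++ T :: R)) -> T <> S ->
  legit S -> cf S (D T) != 0 ->
  cf (Node a p (A ++ S :: R)) (drow_ D (fun r => bas (Node a p r) : V) (A ++ T :: R)) != 0.
Proof.
move=> lN TS lS nz; have := lN; rewrite legit_node => /and3P[cs la].
rewrite all_cat => /andP[lA /= /andP[lT lR]].
have ncat (l r : seq stacking) : size l = size A -> l ++ T :: r <> A ++ S :: R.
  by move=> sl /eqP; rewrite eqseq_cat // => /andP[_ /eqP[]].
rewrite drow_cat cfD (@cf_inspan _ (fun S' => exists2 l, size l = size A & S' = Node a p (l ++ T :: R))).
- rewrite add0r cfZ mulf_eq0 signr_eq0 orFb drow_cons cfD.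
  rewrite [X in _ + X](@cf_inspan _ (fun S' => exists r, S' = Node a p (A ++ T :: r))).
  + rewrite addr0 cf_lin (eq_lin_in (g := fun s' => ((s' == S)%:R : k^o)) (dS_span tqP lT)) //.
    move=> s' ls' [as' _ _]; rewrite /cf lin_bas.
      congr (_ %:R); congr nat_of_bool; apply/eqP/eqP => [[E]|-> //].
      by move: E => /eqP; rewrite eqseq_cat // => /andP[_ /eqP[]].
    rewrite legit_node la all_cat lA /= ls' lR !andbT.
    by move: cs; rewrite !map_cat /= as'.
  + apply: inspanZ; apply: (inspan_drow_bas (F := fun r => Node a p (A ++ T :: r))).
    by move=> l s r _ t _; exists (l ++ val t :: r).
  by case=> r [E]; apply: (ncat A r).
- apply: (inspan_drow_bas (F := fun r => Node a p (r ++ T :: R))) => l s r E t _.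
  by exists (l ++ val t :: r) => //; rewrite E !size_cat.
by case=> l sl [E]; apply: (ncat l R).
Qed.

(** The partner below [T] is the leading term of its differential. The last clause, that expanding a
    box enlarges the word and grouping keeps it, is needed to carry the property through thin
    boxes. *)
Definition stD T := forall t i S0, st T = Some ((true, t, i), S0) ->
  [/\ cf S0 (D T) != 0, inspan (fun S' => S' = S0 \/ low t i S0 S') (D T) &
    if t then ((W1 T < W1 S0)%N : Prop) else W1 T = W1 S0].

Lemma low_ctx t i S0 S' a p A R : ar_in a = 0%N -> pfx A -> low t i S0 S' ->
  low t (size A + i) (Node a p (A ++ S0 :: R)) (Node a p (A ++ S' :: R)).
Proof.
move=> a0 pA; rewrite /low /W1 !lw_thin // !lwr_cat !lwr_cons.
case=> [h|[t' [i' [S'' E]]]|[-> Ew [t' [i' [S'' [E h]]]]]].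
- by apply: Or31; apply: bv_ctx.
- by apply: Or32; rewrite (st_deep _ _ a0 pA E); do 3 eexists.
apply: Or33; split=> //.
  by rewrite !bv_cat; congr (bv _ _); apply: bv_eq.
rewrite (st_deep _ _ a0 pA E); do 3 eexists; split; first by [].
by case/orP: h => [->//|h]; rewrite ltn_add2l h orbT.
Qed.

(** The move of the whole row happens inside the entry [T]. Differentials of [T] are controlled by
    induction, and those of the other entries leave the break in [T]. Splittings of the root keep
    the word. *)
Lemma stD_deep a p A T R t i T' : legit (Node a p (A ++ T :: R)) -> ar_in a = 0%N ->
  pfx A -> legit T -> (0 < ar_in (st_ar T))%N -> stD T ->
  st T = Some ((true, t, i), T') ->
  [/\ cf (Node a p (A ++ T' :: R)) (D (Node a p (A ++ T :: R))) != 0,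
     inspan (fun S' => S' = Node a p (A ++ T' :: R) \/
       low t (size A + i) (Node a p (A ++ T' :: R)) S') (D (Node a p (A ++ T :: R))) &
    if t then ((W1 (Node a p (A ++ T :: R)) < W1 (Node a p (A ++ T' :: R)))%N : Prop)
    else W1 (Node a p (A ++ T :: R)) = W1 (Node a p (A ++ T' :: R))].
Proof.
move=> lN a0 pA lT T0 HT sT; have := lN; rewrite legit_node => /and3P[cs la lss].
have sz := composable_up cs; have [a2 /eqP Ea] := andP la.
have [nz sp wT] := HT _ _ _ sT; have [lT' aT' sT' nT'] := st_inv lT T0 sT.
rewrite a0 -sz in a2 Ea.
have W : if t then ((W1 (Node a p (A ++ T :: R)) < W1 (Node a p (A ++ T' :: R)))%N : Prop)
    else W1 (Node a p (A ++ T :: R)) = W1 (Node a p (A ++ T' :: R)).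
  rewrite /W1 !lw_thin // !lwr_cat !lwr_cons.
  by case: (t) wT => h; [apply: bv_ctx | rewrite !bv_cat; congr (bv _ _); apply: bv_eq].
have TT : T <> T'.
  by move=> E; move: nT'; rewrite E; clear; lia.
split=> //.
- rewrite dS_node cfD [X in X + _](@cf_inspan _ (fun S => if S is Node b _ _ then
    (ar_up b < size (A ++ T :: R))%N else True)).
  + rewrite add0r cfZ mulf_eq0 signr_eq0 /=; exact: cf_drow_deep.
  + rewrite Ea; apply: inspan_gr_thin => // j b bn _.
    by rewrite /splitn /lax_arity /ar_up /=; move: bn; move: (size _); clear; lia.
  by rewrite Ea /lax_arity /ar_up /= ltnn.
rewrite dS_node; apply: inspanD.
  rewrite [in dgen _ _ a]Ea; apply: inspan_gr_thin => // j b bn jb.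
  have [l1 [B [l3 [q [Ess sB Ej ->]]]]] := splitn_parts p jb.
  have Ew : W1 (Node (lax_arity 0 (size (A ++ T :: R) - b).+1) p
      (l1 ++ Node (lax_arity 0 b) q B :: l3)) = W1 (Node a p (A ++ T :: R)).
    by rewrite (@W1_group _ a) // Ess.
  (* If the move expands a box, all splittings of the root keep the old word, which is smaller.
     Otherwise the new thin box lies before [T] and can be merged, or contains [T], or lies behind
     it; in the last two cases the move of [T] is still there. *)
  right; case: t sT sT' W wT sp => sT sT' W _ _; first by apply: Or31; rewrite Ew.
  case: (split3 Ess) => [[m [EA El]]|[m1 [m2 [EA EB ER]]]|[m [El ER]]].
  + have pB : pfx B /\ pfx l1.
      by move: pA; rewrite EA => /pfx_cat[? /pfx_cat[]].
    apply: Or33; rewrite Ew; split=> //.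
    rewrite (st_deep p l3 (erefl : ar_in (lax_arity 0 _) = 0%N) pB.2
      (st_pfx q (erefl : ar_in (lax_arity 0 b) = 0%N) pB.1)).
    by do 3 eexists; split.
  + have [pl pm] : pfx l1 /\ pfx m1 by apply: pfx_cat; rewrite -EA.
    apply: Or32; rewrite EB.
    rewrite (st_deep p l3 (erefl : ar_in (lax_arity 0 _) = 0%N) pl
      (st_deep q m2 (erefl : ar_in (lax_arity 0 b) = 0%N) pm sT)).
    by do 3 eexists.
  apply: Or32; rewrite El -catA cat_cons.
  rewrite (st_deep p _ (erefl : ar_in (lax_arity 0 _) = 0%N) pA sT).
  by do 3 eexists.
apply: inspanZ; apply: inspan_drow_bas => l s r /split1[[m [EA ->]]|[<- <- <-]|[m [-> ER]]].
- have ls : legit s /\ isc s || isF s.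
    split; first by apply: (allP lss); rewrite EA -catA mem_cat mem_head orbT.
    by case/andP: pA => /allP + _; apply; rewrite EA mem_cat mem_head orbT.
  apply: inspanS (D_letter ls.1 ls.2) => s' _ [Ec EF]; right; apply: Or32.
  rewrite -cat_cons catA (st_deep p R a0 _ sT); first by do 3 eexists.
  by apply: pfx_replace Ec EF _; rewrite -EA.
- apply: inspanS sp => s' _ [->|h]; first by left.
  by right; apply: low_ctx.
move=> s' _; right; apply: Or32; rewrite -catA cat_cons (st_deep p _ a0 pA sT).
by do 3 eexists.
Qed.

(** The leading term splits the root so as to group the pair [x], [y]. Any other splitting has the
    same word: it leaves the pair intact, or puts a mergeable prefix under a thin box, or tears the
    pair apart by a thin box that begins with [y]. *)
Lemma stD_Fc a p A x y R : legit (Node a p (A ++ x :: y :: R)) -> ar_in a = 0%N ->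
  pfx A -> isF x -> isc y -> (0 < size A + size R)%N ->
  let S0 := Node (lax_arity 0 (size (A ++ gpair x y :: R))) p (A ++ gpair x y :: R) in
  [/\ cf S0 (D (Node a p (A ++ x :: y :: R))) != 0,
     inspan (fun S' => S' = S0 \/ low false (size A) S0 S') (D (Node a p (A ++ x :: y :: R))) &
     W1 (Node a p (A ++ x :: y :: R)) = W1 S0].
Proof.
move=> lN a0 pA Fx cy sAR S0; have := lN; rewrite legit_node => /and3P[cs la lss].
have sz := composable_up cs; have [a2 /eqP Ea] := andP la.
rewrite a0 -sz in a2 Ea.
have pAx : pfx (A ++ [:: x]).
  elim: (A) pA => [|z A' IH]; first by rewrite pfx_cons Fx orbT.
  rewrite cat_cons !pfx_cons => /and3P[-> h /IH ->]; rewrite andbT /=.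
  by case: A' h {IH} => //= _; rewrite isFc ?andbF.
have W : W1 (Node a p (A ++ x :: y :: R)) = W1 S0.
  by rewrite /S0 -[x :: y :: R]/([:: x; y] ++ R) -(@W1_group (lax_arity 0 (size (A ++ gpair x y :: R))) a p (ar_in (st_ar x)) A _ R 2).
have sS : size (A ++ x :: y :: R) = (size A + size R).+2 by rewrite size_cat /= !addnS.
have ES0 : S0 = splitn p (A ++ x :: y :: R) (size A) 2.
  rewrite /S0 /splitn take_size_cat // drop_size_cat // sS size_cat /= subn2 /= addnS take0.
  have -> : drop (size A + 2) (A ++ x :: y :: R) = R.
    by rewrite addnC -drop_drop drop_size_cat // /= drop0.
  congr (Node _ _ (_ ++ Node _ _ _ :: _)).
  by case/andP: cs => _; rewrite map_cat chained_cat => /andP[_ /= /andP[/eqP -> _]].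
have b2 : (2 <= 2 < size (A ++ x :: y :: R))%N by rewrite sS; move: sAR; clear; lia.
have h2 : (size A + 2 <= size (A ++ x :: y :: R))%N by rewrite sS; clear; lia.
split=> //.
- rewrite dS_node cfD [X in _ + X](@cf_inspan _ (fun S => if S is Node b _ _ then
    (ar_up b = size (A ++ x :: y :: R))%N else False)).
  + rewrite addr0 ES0 [in dgen _ _ a]Ea; apply: cf_splitn => //.
    by rewrite -Ea.
  + apply: inspanZ; apply: inspan_drow_bas => l s r _ t _; by rewrite Ea.
  by rewrite /S0 /lax_arity /ar_up /= sS size_cat /= addnS; clear; lia.
rewrite dS_node; apply: inspanD; last first.
  apply: inspanZ; apply: inspan_drow_bas => l s r /split1[[m [EA ->]]|[<- Es Er]|[m [-> ER]]].
  - have ls : legit s /\ isc s || isF s.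
      split; first by apply: (allP lss); rewrite EA -catA mem_cat mem_head orbT.
      by case/andP: pA => /allP + _; apply; rewrite EA mem_cat mem_head orbT.
    apply: inspanS (D_letter ls.1 ls.2) => s' _ [Ec EF]; right; apply: Or32.
    rewrite -cat_cons catA st_Fc //; first by do 3 eexists.
      by apply: pfx_replace Ec EF _; rewrite -EA.
    by move: sAR; rewrite EA !size_cat.
  - have lx : legit x by apply: (allP lss); rewrite mem_cat mem_head orbT.
    rewrite -Es -Er; apply: inspanS (D_letter lx (introT orP (or_intror Fx))) => s' _ [_ EF].
    by right; apply: Or32; rewrite st_Fc ?EF //; do 3 eexists.
  case: m ER => [|z m] /= [<- ER].
    have ly : legit y by apply: (allP lss); rewrite mem_cat !inE eqxx !orbT.
    rewrite -ER; apply: inspanS (D_letter ly (introT orP (or_introl cy))) => s' _ [Ec _].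
    by right; apply: Or32; rewrite -catA st_Fc ?Ec //; do 3 eexists.
  move=> s' _; right; apply: Or32; rewrite -catA !cat_cons st_Fc //; first by do 3 eexists.
  by rewrite size_cat /= !addnS.
rewrite [in dgen _ _ a]Ea; apply: inspan_gr_thin => // j b bn jb.
have lsp : legit (splitn p (A ++ x :: y :: R) j b).
  by apply: legit_splitn bn jb; rewrite -Ea.
have [l1 [B [l3 [q [Ess sB Ej E]]]]] := splitn_parts p jb; rewrite E in lsp *.
set a' := lax_arity 0 _ in lsp *.
have a0' : ar_in a' = 0%N by [].
have Ew : W1 (Node a' p (l1 ++ Node (lax_arity 0 b) q B :: l3)) = W1 S0.
  by rewrite (@W1_group _ a) // -Ess.
have ab0 : ar_in (lax_arity 0 b) = 0%N by [].
have up_case : pfx l1 -> pfx B ->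
    low false (size A) S0 (Node a' p (l1 ++ Node (lax_arity 0 b) q B :: l3)).
  move=> pl pB; apply: Or33; split=> //.
  by rewrite (st_deep p l3 a0' pl (st_pfx q ab0 pB)); do 3 eexists; split.
case: (split3 Ess) => [[m [EA El]]|[m1 [m2 [EA EB ER]]]|[m [El ER]]].
- have [pl pB] : pfx l1 /\ pfx B by have := pA; rewrite EA => /pfx_cat[? /pfx_cat[]].
  by right; apply: up_case.
- have [pl pm] : pfx l1 /\ pfx m1 by apply: pfx_cat; rewrite -EA.
  case: m2 EB ER => [|y' m2] EB /= ER.
    right; apply: up_case => //.
    by move: pAx; rewrite EA -catA EB => /pfx_cat[].
  case: ER => Ey ER; rewrite -Ey in EB; have [s2|s2] := posnP (size m1 + size m2)%N.
    left; rewrite ES0 -E; congr splitn; last by rewrite -sB EB size_cat /= !addnS s2.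
    by rewrite Ej EA size_cat; move: s2; clear; lia.
  right; apply: Or32.
  rewrite EB (st_deep p l3 a0' pl (st_Fc q ab0 pm Fx cy s2)).
  by do 3 eexists.
(* If the new thin box begins with [y], then [x] joins the prefix, and the move found in the new box
   lowers the degree or has a larger index. *)
right; case: m El ER => [|z m] El /= ER.
  case: B sB ER lsp Ew {Ess E up_case jb} => [|y' B] sB ER lsp Ew.
    by move: bn; rewrite -sB.
  case: ER => Ey _; rewrite -Ey in lsp Ew *.
  have [lX X0] : legit (Node (lax_arity 0 b) q (y :: B)) /\
      (0 < ar_in (st_ar (Node (lax_arity 0 b) q (y :: B))))%N.
    move: lsp; rewrite legit_node all_cat /= => /and3P[/andP[_ ch] _ /and3P[_ lX _]].
    split=> //; move: ch; rewrite map_cat chained_cat El map_cat top_cat /= => /andP[_ /andP[/eqP -> _]].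
    by case: (x) Fx => // ? ? ? /eqP ->; rewrite /top /= /comp_arity /ar_out /= add1n.
  have nX : isg (Node (lax_arity 0 b) q (y :: B)) = false.
    apply/negP; case: (B) => [|? [|? ?]] // /and3P[_ Fy _].
    by move: cy; rewrite isFc.
  have nl : isc (Node (lax_arity 0 b) q (y :: B)) || isF (Node (lax_arity 0 b) q (y :: B)) = false by [].
  case EX : (st (Node (lax_arity 0 b) q (y :: B))) => [[[[d2 t2] i2] X']|]; last first.
    by have := st_none lX X0 EX; rewrite orbA nl nX.
  have pl : pfx l1 by rewrite El.
  have EE := st_deep p l3 a0' pl EX; case: d2 EX EE => EX EE.
    by apply: Or32; rewrite EE; do 3 eexists.
  apply: Or33; split=> //.
  rewrite EE; do 3 eexists; split; first by [].
  by rewrite El size_cat /= addn1 addSn ltnS leq_addr orbT.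
case: ER => Ez ER; rewrite -Ez in El.
apply: Or32; rewrite El -catA !cat_cons st_Fc //; first by do 3 eexists.
by rewrite size_cat /= !addnS.
Qed.
End Leading.

Definition rin S := if S is Node a _ _ then (0 < ar_in a)%N else false.

Lemma isc_corow a b Ks : (0 < a)%N ->
  map isc (corow a b Ks) = nseq a.-1 true ++ nseq (size Ks) false.
Proof.
case: a => // a _; rewrite [a.+1.-1]/=.
elim: a => [|a IH]; first by rewrite /corow /=; elim: Ks => //= K Ks ->.
by rewrite /corow crowS cat_cons -/(corow a.+1 b Ks) map_cons IH.
Qed.

Lemma rin_corow a b Ks : (0 < a)%N -> all rin (corow a b Ks).
Proof.
case: a => // a _; elim: a => [|a IH].
  by rewrite /corow /=; elim: Ks.
by rewrite /corow crowS cat_cons -/(corow a.+1 b Ks) /= IH.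
Qed.

Lemma lwr_rin R : all rin R -> lwr R = map isc R.
Proof.
elim: R => // -[//|a p ss] R IH /= /andP[a0 /IH E].
by rewrite lwr_cons lw_letter // E.
Qed.

Lemma lwr_graft R p ss : all rin R -> lwr (graft_row R p ss) = map isc R.
Proof.
elim: R p ss => // -[//|a b l] R IH p ss /= /andP[a0 h].
by rewrite lwr_cons IH // lw_letter.
Qed.

Lemma pure_rin B P R : all legit R -> all (pureb B) R -> chained P (map st_ar R) ->
  (0 < P)%N -> all rin R.
Proof.
elim: R P => // s R IH P /= /andP[ls lR] /andP[ps pR] /andP[/eqP sP ch] P0.
rewrite (IH _ lR pR ch); last by apply: legit_pos; rewrite ?sP.
rewrite andbT; case: s ls ps sP {ch} => [_ _ /= E|a b l _ + _].
  by rewrite -E in P0.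
by rewrite pureb_node => /and3P[].
Qed.

Lemma graft_corow x n p ss : (0 < x)%N -> size ss = n -> chained p (map st_ar ss) ->
  graft_row (corow x 0 (eta n)) p ss = corow x p ss.
Proof.
case: x => // x _; elim: x => [|x IH] sz ch.
  rewrite /corow [crow 1 0]/= [crow 1 p]/= !cat0s.
  elim: ss n p sz ch => [|K ss IH] [|n] p //= [sz] /andP[/eqP Kp ch].
  by rewrite take0 drop0 IH // /Flet Kp.
rewrite /corow !crowS !cat_cons -!/(corow x.+1 _ _) graft_cons.
rewrite [up (clet _)]/= take0 drop0 IH //; congr (_ :: _).
by rewrite /clet graft_node addn0.
Qed.

(** Among the rows with [P] incoming wires, one outgoing wire and [q] inputs, c, ..., c, F, ..., F
    has the largest word. At the first deviation either c is replaced while the word gets no longer,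
    or the word becomes shorter; both follow from the count of wires and inputs in [row_bound]. *)
Lemma row_word B P q R v : all legit R -> all (pureb B) R -> chained P (map st_ar R) ->
  top P (map st_ar R) = 1%N -> (0 < P)%N -> width R = q -> (0 < v)%N ->
  R = corow P 0 (eta q) \/
  (bv v (map isc R) < bv v (nseq P.-1 true ++ nseq q false))%N.
Proof.
elim: R P q v => [|s R IH] P q v.
  by move=> _ _ _ tP _ <- _; left; rewrite -[P]/(top P [::]) tP.
move=> /= /andP[ls lR] /andP[ps pR] /andP[/eqP sP ch]; rewrite top_cons => tR P0.
rewrite width_cons => Eq v0.
have o0 : (0 < ar_out (st_ar s))%N by apply: legit_pos; rewrite ?sP.
case cs : (isc s).
  case: s ls ps sP o0 cs ch tR Eq => // a b l ls _ sP o0 /eqP Ea ch tR Eq.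
  move: ls; rewrite legit_node Ea => /and3P[cl _ _]; have := composable_up cl.
  case: l cl sP o0 ch tR Eq => // _ sP o0 ch tR Eq _; rewrite Ea in sP o0 ch tR Eq.
  have EP : P = b.+2 by rewrite -sP.
  have := IH b.+1 q v.*2.+1 lR pR ch tR isT Eq isT.
  rewrite EP /= addn1; case=> [->|h]; [left | by right].
  by rewrite /corow crowS cat_cons addn0.
have rb := row_bound lR pR ch; rewrite tR in rb.
have pb := pure_bound ls ps; rewrite sP in pb.
have [P1|P2] := leqP P 1; last first.
  right; case: P P0 P2 sP pb => [|[|P]] // _ _ _ pb.
  rewrite /= addn0 addn1; apply: bv_short; first by [].
  rewrite size_map size_cat !size_nseq -Eq.
  by move: rb pb; move: (size R) (width R) (up s) (ar_out _); clear; lia.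
have {P1}EP : P = 1%N by apply/eqP; rewrite eqn_leq P1 P0.
rewrite EP /=; have o1 : ar_out (st_ar s) = 1%N.
  by apply/eqP; rewrite eqn_leq o0 andbT; move: pb; rewrite EP => /andP[].
rewrite o1 in ch tR rb pb *.
have [u1|u2] := leqP (up s) 1; last first.
  right; rewrite -[X in (X < _)%N]/(bv v (false :: map isc R)); apply: bv_shorter => //.
  rewrite /= size_map size_nseq -Eq.
  by move: rb u2; move: (size R) (width R) (up s); clear; lia.
have {u1}us : up s = 1%N.
  by move: u1 pb; rewrite EP; move: (up s); clear; lia.
rewrite us in Eq; rewrite -Eq /= addn0.
have Es : s = Flet Eta.
  case: s ls ps sP cs us o1 {o0 pb ch tR Eq} => // a b l.
  rewrite legit_node pureb_node EP => /and3P[cl la ll] /and3P[a0 _ pl] sP _ us _.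
  have sl := composable_up cl; move: sP; rewrite -[LHS]/(ar_in a + b)%N => sP.
  have Eb : b = 0%N by move: sP a0; clear; lia.
  have Ea1 : ar_in a = 1%N by move: sP a0; clear; lia.
  move: cl; rewrite Eb => /andP[_ chl].
  have El : l = eta (size l).
    elim: l ll pl chl {us sl} => //= z l IHl /andP[lz ll] /andP[pz pl] /andP[/eqP z0 chl].
    have Ez := pure_thin lz pz z0; rewrite Ez in chl *.
    by rewrite -IHl.
  move: us; rewrite -[LHS]/(width l) El width_eta => s1.
  rewrite s1 in El; rewrite El /Flet /=; congr Node.
  by case/andP: la => _ /eqP ->; rewrite Ea1 -sl s1.
have := IH 1%N (width R) v.*2 lR pR ch tR isT erefl; rewrite double_gt0 v0 => /(_ isT).
by rewrite add0n; case=> [Er|h]; [left; rewrite Es {1}Er | right].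
Qed.

Lemma chained_eta_row n : chained 0 (map st_ar (eta n)) /\ top 0 (map st_ar (eta n)) = 0%N.
Proof. by rewrite nseq_eta_ar; apply: chained_eta. Qed.

Section LeadingLetter.
Variable k : fieldType.
Notation V := (fmod k).
Notation D := (dS k tq).
Notation sn b := ((-1) ^+ (nat_of_bool b) : k).

(** Type III terms are compared by [row_word], and the corolla is the largest. Type II terms have a
    one-letter word other than c, of weight 2, whereas the corolla has at least two letters and so
    weight at least 4. Terms that differentiate an entry can still be expanded. *)
Lemma stD_letter a p ss : legit (Node a p ss) -> (0 < ar_in a)%N ->
  (a == (2, 0, 1)%N) || (a == (1, 1, 1)%N) = false ->
  let S0 := corolla (ar_in a) p ss in
  [/\ cf S0 (D (Node a p ss) : V) != 0,
     inspan (fun S' => S' = S0 \/ low true 0 S0 S') (D (Node a p ss) : V) &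
     (W1 (Node a p ss) < W1 S0)%N].
Proof.
move=> lN x0 nl S0; have := lN; rewrite legit_node => /and3P[cs la lss].
have sz := composable_up cs; have ch := proj2 (andP cs).
have sN : st (Node a p ss) = Some ((true, true, 0%N), S0) by rewrite /= x0 nl.
have [lS0 aS0 sS0 nS0] := st_inv lN (leq_trans x0 (leq_addr _ _)) sN.
have [a2 /eqP Ea] := andP la; set x := ar_in a in x0 a2 Ea S0 sN lS0 aS0 sS0 nS0 *.
set n := ar_up a in sz a2 Ea *.
have xn3 : (3 <= x + n)%N.
  rewrite leqNgt; apply/negP => h; rewrite Ea in nl.
  have : (x = 1%N /\ n = 1%N) \/ (x = 2%N /\ n = 0%N).
    by move: h a2 x0; move: (x) (n); clear; lia.
  by move: nl; move: (x) (n) => x' n'; clear => nl [] [Ex En]; rewrite Ex En in nl.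
have wS0 : lw S0 = nseq x.-1 true ++ nseq n false.
  by rewrite lw_thin // lwr_rin ?rin_corow // isc_corow // sz.
have W4 : (4 <= W1 S0)%N.
  have /andP[h _] := bv_bounds 1 (lw S0); apply: leq_trans h.
  rewrite mul1n wS0 size_cat !size_nseq -[4%N]/(2 ^ 2)%N leq_exp2l //.
  by move: xn3 x0; clear; lia.
have W2 b r i : (0 < ar_in b)%N -> isc (Node b r i) = false -> W1 (Node b r i) = 2%N.
  by move=> b0 nc; rewrite /W1 lw_letter // nc.
pose R0 := corow x 0 (eta n).
have [|lR cR tR wR nR] := @corow_facts x 0 (eta n) x0 _ (proj1 (chained_eta_row n)).
  by elim: (n).
pose x1 := (true, Node (lax_arity 0 (x.-1 + n)) x R0).
have x1in : x1 \in tq a.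
  rewrite /tq mem_cat; apply/orP; right; rewrite gtn_eqF //.
  apply/allpairsPdep; exists (x.-1 + n)%N, R0; rewrite mem_iota mem_filter mem_row.
  have pR : all (pureb (x + n).+1) R0.
    apply: (@pure_rebound (sumn (map ar_up (flatten (map boxes R0)))).+1) => //.
    + apply/allP => T TR; apply/allP => y yT; apply/andP; split; last first.
        rewrite ltnS; apply: mem_sumn; apply: map_f; apply/flattenP.
        by exists (boxes T); rewrite ?map_f.
      have rT := allP (rin_corow 0 (eta n) x0) T TR.
      move: TR; rewrite mem_cat => /orP[] /mapP[z zin ET]; rewrite ET in yT.
        by move: yT; rewrite inE => /eqP ->.
      move: zin yT; rewrite mem_nseq => /andP[_ /eqP ->].
      by rewrite inE => /eqP ->.
    + by rewrite -[X in chained X]addn0.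
    by rewrite wR width_eta.
  rewrite /rspec size_corow size_nseq lR -/R0 pR eqxx wR width_eta -/x -/n eqxx.
  rewrite addn0 in cR tR; rewrite cR tR (proj2 (chained_eta_row n)).
  by split=> //; move: xn3 x0; clear; lia.
have G1 : graft x1.2 p ss = S0.
  by rewrite -[x1.2]/(Node (lax_arity 0 (x.-1 + n)) x R0) graft_node /S0 /corolla sz graft_corow.
have Gx y : y \in tq a -> y = x1 \/ (W1 (graft y.2 p ss) < W1 S0)%N.
  rewrite /tq mem_cat -/x -/n => /orP[/allpairsPdep[m [i [min iin ->]]]|].
    right; rewrite graft_node W2 //; first exact: leq_trans W4.
    rewrite /isc; apply/negP => /eqP [_ m0].
    by move: iin; rewrite m0.
  rewrite gtn_eqF // => /allpairsPdep[m [R [_ Rin ->]]].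
  move: Rin; rewrite mem_filter mem_row => /andP[/eqP wRq /and5P[sR lR' pR' chR /eqP tR']].
  rewrite graft_node /W1 lw_thin // (lwr_graft _ _ (pure_rin lR' pR' chR x0)).
  case: (row_word lR' pR' chR tR' x0 wRq (isT : (0 < 1)%N)) => [ER|h].
    left; rewrite /x1 -/R0 in ER *; rewrite -ER.
    by move: sR; rewrite ER size_corow size_nseq => /eqP ->.
  by right; rewrite wS0.
split.
- rewrite dS_node cfD [X in _ + X](@cf_inspan _ (fun S => if S is Node b _ _ then b = a else False)).
  + rewrite addr0 gr_dgen // cf_sum (bigD1_seq x1) //=; last first.
      by apply: (map_uniq (f := snd)); apply: uniq_tq.
    rewrite big_seq_cond big1 => [|y /andP[yin ny]].
      by rewrite addr0 !cfZ; have := G1; rewrite /= => ->; rewrite /cf lin_bas // eqxx mulr1 mulf_neq0 ?signr_eq0.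
    rewrite !cfZ (@cf_inspan _ (fun S => (W1 S < W1 S0)%N)) ?mulr0 ?ltnn //.
    apply: inspan_bas; case: (Gx y yin) => // Ey.
    by rewrite Ey eqxx in ny.
  + by apply: inspanZ; apply: inspan_drow_bas => l s r _ t _.
  by rewrite /S0 /corolla => Eb; move: x0; rewrite /x -Eb.
- rewrite dS_node; apply: inspanD.
    rewrite gr_dgen //; apply: inspan_sum => y yin; do 2 apply: inspanZ.
    apply: inspan_bas; case: (Gx y yin) => [->|h]; first by left.
    by right; apply: Or31.
  apply: inspanZ; apply: inspan_drow_bas => l s r _ t _; right; apply: Or32.
  by rewrite /= -/x x0 nl; do 3 eexists.
rewrite W2 //; first by apply: leq_trans W4.
by apply/negbTE; move/negbT: nl; rewrite negb_or => /andP[].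
Qed.

Lemma stD_all S : legit S -> (0 < ar_in (st_ar S))%N -> stD k S.
Proof.
elim/stacking_mem_ind: S => // a p ss IH lS S0' t i S0.
have := lS; rewrite legit_node => /and3P[cs la lss].
have ch := proj2 (andP cs).
have [a0|a0] := posnP (ar_in a); last first.
  rewrite [st _]/= a0; case: ifP => // nl [<- <- <-].
  exact: stD_letter.
case Eg: (isg (Node a p ss)); first by rewrite (st_g Eg).
have p0 : (0 < p)%N by move: S0'; rewrite /= -[ar_in _]/(ar_in a + p)%N a0.
rewrite st_thin //; case: (scanP lss ch p0) => //.
- move=> A x y R pA Fx cy Ess [<- <- <-]; rewrite Ess.
  apply: stD_Fc => //; first by rewrite -Ess.
  case: A R Ess {pA} => [|? ?] [|? ?] // Ess.
  by move: Eg; rewrite Ess /= a0 Fx cy.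
move=> A T T' R d t' i' pA sT lT T0 Ess [Ed <- <- <-]; rewrite Ed in sT.
have Tss : T \in ss by rewrite Ess mem_cat mem_head orbT.
have := stD_deep (k := k) _ a0 pA lT T0 (IH T Tss lT T0) sT; rewrite Ess => H.
have -> : Node (lax_arity 0 (size (A ++ T' :: R))) p (A ++ T' :: R) =
    Node a p (A ++ T' :: R).
  congr (Node _ _ _); case/andP: la => _ /eqP ->; rewrite a0.
  by rewrite -(composable_up cs) Ess !size_cat.
by apply: (H p); rewrite -Ess.
Qed.
End LeadingLetter.

Lemma st_idx S d t i S' : legit S -> (0 < ar_in (st_ar S))%N ->
  st S = Some ((d, t, i), S') -> (i <= size (lw S))%N.
Proof.
elim/stacking_mem_ind: S d t i S' => // a p ss IH d t i S' lS S0.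
have := lS; rewrite legit_node => /and3P[cs la lss]; have ch := proj2 (andP cs).
have [a0|a0] := posnP (ar_in a); last first.
  by rewrite [st _]/= a0; case: ifP => // _ [_ _ <- _].
case Eg: (isg (Node a p ss)); first by rewrite (st_g Eg).
have p0 : (0 < p)%N by move: S0; rewrite /= -[ar_in _]/(ar_in a + p)%N a0.
rewrite st_thin // lw_thin //; case: (scanP lss ch p0) => [_|A x y R pA Fx cy E|
   A x y R b pA Fx cy E _|A T T' R d' t' i' pA sT lT T0 E] [_ _ <- _] //.
- by rewrite E lwr_cat size_cat size_lwr_pfx // leq_addr.
- by rewrite E lwr_cat size_cat size_lwr_pfx // leq_addr.
have Tss : T \in ss by rewrite E mem_cat mem_head orbT.
rewrite E lwr_cat lwr_cons !size_cat size_lwr_pfx // leq_add2l.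
exact: leq_trans (IH T Tss _ _ _ _ lT T0 sT) (leq_addr _ _).
Qed.

Definition up1 S := if st S is Some ((false, _, _), _) then true else false.
Definition dn1 S := if st S is Some ((true, _, _), _) then true else false.
Definition move1 S := if st S is Some (_, S') then S' else S.
(** A lexicographic order as one number: the word, then grouping before merging moves, then earlier
    before later positions. The position is smaller than [W1] ([st_idx], [size_lt_W1]), so the
    square leaves enough room for the second summand. *)
Definition Wt S := (W1 S * W1 S +
  if st S is Some ((_, false, i), _) then W1 S - i else 0)%N.

Lemma size_lt_W1 S : (size (lw S) < W1 S)%N.
Proof.
have /andP[h _] := bv_bounds 1 (lw S); apply: leq_trans h.
by rewrite mul1n ltn_expl.
Qed.

Lemma low_Wt t i S0 T S' : legit S0 -> (0 < ar_in (st_ar S0))%N ->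
  st S0 = Some ((false, t, i), T) -> low t i S0 S' -> ~~ up1 S' \/ (Wt S' < Wt S0)%N.
Proof.
move=> lS0 S00 sS0 []; last 2 first.
- by case=> t' [i' [S'' E]]; left; rewrite /up1 E.
- case=> Et Ew [t' [i' [S'' [E h]]]]; right; rewrite /Wt sS0 E Et Ew ltn_add2l.
  have i0 := leq_ltn_trans (st_idx lS0 S00 sS0) (size_lt_W1 S0).
  case: t' h {E} => [_|h]; first by rewrite subn_gt0.
  by move: i0 h; rewrite orFb; clear; lia.
move=> h; right.
have b1 : (Wt S' <= W1 S' * W1 S' + W1 S')%N.
  by rewrite /Wt leq_add2l; case: (st S') => [[[[? []] ?] ?]|] //; exact: leq_subr.
have b2 : (W1 S0 * W1 S0 <= Wt S0)%N := leq_addr _ _.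
move: (leq_mul h h) b1 b2; move: (W1 S') (W1 S0) (Wt S') (Wt S0) => u v x y.
by rewrite mulSn mulnS; move: (u * u)%N (v * v)%N => uu vv; clear; lia.
Qed.

(** * Vanishing of the homology in positive degrees *)

Section Acyclic.
Variable k : fieldType.
Notation V := (fmod k).
Notation D := (dS k tq).

Lemma acyclic1_elim p q r e (z : V) : (0 < p)%N ->
  inspan (fun S => st_ar S = (p, q, r) /\ ndeg S = e) z -> lin D z = 0 ->
  exists2 y, inspan (fun S => st_ar S = (p, q, r) /\ ndeg S = e.+1) y &
    inspan (fun S => [/\ st_ar S = (p, q, r), ndeg S = e, ~~ up1 S & ~~ dn1 S])
      (z - lin D y).
Proof.
move=> p0; apply: (@elimination k (fun S => st_ar S = (p, q, r)) up1 dn1 move1 move1 Wt).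
- by move=> S lS qS; apply: inspanS (dS_span tqP lS) => S' _ [E _ _]; rewrite E.
- move=> S lS qS; have S0 : (0 < ar_in (st_ar S))%N by rewrite qS.
  rewrite /up1 /dn1 /move1; case E: (st S) => [[[[[] t] i] S']|] // _.
  by have [lS' aS' -> nS'] := st_inv lS S0 E; rewrite aS'.
- move=> T lT qT; have T0 : (0 < ar_in (st_ar T))%N by rewrite qT.
  rewrite /dn1; case E: (st T) => [[[[[] t] i] S0]|] // _.
  have [lS0 aS0 sS0 nS0] := st_inv lT T0 E.
  have [nz sp _] := stD_all k lT T0 E.
  have -> : move1 T = S0 by rewrite /move1 E.
  split=> //; rewrite ?/up1 ?/move1 ?sS0 //.
  apply: inspanS sp => S' _ [->|h]; first by left.
  by right; apply: low_Wt sS0 h => //; rewrite aS0.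
move=> S lS qS; have S0 : (0 < ar_in (st_ar S))%N by rewrite qS.
have crit U : st U = None -> ~~ up1 U /\ ~~ dn1 U by rewrite /up1 /dn1 => ->.
rewrite /up1 /dn1; case E: (st S) => [[[[[] t] i] S']|] // _ _.
have := st_none lS S0 E; rewrite orbA => /orP[lets|gs].
  apply: inspanS (D_letter lS lets) => s' _ [Ec EF].
  by rewrite (@st_letter s') // Ec EF.
case: S gs lS {qS S0 E} => // a p' [|x [|y [|? ?]]] // gs lS.
have /and3P[/eqP a0 Fx cy] := gs.
have := lS; rewrite legit_node => /and3P[cs la /and3P[lx ly _]].
rewrite dS_node dgen_deg0 //; last by rewrite a0 -(composable_up cs).
rewrite linear0 add0r; apply: inspanZ.
apply: inspan_drow_bas => -[|l0 [|l1 [|? ?]]] s r' //= [].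
- move=> <- <-; apply: inspanS (D_letter lx (introT orP (or_intror Fx))) => s' _ [_ EF].
  by apply: (crit (Node a p' [:: s'; y])); apply: st_g; rewrite /isg a0 EF Fx cy.
- move=> <- <- <-; apply: inspanS (D_letter ly (introT orP (or_introl cy))) => s' _ [Ec _].
  by apply: (crit (Node a p' [:: x; s'])); apply: st_g; rewrite /isg a0 Fx Ec cy.
Qed.

(** With [Flet], [phi0] and [phi2] are the contexts m(K, 1), F(K) and m(F(K), c) of the critical
    stackings. Their boxes have degree 0, so the differential passes to K, with the sign -1 of a
    thin root. *)
Definition phi0 Y := Node (lax_arity 0 2) 0 [:: Y; Eta].
Definition phi2 Y := gpair (Flet Y) (clet (ar_out (st_ar Y)).-1).

Lemma D_Flet K : legit K -> D (Flet K) = lin (fun S => bas (Flet S) : V) (D K).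
Proof.
move=> lK; rewrite dS_node dgen_deg0 // linear0 add0r scale1r drow_cons.
rewrite scaler0 addr0; apply: (eq_lin_in (dS_span tqP lK)) => S _ [aS _ _].
by rewrite /Flet aS.
Qed.

Lemma D_phi2 K : legit K -> D (phi2 K) = -1 *: lin (fun S => bas (phi2 S) : V) (D K).
Proof.
move=> lK; rewrite /phi2 /gpair dS_node dgen_deg0 // linear0 add0r; congr (_ *: _).
rewrite !drow_cons D_Flet // scaler0 addr0.
have -> : D (clet (ar_out (st_ar K)).-1) = 0 :> V.
  by rewrite dS_node dgen_deg0 // linear0 add0r scaler0.
rewrite linear0 scaler0 addr0 lin_linE; apply: (eq_lin_in (dS_span tqP lK)) => S lS [aS _ _].
have [lF aF _] := flet_facts lS; have [_ aF' _] := flet_facts lK.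
have E : st_ar (Flet S) = st_ar (Flet K) by rewrite aF aF' aS.
by rewrite [LHS](lin_bas _ lF) /phi2 /gpair E aS.
Qed.

Lemma D_phi0 K : legit K -> D (phi0 K) = -1 *: lin (fun S => bas (phi0 S) : V) (D K).
Proof.
move=> lK; rewrite /phi0 dS_node dgen_deg0 // linear0 add0r; congr (_ *: _).
by rewrite !drow_cons linear0 !scaler0 !addr0 scaler0 addr0.
Qed.

(* If z is spanned by elements phi K and D (phi K) = c * phi (D K), then      *)
(* stripping phi turns z into a cycle.                                        *)
Lemma context_boundary (phi : stacking -> stacking) (c : k) a' e (y : V) : c != 0 ->
  (forall K, legit K -> st_ar K = a' -> legit (phi K) /\
     D (phi K) = c *: lin (fun S => bas (phi S) : V) (D K)) ->
  (forall z : V, inspan (fun S => st_ar S = a' /\ ndeg S = e) z -> lin D z = 0 ->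
    exists2 w, inspan (fun S => st_ar S = a' /\ ndeg S = e.+1) w & z = lin D w) ->
  inspan (fun S => st_ar S = a' /\ ndeg S = e) y -> lin D y = 0 ->
  exists2 w, inspan (fun S => st_ar S = a' /\ ndeg S = e.+1) w &
    lin (fun S => bas (phi S) : V) y = lin D (c^-1 *: lin (fun S => bas (phi S) : V) w).
Proof.
move=> c0 H ac py Dy; have [w pw Ew] := ac y py Dy; exists w => //.
pose u : V := lin (fun S => bas (phi S) : V) w.
have E : lin D u = c *: lin (fun S => bas (phi S) : V) (lin D w).
  rewrite /u [LHS]lin_linE [lin _ (lin D w)]lin_linE -lin_scale.
  apply: (eq_lin_in pw) => K lK [aK _]; have [lp Ep] := H K lK aK.
  by rewrite [LHS](lin_bas _ lp) Ep.
have -> : lin D (c^-1 *: u) = c^-1 *: lin D u by exact: linearZ.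
by rewrite E scalerA mulVf // scale1r Ew.
Qed.

(** On the critical stackings, [strip1], [strip2] and [strip0] recover K from its context; [strip1]
    and [strip2] vanish on each other's contexts. *)
Definition strip1 S : V := if isF S then bas (mergeF S) else 0.
Definition strip2 S : V := if isg S then bas (mergeF (mergeF S)) else 0.
Definition strip0 S : V := if S is Node _ _ (K :: _) then bas K else 0.

Lemma isF_Flet S : legit S -> isF S -> exists2 K, legit K & S = Flet K.
Proof.
case: S => // a p ss lS /eqP Ea; move: lS; rewrite legit_node Ea => /and3P[cs _].
have := composable_up cs; case: ss cs => [|K [|? ?]] // /andP[_ /andP[/eqP <- _]] _.
by case/andP=> lK _; exists K.
Qed.

Lemma isc_clet S : legit S -> isc S -> exists b, S = clet b.
Proof.
case: S => // a p ss lS /eqP Ea; move: lS; rewrite legit_node Ea => /and3P[cs _].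
by have := composable_up cs; case: ss cs => // _ _ _; exists p.
Qed.

Lemma isg_phi2 S : legit S -> isg S -> exists2 K, legit K & S = phi2 K.
Proof.
case: S => // a p [|x [|y [|? ?]]] // lS /and3P[/eqP a0 Fx cy].
move: lS; rewrite legit_node => /and3P[cs la /and3P[lx ly _]].
have [K lK Ex] := isF_Flet lx Fx; have [b Ey] := isc_clet ly cy.
exists K => //; have [_ aF _] := flet_facts lK.
case/andP: cs => /eqP sz /and3P[/eqP xp /eqP yx _].
case/andP: la => _ /eqP ->; rewrite a0 -sz /phi2 /gpair -Ex xp.
congr (Node _ _ [:: _; _]); rewrite Ey /clet; congr Node.
by move: yx; rewrite Ey Ex aF /= /comp_arity /ar_in /ar_out /= => -[<-].
Qed.

Lemma phi2_facts K : legit K -> (0 < ar_out (st_ar K))%N ->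
  [/\ legit (phi2 K), isg (phi2 K),
    st_ar (phi2 K) = ((ar_in (st_ar K)).+1, up K, ar_out (st_ar K)) & ndeg (phi2 K) = ndeg K].
Proof.
move=> lK o0; have [lF aF nF] := flet_facts lK.
have ac : st_ar (clet (ar_out (st_ar K)).-1) = ((ar_out (st_ar K)).+1, 0%N, ar_out (st_ar K)).
  by case: (ar_out (st_ar K)) o0.
have [|lg ag ng] := @gpair_facts (Flet K) (clet (ar_out (st_ar K)).-1) lF isT.
  by rewrite ac aF.
split=> //; first by rewrite /phi2 ag ac aF /= addn0.
by rewrite ng nF addn0.
Qed.

Lemma ndeg_phi0 K : ndeg (phi0 K) = ndeg K.
Proof. by rewrite /phi0 ndeg_node; change (0 + (ndeg K + 0) = ndeg K)%N; rewrite addn0. Qed.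

(** By elimination the cycle may be taken on critical stackings; c has degree 0 and does not occur.
    Stripping the contexts yields cycles of smaller arity: m(K, 1) has one input more than K, F(K)
    one more wire coming in and one more going out, m(F(K), c) one more wire coming in. By induction
    these are boundaries, and [context_boundary] puts the contexts back. *)
Lemma acyclic_aux n p q r e (z : V) : (p + q <= n)%N ->
  inspan (fun S => st_ar S = (p, q, r) /\ ndeg S = e.+1) z -> lin D z = 0 ->
  exists2 w, inspan (fun S => st_ar S = (p, q, r) /\ ndeg S = e.+2) w & z = lin D w.
Proof.
elim: n p q r e z => [|n IH] p q r e z pqn pz Dz.
  move: pqn; rewrite leqn0 addn_eq0 => /andP[/eqP p0 /eqP q0].
  exists 0; first exact: inspan0.
  rewrite linear0 -[LHS]lin_basE; apply: (lin0 pz) => S lS [aS _].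
  have [|_] := legit_thin lS; first by rewrite aS p0.
  by rewrite aS q0.
have fin (y z' w' : V) : inspan (fun S => st_ar S = (p, q, r) /\ ndeg S = e.+2) y ->
   z' = z - lin D y -> inspan (fun S => st_ar S = (p, q, r) /\ ndeg S = e.+2) w' ->
   z' = lin D w' ->
   exists2 w, inspan (fun S => st_ar S = (p, q, r) /\ ndeg S = e.+2) w & z = lin D w.
  move=> py Ez pw Ew; exists (y + w'); first exact: inspanD.
  by rewrite linearD /= -Ew Ez addrC subrK.
have DD y : lin D (z - lin D y) = 0.
  by rewrite linearB; have := dT_dT y; rewrite /= => ->; rewrite subr0; exact: Dz.
have [p0|p0] := posnP p.
  have r0 : r = 0%N \/ z = 0.
    case: r pz {fin} => [|r] pz; [by left | right].
    rewrite -[z]lin_basE; apply: (lin0 pz) => S lS [aS _].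
    by have [|] := legit_thin lS; rewrite aS ?p0.
  case: r0 => [r0|z0]; last by exists 0; [apply: inspan0 | rewrite z0 linear0].
  have [y py pz'] : exists2 y, inspan (fun S => Q0 q S /\ ndeg S = e.+2) y &
    inspan (fun S => [/\ Q0 q S, ndeg S = e.+1, ~~ up0 S & ~~ dn0 S]) (z - lin D y).
    apply: acyclic0_elim Dz; apply: inspanS pz => S _ [aS nS]; split=> //.
    by rewrite /Q0 aS p0 r0.
  set z' := z - lin D y in pz'.
  have crit S : legit S -> Q0 q S -> ndeg S = e.+1 -> ~~ up0 S -> ~~ dn0 S ->
      exists2 Y, [/\ legit Y, st_ar Y = (0, q.-1, 0)%N & ndeg Y = e.+1] & S = phi0 Y.
    case: S => // a p' ss lS QS nS nu nd.
    have i0 : ar_in (st_ar (Node a p' ss)) = 0%N by rewrite QS.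
    have [Ea Ep s2 lss tss] := thin_node lS i0.
    case: ss s2 lss tss nu nd Ea lS QS nS i0 => [|Y [|[|? ? ?] [|? ?]]] //.
    move=> _ /andP[lY _] /andP[/andP[/eqP Yi /eqP Yo] _] _ _ Ea lS QS nS _.
    exists Y; last by rewrite /phi0 -Ea -Ep.
    split=> //; last by rewrite -nS Ea Ep -(ndeg_phi0 Y).
    move: QS; rewrite /Q0 /= /comp_arity /ar_up /= => -[_ <- _].
    by rewrite addn1 /=; move: Yi Yo; case: (st_ar Y) => [[y1 y2] y3]; rewrite /ar_in /ar_out /= => -> ->.
  have pst : inspan (fun S => st_ar S = (0, q.-1, 0)%N /\ ndeg S = e.+1) (lin strip0 z').
    apply: (inspan_lin pz') => S lS [QS nS nu nd].
    by have [Y [lY aY nY] ->] := crit S lS QS nS nu nd; apply: inspan_bas.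
  have lph K : legit K -> st_ar K = (0, q.-1, 0)%N -> legit (phi0 K) /\
      D (phi0 K) = -1 *: lin (fun S => bas (phi0 S) : V) (D K).
    move=> lK aK; split; last exact: D_phi0.
    by rewrite legit_node /composable /= aK lK.
  have Dst : lin D (lin strip0 z') = 0.
    rewrite lin_linE (eq_lin_in (g := fun S => -1 *: lin strip0 (D S)) pz').
      by rewrite lin_scale -lin_linE DD linear0 scaler0.
    move=> S lS [QS nS nu nd]; have [Y [lY aY nY] ->] := crit S lS QS nS nu nd.
    rewrite -[strip0 (phi0 Y)]/(bas Y : V) [LHS](lin_bas _ lY) D_phi0 // linearZ scalerA mulrNN mulr1 scale1r lin_linE.
    rewrite -[LHS]lin_basE; apply: (eq_lin_in (dS_span tqP lY)) => S' lS' [aS' _ _].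
    have [lp _] := lph S' lS' (etrans aS' aY); by rewrite [RHS](lin_bas _ lp).
  have N1 : (-1 : k) != 0 by rewrite oppr_eq0 oner_eq0.
  have hq : (0 + q.-1 <= n)%N.
    by move: pqn; rewrite p0; case: (q) => [|q'] //; rewrite add0n.
  have [w pw Ew] := context_boundary (phi := phi0) (c := -1) (e := e.+1) N1 lph
    (fun z1 => @IH 0%N q.-1 0%N e z1 hq) pst Dst.
  apply: (fin y z' ((-1)^-1 *: lin (fun S => bas (phi0 S) : V) w)) => //.
  - by move: py; rewrite /Q0 p0 r0.
  - apply: inspanZ; apply: (inspan_lin pw) => K lK [aK nK]; apply: inspan_bas.
    rewrite ndeg_phi0 nK; split=> //; rewrite /= /comp_arity aK /ar_up /ar_out /= p0 r0.
    congr (_, _, _).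
    have [x sx] : exists x, st_ar x = (0, q.-1, 0)%N /\ legit x by exists K.
    have [_] := legit_thin lK (congr1 ar_in aK); rewrite aK /ar_up /=.
    by case: (q) => // q' _; rewrite addn1.
  rewrite -Ew lin_linE -[LHS]lin_basE; apply: (eq_lin_in pz') => S lS [QS nS nu nd].
  by have [Y [lY aY nY] ->] := crit S lS QS nS nu nd;
    rewrite -[strip0 (phi0 Y)]/(bas Y : V) [RHS](lin_bas _ lY).
have [y py pz'] := acyclic1_elim p0 pz Dz.
set z' := z - lin D y in pz'.
have Dz' : lin D z' = 0 by apply: DD.
have crit S : legit S -> st_ar S = (p, q, r) -> ndeg S = e.+1 -> ~~ up1 S -> ~~ dn1 S ->
  (exists2 K, [/\ legit K, st_ar K = (p.-1, q, r.-1) & ndeg K = e.+1] & S = Flet K) \/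
  (exists2 K, [/\ legit K, st_ar K = (p.-1, q, r) & ndeg K = e.+1] & S = phi2 K).
  move=> lS aS nS; have S0 : (0 < ar_in (st_ar S))%N by rewrite aS.
  rewrite /up1 /dn1; case E: (st S) => [[[[[] t] i] S']|] // _ _.
  case/or3P: (st_none lS S0 E) => h.
  - by have [b Eb] := isc_clet lS h; move: nS; rewrite Eb.
  - have [K lK Es] := isF_Flet lS h; left; exists K => //.
    have [_ aF nF] := flet_facts lK; rewrite -nF -Es; split=> //.
    move: aS; rewrite Es aF => -[<- <- <-] /=.
    by case: (st_ar K) => [[? ?] ?].
  have [K lK Es] := isg_phi2 lS h; right; exists K => //.
  have r0 : (0 < r)%N by have := legit_pos lS S0; rewrite aS.
  have o0 : (0 < ar_out (st_ar K))%N.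
    move: aS r0; rewrite Es /phi2 /gpair /= /comp_arity /top /= => -[_ _ <-].
    rewrite /ar_out /= -/(ar_out _); case: (posnP (ar_out (st_ar K))) => // Eo _.
    have := lS; rewrite Es /phi2 legit_node => /and3P[/andP[_ /and3P[_ /eqP + _]] _ _].
    by have [_ aF _] := flet_facts lK; rewrite aF Eo.
  have [_ _ a2 n2] := phi2_facts lK o0; rewrite -n2 -Es; split=> //.
  move: aS; rewrite Es a2 => -[<- <- <-] /=.
  by case: (st_ar K) => [[? ?] ?].
have r0 : (0 < r)%N \/ z' = 0.
  case: (posnP r) => [Er|]; [right | by left].
  rewrite -[z']lin_basE; apply: (lin0 pz') => S lS [aS _ _ _].
  by have := legit_pos lS; rewrite aS Er => /(_ p0).
case: r0 => [r0|z0]; last first.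
  by apply: (fin y z' 0) => //; [apply: inspan0 | rewrite z0 linear0].
have l1 K : legit K -> st_ar K = (p.-1, q, r.-1) -> legit (Flet K) /\
    D (Flet K) = 1 *: lin (fun S => bas (Flet S) : V) (D K).
  by move=> lK aK; have [lF _ _] := flet_facts lK; rewrite scale1r D_Flet.
have l2 K : legit K -> st_ar K = (p.-1, q, r) -> legit (phi2 K) /\
    D (phi2 K) = -1 *: lin (fun S => bas (phi2 S) : V) (D K).
  move=> lK aK; have [|lF _ _ _] := phi2_facts lK; first by rewrite aK.
  by rewrite D_phi2.
have s1F K : strip1 (Flet K) = bas K by [].
have s1g K : strip1 (phi2 K) = 0 by [].
have s2F K : strip2 (Flet K) = 0 by [].
have s2g K : strip2 (phi2 K) = bas K by [].
have p1 : inspan (fun S => st_ar S = (p.-1, q, r.-1) /\ ndeg S = e.+1) (lin strip1 z').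
  apply: (inspan_lin pz') => S lS [aS nS nu nd].
  case: (crit S lS aS nS nu nd) => -[K [lK aK nK] ->].
    by rewrite s1F; apply: inspan_bas.
  by rewrite s1g; apply: inspan0.
have p2 : inspan (fun S => st_ar S = (p.-1, q, r) /\ ndeg S = e.+1) (lin strip2 z').
  apply: (inspan_lin pz') => S lS [aS nS nu nd].
  case: (crit S lS aS nS nu nd) => -[K [lK aK nK] ->].
    by rewrite s2F; apply: inspan0.
  by rewrite s2g; apply: inspan_bas.
have D1 : lin D (lin strip1 z') = 0.
  rewrite lin_linE (eq_lin_in (g := fun S => lin strip1 (D S)) pz').
    by rewrite -lin_linE Dz' linear0.
  move=> S lS [aS nS nu nd]; case: (crit S lS aS nS nu nd) => -[K [lK aK nK] ->].
    rewrite s1F [LHS](lin_bas _ lK) D_Flet // lin_linE -[LHS]lin_basE.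
    apply: (eq_lin_in (dS_span tqP lK)) => S' lS' [aS' _ _].
    by have [lF _ _] := flet_facts lS'; rewrite [RHS](lin_bas _ lF).
  have L0 : lin strip1 (lin (fun S => bas (phi2 S) : V) (D K)) = 0.
    rewrite [LHS]lin_linE; apply: (lin0 (dS_span tqP lK)) => S' lS' [aS' _ _].
    by have [lF _] := l2 S' lS' (etrans aS' aK); rewrite [LHS](lin_bas _ lF).
  rewrite s1g [LHS]linear0 D_phi2 //; symmetry.
  transitivity (-1 *: lin strip1 (lin (fun S => bas (phi2 S) : V) (D K)) : V).
    by exact: linearZ.
  by rewrite L0 scaler0.
have D2 : lin D (lin strip2 z') = 0.
  rewrite lin_linE (eq_lin_in (g := fun S => -1 *: lin strip2 (D S)) pz').
    by rewrite lin_scale -lin_linE Dz' linear0 scaler0.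
  move=> S lS [aS nS nu nd]; case: (crit S lS aS nS nu nd) => -[K [lK aK nK] ->].
    have L0 : lin strip2 (lin (fun S => bas (Flet S) : V) (D K)) = 0.
    rewrite [LHS]lin_linE; apply: (lin0 (dS_span tqP lK)) => S' lS' [aS' _ _].
    by have [lF _ _] := flet_facts lS'; rewrite [LHS](lin_bas _ lF).
  by rewrite s2F [LHS]linear0 D_Flet // L0 scaler0.
  rewrite s2g [LHS](lin_bas _ lK) D_phi2 // linearZ scalerA mulrNN mulr1 scale1r lin_linE.
  rewrite -[LHS]lin_basE; apply: (eq_lin_in (dS_span tqP lK)) => S' lS' [aS' _ _].
  by have [lF _] := l2 S' lS' (etrans aS' aK); rewrite [RHS](lin_bas _ lF).
have pn : (p.-1 + q <= n)%N by move: pqn p0; clear; lia.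
have [w1 pw1 E1] := context_boundary (phi := Flet) (c := 1) (e := e.+1)
  (oner_neq0 k) l1 (fun z1 => @IH p.-1 q r.-1 e z1 pn) p1 D1.
have N1 : (-1 : k) != 0 by rewrite oppr_eq0 oner_eq0.
have [w2 pw2 E2] := context_boundary (phi := phi2) (c := -1) (e := e.+1)
  N1 l2 (fun z1 => @IH p.-1 q r e z1 pn) p2 D2.
apply: (fin y z' (1^-1 *: lin (fun S => bas (Flet S) : V) w1 +
   (-1)^-1 *: lin (fun S => bas (phi2 S) : V) w2)) => //.
  apply: inspanD; apply: inspanZ.
    apply: (inspan_lin pw1) => K lK [aK nK]; apply: inspan_bas.
    have [_ -> ->] := flet_facts lK; rewrite aK nK; split=> //.
    by rewrite /ar_in /ar_up /ar_out /= !prednK.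
  apply: (inspan_lin pw2) => K lK [aK nK]; apply: inspan_bas.
  have [|_ _ -> ->] := phi2_facts lK; first by rewrite aK.
  by rewrite aK nK; split=> //; rewrite /ar_in /ar_up /ar_out /= prednK.
rewrite (_ : lin D (_ + _) = lin D (1^-1 *: lin (fun S => bas (Flet S) : V) w1) +
  lin D ((-1)^-1 *: lin (fun S => bas (phi2 S) : V) w2)); last exact: linearD.
rewrite -E1 -E2 !lin_linE -lin_add -[LHS]lin_basE.
apply: (eq_lin_in pz') => S lS [aS nS nu nd].
case: (crit S lS aS nS nu nd) => -[K [lK aK nK] ->].
  by rewrite s1F s2F linear0 addr0 [RHS](lin_bas _ lK).
by rewrite s1g s2g linear0 add0r [RHS](lin_bas _ lK).
Qed.
End Acyclic.

(** * Quotients of box operads *)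

Section QuotientModule.
Variables (k : fieldType) (V : lmodType k) (J : V -> Prop).
Hypotheses (J0 : J 0) (JP : forall c u v, J u -> J v -> J (c *: u + v)).

Lemma ideal_scale c u : J u -> J (c *: u).
Proof. by move=> Ju; rewrite -[_ *: _]addr0; apply: JP. Qed.
Lemma ideal_opp u : J u -> J (- u).
Proof. by rewrite -scaleN1r; apply: ideal_scale. Qed.
Lemma ideal_add u v : J u -> J v -> J (u + v).
Proof. by move=> Ju; rewrite -[u]scale1r; apply: JP. Qed.

(* The quotient is realized on a set of canonical representatives. *)
Definition qnf (x : V) : V := choose (fun y => `[< J (x - y) >]) x.

Lemma qnfP x : J (x - qnf x).
Proof.
apply/asboolP; apply: (@chooseP V (fun y => `[< J (x - y) >]) x).
by apply/asboolP; rewrite subrr.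
Qed.

Lemma qnf_eq x y : J (x - y) -> qnf x = qnf y.
Proof.
move=> Jxy; have Jyx : J (y - x) by rewrite -opprB; apply: ideal_opp.
rewrite /qnf (@eq_choose _ _ (fun z => `[< J (y - z) >])); last first.
  move=> z; apply/asboolP/asboolP => h.
    by rewrite -[y](subrK x) -addrA; apply: ideal_add.
  by rewrite -[x](subrK y) -addrA; apply: ideal_add.
by apply: choose_id; apply/asboolP => //; rewrite subrr.
Qed.

Definition qtype := {x : V | qnf x == x}.
HB.instance Definition _ := Choice.on qtype.
Notation Q := qtype.

Definition qpi (x : V) : Q.
Proof. by exists (qnf x); apply/eqP/esym/qnf_eq/qnfP. Defined.
Definition qrepr (u : Q) : V := sval u.

Lemma qreprK u : qpi (qrepr u) = u.
Proof. by apply: val_inj; rewrite /= /qrepr; apply/eqP/(svalP u). Qed.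

Lemma qeqP (x y : V) : qpi x = qpi y <-> J (x - y).
Proof.
split=> [E|h]; last by apply: val_inj; apply: qnf_eq.
have Exy : qnf x = qnf y := congr1 sval E.
have := ideal_add (qnfP x) (ideal_opp (qnfP y)).
by rewrite opprB Exy addrA subrK.
Qed.

Lemma qreprP x : J (qrepr (qpi x) - x).
Proof. by apply/qeqP; rewrite qreprK. Qed.

Definition qadd u v : Q := qpi (qrepr u + qrepr v).
Definition qopp u : Q := qpi (- qrepr u).

Lemma qadd_pi x y : qadd (qpi x) (qpi y) = qpi (x + y).
Proof.
by apply/qeqP; rewrite opprD addrACA; apply: ideal_add; apply: qreprP.
Qed.
Lemma qopp_pi x : qopp (qpi x) = qpi (- x).
Proof. by apply/qeqP; rewrite -opprD; apply: ideal_opp; apply: qreprP. Qed.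

Fact qaddA : associative qadd.
Proof.
by move=> u v w; rewrite -[u]qreprK -[v]qreprK -[w]qreprK !qadd_pi addrA.
Qed.
Fact qaddC : commutative qadd.
Proof. by move=> u v; rewrite /qadd addrC. Qed.
Fact qadd0 : left_id (qpi 0) qadd.
Proof. by move=> u; rewrite -[u]qreprK qadd_pi add0r. Qed.
Fact qaddN : left_inverse (qpi 0) qopp qadd.
Proof. by move=> u; rewrite -[u]qreprK qopp_pi qadd_pi addNr. Qed.
HB.instance Definition _ := GRing.isZmodule.Build Q qaddA qaddC qadd0 qaddN.

Lemma qpiD x y : qpi (x + y) = qpi x + qpi y.
Proof. by rewrite -[RHS]/(qadd _ _) qadd_pi. Qed.

Definition qscale (c : k) (u : Q) : Q := qpi (c *: qrepr u).

Lemma qscale_pi c x : qscale c (qpi x) = qpi (c *: x).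
Proof.
apply/qeqP; rewrite -scalerBr -[_ *: _]addr0; apply: JP => //.
by apply/qeqP; rewrite qreprK.
Qed.

Fact qscaleA a b v : qscale a (qscale b v) = qscale (a * b) v.
Proof. by rewrite -[v]qreprK !qscale_pi scalerA. Qed.
Fact qscale1 : left_id 1 qscale.
Proof. by move=> v; rewrite -[v]qreprK qscale_pi scale1r. Qed.
Fact qscaleDr : right_distributive qscale +%R.
Proof.
move=> a u v; rewrite -[u]qreprK -[v]qreprK -qpiD !qscale_pi -qpiD.
by rewrite scalerDr.
Qed.
Fact qscaleDl v : {morph qscale^~ v : a b / a + b}.
Proof. by move=> a b; rewrite -[v]qreprK !qscale_pi -qpiD scalerDl. Qed.
HB.instance Definition _ := GRing.Zmodule_isLmodule.Build k Q
  qscaleA qscale1 qscaleDr qscaleDl.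

Fact qpi_linear : linear qpi.
Proof. by move=> c x y; rewrite qpiD -qscale_pi. Qed.
HB.instance Definition _ := GRing.isLinear.Build k V Q _ qpi qpi_linear.

Lemma quotient_lmod : exists (Q : lmodType k) (pi : {linear V -> Q}),
  (forall x, pi x = 0 <-> J x) /\ forall u, exists x, u = pi x.
Proof.
exists Q, qpi; split=> [x|u]; last by exists (qrepr u); rewrite /= qreprK.
by rewrite -[0](linear0 qpi) /= -[X in _ <-> J X]subr0; exact: qeqP.
Qed.
End QuotientModule.

Lemma pieces_catE (k : fieldType) (M : grmod k) s1 s2 (l1 l2 : seq M) :
  size l1 = size s1 -> pieces (s1 ++ s2) (l1 ++ l2) -> pieces s1 l1 /\ pieces s2 l2.
Proof. by elim: s1 l1 => [|t s1 IH] [|x l1] //= [/IH H] [px /H [p1 p2]]. Qed.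

Lemma chained_catE p s1 s2 : chained p (s1 ++ s2) = chained p s1 && chained (top p s1) s2.
Proof. by elim: s1 p => //= a s1 IH p; rewrite IH andbA. Qed.

(** * The quotient of a box operad by a homogeneous ideal *)

Section BoxQuotient.
Variables (k : fieldType) (B : boxop k) (J : B -> Prop).
Variables (Q : lmodType k) (pi : {linear B -> Q}).
Hypotheses (kerP : forall x, pi x = 0 <-> J x) (surj : forall u, exists x, u = pi x).
Hypothesis Jhom : forall s : seq (arity * int * B),
  uniq [seq t.1 | t <- s] -> (forall t, t \in s -> piece t.1.1 t.1.2 t.2) ->
  J (\sum_(t <- s) t.2) -> forall t, t \in s -> J t.2.
Hypothesis Jl : forall a e p0 s x xs, composable a p0 (unzip1 s) ->
  piece a e x -> J x -> pieces s xs -> J (mu x p0 xs).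
Hypothesis Jr : forall a e p0 s1 t s2 x zs1 y zs2,
  composable a p0 (unzip1 (s1 ++ t :: s2)) -> piece a e x -> pieces s1 zs1 ->
  piece t.1 t.2 y -> J y -> pieces s2 zs2 -> J (mu x p0 (zs1 ++ y :: zs2)).

Definition qpiece a e (u : Q) : Prop := exists2 x, piece a e x & u = pi x.

Fact qpiece0 a e : qpiece a e 0.
Proof. by exists 0; [apply: piece0 | rewrite linear0]. Qed.

Fact qpiece_lin a e (c : k) u v : qpiece a e u -> qpiece a e v -> qpiece a e (c *: u + v).
Proof.
by move=> [x px ->] [y py ->]; exists (c *: x + y); [apply: piece_lin | rewrite linearP].
Qed.

Fact qpiece_span v : exists s : seq (arity * int * Q),
  (forall t, t \in s -> qpiece t.1.1 t.1.2 t.2) /\ v = \sum_(t <- s) t.2.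
Proof.
have [x ->] := surj v; have [s [ps ->]] := piece_span x.
exists [seq (t.1, pi t.2) | t <- s]; split; last by rewrite big_map linear_sum.
by move=> t /mapP[u us ->] /=; exists u.2 => //; apply: ps.
Qed.

Fact qpiece_direct (s : seq (arity * int * Q)) : uniq [seq t.1 | t <- s] ->
  (forall t, t \in s -> qpiece t.1.1 t.1.2 t.2) ->
  \sum_(t <- s) t.2 = 0 -> forall t, t \in s -> t.2 = 0.
Proof.
move=> us ps s0.
have [s' Es ps'] : exists2 s', s = [seq (t.1, pi t.2) | t <- s'] &
    forall t, t \in s' -> piece t.1.1 t.1.2 t.2.
  elim: s ps {us s0} => [|[b u] s IH] ps; first by exists [::].
  have [|s' -> ps'] := IH; first by move=> t ts; apply: ps; rewrite inE ts orbT.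
  have [x px /= ->] := ps _ (mem_head _ _); exists ((b, x) :: s') => // t.
  by rewrite inE => /predU1P[->|/ps'].
move: us s0; rewrite Es -map_comp big_map -linear_sum => us /kerP Js t /mapP[u us' ->] /=.
by apply/kerP; apply: (Jhom us ps' Js).
Qed.

Definition qgr : grmod k := @GrMod k Q qpiece qpiece0 qpiece_lin qpiece_span qpiece_direct.

(** [mu] is meaningful on homogeneous arguments only, so products of classes are formed with
    homogeneous representatives. A nonzero class has representatives in one arity and degree at
    most, as the ideal is homogeneous; 0 is represented by 0, which lies in every piece. *)
Definition hrep (u : Q) : B :=
  match pselect (u <> 0 /\ exists x, (exists a e, piece a e x) /\ u = pi x) with
  | left p => projT1 (cid (proj2 p))
  | right _ => 0
  end.

Lemma hrepP a e u : qpiece a e u -> piece a e (hrep u) /\ pi (hrep u) = u.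
Proof.
move=> [x px Eu]; rewrite /hrep; case: pselect => [p|np]; last first.
  have [->|u0] := pselect (u = 0); first by split; [apply: piece0 | rewrite linear0].
  by case: np; split=> //; exists x; split=> //; exists a, e.
case: cid => y [[a' [e' py]] Ey] /=; split=> //.
have [[<- <-] //|ne] := eqVneq (a', e') (a, e).
case: (proj1 p); rewrite Eu; apply/kerP.
have pN : piece a' e' (- y) by rewrite -scaleN1r; apply: pieceZ.
apply: (Jhom (s := [:: ((a, e), x); ((a', e'), - y)]) _ _ _ (mem_head _ _)).
- by rewrite /= inE eq_sym ne.
- by move=> t; rewrite !inE => /orP[] /eqP ->.
by rewrite big_cons big_seq1; apply/kerP; rewrite linearB /= -Eu -Ey subrr.
Qed.

Definition muQ (u : Q) p0 (us : seq Q) : Q := pi (mu (hrep u) p0 (map hrep us)).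

Lemma mu_congr a e p0 s1 s y zs1 xs xs' :
  composable a p0 (unzip1 (s1 ++ s)) -> piece a e y -> pieces s1 zs1 ->
  pieces s xs -> pieces s xs' -> map pi xs = map pi xs' ->
  pi (mu y p0 (zs1 ++ xs)) = pi (mu y p0 (zs1 ++ xs')).
Proof.
elim: s s1 zs1 xs xs' => [|t s IH] s1 zs1 [|x xs] [|x' xs'] //= cs py p1.
move=> [px pxs] [px' pxs'] [Ex Exs].
transitivity (pi (mu y p0 (zs1 ++ x' :: xs))).
  apply/eqP; rewrite -subr_eq0 addrC -scaleN1r -linearZ -linearD; apply/eqP/kerP.
  rewrite -(mu_linr _ cs py p1 px' px pxs); apply: (Jr cs py p1) pxs => //.
    exact: piece_lin.
  by apply/kerP; rewrite linearP /= Ex scaleN1r addNr.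
rewrite -!cat_rcons; apply: (IH (rcons s1 t)) => //; first by rewrite cat_rcons.
by rewrite -!cats1; apply: pieces_cat.
Qed.

Lemma mu_congl a e p0 s x x' xs :
  composable a p0 (unzip1 s) -> piece a e x -> piece a e x' -> pieces s xs ->
  pi x = pi x' -> pi (mu x p0 xs) = pi (mu x' p0 xs).
Proof.
move=> cs px px' pxs Ex.
apply/eqP; rewrite -subr_eq0 addrC -scaleN1r -linearZ -linearD; apply/eqP/kerP.
rewrite -(mu_linl _ cs px' px pxs); apply: (Jl cs _ _ pxs); first exact: (piece_lin (-1) px' px).
by apply/kerP; rewrite linearP /= Ex scaleN1r addNr.
Qed.

Lemma pieces_rep s xs : pieces s xs ->
  pieces s (map hrep (map pi xs)) /\ map pi (map hrep (map pi xs)) = map pi xs.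
Proof.
elim: s xs => [|t s IH] [|x xs] //= [px /IH[p1 p2]].
have [|p3 p4] := @hrepP t.1 t.2 (pi x); first by exists x.
by rewrite p4 p2.
Qed.

Lemma muQ_pi a e p0 s x xs : composable a p0 (unzip1 s) -> piece a e x -> pieces s xs ->
  muQ (pi x) p0 (map pi xs) = pi (mu x p0 xs).
Proof.
move=> cs px pxs; have [p1 E1] := pieces_rep pxs.
have [|p2 E2] := @hrepP a e (pi x); first by exists x.
rewrite /muQ (mu_congl cs p2 px p1 E2).
exact: (@mu_congr a e p0 [::] s x [::] _ _ cs px I p1 pxs E1).
Qed.

Lemma lift_pieces s us : pieces (M := qgr) s us -> exists2 xs, pieces s xs & us = map pi xs.
Proof.
elim: s us => [|t s IH] [|u us] //=; first by exists [::].
by move=> [[x px ->] /IH[xs pxs ->]]; exists (x :: xs).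
Qed.

Fact muQ_piece a e p0 s (x : qgr) (xs : seq qgr) :
  composable a p0 (unzip1 s) -> piece a e x -> pieces s xs ->
  piece (g := qgr) (comp_arity a p0 (unzip1 s)) (e + \sum_(d <- unzip2 s) d) (muQ x p0 xs).
Proof.
move=> cs [y py ->] /lift_pieces[ys pys ->]; rewrite (muQ_pi cs py pys).
by exists (mu y p0 ys) => //; apply: mu_piece.
Qed.

Fact muQ_linl a e p0 s (c : k) (x y : qgr) (zs : seq qgr) :
  composable a p0 (unzip1 s) -> piece a e x -> piece a e y -> pieces s zs ->
  muQ (c *: x + y) p0 zs = c *: muQ x p0 zs + muQ y p0 zs.
Proof.
move=> cs [x' px ->] [y' py ->] /lift_pieces[zs' pzs ->].
rewrite -linearP (muQ_pi cs (piece_lin c px py) pzs) (muQ_pi cs px pzs) (muQ_pi cs py pzs).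
by rewrite (mu_linl c cs px py pzs) linearP.
Qed.

Fact muQ_linr a e p0 s1 t s2 (c : k) (x : qgr) (zs1 : seq qgr) (y z : qgr) (zs2 : seq qgr) :
  composable a p0 (unzip1 (s1 ++ t :: s2)) -> piece a e x ->
  pieces s1 zs1 -> piece t.1 t.2 y -> piece t.1 t.2 z -> pieces s2 zs2 ->
  muQ x p0 (zs1 ++ (c *: y + z) :: zs2) =
    c *: muQ x p0 (zs1 ++ y :: zs2) + muQ x p0 (zs1 ++ z :: zs2).
Proof.
move=> cs [x' px ->] /lift_pieces[z1 p1 ->] [y' py ->] [z' pz ->] /lift_pieces[z2 p2 ->].
have pc w : piece t.1 t.2 w -> pieces (s1 ++ t :: s2) (z1 ++ w :: z2).
  by move=> pw; apply: pieces_cat => //=; split.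
have E w : map pi z1 ++ pi w :: map pi z2 = map pi (z1 ++ w :: z2) by rewrite map_cat.
rewrite -linearP !E (muQ_pi cs px (pc _ (piece_lin c py pz))).
rewrite (muQ_pi cs px (pc _ py)) (muQ_pi cs px (pc _ pz)).
by rewrite (mu_linr c cs px p1 py pz p2) linearP.
Qed.

Lemma comp_row_lift s p0 xs q0 (tss : seq (seq (arity * int))) (yss : seq (seq B)) :
  chained p0 (unzip1 s) -> pieces s xs -> shape tss = [seq ar_up t.1 | t <- s] ->
  chained q0 (unzip1 (flatten tss)) -> shape yss = shape tss ->
  pieces (flatten tss) (flatten yss) ->
  exists s', [/\ pieces s' (comp_row (@mu k B) q0 xs yss (map unzip1 tss)),
    chained (p0 + q0) (unzip1 s'), size s' = size s &
    comp_row muQ q0 (map pi xs) (map (map pi) yss) (map unzip1 tss) =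
      map pi (comp_row (@mu k B) q0 xs yss (map unzip1 tss))].
Proof.
elim: s p0 xs q0 tss yss => [|t s IH] p0 [|x xs] q0 [|ts tss] [|ys yss] //=.
  by move=> *; exists [::].
move=> /andP[/eqP tp ch] [px pxs] [sts sh] + [sys shy].
rewrite /unzip1 map_cat chained_catE -!/(unzip1 _) => /andP[c1 c2].
move=> /(pieces_catE sys)[p1 p2].
have cs : composable t.1 q0 (unzip1 ts) by rewrite /composable size_map sts eqxx.
have [s' [ps' cs' ss' Es']] := IH _ _ _ _ _ ch pxs sh c2 shy p2.
exists ((comp_arity t.1 q0 (unzip1 ts), t.2 + \sum_(d <- unzip2 ts) d) :: s'); split=> //=.
- by split=> //; apply: mu_piece.
- by rewrite -[ar_in (comp_arity _ _ _)]/(ar_in t.1 + q0)%N tp eqxx.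
- by rewrite ss'.
by rewrite (muQ_pi cs px p1) Es'.
Qed.

Fact muQ_assoc a e p0 s (x : qgr) (xs : seq qgr) q0 (tss : seq (seq (arity * int)))
    (yss : seq (seq qgr)) :
  composable a p0 (unzip1 s) -> piece a e x -> pieces s xs ->
  shape tss = [seq ar_up t.1 | t <- s] -> chained q0 (unzip1 (flatten tss)) ->
  shape yss = shape tss -> pieces (flatten tss) (flatten yss) ->
  muQ x (p0 + q0)%N (comp_row muQ q0 xs yss (map unzip1 tss)) =
    sgn k (koszul (unzip2 s) (map unzip2 tss)) *:
      muQ (muQ x p0 xs) q0 (flatten yss).
Proof.
move=> cs [x' px ->] /lift_pieces[xs' pxs ->] sh ch shy /lift_pieces[ys pys Ey].
have sy : size ys = sumn (shape tss).
  by rewrite -shy -size_flatten -[LHS](size_map pi) -Ey.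
have shr : shape (reshape (shape tss) ys) = shape tss by rewrite reshapeKl // sy.
have flr : flatten (reshape (shape tss) ys) = ys by rewrite reshapeKr // sy.
have Eyss : yss = map (map pi) (reshape (shape tss) ys).
  by rewrite map_reshape -shy -{1}[yss]flattenK Ey.
rewrite Eyss -map_flatten flr.
have pfl : pieces (flatten tss) (flatten (reshape (shape tss) ys)) by rewrite flr.
have [|s' [ps' cs' ss' Es']] :=
  @comp_row_lift s p0 xs' q0 tss (reshape (shape tss) ys) _ pxs sh ch shr pfl.
  by case/andP: cs.
have cs2 : composable a (p0 + q0) (unzip1 s').
  by rewrite /composable cs' size_map ss'; move: cs; rewrite /composable size_map => /andP[->].
have cs3 : composable (comp_arity a p0 (unzip1 s)) q0 (unzip1 (flatten tss)).
  rewrite /composable ch andbT size_map size_flatten sh.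
  by rewrite /comp_arity /ar_up /= /unzip1 -map_comp.
rewrite Es' (muQ_pi cs2 px ps') (muQ_pi cs px pxs) (muQ_pi cs3 (mu_piece cs px pxs) pys).
by rewrite -linearZ -{2}flr -(mu_assoc cs px pxs sh ch shr) // flr.
Qed.

Fact muQ_1r a e (x : qgr) : piece a e x ->
  muQ x 0%N (nseq (ar_up a) (pi (Defs.one B))) = x.
Proof.
move=> [y py ->].
pose s := nseq (ar_up a) ((0, 1, 0)%N : arity, 0 : int).
have cs : composable a 0 (unzip1 s).
  rewrite /composable /s /unzip1 map_nseq size_nseq eqxx /=.
  by elim: (ar_up a).
have ps : pieces s (nseq (ar_up a) (Defs.one B)).
  by rewrite /s; elim: (ar_up a) => //= n IH; split=> //; apply: one_piece.
by rewrite -map_nseq (muQ_pi cs py ps) (mu_1r py).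
Qed.

Fact muQ_1l a e (x : qgr) : piece a e x -> muQ (pi (Defs.one B)) (ar_in a) [:: x] = x.
Proof.
move=> [y py ->].
have cs : composable (0, 1, 0)%N (ar_in a) (unzip1 [:: (a, e)]) by rewrite /composable /= eqxx.
have ps : pieces [:: (a, e)] [:: y] by [].
by rewrite -[[:: pi y]]/(map pi [:: y]) (muQ_pi cs (one_piece B) ps) (mu_1l py).
Qed.

Fact qone_piece : piece (g := qgr) (0, 1, 0)%N 0 (pi (Defs.one B)).
Proof. by exists (Defs.one B) => //; apply: one_piece. Qed.

Definition qbox : boxop k := @BoxOp k qgr muQ (pi (Defs.one B)) qone_piece muQ_piece
  muQ_linl muQ_linr muQ_assoc muQ_1r muQ_1l.

Lemma qpi_morphism : box_morphism (B := qbox) (pi : B -> qbox).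
Proof.
split=> //; first by move=> a e x px; exists x.
by move=> a e p0 s x xs cs px pxs; rewrite -[RHS]/(muQ _ _ _) (muQ_pi cs px pxs).
Qed.
End BoxQuotient.

Theorem box_quotient (k : fieldType) (B : boxop k) (J : B -> Prop) : J 0 ->
  (forall c u v, J u -> J v -> J (c *: u + v)) ->
  (forall s : seq (arity * int * B),
    uniq [seq t.1 | t <- s] -> (forall t, t \in s -> piece t.1.1 t.1.2 t.2) ->
    J (\sum_(t <- s) t.2) -> forall t, t \in s -> J t.2) ->
  (forall a e p0 s x xs, composable a p0 (unzip1 s) ->
    piece a e x -> J x -> pieces s xs -> J (mu x p0 xs)) ->
  (forall a e p0 s1 t s2 x zs1 y zs2,
    composable a p0 (unzip1 (s1 ++ t :: s2)) -> piece a e x -> pieces s1 zs1 ->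
    piece t.1 t.2 y -> J y -> pieces s2 zs2 -> J (mu x p0 (zs1 ++ y :: zs2))) ->
  exists (Q : boxop k) (pi : {linear B -> Q}), [/\ box_morphism pi,
    forall x, pi x = 0 <-> J x, forall u, exists x, u = pi x &
    forall a e u, piece a e u -> exists2 x, piece a e x & u = pi x].
Proof.
move=> J0 JP Jhom Jl Jr; have [Q [pi [kerP surj]]] := quotient_lmod J0 JP.
exists (qbox kerP surj Jhom Jl Jr), pi; split=> //.
exact: (qpi_morphism kerP surj Jhom Jl Jr).
Qed.

Section Factor.
Variables (k : fieldType) (B Q C : boxop k) (pi : {linear B -> Q}) (phi : {linear B -> C}).
Hypotheses (mpi : box_morphism pi) (mphi : box_morphism phi).
Hypothesis surj : forall u, exists x, u = pi x.
Hypothesis lift : forall a e u, piece a e u -> exists2 x, piece a e x & u = pi x.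
Hypothesis ker : forall x, pi x = 0 -> phi x = 0.

Definition factor (u : Q) : C := phi (projT1 (cid (surj u))).

Lemma factorE x : factor (pi x) = phi x.
Proof.
rewrite /factor; case: cid => y /= Ey; apply/eqP; rewrite -subr_eq0 -linearB.
by apply/eqP/ker; rewrite linearB /= Ey subrr.
Qed.

Fact factor_linear : linear factor.
Proof.
move=> c u v; have [x ->] := surj u; have [y ->] := surj v.
by rewrite -linearP !factorE linearP.
Qed.
HB.instance Definition _ := GRing.isLinear.Build k Q C _ factor factor_linear.

Lemma factor_morphism : box_morphism factor.
Proof.
case: mpi mphi => pg p1 pm [fg f1 fm]; split.
- by move=> a e u /lift[x px ->]; rewrite factorE; apply: fg.
- by rewrite -p1 factorE.
move=> a e p0 s u us cs /lift[x px ->] pus.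
have [xs pxs ->] : exists2 xs, pieces s xs & us = map pi xs.
  elim: (s) (us) pus => [|t s' IH] [|v vs] //=; first by exists [::].
  by move=> [/lift[y py ->] /IH[ys pys ->]]; exists (y :: ys).
rewrite -(pm _ _ _ _ _ _ cs px pxs) !factorE (fm _ _ _ _ _ _ cs px pxs); congr mu.
by rewrite -map_comp; apply: eq_map => y /=; rewrite factorE.
Qed.

Lemma box_factor : exists psi : {linear Q -> C},
  box_morphism psi /\ forall x, psi (pi x) = phi x.
Proof. by exists factor; split; [exact: factor_morphism | exact: factorE]. Qed.
End Factor.

(** * Lax as the homology in degree zero *)

(** With the next three lemmas this lists the small columns that occur in the differentials of
    m_{2,1} and m_{3,0}; counting wires and inputs excludes all others. *)
Lemma pure_cell B s : legit s -> pureb B s -> ar_up (st_ar s) = 0%N ->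
  ar_in (st_ar s) = 2%N -> ar_out (st_ar s) = 1%N -> s = Node (lax_arity 2 0) 0 [::].
Proof.
case: s => // a b l; rewrite legit_node pureb_node.
move=> /and3P[cs la ll] /and3P[a0 _ pl] us is_ os.
have sz := composable_up cs; have ch := proj2 (andP cs).
have := row_bound ll pl ch; rewrite -[width l]/(ar_up (st_ar (Node a b l))) us.
move: is_ os; rewrite -[ar_in (st_ar _)]/(ar_in a + b)%N.
rewrite -[ar_out (st_ar _)]/(ar_out a + top b (map st_ar l))%N (lax_box_in la a0) => ib ob.
have t0 : top b (map st_ar l) = 0%N by move: ob; clear; lia.
rewrite t0 add0n addn0 => /andP[_ sb].
case: l {ob} cs sz ch ll pl us t0 sb => [|s [|s' l]] cs sz ch ll pl us t0 sb.
- move: t0 ib; rewrite /top /= => ->; rewrite addn0 => ib.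
  by case/andP: la => _ /eqP ->; rewrite ib -sz.
- case/andP: ll => ls _; move: ch => /= /andP[/eqP sb' _].
  move: t0; rewrite /top /= => o0; move: sb; rewrite -sb' => s0.
  have /andP[ps _] := pl.
  have := pure_bound ls ps; have up0 : ar_up (st_ar s) = 0%N.
    by move: us; rewrite /= /comp_arity /ar_up /= addn0.
  case: s ls ps o0 s0 {sb' up0 cs sz pl us} => // a' b' l' ls ps o0 s0 _.
  move: ls ps; rewrite legit_node pureb_node => /and3P[_ la' _] /and3P[a0' _ _].
  by move: o0; rewrite /= /comp_arity /ar_out /= -/(ar_out a') (lax_box_in la' a0').
by move: sb ib a0; rewrite /=; clear; lia.
Qed.

Lemma pure_cell2 B s : legit s -> pureb B s -> ar_up (st_ar s) = 0%N ->
  ar_in (st_ar s) = 3%N -> ar_out (st_ar s) = 2%N ->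
  s = Node (lax_arity 2 0) 1 [::] \/
  s = Node (lax_arity 1 1) 2 [:: Node (lax_arity 2 0) 0 [::]].
Proof.
case: s => // a b l; rewrite legit_node pureb_node.
move=> /and3P[cs la ll] /and3P[a0 _ pl] us is_ os.
have sz := composable_up cs; have ch := proj2 (andP cs).
have := row_bound ll pl ch; rewrite -[width l]/(ar_up (st_ar (Node a b l))) us.
move: is_ os; rewrite -[ar_in (st_ar _)]/(ar_in a + b)%N.
rewrite -[ar_out (st_ar _)]/(ar_out a + top b (map st_ar l))%N (lax_box_in la a0) => ib ob.
have t1 : top b (map st_ar l) = 1%N by move: ob; clear; lia.
rewrite t1 addn0 => /andP[_ sb].
case: l {ob} cs sz ch ll pl us t1 sb => [|s [|s' l]] cs sz ch ll pl us t1 sb.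
- left; move: t1 ib; rewrite /top /= => ->; rewrite addn1 => -[ib].
  by case/andP: la => _ /eqP ->; rewrite ib -sz.
- right; case/andP: ll => ls _; move: ch => /= /andP[/eqP sb' _].
  have /andP[ps _] := pl.
  have b2 : b = 2%N by move: sb ib a0; rewrite /=; clear; lia.
  have a1 : ar_in a = 1%N by move: ib; rewrite b2; clear; lia.
  rewrite b2; congr (Node _ _ [:: _]).
    by case/andP: la => _ /eqP ->; rewrite a1 -sz.
  apply: (pure_cell ls ps) => //; last by rewrite sb' b2.
  by move: us; rewrite /= /comp_arity /ar_up /= addn0.
by move: sb ib a0; rewrite /=; clear; lia.
Qed.

Lemma pure_f B s : legit s -> pureb B s -> ar_up (st_ar s) = 1%N ->
  ar_in (st_ar s) = 1%N -> s = Node (lax_arity 1 1) 0 [:: Eta].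
Proof.
case: s => // a b l; rewrite legit_node pureb_node.
move=> /and3P[cl la ll] /and3P[a0 _ pl] us; rewrite -[ar_in (st_ar _)]/(ar_in a + b)%N => sP.
have sl := composable_up cl.
have Eb : b = 0%N by move: sP a0; clear; lia.
have Ea1 : ar_in a = 1%N by move: sP a0; clear; lia.
move: cl; rewrite Eb => /andP[_ chl].
have El : l = nseq (size l) Eta.
  elim: l ll pl chl {us sl} => //= z l IHl /andP[lz ll] /andP[pz pl] /andP[/eqP z0 chl].
  have Ez := pure_thin lz pz z0; rewrite Ez in chl *.
  by rewrite -IHl.
move: us; rewrite -[LHS]/(width l) El width_eta => s1.
rewrite s1 in El; rewrite El; congr Node.
by case/andP: la => _ /eqP ->; rewrite Ea1 -sl s1.
Qed.

Lemma pure_ff B s : legit s -> pureb B s -> ar_up (st_ar s) = 1%N ->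
  ar_in (st_ar s) = 2%N -> ar_out (st_ar s) = 2%N ->
  s = Node (lax_arity 1 1) 1 [:: Node (lax_arity 1 1) 0 [:: Eta]].
Proof.
case: s => // a b l; rewrite legit_node pureb_node.
move=> /and3P[cs la ll] /and3P[a0 _ pl] us is_ os.
have sz := composable_up cs; have ch := proj2 (andP cs).
have := row_bound ll pl ch; rewrite -[width l]/(ar_up (st_ar (Node a b l))) us.
move: is_ os; rewrite -[ar_in (st_ar _)]/(ar_in a + b)%N.
rewrite -[ar_out (st_ar _)]/(ar_out a + top b (map st_ar l))%N (lax_box_in la a0) => ib ob.
have t1 : top b (map st_ar l) = 1%N by move: ob; clear; lia.
rewrite t1 => /andP[b1 sb].
have b1' : b = 1%N by move: b1 ib a0; clear; lia.
have a1 : ar_in a = 1%N by move: ib; rewrite b1'; clear; lia.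
rewrite b1' in sb ch *.
case: l {ob t1 cs} sz ch ll pl us sb => [|s [|s' l]] sz ch ll pl us sb.
- by case/andP: la; rewrite a1 -sz.
- case/andP: ll => ls _; case/andP: pl => ps _; move: ch => /= /andP[/eqP si _].
  congr (Node _ _ [:: _]); first by case/andP: la => _ /eqP ->; rewrite a1 -sz.
  apply: (pure_f ls ps) => //.
  by move: us; rewrite /= /comp_arity /ar_up /= addn0.
by move: sb; rewrite /=; clear; lia.
Qed.

Section LaxQuotient.
Variable k : fieldType.
Notation V := (fmod k).
Notation D := (dS k tq).
Notation sn b := ((-1) ^+ (nat_of_bool b) : k).
Notation M := (Node (lax_arity 0 2) 0 [:: Eta; Eta]).
Notation F := (Node (lax_arity 1 1) 0 [:: Eta]).
Notation C := (Node (lax_arity 2 0) 0 [::]).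

Lemma tqE p q : (0 < p)%N -> tq (lax_arity p q) =
  [seq (false, Node (lax_arity p n) 0 (erow n i (q.+1 - n)))
    | n <- [seq n <- iota 0 q | (2 <= p + n)%N], i <- iota 0 n] ++
  [seq (true, Node (lax_arity 0 m) p R) | m <- iota 2 (p + q),
     R <- [seq R <- prow (p + q).+1 m p 1 | width R == q]].
Proof. by case: p => // p _; rewrite /tq; move: prow => pr. Qed.

Lemma mem_type3 p q (P : bool * stacking -> Prop) :
  (forall m R, (2 <= m)%N -> width R = q -> size R = m -> all legit R ->
     all (pureb (p + q).+1) R -> chained p (map st_ar R) ->
     top p (map st_ar R) = 1%N -> (m < p + q)%N -> P (true, Node (lax_arity 0 m) p R)) ->
  forall x, x \in [seq (true, Node (lax_arity 0 m) p R) | m <- iota 2 (p + q),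
     R <- [seq R <- prow (p + q).+1 m p 1 | width R == q]] -> P x.
Proof.
move=> H x /allpairsPdep[n [Q [nin Qin ->]]].
move: Qin; rewrite mem_filter mem_row => /andP[/eqP wQ /and5P[/eqP sQ lQ pQ ch /eqP tQ]].
have := row_bound lQ pQ ch; rewrite tQ wQ sQ => /andP[_ mb].
by apply: H => //; move: nin; rewrite mem_iota => /andP[].
Qed.

Lemma type3_mem p q m (R : seq stacking) : (2 <= m)%N -> (m < 2 + (p + q))%N ->
  width R = q -> rspec (p + q).+1 m p 1 R ->
  (true, Node (lax_arity 0 m) p R) \in [seq (true, Node (lax_arity 0 m) p R) | m <- iota 2 (p + q),
     R <- [seq R <- prow (p + q).+1 m p 1 | width R == q]].
Proof.
move=> m2 mb wR rR; apply/allpairsPdep; exists m, R; split.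
- by rewrite mem_iota m2.
- by rewrite mem_filter wR eqxx mem_row.
by [].
Qed.

Lemma mem2P (T : eqType) (x a b : T) : x \in [:: a; b] -> x = a \/ x = b.
Proof. by rewrite !inE => /orP[] /eqP; [left | right]. Qed.

(** By [row_bound] the rows have two columns; the second is c and the first is one of two. These are
    the two sides of the relation for c alone. *)
Lemma tq_cocycle : perm_eq (tq (lax_arity 3 0))
  [:: (true, Node (lax_arity 0 2) 3 [:: Node (lax_arity 2 0) 1 [::]; C]);
      (true, Node (lax_arity 0 2) 3 [:: Node (lax_arity 1 1) 2 [:: C]; C])].
Proof.
apply: uniq_perm; [by apply: (map_uniq (f := snd)); apply: uniq_tq | by [] | ].
move=> x; rewrite tqE; last by []. rewrite [X in X ++ _](_ : _ = [::]); last by [].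
rewrite cat0s; apply/idP/idP; last first.
  case/mem2P => ->; [exact: (@type3_mem 3 0 2 [:: Node (lax_arity 2 0) 1 [::]; C] isT isT erefl isT)
    | exact: (@type3_mem 3 0 2 [:: Node (lax_arity 1 1) 2 [:: C]; C] isT isT erefl isT)].
apply: (@mem_type3 3 0 (fun x => x \in _)) => m R m2 wR.
move=> sR lR pR ch tR mb; have m2' : m = 2%N by move: m2 mb; clear; lia.
rewrite m2' in sR *; case: R wR sR lR pR ch tR => [|s1 [|s2 [|? ?]]] // wR _.
move=> /and3P[l1 l2 _] /and3P[p1 p2 _] /and3P[/eqP i1 /eqP i2 _] o2.
have [u1 u2] : ar_up (st_ar s1) = 0%N /\ ar_up (st_ar s2) = 0%N.
  by move: wR; rewrite !width_cons; clear; lia.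
have {}o2 : ar_out (st_ar s2) = 1%N := o2.
have b1 := pure_bound l1 p1; have b2 := pure_bound l2 p2.
have o1 : ar_out (st_ar s1) = 2%N by move: b1 b2; rewrite i2 o2 u1 u2 i1; clear; lia.
rewrite (pure_cell l2 p2 u2 (etrans i2 o1) o2).
by case: (pure_cell2 l1 p1 u1 i1 o1) => ->; rewrite !inE eqxx ?orbT.
Qed.

Lemma tq_nat : perm_eq (tq (lax_arity 2 1))
  [:: (true, Node (lax_arity 0 2) 2 [:: C; F]);
      (true, Node (lax_arity 0 2) 2 [:: Node (lax_arity 1 1) 1 [:: F]; C])].
Proof.
apply: uniq_perm; [by apply: (map_uniq (f := snd)); apply: uniq_tq | by [] | ].
move=> x; rewrite tqE; last by []. rewrite [X in X ++ _](_ : _ = [::]); last by [].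
rewrite cat0s; apply/idP/idP; last first.
  case/mem2P => ->; [exact: (@type3_mem 2 1 2 [:: C; F] isT isT erefl isT)
    | exact: (@type3_mem 2 1 2 [:: Node (lax_arity 1 1) 1 [:: F]; C] isT isT erefl isT)].
apply: (@mem_type3 2 1 (fun x => x \in _)) => m R m2 wR.
move=> sR lR pR ch tR mb; have m2' : m = 2%N by move: m2 mb; clear; lia.
rewrite m2' in sR *; case: R wR sR lR pR ch tR => [|s1 [|s2 [|? ?]]] // wR _.
move=> /and3P[l1 l2 _] /and3P[p1 p2 _] /and3P[/eqP i1 /eqP i2 _] o2.
have {}o2 : ar_out (st_ar s2) = 1%N := o2.
have b1 := pure_bound l1 p1; have b2 := pure_bound l2 p2.
rewrite i2 o2 i1 in b1 b2.
have [u1|u1] : ar_up (st_ar s1) = 0%N \/ ar_up (st_ar s1) = 1%N.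
- by move: wR; rewrite !width_cons; clear; case: (ar_up _) => [|[|u]]; [left | right | lia].
- have u2 : ar_up (st_ar s2) = 1%N.
    by move: wR; rewrite !width_cons u1 -[width [::]]/0%N addn0.
  have o1 : ar_out (st_ar s1) = 1%N by move: b1 b2; rewrite u1 u2; clear; lia.
  rewrite (pure_cell l1 p1 u1 i1 o1) (pure_f l2 p2 u2 (etrans i2 o1)).
  by rewrite !inE eqxx.
have u2 : ar_up (st_ar s2) = 0%N by move: wR; rewrite !width_cons u1; clear; lia.
have o1 : ar_out (st_ar s1) = 2%N by move: b1 b2; rewrite u1 u2; clear; lia.
rewrite (pure_cell l2 p2 u2 (etrans i2 o1) o2) (pure_ff l1 p1 u1 i1 o1).
by rewrite !inE eqxx orbT.
Qed.

Lemma muT_opp (x : V) p l1 y l2 : muT x p (l1 ++ (- y) :: l2) = - muT x p (l1 ++ y :: l2).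
Proof.
have z : muT x p (l1 ++ 0 :: l2) = 0.
  by have := muTr x p l1 (-1) 0 0 l2; rewrite scaleN1r oppr0 addr0 scaleN1r addNr.
by have := muTr x p l1 (-1) y 0 l2; rewrite !scaleN1r addr0 z addr0.
Qed.

Lemma mu_val S p l b G : legit S -> all legit l -> composable (st_ar S) p (map st_ar l) ->
  sg S p l = b -> graft S p l = G ->
  mu (bas S : Tbox k) p (map bas l) = sn b *: (bas G : V).
Proof. by move=> lS ll cs <- <-; rewrite -[LHS]/(muT _ _ _) muT_bas // /muB cs. Qed.

Lemma legit_id a : is_lax_box a -> legit (st_id a).
Proof. by move=> la; rewrite /legit st_id_wf /= la; elim: (ar_up _). Qed.

Notation m := (gen 0 2 : Tbox k).
Notation f := (gen 1 1 : Tbox k).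
Notation c := (gen 2 0 : Tbox k).

Lemma tq_assoc : tq (lax_arity 0 3) = [:: (true, Node (lax_arity 0 2) 0 [:: M; Eta]);
  (true, Node (lax_arity 0 2) 0 [:: Eta; M])].
Proof. by vm_compute. Qed.

Lemma D_assoc : lin D (gen 0 3 : V) =
  - (mu m 0 [:: m; Defs.one (Tbox k)] - mu m 0 [:: Defs.one (Tbox k); m]).
Proof.
rewrite /gen lin_bas; last exact: legit_id.
rewrite D_st_id; last by [].
rewrite /dgen tq_assoc.
have -> := @mu_val M 0 [:: M; Eta] false (Node (lax_arity 0 2) 0 [:: M; Eta]) isT isT isT erefl erefl.
have -> := @mu_val M 0 [:: Eta; M] true (Node (lax_arity 0 2) 0 [:: Eta; M]) isT isT isT erefl erefl.
by rewrite !big_cons big_nil /= !(expr0, expr1, scale1r, scaleN1r, opprK, addr0) opprD.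
Qed.

Lemma tq_hom : tq (lax_arity 1 2) = [:: (false, Node (lax_arity 1 1) 0 [:: M]);
  (true, Node (lax_arity 0 2) 1 [:: F; F])].
Proof. by vm_compute. Qed.

Lemma D_hom : lin D (gen 1 2 : V) = mu f 0 [:: m] - mu m 1 [:: f; f].
Proof.
rewrite /gen lin_bas; last exact: legit_id.
rewrite D_st_id; last by [].
rewrite /dgen tq_hom.
have -> := @mu_val F 0 [:: M] false (Node (lax_arity 1 1) 0 [:: M]) isT isT isT erefl erefl.
have -> := @mu_val M 1 [:: F; F] false (Node (lax_arity 0 2) 1 [:: F; F]) isT isT isT erefl erefl.
by rewrite !big_cons big_nil /= !(expr0, expr1, scale1r, scaleN1r, opprK, addr0).
Qed.

Lemma mu_ff : mu f 1 [:: f] = bas (Node (lax_arity 1 1) 1 [:: F]) :> V.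
Proof.
have -> := @mu_val F 1 [:: F] false (Node (lax_arity 1 1) 1 [:: F]) isT isT isT erefl erefl.
by rewrite /= expr0 scale1r.
Qed.
Lemma mu_c1 : mu c 1 [::] = bas (Node (lax_arity 2 0) 1 [::]) :> V.
Proof.
have -> := @mu_val C 1 [::] false (Node (lax_arity 2 0) 1 [::]) isT isT isT erefl erefl.
by rewrite /= expr0 scale1r.
Qed.
(** This sign turns the two equal signs in [tq_cocycle] into the difference of the two sides of the
    relation. *)
Lemma mu_fc : mu f 2 [:: c] = - bas (Node (lax_arity 1 1) 2 [:: C]) :> V.
Proof.
have -> := @mu_val F 2 [:: C] true (Node (lax_arity 1 1) 2 [:: C]) isT isT isT erefl erefl.
by rewrite /= expr1 scaleN1r.
Qed.

Lemma D_nat : lin D (gen 2 1 : V) = mu m 2 [:: c; f] - mu m 2 [:: mu f 1 [:: f]; c].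
Proof.
rewrite mu_ff /gen lin_bas; last exact: legit_id.
rewrite D_st_id; last by [].
rewrite /dgen (perm_big _ tq_nat).
have -> := @mu_val M 2 [:: C; F] true (Node (lax_arity 0 2) 2 [:: C; F]) isT isT isT erefl erefl.
have -> := @mu_val M 2 [:: Node (lax_arity 1 1) 1 [:: F]; C] false
  (Node (lax_arity 0 2) 2 [:: Node (lax_arity 1 1) 1 [:: F]; C]) isT isT isT erefl erefl.
by rewrite !big_cons big_nil /= !(expr0, expr1, scale1r, scaleN1r, opprK, addr0).
Qed.

Lemma D_cocycle : lin D (gen 3 0 : V) =
  - (mu m 3 [:: mu c 1 [::]; c] - mu m 3 [:: mu f 2 [:: c]; c]).
Proof.
have Eo : mu m 3 [:: - bas (Node (lax_arity 1 1) 2 [:: C]) : V; c] =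
    - mu m 3 [:: bas (Node (lax_arity 1 1) 2 [:: C]) : V; c].
  exact: (@muT_opp m 3 [::] _ [:: c]).
rewrite mu_c1 mu_fc Eo /gen lin_bas; last exact: legit_id.
rewrite D_st_id; last by [].
rewrite /dgen (perm_big _ tq_cocycle).
have -> := @mu_val M 3 [:: Node (lax_arity 2 0) 1 [::]; C] false
  (Node (lax_arity 0 2) 3 [:: Node (lax_arity 2 0) 1 [::]; C]) isT isT isT erefl erefl.
have -> := @mu_val M 3 [:: Node (lax_arity 1 1) 2 [:: C]; C] false
  (Node (lax_arity 0 2) 3 [:: Node (lax_arity 1 1) 2 [:: C]; C]) isT isT isT erefl erefl.
by rewrite !big_cons big_nil /= !(expr0, expr1, scale1r, scaleN1r, opprK, addr0) opprD.
Qed.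

Lemma gen_piece p q : (2 <= p + q)%N ->
  fpiece (lax_arity p q) (p%:Z + q%:Z - 2) (gen p q : V).
Proof. exact: gen_elements. Qed.

Lemma lax_pieces : [/\ piece (g := Tbox k) (0, 2, 0)%N 0 m,
  piece (g := Tbox k) (1, 1, 1)%N 0 f & piece (g := Tbox k) (2, 0, 1)%N 0 c].
Proof.
by split; [have := @gen_elements k 0 2 isT | have := @gen_elements k 1 1 isT
  | have := @gen_elements k 2 0 isT].
Qed.

(** Stated after an arbitrary morphism [g], so that it shows both that the quotient by [bdry]
    satisfies the relations and that morphisms to box operads with these relations kill
    boundaries. *)
Lemma D_gen3 (B : boxop k) (g : {linear Tbox k -> B}) : box_morphism g ->
  let mg := mu (g m) in let fg := mu (g f) in
  [/\ g (lin D (gen 0 3)) = - (mg 0%N [:: g m; Defs.one B] - mg 0%N [:: Defs.one B; g m]),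
      g (lin D (gen 1 2)) = fg 0%N [:: g m] - mg 1%N [:: g f; g f],
      g (lin D (gen 2 1)) = mg 2%N [:: g c; g f] - mg 2%N [:: fg 1%N [:: g f]; g c] &
      g (lin D (gen 3 0)) =
        - (mg 3%N [:: mu (g c) 1 [::]; g c] - mg 3%N [:: fg 2%N [:: g c]; g c])].
Proof.
move=> [gg g1 gm] mg fg; have [pm pf pc] := lax_pieces; have po := one_piece (Tbox k).
pose tm := ((0, 2, 0)%N : arity, 0 : int); pose tf := ((1, 1, 1)%N : arity, 0 : int).
pose tc := ((2, 0, 1)%N : arity, 0 : int); pose t1 := ((0, 1, 0)%N : arity, 0 : int).
have pff : piece (g := Tbox k) (2, 1, 2)%N 0 (mu f 1 [:: f]).
  by rewrite mu_ff; apply: inspan_bas.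
have pc1 : piece (g := Tbox k) (3, 0, 2)%N 0 (mu c 1 [::]).
  by rewrite mu_c1; apply: inspan_bas.
have pfc : piece (g := Tbox k) (3, 0, 2)%N 0 (mu f 2 [:: c]).
  by rewrite mu_fc -scaleN1r; apply: pieceZ; apply: inspan_bas.
pose t3 := ((3, 0, 2)%N : arity, 0 : int); pose t2 := ((2, 1, 2)%N : arity, 0 : int).
have Eff : g (mu f 1 [:: f]) = fg 1%N [:: g f] :=
  gm (1, 1, 1)%N 0 1%N [:: tf] f [:: f] isT pf (conj pf I).
have Ec1 : g (mu c 1 [::]) = mu (g c) 1 [::] := gm (2, 0, 1)%N 0 1%N [::] c [::] isT pc I.
have Efc : g (mu f 2 [:: c]) = fg 2%N [:: g c] :=
  gm (1, 1, 1)%N 0 2%N [:: tc] f [:: c] isT pf (conj pc I).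
have E1 : g (mu m 0 [:: m; Defs.one _]) = mg 0%N [:: g m; Defs.one B].
  rewrite -g1.
  exact: (gm (0, 2, 0)%N 0 0%N [:: tm; t1] m [:: m; Defs.one _] isT pm (conj pm (conj po I))).
have E2 : g (mu m 0 [:: Defs.one _; m]) = mg 0%N [:: Defs.one B; g m].
  rewrite -g1.
  exact: (gm (0, 2, 0)%N 0 0%N [:: t1; tm] m [:: Defs.one _; m] isT pm (conj po (conj pm I))).
have E3 : g (mu f 0 [:: m]) = fg 0%N [:: g m] :=
  gm (1, 1, 1)%N 0 0%N [:: tm] f [:: m] isT pf (conj pm I).
have E4 : g (mu m 1 [:: f; f]) = mg 1%N [:: g f; g f] :=
  gm (0, 2, 0)%N 0 1%N [:: tf; tf] m [:: f; f] isT pm (conj pf (conj pf I)).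
have E5 : g (mu m 2 [:: c; f]) = mg 2%N [:: g c; g f] :=
  gm (0, 2, 0)%N 0 2%N [:: tc; tf] m [:: c; f] isT pm (conj pc (conj pf I)).
have E6 : g (mu m 2 [:: mu f 1 [:: f]; c]) = mg 2%N [:: fg 1%N [:: g f]; g c].
  rewrite -Eff.
  exact: (gm (0, 2, 0)%N 0 2%N [:: t2; tc] m [:: mu f 1 [:: f]; c] isT pm (conj pff (conj pc I))).
have E7 : g (mu m 3 [:: mu c 1 [::]; c]) = mg 3%N [:: mu (g c) 1 [::]; g c].
  rewrite -Ec1.
  exact: (gm (0, 2, 0)%N 0 3%N [:: t3; tc] m [:: mu c 1 [::]; c] isT pm (conj pc1 (conj pc I))).
have E8 : g (mu m 3 [:: mu f 2 [:: c]; c]) = mg 3%N [:: fg 2%N [:: g c]; g c].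
  rewrite -Efc.
  exact: (gm (0, 2, 0)%N 0 3%N [:: t3; tc] m [:: mu f 2 [:: c]; c] isT pm (conj pfc (conj pc I))).
have oppB (X Y : Tbox k) : g (- (X - Y)) = - (g X - g Y) by rewrite linearN linearB.
have subB (X Y : Tbox k) : g (X - Y) = g X - g Y by rewrite linearB.
split.
- exact: (etrans (congr1 g D_assoc) (etrans (oppB _ _) (congr2 (fun X Y : B => - (X - Y)) E1 E2))).
- exact: (etrans (congr1 g D_hom) (etrans (subB _ _) (congr2 (fun X Y : B => X - Y) E3 E4))).
- exact: (etrans (congr1 g D_nat) (etrans (subB _ _) (congr2 (fun X Y : B => X - Y) E5 E6))).
exact: (etrans (congr1 g D_cocycle) (etrans (oppB _ _) (congr2 (fun X Y : B => - (X - Y)) E7 E8))).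
Qed.

Lemma set_nth_catE (T : Type) (x0 : T) l1 y l2 z :
  set_nth x0 (l1 ++ y :: l2) (size l1) z = l1 ++ z :: l2.
Proof. by elim: l1 => //= x l1 ->. Qed.

Lemma bas_node a p0 ss : legit (Node a p0 ss) ->
  bas (Node a p0 ss) = sn (loc (st_id a) p0 ss) *:
    mu (bas (st_id a) : Tbox k) p0 (map bas ss).
Proof.
rewrite legit_node => /and3P[cs la lss]; have lid := legit_id la.
have cid : composable (st_ar (st_id a)) p0 (map st_ar ss) by rewrite st_id_ar.
have sz := composable_up cs.
have Eg : graft (st_id a) p0 ss = Node a p0 ss.
  by rewrite /st_id graft_node add0n -sz graft_row_1l.
rewrite -[mu _ _ _]/(muT _ _ _) muT_bas // /muB cid Eg scalerA -sn_addb.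
by rewrite /sg kap_node kap_row_eta addbb scale1r.
Qed.

(** Both sides are derivations along [g], and every stacking is a composite of corollas. *)
Lemma morphism_dg (N : dgboxop k) (g : {linear Tbox k -> N}) : box_morphism g ->
  (forall a, is_lax_box a -> g (D (st_id a)) = diff N (g (bas (st_id a)))) ->
  forall x, g (lin D x) = diff N (g x).
Proof.
move=> [gg g1 gm] gD x.
have H S : legit S -> g (lin D (bas S)) = diff N (g (bas S)).
  elim/stacking_mem_ind: S => [_|a p0 ss IH].
    have -> : lin D (bas Eta : V) = 0 by rewrite lin_bas.
    rewrite linear0 -[bas Eta]/(Defs.one (Tbox k)) g1.
    (* The unit is a cycle: the Leibniz rule for 1 = mu(1; 1) gives d1 = d1 + d1. *)
    have := @diff_mu _ N (0, 1, 0)%N 0 0%N [:: ((0, 1, 0)%N, 0)] _ [:: Defs.one N] isT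
      (one_piece N) (conj (one_piece N) I).
    rewrite big_ord1 /= big_nil addr0 /sgn expr0z scale1r.
    have -> : mu (Defs.one N) 0 [:: Defs.one N] = Defs.one N by exact: (mu_1r (one_piece N)).
    have -> : mu (diff N (Defs.one N)) 0 [:: Defs.one N] = diff N (Defs.one N).
      exact: (mu_1r (diff_piece (one_piece N))).
    have -> : mu (Defs.one N) 0 [:: diff N (Defs.one N)] = diff N (Defs.one N).
      exact: (mu_1l (diff_piece (one_piece N))).
    by move=> E; have := congr1 (fun y => y - diff N (Defs.one N)) E; rewrite subrr addrK.
  move=> lN; have := lN; rewrite legit_node => /and3P[cs la lss].
  rewrite bas_node // !linearZ /= ; congr (_ *: _).
  have cs' : composable a p0 (unzip1 (st_pieces ss)) by rewrite unzip1_st.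
  have pid : piece (g := Tbox k) a (ndegz (st_id a)) (bas (st_id a)).
    by apply: inspan_bas; rewrite st_id_ar.
  have ps : pieces (st_pieces ss) (map bas ss : seq (Tbox k)).
    elim: (ss) lss => //= s ss' IHs /andP[ls lss']; split; last exact: IHs.
    by apply: inspan_bas.
  have pgs : pieces (st_pieces ss) (map g (map bas ss : seq (Tbox k))).
    by elim: (st_pieces ss) (map bas ss : seq (Tbox k)) ps => [|t s IHs] [|y ys] //= [/gg ? /IHs].
  have := dT_mu cs' pid ps; rewrite -[dT k _]/(lin D _) => ->.
  have Eid : dT k (bas (st_id a)) = D (st_id a) by exact: (lin_bas D (legit_id la)).
  have E4 : g (mu (dT k (bas (st_id a)) : Tbox k) p0 (map bas ss)) =
      mu (diff N (g (bas (st_id a)))) p0 (map g (map bas ss : seq (Tbox k))).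
    apply: (etrans (gm _ _ _ _ _ _ cs' (dT_piece pid) ps)).
    by apply: (congr1 (fun u => mu u _ _)); rewrite -gD // Eid.
  rewrite -[dT k _]/(lin D _) linearD (gm _ _ _ _ _ _ cs' pid ps).
  rewrite (diff_mu cs' (gg _ _ _ pid) pgs); congr (_ + _); first exact: E4.
  rewrite [LHS]linear_sum [in RHS]size_map; apply: eq_bigr => -[i lti0] _.
  rewrite [nat_of_ord _]/= [LHS]linearZ; congr (_ *: _); pose X : seq (Tbox k) := map bas ss.
  have lti : (i < size X)%N := lti0.
  have lti' : (i < size ss)%N by move: lti0; rewrite size_map.
  have Ex : (map g X)`_i = g (bas (nth Eta ss i)) by rewrite -map_comp (nth_map Eta).
  have Ey : X`_i = bas (nth Eta ss i) by rewrite (nth_map Eta).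
  have [t [Es pt p1 p2]] := pieces_split ps lti.
  have cs2 : composable a p0 (unzip1 (take i (st_pieces ss) ++ (t.1, t.2 - 1) :: drop i.+1 (st_pieces ss))).
    by move: cs'; rewrite {1}Es /unzip1 !map_cat.
  have S1 v : set_nth 0 X i v = take i X ++ v :: drop i.+1 X by rewrite set_nthE lti.
  have S2 v : set_nth 0 (map g X) i v = take i (map g X) ++ v :: drop i.+1 (map g X).
    by rewrite set_nthE size_map lti.
  have Es2 : set_nth 0 (map g X) i (diff N (map g X)`_i) = map g (set_nth 0 X i (dT k X`_i)).
    rewrite S2 S1 map_cat map_cons map_take map_drop Ex Ey; congr (_ ++ _ :: _).
    by symmetry; apply: IH; rewrite ?mem_nth //; apply: (allP lss); rewrite mem_nth.
  have p3 : pieces (take i (st_pieces ss) ++ (t.1, t.2 - 1) :: drop i.+1 (st_pieces ss))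
      (set_nth 0 X i (dT k X`_i)).
    by rewrite S1; apply: pieces_cat => //=; split=> //; apply: dT_piece.
  by rewrite -/X Es2; apply: (gm _ _ _ _ _ _ cs2 pid p3).
apply: (etrans (linE (g \o dT k : {linear V -> N}) x)).
apply: (etrans _ (esym (linE (diff N \o g : {linear V -> N}) x))).
by apply: eq_lin => S lS; exact: H.
Qed.

Definition lb (B : boxop k) (m' f' c' : B) (p q : nat) : B :=
  match p, q with 0, 2 => m' | 1, 1 => f' | 2, 0 => c' | _, _ => 0 end.

Lemma lb0 (B : boxop k) (m' f' c' : B) p q : (2 < p + q)%N -> lb m' f' c' p q = 0.
Proof. by case: p q => [|[|[|p]]] [|[|[|q]]]. Qed.

Lemma lb_elements (B : boxop k) (m' f' c' : B) : piece (0, 2, 0)%N 0 m' ->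
  piece (1, 1, 1)%N 0 f' -> piece (2, 0, 1)%N 0 c' -> lax_infty_elements (lb m' f' c').
Proof.
move=> pm pf pc p q pq; have [h|h] := ltnP 2 (p + q).
  by rewrite lb0 //; apply: piece0.
by case: p q pq h => [|[|[|p]]] [|[|[|q]]].
Qed.

Lemma free_st_pos (B : boxop k) (b : nat -> nat -> B) : lax_infty_elements b ->
  (forall p q, (2 < p + q)%N -> b p q = 0) ->
  forall S, legit S -> (0 < ndeg S)%N -> free_st b S = 0.
Proof.
move=> eb b0; elim/stacking_mem_ind => // a p0 ss IH.
rewrite legit_node ndeg_node => /and3P[cs la lss] nS.
rewrite [free_st _ _]/= -/(map (free_st b) ss).
have cs' : composable a p0 (unzip1 (st_pieces ss)) by rewrite unzip1_st.
have ps := pieces_free eb lss.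
have [h|h] := ltnP 2 (ar_in a + ar_up a).
  by rewrite b0 // (mu_0l 0 cs' ps) scaler0.
have /hasP[s sss s0] : has (fun s => 0 < ndeg s)%N ss.
  apply: contraLR nS => /hasPn H; rewrite -leqNgt leqn0 addn_eq0.
  apply/andP; split; first by rewrite subn_eq0.
  elim: (ss) H => //= s ss' IHs H.
  rewrite addn_eq0 IHs ?andbT; last by move=> t tss; apply: H; rewrite inE tss orbT.
  by have := H s (mem_head _ _); rewrite lt0n negbK.
have Es := IH s sss (allP lss s sss) s0.
case/splitPr: sss lss cs' ps {IH nS cs} => l r lss cs' ps.
move: ps cs'; rewrite /st_pieces !map_cat /= Es => ps cs'.
have [|p1 [_ p2]] := pieces_catE _ ps; first by rewrite !size_map.
by rewrite (mu_0r cs' (b_piece eb la) p1 p2) scaler0.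
Qed.

Notation pr a e := (lin (fun S => if (st_ar S, ndegz S) == (a, e) then bas S else 0 : V)).

Lemma pr_piece a e (x : V) : fpiece a e (pr a e x).
Proof.
apply: (@inspan_lin _ (fun=> True)) => // S lS _.
by case: eqP => [[<- <-]|_]; [apply: inspan_bas | apply: inspan0].
Qed.

Lemma pr_id a e (x : V) : fpiece a e x -> pr a e x = x.
Proof.
move=> px; rewrite -[RHS]lin_basE; apply: (eq_lin_in px) => S lS [aS nS].
by rewrite aS /ndegz nS eqxx.
Qed.

Lemma pr_0 a e a' e' (x : V) : (a', e') != (a, e) -> fpiece a' e' x -> pr a e x = 0.
Proof.
move=> ne px; apply: (lin0 px) => S lS [aS nS].
by rewrite aS /ndegz nS (negPf ne).
Qed.

Lemma D_piece a e (x : V) : fpiece a e x -> fpiece a (e - 1) (lin D x).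
Proof. exact: dT_piece. Qed.

Lemma pr_D a e (x : V) : pr a e (lin D x) = lin D (pr a (e + 1) x).
Proof.
rewrite !lin_linE; apply: eq_lin => S lS.
have pS : fpiece (st_ar S) (ndegz S) (bas S : V) by apply: inspan_bas.
have := D_piece pS; rewrite lin_bas // => pD.
case: eqP => [[aS nS]|ne].
  by rewrite /= lin_bas //; apply: pr_id; rewrite -aS -[e](addrK 1) -nS.
rewrite linear0; apply: (pr_0 _ pD); apply/eqP => -[aS nS]; case: ne.
by rewrite aS -nS subrK.
Qed.

Lemma piece_neg a e (x : V) : fpiece a e x -> e < 0 -> x = 0.
Proof.
by move=> px e0; rewrite -[x]lin_basE; apply: (lin0 px) => S _ [_ nS]; move: e0; rewrite -nS.
Qed.

Lemma D_deg0E a (x : V) : fpiece a 0 x -> lin D x = 0.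
Proof. by move=> /D_piece px; apply: (piece_neg px). Qed.

(** The ideal with quotient H_0: boundaries in degree 0 and everything in the other degrees. The
    projections [pr] give it a meaning for inhomogeneous elements. *)
Definition bdry (x : V) : Prop := forall a, exists2 y, fpiece a 1 y & pr a 0 x = lin D y.

Lemma bdry0 : bdry 0.
Proof. by move=> a; exists 0; [apply: inspan0 | rewrite !linear0]. Qed.

Lemma bdryP (c : k) u v : bdry u -> bdry v -> bdry (c *: u + v).
Proof.
move=> Ju Jv a; have [y py Ey] := Ju a; have [z pz Ez] := Jv a.
exists (c *: y + z); last by rewrite !linearP /= Ey Ez.
by apply: inspanD => //; apply: inspanZ.
Qed.

Lemma bdry_deg a e (x : V) : fpiece a e x -> e != 0 -> bdry x.
Proof.
move=> px e0 b; exists 0; first exact: inspan0.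
by rewrite linear0; apply: (pr_0 _ px); rewrite xpair_eqE (negPf e0) andbF.
Qed.

Lemma bdry_D a (y : V) : fpiece a 1 y -> bdry (lin D y).
Proof. by move=> py b; exists (pr b 1 y); [apply: pr_piece | rewrite pr_D add0r]. Qed.

Lemma bdry_inv a (x : V) : fpiece a 0 x -> bdry x -> exists2 y, fpiece a 1 y & x = lin D y.
Proof. by move=> px /(_ a)[y py]; rewrite pr_id // => ->; exists y. Qed.

Lemma bdry_hom (s : seq (arity * int * Tbox k)) : uniq [seq t.1 | t <- s] ->
  (forall t, t \in s -> piece t.1.1 t.1.2 t.2) ->
  bdry (\sum_(t <- s) t.2) -> forall t, t \in s -> bdry t.2.
Proof.
move=> us ps Js t ts b; have pt := ps t ts.
have [Et|ne] := eqVneq t.1 (b, 0); last first.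
  exists 0; first exact: inspan0.
  by rewrite linear0; apply: (pr_0 _ pt); rewrite -surjective_pairing.
have [y py Ey] := Js b; exists y => //; rewrite -Ey.
have pe := perm_to_rem ts; rewrite (perm_big _ pe) big_cons linearD linear_sum.
rewrite [X in _ = _ + X]big_seq big1 ?addr0 // => u ur.
have up : u \in s by rewrite (perm_mem pe) inE ur orbT.
apply: (pr_0 _ (ps u up)); rewrite -surjective_pairing -Et.
move: us; rewrite (perm_uniq (perm_map _ pe)) /= => /andP[nt _].
by apply: contraNneq nt => <-; apply: (map_f (fun t => t.1)).
Qed.

Lemma mu_neg a e p0 s (x : Tbox k) (xs : seq (Tbox k)) :
  composable a p0 (unzip1 s) -> piece a e x -> pieces s xs ->
  has (fun t => t.2 < 0) s -> mu x p0 xs = 0.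
Proof.
move=> cs px pxs /hasP[t ts t0]; case/splitPr: ts cs pxs => s1 s2 cs pxs.
have sz := pieces_size pxs.
have Ex : xs = take (size s1) xs ++ drop (size s1) xs by rewrite cat_take_drop.
rewrite Ex in pxs *; have [|p1] := pieces_catE _ pxs.
  by rewrite size_takel // sz size_cat leq_addr.
case: (drop _ _) => [|y ys] //= [py p2].
by rewrite (piece_neg py t0); apply: (mu_0r cs px p1 p2).
Qed.

Lemma sum_nneg (ds : seq int) : all (fun d => 0 <= d) ds ->
  0 <= \sum_(d <- ds) d /\ (\sum_(d <- ds) d = 0 -> all (eq_op^~ 0) ds).
Proof.
elim: ds => [|d ds IH] /=; first by rewrite big_nil.
move=> /andP[d0 /IH[s0 H]]; rewrite big_cons; move: (\sum_(_ <- _) _) s0 H => S s0 H.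
split; first by lia.
move=> E; have d00 : d = 0 by lia.
by rewrite d00 eqxx H //; lia.
Qed.

Lemma bdry_mu a e p0 s (x : Tbox k) (xs : seq (Tbox k)) :
  composable a p0 (unzip1 s) -> piece a e x -> pieces s xs ->
  ~~ ((e == 0) && all (fun t => t.2 == 0) s) -> bdry (mu x p0 xs).
Proof.
move=> cs px pxs n0; case: (boolP (e < 0)) => e0.
  by rewrite (piece_neg px e0) (mu_0l 0 cs pxs); apply: bdry0.
case: (boolP (has (fun t => t.2 < 0) s)) => [h|/hasPn h].
  by rewrite (mu_neg cs px pxs h); apply: bdry0.
have [|s0 H] := @sum_nneg (unzip2 s).
  by rewrite all_map; apply/allP => t /h /=; move: (t.2) => d; lia.
apply: (bdry_deg (mu_piece cs px pxs)); apply: contra n0 => /eqP E.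
move: s0 H E; move: (\sum_(_ <- _) _) => S s0 H E.
have -> : e = 0 by lia.
by move: (H ltac:(lia)); rewrite all_map eqxx.
Qed.

Lemma D_row s (xs : seq (Tbox k)) : pieces s xs -> all (fun t => t.2 == 0) s ->
  forall i, lin D xs`_i = 0.
Proof.
elim: s xs => [|t s IH] [|x xs] //= pxs => [_ i|]; first by rewrite nth_nil linear0.
case: pxs => px pxs /andP[/eqP t0 s0] [|i] /=; last exact: (IH xs).
by rewrite t0 in px; apply: D_deg0E px.
Qed.

(** A product with a factor of nonzero degree lies in the ideal by [bdry_mu]. Otherwise the entries
    [xs] have degree 0 and are cycles, and by the Leibniz rule the composite of a boundary with them
    is a boundary. *)
Lemma bdry_l a e p0 s (x : Tbox k) (xs : seq (Tbox k)) : composable a p0 (unzip1 s) ->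
  piece a e x -> bdry x -> pieces s xs -> bdry (mu x p0 xs).
Proof.
move=> cs px Jx pxs.
case: (boolP ((e == 0) && all (fun t => t.2 == 0) s)) => [/andP[/eqP e0 s0]|]; last first.
  exact: (bdry_mu cs px pxs).
rewrite e0 in px; have [y py Ex] := bdry_inv px Jx.
have {}py : piece (g := Tbox k) a 1 y := py.
have := dT_mu cs py pxs; rewrite big1 ?addr0 => [E|i _]; last first.
  by rewrite -[dT k _]/(lin D _) (D_row pxs s0) (mu_set0 cs py pxs) ?scaler0 ?ltn_ord.
rewrite Ex -[lin D y]/(dT k y) -E; apply: (@bdry_D (comp_arity a p0 (unzip1 s))).
have := mu_piece cs py pxs; rewrite big_map big_seq big1 ?addr0 // => t ts.
by apply/eqP/(allP s0).
Qed.

Lemma bdry_r a e p0 s1 t s2 (x : Tbox k) (zs1 : seq (Tbox k)) (y : Tbox k) (zs2 : seq (Tbox k)) :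
  composable a p0 (unzip1 (s1 ++ t :: s2)) -> piece a e x -> pieces s1 zs1 ->
  piece t.1 t.2 y -> bdry y -> pieces s2 zs2 -> bdry (mu x p0 (zs1 ++ y :: zs2)).
Proof.
move=> cs px p1 py Jy p2.
have ps : pieces (s1 ++ t :: s2) (zs1 ++ y :: zs2) by apply: pieces_cat.
case: (boolP ((e == 0) && all (fun t => t.2 == 0) (s1 ++ t :: s2))); last first.
  exact: (bdry_mu cs px ps).
rewrite all_cat => /andP[/eqP e0 /andP[z1 /andP[/eqP t0 z2]]].
rewrite t0 in py; have [w pw Ey] := bdry_inv py Jy.
have cs' : composable a p0 (unzip1 (s1 ++ (t.1, 1) :: s2)).
  by move: cs; rewrite /unzip1 !map_cat.
have ps' : pieces (s1 ++ (t.1, 1) :: s2) (zs1 ++ w :: zs2) by apply: pieces_cat.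
have := dT_mu cs' px ps'; rewrite e0 in px.
have -> : dT k x = 0 by apply: (D_deg0E px).
rewrite (mu_0l 0 cs' ps') add0r.
have lti : (size zs1 < size (zs1 ++ w :: zs2))%N by rewrite size_cat addnS ltnS leq_addr.
rewrite (bigD1 (Ordinal lti)) //= [X in _ + X]big1 ?addr0 => [|i ni]; last first.
  have Ei : dT k (zs1 ++ w :: zs2)`_i = 0.
    rewrite -[dT k _]/(lin D _) nth_cat; case: ltngtP => h.
    - exact: (D_row p1 z1).
    - have -> : (i - size zs1)%N = (i - size zs1).-1.+1 by rewrite prednK ?subn_gt0.
      exact: (D_row p2 z2).
    by case/eqP: ni; apply: val_inj.
  rewrite Ei; apply: etrans (scaler0 _ _); congr (_ *: _).
  exact: (mu_set0 cs' px ps' (ltn_ord i)).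
rewrite nth_cat ltnn subnn /= set_nth_catE -[dT k w]/(lin D w) -Ey.
set c := sgn _ _ => E; have c0 : c != 0 by rewrite expfz_neq0 // oppr_eq0 oner_eq0.
have E2 : mu x p0 (zs1 ++ y :: zs2) = c^-1 *: dT k (mu x p0 (zs1 ++ w :: zs2)) + 0.
  by rewrite addr0; apply: (canRL (scalerK c0)); exact: (esym E).
have : bdry (mu x p0 (zs1 ++ y :: zs2)); last by [].
rewrite E2; apply: bdryP; last exact: bdry0.
apply: (@bdry_D (comp_arity a p0 (unzip1 (s1 ++ (t.1, 1) :: s2)))).
have := mu_piece cs' px ps'; congr (fpiece _ _ _).
rewrite big_map big_cat big_cons /= big_seq big1 => [|u us]; last by apply/eqP/(allP z1).
rewrite big_seq big1 => [|u us]; last by apply/eqP/(allP z2).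
by rewrite !add0r addr0.
Qed.

Section LaxTarget.
Variables (B : boxop k) (m' f' c' : B).
Hypothesis le : lax_elements m' f' c'.

Let eb : lax_infty_elements (lb m' f' c').
Proof. by case: le => pm pf pc _; apply: lb_elements. Qed.

(** If p + q = 2 the differential is 0 for reasons of degree; if p + q = 3 its image is one of the
    four relations; if p + q > 3 it has positive degree, so each term contains a generator sent to
    0. *)
Lemma free_lax_gen a : is_lax_box a -> freeT (lb m' f' c') (D (st_id a)) = 0.
Proof.
case: a => -[p q] r /andP[]; rewrite -[ar_in _]/p -[ar_up _]/q => pq /eqP [->] {r}.
rewrite -/(lax_arity p q); have la := lax_arity_box pq.
have Dsp : inspan (dterm (st_id (lax_arity p q))) (D (st_id (lax_arity p q))) :=
  dS_span tqP (legit_id la).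
have pg := gen_piece pq.
case: (ltngtP (p + q) 3) => h3.
- have E : lin D (gen p q) = 0 :> V.
    by apply: (piece_neg (D_piece pg)); move: pq h3; clear; lia.
  by rewrite -[D _](lin_bas D (legit_id la)) -/(gen p q) E linear0.
- apply: (lin0 Dsp) => S lS [_ _ nS]; apply: (free_st_pos eb) => //.
    by move=> p' q'; apply: lb0.
  case: (inspan_basP (legit_id la) pg) => _; move: nS h3.
  by move: (ndeg S) (ndeg (st_id (lax_arity p q))) => u v; clear; lia.
rewrite -[D _](lin_bas D (legit_id la)) -/(gen p q).
have [r1 r2 r3 r4] := D_gen3 (freeT_morphism eb).
have [_ _ _ [e1 e2 e3 e4]] := le.
rewrite !(freeT_gen eb) // /lb e1 e2 e3 e4 !subrr ?oppr0 in r1 r2 r3 r4.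
have : [\/ p = 0%N /\ q = 3%N, p = 1%N /\ q = 2%N, p = 2%N /\ q = 1%N | p = 3%N /\ q = 0%N].
  move: h3; clear; case: p => [|[|[|[|p]]]] h; [constructor 1 | constructor 2 | constructor 3
    | constructor 4 | exfalso]; lia.
by case=> -[-> ->]; [exact: r1 | exact: r2 | exact: r3 | exact: r4].
Qed.

Lemma free_lax_D x : freeT (lb m' f' c') (lin D x) = 0.
Proof.
exact: (morphism_dg (N := dg0 B) (g := freeT (lb m' f' c')) (freeT_morphism eb) free_lax_gen).
Qed.

Lemma free_lax_bdry x : bdry x -> freeT (lb m' f' c') x = 0.
Proof.
move=> Jx; pose A := undup [seq st_ar (val s) | s <- (msupp x : seq _)].
have Ax : inspan (fun S => st_ar S \in A) x.
  by move=> s sx; rewrite mem_undup; apply: (map_f (fun s : lstk => st_ar (val s))).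
transitivity (\sum_(a <- A) freeT (lb m' f' c') (pr a 0 x)); last first.
  by rewrite big1 // => a _; have [y _ ->] := Jx a; apply: free_lax_D.
under eq_bigr => a _ do rewrite lin_linE.
rewrite -lin_sum; apply: (eq_lin_in Ax) => S lS aS.
have [n0|n0] := posnP (ndeg S); last first.
  rewrite (free_st_pos eb) //; last by move=> p q; apply: lb0.
  rewrite big1 // => a _; case: eqP => [[_ E]|_]; last exact: linear0.
  by move: n0; rewrite /ndegz in E; move: E; move: (ndeg S); clear; lia.
rewrite (bigD1_seq (st_ar S)) ?undup_uniq //= big1 ?addr0 => [|a na].
  by rewrite /ndegz n0 eqxx freeT_bas.
by case: eqP => [[E _]|_]; [rewrite E eqxx in na | exact: linear0].
Qed.
End LaxTarget.

Lemma pieces_map (M N : grmod k) (g : M -> N) s xs : graded_map g ->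
  pieces s xs -> pieces s (map g xs).
Proof. by move=> gg; elim: s xs => [|t s IH] [|x xs] //= [/gg ? /IH]. Qed.

Lemma comp_morphism (B1 B2 B3 : boxop k) (g : B1 -> B2) (h : B2 -> B3) :
  box_morphism g -> box_morphism h -> box_morphism (h \o g).
Proof.
move=> [gg g1 gm] [hg h1 hm]; split=> [a e x /gg/hg //||a e p0 s x xs cs px pxs].
  by rewrite /= g1.
by rewrite /= (gm _ _ _ _ _ _ cs px pxs) (hm _ _ _ _ _ _ cs (gg _ _ _ px) (pieces_map gg pxs)) map_comp.
Qed.

(** The quotient H_0 inherits the relations from the boundaries of degree-1 generators. Conversely,
    elements that satisfy the relations define a morphism from [Tbox] that kills [bdry]
    ([free_lax_bdry]) and hence factors; uniqueness holds because the other generators have image 0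
    in the quotient. *)
Theorem lax_quotient : exists (Q : boxop k) (pi : {linear Tbox k -> Q}),
  [/\ box_morphism pi, forall x, pi x = 0 <-> bdry x,
      forall a e u, piece a e u -> exists2 x, piece a e x & u = pi x &
      is_lax (pi m) (pi f) (pi c)].
Proof.
have [Q [pi [mp ker surj lift]]] :=
  @box_quotient k (Tbox k) bdry bdry0 bdryP bdry_hom bdry_l bdry_r.
exists Q, pi; split=> //; have [pg p1 pm] := mp.
have [p02 p11 p20] := lax_pieces.
have pD p q : (p + q = 3)%N -> pi (lin D (gen p q)) = 0.
  move=> pq; apply/ker; apply: (@bdry_D (lax_arity p q)).
  have := @gen_piece p q; rewrite pq => /(_ isT); congr (fpiece _ _ _).
  by move: pq; clear; lia.
have [r1 r2 r3 r4] := D_gen3 mp.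
rewrite !pD // in r1 r2 r3 r4.
have sub0 (A A' : Q) : 0 = A - A' -> A = A' by move/esym/eqP; rewrite subr_eq0 => /eqP.
have sub0N (A A' : Q) : 0 = - (A - A') -> A = A' by move=> h; apply: sub0; rewrite -[RHS]opprK -h oppr0.
split.
  split; try exact: pg; split; [exact: sub0N | by symmetry; apply: sub0 | exact: sub0 | exact: sub0N].
move=> B m' f' c' le; have eb : lax_infty_elements (lb m' f' c').
  by case: le => ? ? ? _; apply: lb_elements.
have [|psi [mpsi Epsi]] := box_factor mp (freeT_morphism eb) surj lift.
  by move=> x /ker; apply: free_lax_bdry.
exists psi; split=> //; first by rewrite !Epsi !(freeT_gen eb).
move=> psi' mpsi' [E1 E2 E3] u; have [x ->] := surj u; rewrite Epsi.
apply: (freeT_unique (psi := psi' \o pi)); first exact: comp_morphism mp mpsi'.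
move=> p q pq /=; have [h|h] := ltnP 2 (p + q).
  rewrite lb0 // (_ : pi (gen p q) = 0) ?linear0 //; apply/ker.
  by apply: (bdry_deg (gen_piece pq)); move: h; clear; lia.
by case: p q pq h => [|[|[|p]]] [|[|[|q]]].
Qed.
End LaxQuotient.

(** * Generators and the minimal model *)

Section RowProduct.
Variables (k : fieldType) (B : boxop k).

Fixpoint st_row_mu (ss : seq stacking) (ys : seq B) : seq B :=
  if ss is s :: ss' then
    mu_st s (take (size (boxes s)) ys) :: st_row_mu ss' (drop (size (boxes s)) ys)
  else [::].
End RowProduct.

Section MorphismStacking.
Variables (k : fieldType) (A B : boxop k).

Lemma morphism_mu_st (g : A -> B) S s xs : box_morphism g -> st_wf S -> pieces s xs ->
  unzip1 s = boxes S ->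
  g (mu_st S xs) = mu_st S (map g xs) /\ exists e, piece (st_ar S) e (mu_st S xs).
Proof.
move=> [gg g1 gm]; elim/stacking_mem_ind: S s xs => [|a p0 ss IH] s xs.
  by move=> _ _ _; split; [exact: g1 | exists 0; exact: one_piece].
move=> wN; have := wN => /= /andP[cs wss].
case: s => [|[b e] s]; first by case: xs.
case: xs => [|x xs] //= [px pxs] [Eb Es]; rewrite {}Eb in px.
rewrite -!/(st_row_mu _ _).
have [s' [p' E' Eg]] : exists s', [/\ pieces s' (st_row_mu ss xs),
    unzip1 s' = map st_ar ss & map g (st_row_mu ss xs) = st_row_mu ss (map g xs)].
  elim: ss IH wss s xs pxs Es {cs wN} => [|T ss IHs] IH /=; first by move=> *; exists [::].
  move=> /andP[wT wss] s xs pxs; set n := size (boxes T) => Es.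
  have sn : size (take n s) = n.
    by rewrite size_takel //; move: (congr1 size Es); rewrite size_map size_cat => ->; apply: leq_addr.
  have sx := pieces_size pxs.
  have [||p1 p2] := @pieces_catE _ _ (take n s) (drop n s) (take n xs) (drop n xs).
  - by rewrite !size_take sx.
  - by rewrite !cat_take_drop.
  have E1 : unzip1 (take n s) = boxes T by rewrite /unzip1 map_take -/(unzip1 s) Es take_size_cat.
  have E2 : unzip1 (drop n s) = flatten (map boxes ss) by rewrite /unzip1 map_drop -/(unzip1 s) Es drop_size_cat.
  have [gT [e' pT]] := IH T (mem_head _ _) _ _ wT p1 E1.
  have [s' [p' E' Eg]] := IHs (mem_tail IH) wss _ _ p2 E2.
  by exists ((st_ar T, e') :: s'); rewrite /= E' gT Eg map_take map_drop.
have cs' : composable a p0 (unzip1 s') by rewrite E'.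
have E0 := gm _ _ _ _ _ _ cs' px p'; rewrite Eg in E0; split; first exact: E0.
by exists (e + \sum_(d <- unzip2 s') d); rewrite -E'; apply: mu_piece.
Qed.
End MorphismStacking.

(** * The space of generators and the projection onto it *)

Section Generators.
Variable k : fieldType.
Notation V := (fmod k).
Notation D := (dS k tq).

Definition is_id (S : stacking) : bool := S == st_id (head (0, 0, 0)%N (boxes S)).

Lemma is_id_st_id a : is_id (st_id a).
Proof. by rewrite /is_id /=. Qed.

Lemma is_idP S : is_id S -> exists a, S = st_id a.
Proof. by move/eqP=> E; exists (head (0, 0, 0)%N (boxes S)). Qed.

Notation genproj := (lin (fun S => if is_id S then bas S else 0 : V)).

Lemma genproj_idem x : genproj (genproj x) = genproj x.
Proof.
rewrite lin_linE; apply: eq_lin => S lS.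
by case E: (is_id S); rewrite ?linear0 //= lin_bas // E.
Qed.

Lemma genproj_piece a e (x : V) : fpiece a e x -> fpiece a e (genproj x).
Proof.
move=> px; apply: (inspan_lin px) => S lS aS.
by case: (is_id S); [apply: inspan_bas | apply: inspan0].
Qed.

Definition gpred (x : V) : bool := genproj x == x.

Fact gpred_submod : GRing.subsemimod_closed gpred.
Proof.
split; first split.
- by rewrite /in_mem /= /gpred linear0.
- by move=> x y /eqP Ex /eqP Ey; rewrite /in_mem /= /gpred linearD /= Ex Ey.
by move=> c x /eqP Ex; rewrite /in_mem /= /gpred linearZ /= Ex.
Qed.
HB.instance Definition _ := GRing.isSubmodClosed.Build k V gpred gpred_submod.

(** The space X of generators, realized as the image of the projection to corollas inside the free
    module; [genval] is the inclusion and [toX] the projection. *)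
Record genmod := GenMod { genval :> V; _ : gpred genval }.
HB.instance Definition _ := [isSub for genval].
HB.instance Definition _ := [Choice of genmod by <:].
HB.instance Definition _ := [SubChoice_isSubLmodule of genmod by <:].

Fact genval_linear : linear genval.
Proof. by move=> c x y; rewrite -[genval]/(\val : genmod -> V) linearP. Qed.
HB.instance Definition _ := GRing.isLinear.Build k genmod V _ genval genval_linear.

Definition toX (x : V) : genmod := GenMod (introT eqP (genproj_idem x)).

Fact toX_linear : linear toX.
Proof. by move=> c x y; apply: val_inj; rewrite /= linearP. Qed.
HB.instance Definition _ := GRing.isLinear.Build k V genmod _ toX toX_linear.

Lemma genvalK x : toX (genval x) = x.
Proof. by apply: val_inj; apply/eqP; case: x. Qed.

Definition Xpiece a e (x : genmod) := fpiece a e (genval x).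
Fact Xpiece0 a e : Xpiece a e 0.
Proof. by rewrite /Xpiece linear0; apply: inspan0. Qed.
Fact Xpiece_lin a e (c : k) u v : Xpiece a e u -> Xpiece a e v -> Xpiece a e (c *: u + v).
Proof. by move=> pu pv; rewrite /Xpiece linearP; apply: (@piece_lin _ (fgr k)). Qed.
Fact Xpiece_span v : exists s : seq (arity * int * genmod),
  (forall t, t \in s -> Xpiece t.1.1 t.1.2 t.2) /\ v = \sum_(t <- s) t.2.
Proof.
have [s [ps Es]] := fpiece_span (genval v); exists [seq (t.1, toX t.2) | t <- s]; split.
  by move=> t /mapP[u us ->]; apply: genproj_piece; apply: ps.
by rewrite -[LHS]genvalK Es linear_sum big_map.
Qed.
Fact Xpiece_direct (s : seq (arity * int * genmod)) : uniq [seq t.1 | t <- s] ->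
  (forall t, t \in s -> Xpiece t.1.1 t.1.2 t.2) ->
  \sum_(t <- s) t.2 = 0 -> forall t, t \in s -> t.2 = 0.
Proof.
move=> us ps s0 t ts; apply: val_inj; rewrite [RHS](linear0 genval).
pose s' := [seq (t.1, genval t.2) | t <- s].
apply: (@piece_direct _ (fgr k) s' _ _ _ (t.1, genval t.2)).
- by rewrite -map_comp.
- by move=> u /mapP[w ws ->]; apply: ps.
- by rewrite big_map -linear_sum s0 linear0.
by apply/mapP; exists t.
Qed.
Definition gengr : grmod k :=
  @GrMod k genmod Xpiece Xpiece0 Xpiece_lin Xpiece_span Xpiece_direct.

Lemma genproj_gen p q : genproj (gen p q) = gen p q :> V.
Proof.
rewrite -[RHS]lin_basE; apply: (@eq_lin_in _ _ _ _ (fun S => is_id S)).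
  by apply: inspan_bas; apply: is_id_st_id.
by move=> S _ ->.
Qed.

(** The differential keeps the arity and lowers the degree by one, but corollas of the same arity
    have the same degree. *)
Lemma genproj_D x : genproj (lin D (genproj x)) = 0.
Proof.
rewrite [lin D _]lin_linE lin_linE; apply: (@lin0 _ _ _ (fun=> True)) => // S lS _.
case E: (is_id S); last by rewrite !linear0.
rewrite /= lin_bas //; apply: (lin0 (dS_span tqP lS)) => T _ [aT _ nT].
case E' : (is_id T) => //; have [a Ea] := is_idP E; have [b Eb] := is_idP E'.
move: aT nT; rewrite Ea Eb !st_id_ar => ->; clear; move: (ndeg _); lia.
Qed.

Fixpoint spans (Ts : seq stacking) (xs : seq V) : Prop :=
  match Ts, xs with
  | [::], [::] => True
  | T :: Ts', x :: xs' => inspan (eq T) x /\ spans Ts' xs'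
  | _, _ => False
  end.

Lemma spans_size Ts xs : spans Ts xs -> size xs = size Ts.
Proof. by elim: Ts xs => [|T Ts IH] [|x xs] //= [_ /IH ->]. Qed.

Lemma spans_catE T1 T2 x1 x2 : size x1 = size T1 -> spans (T1 ++ T2) (x1 ++ x2) ->
  spans T1 x1 /\ spans T2 x2.
Proof. by elim: T1 x1 => [|T T1 IH] [|x x1] //= [/IH H] [px /H []]. Qed.

Lemma spans_ml P (F : seq stacking -> V) Ts xs : spans Ts xs ->
  inspan P (F Ts) -> inspan P (ml F xs).
Proof.
elim: Ts xs F => [|T Ts IH] [|x xs] //= F [px pxs] PF.
by apply: (inspan_lin px) => S _ <-; apply: IH.
Qed.

Lemma spans_mu S p0 Ts x xs : inspan (eq S) x -> spans Ts xs ->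
  inspan (eq (graft S p0 Ts)) (muT x p0 xs).
Proof.
move=> px pxs; apply: (inspan_lin px) => S' _ <-; apply: (spans_ml pxs).
by rewrite /muB; case: ifP => _; [apply: inspanZ; apply: inspan_bas | apply: inspan0].
Qed.

(** Composing multiples of corollas along [S] gives a multiple of [S]. So the projection to
    generators kills all composites except those along an identity. *)
Lemma spans_mu_st S (xs : seq (Tbox k)) : st_wf S -> spans (map st_id (boxes S)) xs ->
  inspan (eq S) (mu_st S xs).
Proof.
elim/stacking_mem_ind: S xs => [|a p0 ss IH] xs; first by move=> _ _; apply: inspan_bas.
move=> /= /andP[cs wss]; case: xs => [|x xs] //= [px pxs].
rewrite -!/(st_row_mu _ _).
have : spans ss (st_row_mu ss xs).
  elim: ss IH wss xs pxs {cs} => [|T ss IHs] IH /=; first by [].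
  move=> /andP[wT wss] xs; set n := size (boxes T); rewrite map_cat => pxs.
  have sx := spans_size pxs.
  have [||p1 p2] := @spans_catE (map st_id (boxes T)) (map st_id (flatten (map boxes ss))) (take n xs) (drop n xs).
  - by rewrite size_map size_takel // sx size_cat size_map leq_addr.
  - by rewrite cat_take_drop.
  by split; [apply: IH => //; rewrite mem_head | apply: IHs => //; exact: mem_tail IH].
move=> pr; have H := @spans_mu (st_id a) p0 ss x (st_row_mu ss xs) px pr.
have E : graft (st_id a) p0 ss = Node a p0 ss.
  by rewrite /st_id graft_node add0n -(composable_up cs) graft_row_1l.
by rewrite E in H; exact: H.
Qed.
End Generators.

(** * Assembling the minimal model *)

Section Final.
Variables (k : fieldType) (L : boxop k) (m f c : L) (M : dgboxop k) (mm : nat -> nat -> M).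
Hypotheses (HL : is_lax m f c) (HM : is_lax_infty mm).
Notation V := (fmod k).
Notation D := (dS k tq).
Notation T := (Tbox k).
Notation genproj := (lin (fun S => if is_id S then bas S else 0 : V)).

Lemma idfun_morphism (B : boxop k) : box_morphism (idfun : B -> B).
Proof. by split=> // a e p0 s x xs _ _ _; rewrite map_id. Qed.

Let em : lax_infty_elements mm. Proof. by case: HM. Qed.
Let beta : {linear T -> M} := freeT mm.
Let beta_mor : box_morphism beta := freeT_morphism em.

Lemma from_M : exists alpha : {linear M -> T},
  [/\ box_morphism alpha, cancel alpha beta & cancel beta alpha].
Proof.
have [_ univ _] := HM.
have [alpha [am ag _]] := univ T (@gen k) (@gen_elements k).
exists alpha; split=> // x.
  have [h [_ _ hu]] := univ M mm em.
  transitivity (h x); last symmetry; [apply: (hu (beta \o alpha)) | apply: (hu idfun)] => //.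
  - exact: comp_morphism am beta_mor.
  - by move=> p q pq /=; rewrite ag // freeT_gen.
  exact: idfun_morphism.
have Hm : box_morphism (alpha \o beta) := comp_morphism beta_mor am.
have Hg p q : (2 <= p + q)%N -> (alpha \o beta) (gen p q) = gen p q.
  by move=> pq /=; rewrite freeT_gen // ag.
have H1 := @freeT_unique k T (@gen k) (alpha \o beta) Hm Hg.
have H2 := @freeT_unique k T (@gen k) idfun (idfun_morphism T) (fun _ _ _ => erefl).
exact: (etrans (H1 x) (esym (H2 x))).
Qed.

(** On generators both differentials are the same signed sum, as the finite set of stackings given
    for [M] is that of [tq] by [mem_tq]; [morphism_dg] extends this to all elements. *)
Lemma beta_dg x : beta (lin D x) = diff M (beta x).
Proof.
apply: (morphism_dg (N := M) beta_mor) => a la {x}.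
have [Ea pq] : a = lax_arity (ar_in a) (ar_up a) /\ (2 <= ar_in a + ar_up a)%N.
  by case/andP: la => h /eqP.
move: Ea pq; move: (ar_in a) (ar_up a) => p q -> pq {a la}.
rewrite -[bas _]/(gen p q) freeT_gen // gen_diff // linear_sum.
have [_ _ /(_ p q pq)[s [us ms ->]]] := HM.
rewrite (perm_big s); last first.
  by apply: uniq_perm => //; [apply: uniq_tq | move=> S; rewrite ms mem_tq].
rewrite !big_seq; apply: eq_bigr => S; rewrite ms => /and3P[/and4P[wS _ _ _] _ bS].
rewrite linearZ; congr (_ *: _).
pose sb := [seq (a, (ar_in a)%:Z + (ar_up a)%:Z - 2) | a <- boxes S].
have psb : pieces sb [seq gen (ar_in a) (ar_up a) : T | a <- boxes S].
  rewrite /sb; elim: (boxes S) bS => //= a l IH /andP[la ll]; split; last exact: IH.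
  exact: (b_piece (@gen_elements k)).
have usb : unzip1 sb = boxes S by rewrite /unzip1 -map_comp map_id.
have [-> _] := morphism_mu_st beta_mor wS psb usb.
rewrite -map_comp; congr mu_st; apply/eq_in_map => a /(allP bS) /andP[a2 _] /=.
exact: freeT_gen.
Qed.

Lemma to_L : exists chi : {linear T -> L}, [/\ box_morphism chi,
  forall x, chi x = 0 <-> bdry x,
  forall a e u, piece a e u -> exists2 x, piece a e x & u = chi x &
  [/\ chi (gen 0 2) = m, chi (gen 1 1) = f & chi (gen 2 0) = c]].
Proof.
have [Q [pi [mp ker lift [le univ]]]] := lax_quotient k.
have [leL univL] := HL.
have [ga [gm [g1 g2 g3] _]] := univL Q _ _ _ le.
have [de [dm [d1 d2 d3] _]] := univ L _ _ _ leL.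
have dK : cancel ga de.
  move=> x; have [h [_ _ hu]] := univL L _ _ _ leL.
  transitivity (h x); last symmetry; [apply: (hu (de \o ga)) | apply: (hu idfun)] => //.
  - exact: comp_morphism gm dm.
  - by rewrite /= g1 g2 g3.
  exact: idfun_morphism.
have gK : cancel de ga.
  move=> x; have [h [_ _ hu]] := univ Q _ _ _ le.
  transitivity (h x); last symmetry; [apply: (hu (ga \o de)) | apply: (hu idfun)] => //.
  - exact: comp_morphism dm gm.
  - by rewrite /= d1 d2 d3.
  exact: idfun_morphism.
exists (de \o pi); split=> //.
- exact: comp_morphism mp dm.
- move=> x; rewrite -ker /=; split=> [E|->]; last exact: linear0.
  by rewrite -[pi x]gK E linear0.
move=> a e u pu; have [gg _ _] := gm; have [x px Ex] := lift _ _ _ (gg _ _ _ pu).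
by exists x => //=; rewrite -Ex dK.
Qed.

(** The morphism is the projection of [Tbox] to its quotient by [bdry], transported along the
    isomorphisms. In degree 0 it is an isomorphism on homology by the choice of [bdry]; in positive
    degrees the homology of [Tbox] and the target both vanish, and in negative degrees both modules
    do. *)
Lemma lax_infty_minimal_model : exists phi : {linear M -> dg0 L},
  [/\ phi (mm 0%N 2%N) = m, phi (mm 1%N 1%N) = f, phi (mm 2%N 0%N) = c,
      forall p q : nat, (2 < p + q)%N -> phi (mm p q) = 0 & minimal_model phi].
Proof.
have [alpha [am aK bK]] := from_M.
have [chi [cm ker lift [c1 c2 c3]]] := to_L.
have aD x : alpha (diff M x) = lin D (alpha x) by rewrite -{1}[x]aK -beta_dg bK.
have ag p q : (2 <= p + q)%N -> alpha (mm p q) = gen p q.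
  by move=> pq; rewrite -[RHS]bK freeT_gen.
exists (chi \o alpha : {linear M -> L}).
have [ga _ _] := am; have [gb _ _] := beta_mor; have [gc _ _] := cm.
split; rewrite /= ?ag //.
  move=> p q pq; have pq' := ltnW pq; rewrite ag //; apply/ker.
  by apply: (bdry_deg (@gen_piece k _ _ pq')); move: pq; clear; lia.
split.
- split; first exact: (comp_morphism am cm).
  move=> x /=; rewrite aD; apply/ker => a.
  by exists (lin (fun S => if (st_ar S, ndegz S) == (a, 1) then bas S else 0) (alpha x)); [apply: pr_piece | rewrite pr_D add0r].
- move=> a e; split=> [z pz dz [w _ /= Ez]|y py _]; last first.
    have [x px ->] := lift _ _ _ py; have [e0|e0] := eqVneq e 0.
      exists (beta x), 0; split; first exact: gb.
      - by rewrite -beta_dg e0 in px *; rewrite (D_deg0E px) linear0.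
      - exact: piece0.
      by rewrite /= bK addr0.
    exists 0, 0; split; [exact: piece0 | exact: linear0 | exact: piece0 |].
    by rewrite linear0 addr0; apply/ker; apply: (bdry_deg px).
  have px := ga _ _ _ pz; have Dx : lin D (alpha z) = 0 by rewrite -aD dz linear0.
  have Jx : bdry (alpha z) by apply/ker.
  have [w' pw Ew] : exists2 w', fpiece a (e + 1) w' & alpha z = lin D w'.
    (* The three cases are degree 0, the positive degree n + 1, and the negative degrees. *)
    case: e pz px {w Ez} => [[|n]|n] pz px.
    + exact: bdry_inv px Jx.
    + case: a pz px => -[p q] r pz px.
      have [|w pw Ew] := @acyclic_aux k (p + q) p q r n (alpha z) (leqnn _) _ Dx.
        by apply: inspanS px => S _ [-> [->]].
      exists w => //; apply: inspanS pw => S _ [-> ->]; split=> //.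
      by rewrite -addn1 PoszD.
    exists 0; first exact: inspan0.
    by rewrite (piece_neg px) // linear0.
  exists (beta w'); first exact: gb.
  by rewrite -beta_dg -Ew aK.
exists (gengr k), (beta \o (@genval k) : {linear genmod k -> M}); split; [split |].
- by move=> a e x px; apply: gb.
- move=> B g gg; pose b p q : B := g (toX (gen p q)).
  have eb : lax_infty_elements b.
    by move=> p q pq; apply: gg; apply: genproj_piece; apply: (@gen_piece k _ _ pq).
  have [_ univ _] := HM; have [h [hm hg hu]] := univ B b eb.
  exists h; split=> // [x|psi pm ps].
    rewrite -{2}[x]genvalK /= -[X in h (beta X)](_ : genproj (genval x) = _); last first.
      by apply/eqP; case: (x).
    have := linE ((h \o beta) \o genproj : {linear V -> B}) (genval x).
    have := linE (g \o @toX k : {linear V -> B}) (genval x).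
    rewrite /= => -> ->; apply: eq_lin => S lS; rewrite lin_bas //.
    case E: (is_id S); last first.
      rewrite !linear0 -[LHS](linear0 g); congr (g _); apply: val_inj.
      by rewrite [LHS](linear0 (@genval k)) /= lin_bas // E.
    have [a Ea] := is_idP E; have la : is_lax_box a.
      by move: lS; rewrite Ea => /andP[_] /= /andP[].
    case/andP: la => a2 /eqP la; rewrite Ea la -[bas _]/(gen (ar_in a) (ar_up a)).
    by rewrite freeT_gen // hg.
  apply: hu => // p q pq; rewrite /b -ps /= genproj_gen freeT_gen //.
exists (@toX k \o alpha : {linear M -> genmod k}); last first.
  move=> x; rewrite /= aD bK; apply: val_inj; rewrite [RHS](linear0 (@genval k)) /=.
  have Ex : genproj (genval x) = genval x by apply/eqP; case: (x).
  by rewrite -Ex; apply: genproj_D.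
split=> [x|S s xs wS nS bS pxs] /=; first by rewrite bK genvalK.
have pv : pieces (M := T) s (map (@genval k) xs).
  by elim: (s) (xs) pxs => [|t s' IH] [|x xs'] //= [px /IH].
have sb : spans (map st_id (boxes S)) (map (@genval k) xs).
  rewrite bS; elim: (s) (xs) pxs => [|t s' IH] [|x xs'] //= [px /IH pxs]; split=> //.
  have <- : genproj (genval x) = genval x by apply/eqP; case: (x).
  apply: (inspan_lin px) => S' _ [aS' _].
  case E: (is_id S'); last exact: inspan0.
  apply: inspan_bas; have [b Eb] := is_idP E.
  by move: aS'; rewrite Eb st_id_ar => ->.
have [E _] := morphism_mu_st beta_mor wS pv (esym bS).
have -> : map (beta \o @genval k) xs = map beta (map (@genval k) xs) by rewrite map_comp.
rewrite -E bK; apply: val_inj; rewrite [RHS](linear0 (@genval k)) /=.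
apply: (lin0 (spans_mu_st wS sb)) => S' _ <-.
by case E2: (is_id S) => //; have [a Ea] := is_idP E2; case: (nS a).
Qed.
End Final.

(** The two existence statements ensure that the universal properties describing Lax and Lax_infty
    are realized, so that the last statement is not vacuous. *)
Theorem theorem1p4 (k : fieldType) (char0 : [pchar k] =i pred0) :
  (exists (L : boxop k) (m f c : L), is_lax m f c) /\
  (exists (M : dgboxop k) (mm : nat -> nat -> M), is_lax_infty mm) /\
  (forall (L : boxop k) (m f c : L), is_lax m f c ->
   forall (M : dgboxop k) (mm : nat -> nat -> M), is_lax_infty mm ->
   exists phi : {linear M -> dg0 L},
     [/\ phi (mm 0%N 2%N) = m, phi (mm 1%N 1%N) = f, phi (mm 2%N 0%N) = c,
         forall p q : nat, (2 < p + q)%N -> phi (mm p q) = 0 &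
         minimal_model phi]).
Proof.
split.
  have [Q [pi [_ _ _ HQ]]] := lax_quotient k.
  by exists Q, (pi (gen 0 2)), (pi (gen 1 1)), (pi (gen 2 0)).
split; first by exists (Tdg k), (@gen k); exact: Tdg_lax_infty.
by move=> L m f c HL M mm HM; apply: lax_infty_minimal_model.
Qed.
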